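(* The Cuntz-Pimsner algebra $\mathcal{O}_P$ of the simplest Motzkin subproduct system is $2$-subhomogeneous, i.e. all its irreducible representations have dimension at most $2$. More precisely, the spectrum $\mathrm{Spec}$ of $\mathcal{O}_P$ decomposes (as a set) as $\mathrm{Spec}(1)\sqcup \mathrm{Spec}(2)$, where the $1$-dimensional part $\mathrm{Spec}(1)$ is homeomorphic to two disjoint circles, and $\mathrm{Spec}(2)$ is homeomorphic to the ($3$-dimensional) quotient space $$\dfrac{\big([0,1/\sqrt 2]\times \mathbb{T}^2\big)\setminus (C_+\cup C_-)}{(0,u,v)\sim (0,u,\hat v)\ \text{ and }\ (1/\sqrt 2, u,v)\sim (1/\sqrt 2, \overline u v^2,v)},$$ (the relations being imposed for all $u,v,\hat v\in\mathbb{T}$ for which the triples lie in the space), where $C_\pm$ is the circle $\{(1/\sqrt 2, u,\pm u):\ u\in\mathbb{T}\}$.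
   Context: $\mathbb{T}$ denotes the set of complex numbers of modulus $1$. **Simplest Motzkin subproduct system.** Let $H$ be a Hilbert space of dimension $3$ with orthonormal basis $v_1,v_2,v_3$. Let $\lambda=1/3$, let $a_1=a_3$ and $a_2$ be complex numbers of modulus $1/\sqrt 3$, and set $v:=(v_1+v_3)/\sqrt 2\in H$ and $v_A:=a_1 v_1\otimes v_3+a_2 v_2\otimes v_2+a_3v_3\otimes v_1\in H\otimes H$ (a unit vector). Let $p\in B(H)$ be the orthogonal projection onto $\mathbb{C}v$ and $t\in B(H\otimes H)$ the orthogonal projection onto $\mathbb{C}v_A$. On $H^{\otimes k}$ set $p_i:=\mathrm{id}^{\otimes (i-1)}\otimes p\otimes \mathrm{id}^{\otimes(k-i)}$ for $1\le i\le k$ and $t_i:=\mathrm{id}^{\otimes (i-1)}\otimes t\otimes \mathrm{id}^{\otimes(k-i-1)}$ for $1\le i\le k-1$. Let $P_m(x)$ be the polynomials with $P_0=P_1=1$, $P_{m+1}(x)=P_m(x)-xP_{m-1}(x)$. The (represented) Motzkin Jones-Wenzl idempotents $g_k\in B(H^{\otimes k})$ are defined by $g_1=1-p_1$ and $$g_{k+1}=g_k(1-p_{k+1})-\frac{\lambda^{-1}}{\lambda^{-1}-1}\,\frac{P_{k-1}((\lambda^{-1}-1)^{-2})}{P_k((\lambda^{-1}-1)^{-2})}\,g_kt_kg_k ,$$ where $g_k$ on the right stands for $g_k\otimes \mathrm{id}$. The simplest Motzkin subproduct system is $H_0=\mathbb{C}$, $H_k=g_kH^{\otimes k}$ for $k\ge1$,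 so that $H_{k+l}\subset H_k\otimes H_l$. **Cuntz-Pimsner algebra.** Let $\mathcal{F}:=\bigoplus_{k\ge0}H_k$, viewed as a closed subspace of the full Fock space $\bigoplus_{k\ge 0}H_1^{\otimes k}$, with orthogonal projection $e$ onto $\mathcal{F}$. For $x\in H_1$ let $S_x:\mathcal{F}\to\mathcal{F}$, $S_x(\xi)=e(x\otimes \xi)$. The Toeplitz algebra is the unital C$^*$-algebra generated by $\{S_x: x\in H_1\}$; it contains the compact operators $\mathcal{K}(\mathcal{F})$, and the Cuntz-Pimsner algebra $\mathcal{O}_P$ is the quotient of the Toeplitz algebra by $\mathcal{K}(\mathcal{F})$. **Known presentation (recalled from earlier work, up to rescaling generators, and used by the paper as its working description of the algebra).** $\mathcal{O}_P$ is isomorphic to the universal unital C$^*$-algebra generated by $a,b$ subject to $$1=a^*a+b^*b=a^*a+aa^*=b^*b+bb^*,\qquad a^2=b^2,\qquad ba^*=b^*a.$$ **Representations and spectrum.** A representation of $\mathcal{O}_P$ is a unital $*$-homomorphism $\pi:\mathcal{O}_P\to B(K)$, with $K$ a complex Hilbert space; it is irreducible if $K\ne\{0\}$ and no non-zero proper closed subspace of $K$ is invariant. The spectrum $\mathrm{Spec}$ is the set of irreducible representations modulo unitary conjugacy, with its usual topology; $\mathrm{Spec}(d)$ is the subset of classes of $d$-dimensional irreducible representations, with the subspace topology. For finite $d$, this topology on $\mathrm{Spec}(d)$ coincides with the quotient topology of $\mathrm{Irr}(d)/\!\simeq$, where $\mathrm{Irr}(d)\subset M_d(\mathbb{C})\times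 M_d(\mathbb{C})$ is the set (with subspace topology) of pairs $(A,B)=(\pi(a),\pi(b))$ coming from irreducible representations $\pi$ on $\mathbb{C}^d$ and $\simeq$ is simultaneous conjugacy by a unitary in $U(d)$. A C$^*$-algebra is $n$-subhomogeneous if the dimensions of its irreducible representations are bounded above by $n$. *)

(* Defs.v *)
(* MathComp-Analysis, over an arbitrary [R : realType]. *)
From HB Require Import structures.
From mathcomp Require Import all_boot all_order all_algebra.
From mathcomp Require Import all_classical all_reals all_analysis.
From mathcomp Require Import generic_quotient complex ring lra.
From Stdlib Require Import Relation_Operators.
Set Implicit Arguments.
Unset Strict Implicit.
Unset Printing Implicit Defensive.
Import Order.TTheory GRing.Theory Num.Theory.
Import numFieldNormedType.Exports.
Local Open Scope classical_set_scope.
Local Open Scope quotient_scope.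
Local Open Scope ring_scope.

(* [R[i]], packed as a [numClosedFieldType] so that the library's topology of
   number fields is inferred on it. *)
Definition C (R : realType) : numClosedFieldType := R[i].

(** * Inner product spaces and operators *)

(* The form is linear in its first argument, antilinear in the second. *)
Record ipspace (R : realType) := IPSpace {
  ip_sort :> lmodType (C R) ;
  ip_form : {dot ip_sort for Num.conj} }.

Notation "''[' x , y ]" := (ip_form _ x y) : ring_scope.
Notation "''[' x ]" := (ip_form _ x x) : ring_scope.

Section Operators.
Context {R : realType}.

Definition complete_ipspace (V : ipspace R) := forall u : nat -> V,
  (forall e : C R, 0 < e -> exists N, forall m n,
     (N <= m)%N -> (N <= n)%N -> '[u m - u n] < e) ->
  exists l, forall e : C R, 0 < e -> exists N, forall n,
     (N <= n)%N -> '[u n - l] < e.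

Definition hilbert_dim (V : ipspace R) (d : nat) := exists e : 'I_d -> V,
  (forall i j, '[e i, e j] = (i == j)%:R) /\
  (forall x, x = \sum_i '[x, e i] *: e i).

Definition bounded_operator (V : ipspace R) (T : V -> V) :=
  linear T /\ exists M, forall x, '[T x] <= M * '[x].

Definition adjoint (V : ipspace R) (T S : V -> V) :=
  forall x y, '[T x, y] = '[x, S y].

(* The image of the unit ball is totally bounded; on a complete space this is
   relative compactness. *)
Definition compact_operator (V : ipspace R) (T : V -> V) :=
  bounded_operator T /\
  forall e : C R, 0 < e -> exists s : seq V, forall x, '[x] <= 1 ->
    exists2 y, y \in s & '[T x - y] < e.

Definition cstar_subalgebra (V : ipspace R) (A : set (V -> V)) :=
  [/\ A `<=` @bounded_operator V /\ A id,
      (forall a S T, A S -> A T -> A (fun x => a *: S x + T x)),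
      (forall S T, A S -> A T -> A (S \o T)),
      (forall S T, A S -> adjoint S T -> A T) &
      (forall T, bounded_operator T ->
         (forall e : C R, 0 < e -> exists2 S, A S &
            forall x, '[T x - S x] <= e * '[x]) -> A T)].

Definition closed_subspace (V : ipspace R) (W : set V) :=
  [/\ W 0, (forall a x y, W x -> W y -> W (a *: x + y)) &
      (forall x, (forall e : C R, 0 < e -> exists2 y, W y & '[x - y] < e) ->
         W x)].

End Operators.

(** * Representations of the quotient, by the compact operators, of the unital
    C*-algebra generated by a set [G] of operators *)

Section Representations.
Context {R : realType} (V : ipspace R) (G : set (V -> V)).

Definition cstar_gen : set (V -> V) :=
  [set T | forall A, cstar_subalgebra A -> G `<=` A -> A T].

Definition ccoset (T : V -> V) : set (V -> V) :=
  [set S | cstar_gen S /\ compact_operator (fun x => S x - T x)].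

Definition cquotient : set (set (V -> V)) := [set ccoset T | T in cstar_gen].

(* The algebra operations of [cquotient] are written on representatives; the
   values of [pi] outside [cquotient] are irrelevant. *)
Definition representation (K : ipspace R) (pi : set (V -> V) -> K -> K) :=
  [/\ (forall T, cstar_gen T -> bounded_operator (pi (ccoset T))),
      pi (ccoset id) = id,
      (forall a S T, cstar_gen S -> cstar_gen T ->
         pi (ccoset (fun x => a *: S x + T x)) =
         (fun x => a *: pi (ccoset S) x + pi (ccoset T) x)),
      (forall S T, cstar_gen S -> cstar_gen T ->
         pi (ccoset (S \o T)) = pi (ccoset S) \o pi (ccoset T)) &
      (forall S T, cstar_gen S -> adjoint S T ->
         adjoint (pi (ccoset S)) (pi (ccoset T)))].

Definition irreducible_rep (K : ipspace R) (pi : set (V -> V) -> K -> K) :=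
  [/\ representation pi, (exists x : K, x != 0) &
      forall W : set K, closed_subspace W ->
        (forall a x, cquotient a -> W x -> W (pi a x)) ->
        W = [set 0] \/ W = setT].

Definition unitarily_equivalent (K L : ipspace R)
    (p : set (V -> V) -> K -> K) (q : set (V -> V) -> L -> L) :=
  exists U : K -> L,
    [/\ linear U, (forall x y, '[U x, U y] = '[x, y]),
        (forall y, exists x, U x = y) &
        forall a x, cquotient a -> U (p a x) = q a (U x)].

Definition subhomogeneous (n : nat) :=
  forall (K : ipspace R) (pi : set (V -> V) -> K -> K),
    complete_ipspace K -> irreducible_rep pi ->
    exists2 d, (d <= n)%N & hilbert_dim K d.

End Representations.

(** * The space of [d]-dimensional irreducible representations *)

(* C^d as an inner product space; the representations of dimension [d] are
   realized on it. *)
Section FiniteDimensional.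
Context {R : realType} (d : nat).

Definition cvdot (x y : 'cV[C R]_d) : C R := \sum_i x i 0 * (y i 0)^*.

Lemma cvdot_bilinear : bilinear_for *%R (Num.conj \; *%R) cvdot.
Proof.
split=> [y a x x'|x a y y']; rewrite /cvdot /= mulr_sumr -big_split /=;
  apply: eq_bigr => i _; rewrite !mxE.
- by rewrite mulrDl mulrA.
- by rewrite rmorphD rmorphM mulrDr mulrCA.
Qed.
HB.instance Definition _ := bilinear_isBilinear.Build (C R) 'cV[C R]_d
  'cV[C R]_d (C R) *%R (Num.conj \; *%R) cvdot cvdot_bilinear.

Lemma cvdot_herm x y : cvdot x y = (-1) ^+ false * Num.conj (cvdot y x).
Proof.
rewrite expr0 mul1r /cvdot rmorph_sum; apply: eq_bigr => i _.
by rewrite rmorphM /= conjCK mulrC.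
Qed.
HB.instance Definition _ := isHermitianSesquilinear.Build (C R) 'cV[C R]_d
  false Num.conj cvdot cvdot_herm.

Lemma cvdot_gt0 x : x != 0 -> 0 < cvdot x x.
Proof.
move=> x0; rewrite lt0r sumr_ge0 ?andbT; last first.
  by move=> i _; rewrite mul_conjC_ge0.
apply: contra x0; rewrite psumr_eq0; last by move=> i _; rewrite mul_conjC_ge0.
move=> /allP h; apply/eqP/matrixP => i j; rewrite ord1 !mxE.
by have := h i (mem_index_enum i); rewrite mul_conjC_eq0 => /eqP.
Qed.
HB.instance Definition _ := isDotProduct.Build (C R) 'cV[C R]_d cvdot cvdot_gt0.

Definition cvspace : ipspace R := IPSpace cvdot.

End FiniteDimensional.
Arguments cvspace R d : clear implicits.

Section Spectrum.
Context {R : realType} (V : ipspace R) (G : set (V -> V)).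

Lemma cstar_gen_id : cstar_gen G id.
Proof. by move=> A [[_ ?]]. Qed.

Lemma cstar_gen_comp S T : cstar_gen G S -> cstar_gen G T ->
  cstar_gen G (S \o T).
Proof.
move=> hS hT A hA GA; case: (hA) => _ _ h _ _.
by apply: h; [exact: hS|exact: hT].
Qed.

Lemma linear_fun0 (K L : ipspace R) (T : K -> L) : linear T -> T 0 = 0.
Proof.
move=> h; have := h (-1) 0 0; rewrite scaler0 addr0 scaleN1r addNr.
exact.
Qed.

Lemma ip_ge0 (K : ipspace R) (x : K) : 0 <= '[x].
Proof.
have [->|/neq0_dnorm_gt0/ltW->//] := eqVneq x 0; by rewrite linear0r.
Qed.

Lemma bounded_eq0 (K : ipspace R) (T : K -> K) u : bounded_operator T ->
  (forall e : C R, 0 < e -> exists2 v, T v = 0 & '[u - v] < e) -> T u = 0.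
Proof.
move=> [linT [M bM]] hu; apply/eqP/negPn/negP => /neq0_dnorm_gt0 Tu0.
have N0 : 0 < `|M| + 1 by rewrite ltr_wpDl.
have [v Tv] := hu _ (divr_gt0 (Tu0 _ (ip_form K)) N0).
rewrite ltr_pdivlMr // => uv.
have Tuv : T (u - v) = T u.
  by rewrite addrC -scaleN1r linT Tv scaler0 add0r.
have := bM (u - v); rewrite Tuv => le1.
have M0 : 0 <= M * '[u - v] by apply: le_trans le1; exact: ip_ge0.
have le2 : M * '[u - v] <= '[u - v] * (`|M| + 1).
  rewrite -(ger0_norm M0) normrM (ger0_norm (ip_ge0 _)) mulrC.
  by rewrite ler_wpM2l ?ip_ge0 // lerDl.
by have := le_lt_trans (le_trans le1 le2) uv; rewrite ltxx.
Qed.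

Lemma irreducible_prime (K : ipspace R) (pi : set (V -> V) -> K -> K) S T :
  irreducible_rep G pi -> cstar_gen G S -> cstar_gen G T ->
  (exists x, pi (ccoset G S) x != 0) -> (exists x, pi (ccoset G T) x != 0) ->
  exists2 Q, cstar_gen G Q &
    exists x, pi (ccoset G (S \o (Q \o T))) x != 0.
Proof.
case=> -[bpi idpi linpi mulpi adjpi] _ irr hS hT [x Sx] [y Ty].
apply: contrapT => H.
have {}H Q z : cstar_gen G Q ->
    pi (ccoset G S) (pi (ccoset G Q) (pi (ccoset G T) z)) = 0.
  move=> hQ; apply/eqP/negPn/negP => h; apply: H; exists Q => //; exists z.
  have hQT := cstar_gen_comp hQ hT.
  by rewrite (mulpi S (Q \o T) hS hQT) (mulpi Q T hQ hT).
pose W := [set z | forall Q, cstar_gen G Q ->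
  pi (ccoset G S) (pi (ccoset G Q) z) = 0].
have lin Q : cstar_gen G Q -> linear (pi (ccoset G Q)) by move=> /bpi[].
have [||W0|WT] := irr W.
- split.
  + by move=> Q hQ; rewrite !linear_fun0 //; exact: lin.
  + move=> a u v hu hv Q hQ; rewrite lin // lin // hu // hv //.
    by rewrite scaler0 addr0.
  + move=> u hu Q hQ; have := bpi _ (cstar_gen_comp hS hQ).
    rewrite (mulpi S Q hS hQ) => /bounded_eq0; apply => e /hu[v Wv uv].
    by exists v => //; exact: Wv.
- move=> _ z [Q hQ <-] Wz P hP; have := Wz _ (cstar_gen_comp hP hQ).
  by rewrite (mulpi P Q hP hQ).
- have : W (pi (ccoset G T) y) by move=> Q hQ; exact: H.
  by rewrite W0 => /eqP; rewrite (negPf Ty).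
- have : W x by rewrite WT.
  by move=> /(_ _ cstar_gen_id); rewrite idpi => /eqP; rewrite (negPf Sx).
Qed.

Context (d : nat).

Record irrep := Irrep {
  irrep_map :> set (V -> V) -> cvspace R d -> cvspace R d ;
  irrep_irreducible : irreducible_rep G irrep_map }.

HB.instance Definition _ := gen_eqMixin irrep.
HB.instance Definition _ := gen_choiceMixin irrep.

Definition irrep_eq : rel irrep := fun p q => `[< unitarily_equivalent G p q >].

Lemma irrep_eq_refl : reflexive irrep_eq.
Proof. by move=> p; apply/asboolP; exists id; split => // y; exists y. Qed.

Lemma irrep_eq_sym : symmetric irrep_eq.
Proof.
have sub p q : irrep_eq p q -> irrep_eq q p.
  move=> /asboolP[U [linU isoU surU intU]]; apply/asboolP.
  have inj x y : U x = U y -> x = y.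
    move=> Uxy; apply/eqP; rewrite -subr_eq0; apply/negPn/negP.
    move=> /(@neq0_dnorm_gt0 _ _ _ (ip_form (cvspace R d))).
    by rewrite -isoU addrC -scaleN1r linU Uxy scaleN1r addNr linear0r ltxx.
  have [W UW] := choice surU; exists W; split.
  - by move=> a x y; apply: inj; rewrite linU !UW.
  - by move=> x y; rewrite -isoU !UW.
  - by move=> x; exists (U x); apply: inj; rewrite UW.
  - by move=> a x aQ; apply: inj; rewrite intU // !UW.
by move=> p q; apply/idP/idP; exact: sub.
Qed.

Lemma irrep_eq_trans : transitive irrep_eq.
Proof.
move=> q p r /asboolP[U [lU iU sU tU]] /asboolP[W [lW iW sW tW]].
apply/asboolP; exists (W \o U); split => /=.
- by move=> a x y /=; rewrite lU lW.
- by move=> x y; rewrite iW iU.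
- by move=> y; have [z <-] := sW y; have [x <-] := sU z; exists x.
- by move=> a x aQ; rewrite tU // tW.
Qed.

Canonical irrep_eq_equiv :=
  EquivRel irrep_eq irrep_eq_refl irrep_eq_sym irrep_eq_trans.

Definition spectrum := {eq_quot irrep_eq}.
HB.instance Definition _ := Choice.on spectrum.

(* This does not depend on the representative of the class [s]. *)
Definition in_kernel (s : spectrum) (a : set (V -> V)) := forall x, repr s a x = 0.

(* The trace on the [d]-dimensional classes of the hull-kernel topology: the open
   sets are the complements of the hulls of the subsets [I] of [cquotient]; the
   hull of [I] is that of the ideal it generates. *)
Definition spectrum_open (U : set spectrum) :=
  exists2 I : set (set (V -> V)), I `<=` cquotient G &
    U = [set s | exists2 a, I a & ~ in_kernel s a].

Lemma in_kernelN s a : ~ in_kernel s a <-> exists x, repr s a x != 0.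
Proof.
split=> [|[x sx] h]; last by rewrite h eqxx in sx.
by move=> /existsNP[x /eqP sx]; exists x.
Qed.

Lemma spectrum_openT : spectrum_open setT.
Proof.
exists [set ccoset G id]; first by move=> _ ->; exists id => //; exact: cstar_gen_id.
apply/seteqP; split => // s _; exists (ccoset G id) => //; apply/in_kernelN.
have [[_ idpi _ _ _] [x x0] _] := irrep_irreducible (repr s).
by exists x; rewrite idpi.
Qed.

Lemma spectrum_openI : setI_closed spectrum_open.
Proof.
move=> _ _ [I IQ ->] [J JQ ->].
exists [set a | exists S Q T, [/\ cstar_gen G S, cstar_gen G Q, cstar_gen G T &
  I (ccoset G S) /\ J (ccoset G T) /\ a = ccoset G (S \o (Q \o T))]].
  move=> _ [S [Q [T [hS hQ hT [_ [_ ->]]]]]].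
  exists (S \o (Q \o T)) => //; apply: (cstar_gen_comp hS).
  exact: cstar_gen_comp hQ hT.
apply/seteqP; split=> s /=.
- move=> [[a Ia /in_kernelN sa] [b Jb /in_kernelN sb]].
  have [S hS Sa] := IQ _ Ia; have [T hT Tb] := JQ _ Jb; subst a b.
  have [Q hQ hx] := irreducible_prime (irrep_irreducible (repr s)) hS hT sa sb.
  exists (ccoset G (S \o (Q \o T))); last exact/in_kernelN.
  by exists S, Q, T.
- move=> [_ [S [Q [T [hS hQ hT [IS [JT ->]]]]]] /in_kernelN[x]].
  have [[bpi _ _ mulpi _] _ _] := irrep_irreducible (repr s).
  have lin P : cstar_gen G P -> linear (repr s (ccoset G P)) by move=> /bpi[].
  have hQT := cstar_gen_comp hQ hT.
  rewrite (mulpi S (Q \o T) hS hQT) (mulpi Q T hQ hT) /=.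
  move=> h; split; [exists (ccoset G S)|exists (ccoset G T)] => //.
    by move=> hS0; move: h; rewrite hS0 eqxx.
  by move=> hT0; move: h; rewrite hT0 !linear_fun0 ?eqxx //; exact: lin.
Qed.

Lemma spectrum_open_bigU (I : Type) (f : I -> set spectrum) :
  (forall i, spectrum_open (f i)) -> spectrum_open (\bigcup_i f i).
Proof.
move=> h; have /choice[J hJ] : forall i, exists J, J `<=` cquotient G /\
    f i = [set s | exists2 a, J a & ~ in_kernel s a].
  by move=> i; have [J ? ?] := h i; exists J.
exists (\bigcup_i J i); first by move=> a [i _]; apply: (hJ i).1.
apply/seteqP; split=> s.
  by move=> [i _]; rewrite (hJ i).2 => -[a Ja sa]; exists a => //; exists i.
by move=> [a [i _ Ja] sa]; exists i => //; rewrite (hJ i).2; exists a.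
Qed.

HB.instance Definition _ := isOpenTopological.Build spectrum
  spectrum_openT spectrum_openI spectrum_open_bigU.

Definition class_in_spectrum (K : ipspace R) (pi : set (V -> V) -> K -> K) :=
  exists p : irrep, unitarily_equivalent G pi p.

End Spectrum.

(** * The simplest Motzkin subproduct system and its Fock space *)

(* A word [w] indexes the basis vector of the full Fock space of [H] that is the
   tensor product of the vectors v_(i+1), i in [w]; the letters 0, 1, 2 : 'I_3
   stand for v_1, v_2, v_3. *)
Notation word := (seq 'I_3).

Section Motzkin.
Context {R : realType} (a1 a2 : C R).
Local Notation lambda := (3%:R^-1 : C R).
Local Notation tensor := (word -> (C R)^o).

Definition mvec (i : 'I_3) : C R :=
  [:: (sqrtC 2%:R)^-1; 0; (sqrtC 2%:R)^-1]`_i.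

(* The coefficient of v_A on v_(i+1) (x) v_(j+1). *)
Definition mvecA (i j : 'I_3) : C R :=
  if (i + j == 2)%N then [:: a1; a2; a1]`_i else 0.

Definition letter (w : word) (i : nat) : 'I_3 := nth ord0 w i.
Definition subst (w : word) (i : nat) (a : 'I_3) : word := set_nth ord0 w i a.

(* [mproj i] and [mprojA i] are p_(i+1) and t_(i+1); they are meaningful on the
   words long enough to have a letter in position [i], resp. [i.+1]. *)
Definition mproj (i : nat) (f : tensor) : tensor := fun w =>
  mvec (letter w i) * \sum_(a : 'I_3) (mvec a)^* * f (subst w i a).

Definition mprojA (i : nat) (f : tensor) : tensor := fun w =>
  mvecA (letter w i) (letter w i.+1) *
  \sum_(a : 'I_3) \sum_(b : 'I_3)
    (mvecA a b)^* * f (subst (subst w i a) i.+1 b).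

Fixpoint jwpoly (m : nat) : {poly C R} :=
  match m with
  | 0 => 1
  | m'.+1 => if m' is m''.+1 then jwpoly m' - 'X * jwpoly m'' else 1
  end.

Definition jwcoef (k : nat) : C R :=
  let x := (lambda^-1 - 1) ^- 2 in
  lambda^-1 / (lambda^-1 - 1) * ((jwpoly k.-1).[x] / (jwpoly k).[x]).

(* [jw k] is g_k tensored with identities on the right: it acts on the first
   [k] letters. *)
Fixpoint jw (k : nat) : tensor -> tensor :=
  match k with
  | 0 => id
  | j.+1 => if j is i.+1 then
      fun f => jw j (f - mproj j f) - jwcoef j *: jw j (mprojA i (jw j f))
    else fun f => f - mproj 0 f
  end.

Definition degree (k : nat) : set tensor :=
  [set f | forall w, size w != k -> f w = 0].

Definition motzkin (k : nat) : set tensor :=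
  [set f | degree k f /\ exists2 h, degree k h &
    forall w, size w = k -> f w = jw k h w].

Definition component (k : nat) (f : tensor) : tensor :=
  fun w => if size w == k then f w else 0.

Definition slice_dot (f g : tensor) (k : nat) : C R :=
  \sum_(w : k.-tuple 'I_3) f w * (g w)^*.

Definition square_summable (f : tensor) := exists M : C R, forall n,
  \sum_(0 <= k < n) slice_dot f f k <= M.

(* The sum of a series of complex numbers, computed componentwise. *)
Definition csum (z : nat -> C R) : C R :=
  Complex (limn (series (fun k => complex.Re (z k))))
          (limn (series (fun k => complex.Im (z k)))).

(* The inner product of the full Fock space; it is meaningful on
   square-summable functions. *)
Definition fdot (f g : tensor) : C R := csum (slice_dot f g).

Definition fock_pred : pred tensor := fun f =>
  `[< square_summable f /\ forall k, motzkin k (component k f) >].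

Lemma tensorE (a : C R) (f g : tensor) w :
  (a *: f + g : tensor) w = a * (f w : C R) + g w :> C R.
Proof. by []. Qed.

Lemma mproj_linear i : linear (mproj i).
Proof.
move=> a f g; apply/funext => w; rewrite tensorE /mproj.
rewrite mulrCA -mulrDr; congr (_ * _); rewrite mulr_sumr -big_split /=.
by apply: eq_bigr => b _; rewrite tensorE mulrDr mulrCA.
Qed.

Lemma mprojA_linear i : linear (mprojA i).
Proof.
move=> a f g; apply/funext => w; rewrite tensorE /mprojA.
rewrite mulrCA -mulrDr; congr (_ * _); rewrite mulr_sumr -big_split /=.
apply: eq_bigr => b _; rewrite mulr_sumr -big_split /=.
by apply: eq_bigr => c _; rewrite tensorE mulrDr mulrCA.
Qed.

Lemma jw_linear k : linear (jw k).
Proof.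
elim: k => [//|[_|j IH]] a f g; first by rewrite /= mproj_linear opprD scalerBr addrACA.
rewrite [LHS]/= [jw j.+2 f]/= [jw j.+2 g]/= -/(jw j.+1).
rewrite IH mprojA_linear IH mproj_linear.
have -> : a *: f + g - (a *: mproj j.+1 f + mproj j.+1 g) =
          a *: (f - mproj j.+1 f) + (g - mproj j.+1 g).
  by rewrite opprD scalerBr addrACA.
rewrite IH (scalerDr (jwcoef _)) opprD addrACA; congr (_ + _).
by rewrite scalerBr !scalerA mulrC.
Qed.

Lemma component_linear k : linear (component k).
Proof.
move=> a f g; apply/funext => w; rewrite tensorE /component tensorE.
by case: eqP => // _; rewrite mulr0 addr0.
Qed.

Lemma motzkin_linear k a f g : motzkin k f -> motzkin k g ->
  motzkin k (a *: f + g).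
Proof.
move=> [f0 [h h0 fh]] [g0 [l l0 gl]]; split.
  move=> w wk; rewrite tensorE f0 // g0 //.
  by rewrite mulr0 addr0.
exists (a *: h + l).
  move=> w wk; rewrite tensorE h0 // l0 //.
  by rewrite mulr0 addr0.
move=> w wk; rewrite jw_linear tensorE.
by rewrite fh // gl.
Qed.

Lemma slice_dot_ge0 f k : 0 <= slice_dot f f k.
Proof. by apply: sumr_ge0 => w _; rewrite mul_conjC_ge0. Qed.

Lemma sum_slice_ge0 f n : 0 <= \sum_(0 <= k < n) slice_dot f f k.
Proof. by apply: sumr_ge0 => k _; exact: slice_dot_ge0. Qed.

Lemma square_summable_linear a f g : square_summable f -> square_summable g ->
  square_summable (a *: f + g).
Proof.
move=> [M hM] [N hN]; exists (2 * (a * a^*) * M + 2 * N) => n.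
apply: (@le_trans _ _ (\sum_(0 <= k < n)
  (2 * (a * a^*) * slice_dot f f k + 2 * slice_dot g g k))); last first.
  rewrite big_split /= -!mulr_sumr lerD // ler_wpM2l ?hM ?hN //.
  by rewrite mulr_ge0 // mul_conjC_ge0.
apply: ler_sum => k _; rewrite /slice_dot !mulr_sumr -big_split /=.
apply: ler_sum => w _; rewrite tensorE.
set x := f w; set y := g w.
rewrite -subr_ge0.
have -> : 2 * (a * a^*) * (x * x^*) + 2 * (y * y^*) -
    (a * x + y) * (a * x + y)^* = (a * x - y) * (a * x - y)^*.
  rewrite !(rmorphD, rmorphB, rmorphM) /=.
  by ring.
by rewrite mul_conjC_ge0.
Qed.

Lemma fock_pred_submod : submod_closed fock_pred.
Proof.
split.
  apply/asboolP; split.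
    exists 0 => n; rewrite big1 // => k _; rewrite /slice_dot big1 // => w _.
    by rewrite mul0r.
  move=> k; split=> [w wk|]; first by rewrite /component (negPf wk).
  exists 0 => [//|w wk]; rewrite /component wk eqxx.
  have := jw_linear k 0 0 0; rewrite scale0r addr0 => ->.
  by rewrite scale0r add0r; have := jw_linear k (-1) 0 0;
     rewrite scaler0 addr0 scaleN1r addNr => ->.
move=> a f g /asboolP[sf mf] /asboolP[sg mg]; apply/asboolP; split.
  exact: square_summable_linear.
by move=> k; rewrite component_linear; apply: motzkin_linear.
Qed.

HB.instance Definition _ := GRing.isSubmodClosed.Build (C R) tensor fock_pred
  fock_pred_submod.

Definition sum_cvg (z : nat -> C R) :=
  cvgn (series (fun k => complex.Re (z k))) /\
  cvgn (series (fun k => complex.Im (z k))).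

Lemma csum_linear a z z' : sum_cvg z -> sum_cvg z' ->
  csum (fun k => a * z k + z' k) = a * csum z + csum z'.
Proof.
case: a => ar ai [rz iz] [rz' iz']; rewrite /csum.
have -> : (fun k => complex.Re (Complex ar ai * z k + z' k)) =
  (ar *: (fun k => complex.Re (z k)) - ai *: (fun k => complex.Im (z k)) +
  (fun k => complex.Re (z' k))).
  by apply/funext => k; rewrite !fctE; case: (z k) (z' k) => ? ? [? ?].
have -> : (fun k => complex.Im (Complex ar ai * z k + z' k)) =
  (ar *: (fun k => complex.Im (z k)) + ai *: (fun k => complex.Re (z k)) +
  (fun k => complex.Im (z' k))).
  by apply/funext => k; rewrite !fctE; case: (z k) (z' k) => ? ? [? ?].
have sz (b : R) (u : nat -> R) : series (b *: u) = b *: series u.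
  by apply/funext => n; rewrite !seriesEnat /= !fctE scaler_sumr.
have sD (u v : nat -> R) : series (u + v) = series u + series v.
  by apply/funext => n; rewrite !seriesEnat /= !fctE big_split.
have sB (u : nat -> R) : series (- u) = - series u.
  by apply/funext => n; rewrite !seriesEnat /= !fctE sumrN.
rewrite !(sD, sB, sz).
set P := limn (series _); set Q := limn (series _).
have cz (b : R) u : cvgn (series u) -> b *: series u @ \oo --> b * limn (series u).
  by move=> h; apply: cvgZl_tmp.
have -> : limn (ar *: series (fun k => complex.Re (z k)) -
    ai *: series (fun k => complex.Im (z k)) +
    series (fun k => complex.Re (z' k))) = ar * P - ai * Q + limn (series (fun k => complex.Re (z' k))).
  apply: cvg_lim => //; apply: cvgD rz'; apply: cvgB; exact: cz.
have -> : limn (ar *: series (fun k => complex.Im (z k)) +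
    ai *: series (fun k => complex.Re (z k)) +
    series (fun k => complex.Im (z' k))) = ar * Q + ai * P + limn (series (fun k => complex.Im (z' k))).
  apply: cvg_lim => //; apply: cvgD iz'; apply: cvgD; exact: cz.
by [].
Qed.

Lemma csum_conj z : sum_cvg z -> csum (fun k => (z k)^*) = (csum z)^*.
Proof.
move=> [rz iz]; rewrite /csum.
have -> : (fun k => complex.Re (z k)^* ) = (fun k => complex.Re (z k)).
  by apply/funext => k; case: (z k).
have -> : (fun k => complex.Im (z k)^* ) = - (fun k => complex.Im (z k)).
  by apply/funext => k; rewrite !fctE; case: (z k).
have -> : series (- (fun k => complex.Im (z k))) =
    - series (fun k => complex.Im (z k)).
  by apply/funext => n; rewrite !seriesEnat /= !fctE sumrN.
by rewrite limN.
Qed.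

Lemma slice_dot_linear a f f' g k :
  slice_dot (a *: f + f') g k = a * slice_dot f g k + slice_dot f' g k.
Proof.
rewrite /slice_dot mulr_sumr -big_split /=; apply: eq_bigr => w _.
by rewrite tensorE mulrDl mulrA.
Qed.

Lemma slice_dot_conj f g k : slice_dot f g k = (slice_dot g f k)^*.
Proof.
rewrite /slice_dot rmorph_sum; apply: eq_bigr => w _.
by rewrite rmorphM /= conjCK mulrC.
Qed.

Lemma ReDC (x y : C R) : complex.Re (x + y) = complex.Re x + complex.Re y.
Proof. by case: x y => ? ? []. Qed.

Lemma re_slice_cvg f : square_summable f ->
  cvgn (series (fun k => complex.Re (slice_dot f f k))).
Proof.
move=> [M hM]; apply: nondecreasing_is_cvgn.
  apply/nondecreasing_seqP => n; rewrite !seriesEnat /= big_nat_recr //= lerDl.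
  by have := slice_dot_ge0 f n; rewrite lecE => /andP[].
exists (complex.Re M) => _ [n _ <-]; rewrite seriesEnat /=.
have := hM n; rewrite lecE => /andP[_]; congr (_ <= _).
by elim/big_ind2: _ => // ? ? ? ? <- <-; rewrite ReDC.
Qed.

Lemma mulC_bound (x y : C R) :
  `|complex.Re (x * y^*)| <= complex.Re (x * x^* + y * y^*) /\
  `|complex.Im (x * y^*)| <= complex.Re (x * x^* + y * y^*).
Proof.
case: x y => [a b] [c e]; rewrite /= !ler_norml.
have h (t : R) : 0 <= t ^+ 2 by exact: sqr_ge0.
have [h1 h2] := (h (a + c), h (a - c)); have [h3 h4] := (h (b + e), h (b - e)).
have [h5 h6] := (h (a + e), h (a - e)); have [h7 h8] := (h (b + c), h (b - c)).
have [ha hb] := (h a, h b); have [hc he] := (h c, h e).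
by split; apply/andP; split; lra.
Qed.

Lemma ImDC (x y : C R) : complex.Im (x + y) = complex.Im x + complex.Im y.
Proof. by case: x y => ? ? []. Qed.

Lemma slice_dot_bound f g k :
  `|complex.Re (slice_dot f g k)| <=
    complex.Re (slice_dot f f k) + complex.Re (slice_dot g g k) /\
  `|complex.Im (slice_dot f g k)| <=
    complex.Re (slice_dot f f k) + complex.Re (slice_dot g g k).
Proof.
rewrite -ReDC /slice_dot -big_split /=; split.
  elim/big_ind2: _ => [||w _]; [by rewrite normr0| |by case: (mulC_bound (f w) (g w))].
  move=> x1 x2 y1 y2; rewrite !ReDC => hx hy.
  by rewrite (le_trans (ler_normD _ _)) // lerD.
elim/big_ind2: _ => [||w _]; [by rewrite normr0| |by case: (mulC_bound (f w) (g w))].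
move=> x1 x2 y1 y2; rewrite ReDC ImDC => hx hy.
by rewrite (le_trans (ler_normD _ _)) // lerD.
Qed.

Lemma slice_sum_cvg f g : square_summable f -> square_summable g ->
  sum_cvg (slice_dot f g).
Proof.
move=> sf sg.
have ge0 h k : 0 <= complex.Re (slice_dot h h k).
  by have := slice_dot_ge0 h k; rewrite lecE => /andP[].
have cv : cvgn (series (fun k => complex.Re (slice_dot f f k) +
                                 complex.Re (slice_dot g g k))).
  have -> : series (fun k => complex.Re (slice_dot f f k) +
                             complex.Re (slice_dot g g k)) =
    series (fun k => complex.Re (slice_dot f f k)) +
    series (fun k => complex.Re (slice_dot g g k)).
    by apply/funext => n; rewrite !seriesEnat /= !fctE big_split.
  by apply: is_cvgD; exact: re_slice_cvg.
split; apply: normed_cvg; apply: series_le_cvg cv => k /=.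
- exact: normr_ge0.
- by rewrite addr_ge0.
- by case: (slice_dot_bound f g k).
- exact: normr_ge0.
- by rewrite addr_ge0.
- by case: (slice_dot_bound f g k).
Qed.

Definition fock := {f : tensor | fock_pred f}.
HB.instance Definition _ := SubChoice.on fock.
HB.instance Definition _ := [SubChoice_isSubLmodule of fock by <:].

Definition fockdot (f g : fock) : C R := fdot (val f) (val g).

Lemma fock_summable (f : fock) : square_summable (val f).
Proof. by have /asboolP[] := valP f. Qed.

Lemma fockdot_conj f g : fockdot f g = (fockdot g f)^*.
Proof.
rewrite /fockdot /fdot -csum_conj; last first.
  by apply: slice_sum_cvg; exact: fock_summable.
by congr csum; apply/funext => k; exact: slice_dot_conj.
Qed.

Lemma fockdot_linear a f f' g :
  fockdot (a *: f + f') g = a * fockdot f g + fockdot f' g.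
Proof.
rewrite /fockdot /fdot -csum_linear; do ?by apply: slice_sum_cvg; exact: fock_summable.
by congr csum; apply/funext => k; exact: slice_dot_linear.
Qed.

Lemma fockdot_bilinear : bilinear_for *%R (Num.conj \; *%R) fockdot.
Proof.
split=> [g a f f'|f a g g'] /=; first exact: fockdot_linear.
rewrite fockdot_conj fockdot_linear rmorphD rmorphM /=.
by rewrite -!fockdot_conj.
Qed.
HB.instance Definition _ := bilinear_isBilinear.Build (C R) fock fock (C R)
  *%R (Num.conj \; *%R) fockdot fockdot_bilinear.

Lemma fockdot_herm f g : fockdot f g = (-1) ^+ false * Num.conj (fockdot g f).
Proof. by rewrite expr0 mul1r -fockdot_conj. Qed.
HB.instance Definition _ := isHermitianSesquilinear.Build (C R) fock
  false Num.conj fockdot fockdot_herm.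

Lemma fockdot_gt0 f : f != 0 -> 0 < fockdot f f.
Proof.
move=> f0; have [w fw] : exists w, val f w != 0.
  apply: contrapT => h; move/eqP: f0; apply; apply/val_inj/funext => w.
  by apply/eqP/negPn/negP => fw; apply: h; exists w.
rewrite /fockdot /fdot /csum ltcE /=; apply/andP; split.
  have -> : (fun k => complex.Im (slice_dot (val f) (val f) k)) = (fun=> 0).
    apply/funext => k; apply/eqP.
    by have := slice_dot_ge0 (val f) k; rewrite lecE => /andP[].
  have -> : series (fun=> 0 : R) = (fun=> 0).
    by apply/funext => n; rewrite seriesEnat /= big1.
  by rewrite lim_cst.
have cv := re_slice_cvg (fock_summable f).
have ge0 k : 0 <= complex.Re (slice_dot (val f) (val f) k).
  by have := slice_dot_ge0 (val f) k; rewrite lecE => /andP[].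
have nd : nondecreasing_seq
    (series (fun k => complex.Re (slice_dot (val f) (val f) k))).
  by apply/nondecreasing_seqP => n; rewrite !seriesEnat /= big_nat_recr //= lerDl.
have := nondecreasing_cvgn_le nd cv (size w).+1; rewrite {1}/series /=.
rewrite big_nat_recr //=; apply: lt_le_trans.
rewrite ltr_wpDl ?sumr_ge0 //.
suff: 0 < slice_dot (val f) (val f) (size w) by rewrite ltcE => /andP[].
rewrite /slice_dot (bigD1 (in_tuple w)) //= ltr_pwDl //.
  by rewrite mul_conjC_gt0.
by apply: sumr_ge0 => u _; rewrite mul_conjC_ge0.
Qed.
HB.instance Definition _ := isDotProduct.Build (C R) fock fockdot fockdot_gt0.

Definition fock_space : ipspace R := IPSpace fockdot.

(* x (x) f, for [x] of degree 1. *)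
Definition tensor_vec (x f : tensor) : tensor := fun w =>
  if w is a :: w' then x [:: a] * f w' else 0.

(* [T] is the operator S_x: [T f] is the orthogonal projection of x (x) f onto
   the Fock space of the subproduct system. *)
Definition creation (x : tensor) (T : fock_space -> fock_space) :=
  forall f g : fock, '[T f, g] = fdot (tensor_vec x (val f)) (val g).

(* [cstar_gen creations] is the Toeplitz algebra and [cquotient creations] the
   Cuntz-Pimsner algebra of the subproduct system. *)
Definition creations : set (fock_space -> fock_space) :=
  [set T | exists2 x, motzkin 1 x & creation x T].

End Motzkin.
Arguments creations {R} a1 a2.
Arguments fock_space {R} a1 a2.

(** * The topological spaces of the statement *)

Definition homeomorphic (X Y : topologicalType) :=
  exists (f : X -> Y) (g : Y -> X),
    [/\ cancel f g, cancel g f, continuous f & continuous g].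

Section Model.
Context (R : realType).

Definition circle : set (C R) := [set z | `|z| = 1].

Definition isqrt2 : R := (Num.sqrt 2)^-1.

Definition model_circle (s : C R) : set (R * C R * C R) :=
  [set (isqrt2, u, s * u) | u in circle].

Definition model_dom : set (R * C R * C R) :=
  (`[0, isqrt2] `*` circle `*` circle) `\`
  (model_circle 1 `|` model_circle (-1)).

Definition model_glue (x y : model_dom) : Prop :=
  let: (r, u, v) := \val x in let: (r', u', v') := \val y in
  (r = 0 /\ r' = 0 /\ u' = u) \/
  (r = isqrt2 /\ r' = isqrt2 /\ u' = u^* * v ^+ 2 /\ v' = v).

Definition model_eq : rel model_dom := fun x y =>
  `[< clos_refl_sym_trans _ model_glue x y >].

Lemma model_eq_refl : reflexive model_eq.
Proof. by move=> x; apply/asboolP/rst_refl. Qed.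

Lemma model_eq_sym : symmetric model_eq.
Proof. by move=> x y; apply/idP/idP => /asboolP h; apply/asboolP/rst_sym. Qed.

Lemma model_eq_trans : transitive model_eq.
Proof.
move=> y x z /asboolP xy /asboolP yz; apply/asboolP.
exact: rst_trans xy yz.
Qed.

Canonical model_eq_equiv :=
  EquivRel model_eq model_eq_refl model_eq_sym model_eq_trans.

Definition model := quotient_topology {eq_quot model_eq}.
HB.instance Definition _ := Topological.on model.
End Model.
Arguments circle R : clear implicits.

(* Main.v *)
From HB Require Import structures.
Require Import Defs.
From mathcomp Require Import all_boot all_order all_algebra.
From mathcomp Require Import all_classical all_reals all_analysis.
From mathcomp Require Import generic_quotient complex ring lra.
From Stdlib Require Import Relation_Operators.
Set Implicit Arguments.
Unset Strict Implicit.
Unset Printing Implicit Defensive.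
Import Order.TTheory GRing.Theory Num.Theory.
Import numFieldNormedType.Exports.
Local Open Scope classical_set_scope.
Local Open Scope quotient_scope.
Local Open Scope ring_scope.

(** Why the theorem holds.

    The range of the Jones-Wenzl idempotent g_k is the common kernel of the p_i
    and of the t_i ([motzkinP]). So H_1 is spanned by v_1 - v_3 and v_2, and the
    only relation between these two letters says that their squares are
    proportional. If the two letters are exchanged at every second position of a
    word, that relation becomes a commutation: H_k is the k-th symmetric power of
    C^2 ([letter_rel_class], [slice_dot_coord]). The generators are then
    combinations of the two shifts of a symmetric Fock space, where the role of the
    coordinates alternates with the parity of the degree ([creations_span]). All
    the relations of the quotient follow, with explicit compact defects; they are
    collected in [shift_model], together with the coherent vectors.

    Dimension at most 2. In a representation, the sum X and the difference Y of the
    two generators are normal, X anticommutes with Y and with its adjoint, and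
    X^*X + Y^*Y = 2. So X^2, Y^2 and X^*X are central, hence scalar if the
    representation is irreducible ([schur]). If X or Y vanishes, the dimension
    is 1. Otherwise an eigenvector e of X and Y e span the space
    ([irreducible_classification]), and the class is determined by the non-zero
    scalars sg = X^2 and dl = - Y^2, which satisfy |sg| + |dl| = 2
    ([params2_equivalent]).

    Existence. Let z be in the unit sphere of C^2. Up to an error that vanishes at
    infinity, each shift maps the n-th coherent vector of z to z1 or z2 times the
    next one, according to the parity of n. So averages of coherent vectors over
    long windows of even and of odd degrees are almost permuted, and an element T of
    the algebra acts on them, in the limit, by a 2 x 2 matrix: its [symbol] at z.
    The symbol is multiplicative, continuous in z, and zero for compact operators.
    At z1 <> z2, - z2 it is an irreducible representation with sg = (z1 + z2)^2 and
    dl = (z1 - z2)^2 ([point_irreducible], [point_params2]). On the circles z1 = z2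
    and z1 = - z2 it has an invariant line, which yields the characters
    ([character_plus], [character_minus]).

    Topology. Scalars by which an element of the algebra acts are continuous
    functions on the spectrum: |H| + H separates the classes where H is positive
    ([scalar_continuous]). So sg and dl are continuous and injective on Spec(2).
    The sphere maps onto the pairs with |sg| + |dl| = 2 ([point_map]), and so does
    [0, 1/sqrt 2] x T^2 ([model_map]), with the fibres that the gluing prescribes
    ([model_map_inj]) and with the two removed circles over the zeros of sg and dl
    ([model_map_eq0]). Both spaces are compact, so closed sets of classes, which
    are given by the vanishing of symbols, correspond to closed sets of parameters,
    and these to closed sets of the model ([spectrum2_homeomorphic]). On Spec(1)
    the scalars of X and Y are coordinates on the two circles
    ([spectrum1_homeomorphic]). *)

Import ComplexField.

(** * Complex numbers *)

(** The inclusion of the reals, with values in [C R] rather than in [R[i]], so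
    that the structures of [C R] are inferred on it. *)
Definition rc {R : realType} (r : R) : C R := real_complex R r.

Section RealPart.
Variable R : realType.
Fact rc_additive : additive (@rc R).
Proof. exact: real_complex_is_additive. Qed.
HB.instance Definition _ := GRing.isAdditive.Build R (C R) (@rc R) rc_additive.
Fact rc_multiplicative : multiplicative (@rc R).
Proof. exact: real_complex_is_multiplicative. Qed.
HB.instance Definition _ := GRing.isMultiplicative.Build R (C R) (@rc R)
  rc_multiplicative.
End RealPart.

Section ComplexModulus.
Context {R : realType}.
Implicit Types z w : C R.

(** The modulus as an element of R; the norm of [C R] takes its values in [C R]. *)
Definition cm z : R := complex.Re `|z|.

Lemma rcI : injective (@rc R). Proof. exact: complexI. Qed.

Lemma rc_ler (x y : R) : (rc x <= rc y) = (x <= y). Proof. exact: lecR. Qed.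
Lemma rc_ltr (x y : R) : (rc x < rc y) = (x < y). Proof. exact: ltcR. Qed.

Lemma cmE z : `|z| = rc (cm z).
Proof. by rewrite /cm normc_def. Qed.

Lemma cm_ge0 z : 0 <= cm z.
Proof. by rewrite -rc_ler rmorph0 -cmE normr_ge0. Qed.

Lemma cm0 : cm 0 = 0. Proof. by rewrite /cm normr0. Qed.

Lemma cm1 : cm 1 = 1. Proof. by rewrite /cm normr1. Qed.

Lemma cm_eq0 z : cm z = 0 -> z = 0.
Proof. by move=> h; apply/eqP; rewrite -normr_eq0 cmE h. Qed.

Lemma cm_gt0 z : z != 0 -> 0 < cm z.
Proof.
by move=> h; rewrite lt0r cm_ge0 andbT; apply: contraNneq h => /cm_eq0 ->.
Qed.

Lemma cmM z w : cm (z * w) = cm z * cm w.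
Proof. by apply: rcI; rewrite -cmE normrM !cmE rmorphM. Qed.

Lemma cmD z w : cm (z + w) <= cm z + cm w.
Proof.
by rewrite -rc_ler -cmE rmorphD /= -!cmE ler_normD.
Qed.

Lemma cmN z : cm (- z) = cm z. Proof. by rewrite /cm normrN. Qed.

Lemma cmB z w : cm (z - w) = cm (w - z). Proof. by rewrite /cm distrC. Qed.

Lemma cm_conj z : cm z^* = cm z. Proof. by rewrite /cm norm_conjC. Qed.

Lemma cmV z : cm z^-1 = (cm z)^-1.
Proof. by apply: rcI; rewrite -cmE normfV !cmE fmorphV. Qed.

Lemma cmX z n : cm (z ^+ n) = cm z ^+ n.
Proof. by elim: n => [|n IH]; rewrite ?expr0 ?cm1 // !exprS cmM IH. Qed.

Lemma cm_rc (r : R) : cm (rc r) = `|r|.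
Proof. by rewrite /cm normc_def /= expr0n addr0 sqrtr_sqr. Qed.

Lemma mul_conj_cm z : z * z^* = rc (cm z ^+ 2).
Proof. by rewrite -normCK cmE rmorphXn. Qed.

Lemma ReD z w : complex.Re (z + w) = complex.Re z + complex.Re w.
Proof. by case: z w => ? ? []. Qed.

Lemma Re_rcM (r : R) z : complex.Re (rc r * z) = r * complex.Re z.
Proof. by case: z => a b /=; rewrite mul0r subr0. Qed.

Lemma Re_le_cm z : complex.Re z <= cm z.
Proof.
rewrite /cm normc_def /=; apply: le_trans (ler_norm _) _.
by rewrite -sqrtr_sqr ler_wsqrtr // lerDl sqr_ge0.
Qed.

Lemma ReN z : complex.Re (- z) = - complex.Re z.
Proof. by case: z. Qed.

Lemma Re_norm_cm z : `|complex.Re z| <= cm z.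
Proof.
by rewrite ler_norml Re_le_cm andbT lerNl -ReN -cmN Re_le_cm.
Qed.

Lemma Im_norm_cm z : `|complex.Im z| <= cm z.
Proof.
rewrite /cm normc_def /= -sqrtr_sqr ler_wsqrtr // lerDr sqr_ge0 //.
Qed.

Lemma cm_le_ReIm z : cm z <= `|complex.Re z| + `|complex.Im z|.
Proof.
case: z => a b; rewrite (_ : Complex a b = rc a + 'i%C * rc b :> C R); last first.
  by rewrite [LHS]complexE.
apply: le_trans (cmD _ _) _; rewrite cmM !cm_rc.
rewrite (_ : cm 'i%C = 1); last by rewrite /cm normc_def /= expr0n expr1n add0r sqrtr1.
by rewrite mul1r /= !(mul0r, mul1r, addr0, add0r, subr0, mulr0).
Qed.

Lemma conj_Re z : complex.Re z^* = complex.Re z.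
Proof. by case: z. Qed.

Lemma conj_rc (r : R) : (rc r)^* = rc r.
Proof. exact: conjc_real. Qed.

Lemma rc_le z (r : R) : 0 <= z -> (z <= rc r) = (complex.Re z <= r).
Proof. by move=> /ger0_Im h; rewrite lecE /= h eqxx. Qed.

Lemma ge0_rc z : 0 <= z -> z = rc (complex.Re z).
Proof. by case: z => a b /ger0_Im /= ->. Qed.

Lemma gt0_rc_sqr z : 0 < z -> exists2 r : R, 0 < r & z = rc (r ^+ 2).
Proof.
move=> z0; have z1 : 0 < complex.Re z by move: z0; rewrite ltcE => /andP[].
exists (Num.sqrt (complex.Re z)); first by rewrite sqrtr_gt0.
by rewrite sqr_sqrtr ?(ltW z1) //; apply: ge0_rc; exact: ltW.
Qed.

End ComplexModulus.

Section ComplexComplete.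
Context {R : realType}.

Lemma realC_complete (u : nat -> R) :
  (forall e : R, 0 < e -> exists N, forall m n, (N <= m)%N -> (N <= n)%N ->
     `|u m - u n| < e) ->
  exists l, forall e : R, 0 < e -> exists N, forall n, (N <= n)%N -> `|u n - l| < e.
Proof.
move=> h; have cu : cvgn u.
  apply/cauchy_cvgP/cauchy_exP => e e0; have [N hN] := h _ e0.
  exists (u N); exists N => // n /= Nn; rewrite /ball /=; exact: hN.
exists (limn u) => e e0.
move/cvgrPdist_lt: cu => /(_ e e0)[N _ hN].
by exists N => n Nn; rewrite distrC; exact: hN.
Qed.

Lemma complexC_complete (u : nat -> C R) :
  (forall e : R, 0 < e -> exists N, forall m n, (N <= m)%N -> (N <= n)%N ->
     cm (u m - u n) < e) ->
  exists l, forall e : R, 0 < e -> exists N, forall n, (N <= n)%N -> cm (u n - l) < e.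
Proof.
move=> h.
have ReB (z w : C R) : complex.Re (z - w) = complex.Re z - complex.Re w.
  by case: z w => ? ? [].
have ImB (z w : C R) : complex.Im (z - w) = complex.Im z - complex.Im w.
  by case: z w => ? ? [].
have [lr hr] : exists l, forall e : R, 0 < e -> exists N, forall n, (N <= n)%N ->
    `|complex.Re (u n) - l| < e.
  apply: realC_complete => e /h[N hN]; exists N => m n Nm Nn.
  by rewrite -ReB; exact: le_lt_trans (Re_norm_cm _) (hN _ _ Nm Nn).
have [li hi] : exists l, forall e : R, 0 < e -> exists N, forall n, (N <= n)%N ->
    `|complex.Im (u n) - l| < e.
  apply: realC_complete => e /h[N hN]; exists N => m n Nm Nn.
  by rewrite -ImB; exact: le_lt_trans (Im_norm_cm _) (hN _ _ Nm Nn).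
exists (Complex lr li) => e e0.
have e2 : 0 < e / 2 by rewrite divr_gt0.
have [N1 h1] := hr _ e2; have [N2 h2] := hi _ e2; exists (maxn N1 N2) => n.
rewrite geq_max => /andP[n1 n2]; apply: le_lt_trans (cm_le_ReIm _) _.
rewrite ReB ImB [ltRHS](splitr e); apply: ltrD; [exact: h1|exact: h2].
Qed.

End ComplexComplete.

(** * Norms *)
Section Norm.
Context {R : realType} {V : ipspace R}.
Implicit Types (x y z : V) (a : C R).

Definition nm x : R := Num.sqrt (complex.Re '[x]).

Lemma ip_ge0 x : 0 <= '[x]. Proof. exact: (dnorm_ge0 (ip_form V)). Qed.

Lemma Re_ip_ge0 x : 0 <= complex.Re '[x].
Proof. by have := ip_ge0 x; rewrite lecE => /andP[]. Qed.

Lemma nm_ge0 x : 0 <= nm x. Proof. exact: sqrtr_ge0. Qed.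

Lemma nm_sqr x : nm x ^+ 2 = complex.Re '[x].
Proof. by rewrite sqr_sqrtr // Re_ip_ge0. Qed.

Lemma ipE x : '[x] = rc (nm x ^+ 2).
Proof. by rewrite nm_sqr; apply: ge0_rc; exact: ip_ge0. Qed.

Lemma ipC x y : '[x, y] = '[y, x]^*.
Proof. by rewrite (hermC (ip_form V)) expr0 mul1r. Qed.

Lemma ipDl x y z : '[x + y, z] = '[x, z] + '[y, z].
Proof. by rewrite linearDl. Qed.
Lemma ipDr x y z : '[x, y + z] = '[x, y] + '[x, z].
Proof. by rewrite linearDr. Qed.
Lemma ipBl x y z : '[x - y, z] = '[x, z] - '[y, z].
Proof. by rewrite linearBl. Qed.
Lemma ipBr x y z : '[x, y - z] = '[x, y] - '[x, z].
Proof. by rewrite linearBr. Qed.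
Lemma ipZl a x y : '[a *: x, y] = a * '[x, y].
Proof. by rewrite linearZl_LR. Qed.
Lemma ipZr a x y : '[x, a *: y] = a^* * '[x, y].
Proof. by rewrite linearZr. Qed.
Lemma ip0l x : '[0, x] = 0. Proof. by rewrite linear0l. Qed.
Lemma ip0r x : '[x, 0] = 0. Proof. by rewrite linear0r. Qed.

Lemma ip_suml I (r : seq I) (P : pred I) (F : I -> V) y :
  '[\sum_(i <- r | P i) F i, y] = \sum_(i <- r | P i) '[F i, y].
Proof. by elim/big_ind2: _ => [||//]; [exact: ip0l|move=> a b c d <- <-; rewrite ipDl]. Qed.

Lemma ip_sumr I (r : seq I) (P : pred I) (F : I -> V) y :
  '[y, \sum_(i <- r | P i) F i] = \sum_(i <- r | P i) '[y, F i].
Proof. by elim/big_ind2: _ => [||//]; [exact: ip0r|move=> a b c d <- <-; rewrite ipDr]. Qed.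

Lemma nm_eq0 x : nm x = 0 -> x = 0.
Proof.
move=> h; apply/eqP; rewrite -(dnorm_eq0 (ip_form V)) ipE h expr0n.
by apply/eqP.
Qed.

Lemma nm0 : nm 0 = 0. Proof. by rewrite /nm ip0l sqrtr0. Qed.

Lemma nmZ a x : nm (a *: x) = cm a * nm x.
Proof.
apply/eqP; rewrite -(eqrXn2 (n := 2)) ?mulr_ge0 ?nm_ge0 ?cm_ge0 //; apply/eqP.
apply: rcI; rewrite -ipE exprMn rmorphM /= -ipE.
by rewrite ipZl ipZr mulrA mul_conj_cm.
Qed.

Lemma nmN x : nm (- x) = nm x.
Proof. by rewrite -scaleN1r nmZ cmN cm1 mul1r. Qed.

Lemma nmB x y : nm (x - y) = nm (y - x).
Proof. by rewrite -nmN opprB. Qed.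

Lemma nmD_sqr x y : nm (x + y) ^+ 2 = nm x ^+ 2 + nm y ^+ 2 + 2 * complex.Re '[x, y].
Proof.
rewrite !nm_sqr ipDl !ipDr !ReD (ipC y x) conj_Re.
by rewrite mulr2n mulrDl mul1r; ring.
Qed.

Lemma cauchy_schwarz x y : cm '[x, y] <= nm x * nm y.
Proof.
have [->|y0] := eqVneq y 0; first by rewrite ip0r cm0 mulr_ge0 ?nm_ge0.
have ny : 0 < nm y.
  by rewrite lt0r nm_ge0 andbT; apply: contraNneq y0 => /nm_eq0 ->.
have ny2 : 0 < nm y ^+ 2 by rewrite exprn_gt0.
pose a := - ('[x, y] / rc (nm y ^+ 2)).
have := sqr_ge0 (nm (x + a *: y)); rewrite nmD_sqr nmZ ipZr.
have -> : a^* * '[x, y] = - rc ((cm '[x, y]) ^+ 2 / nm y ^+ 2).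
  rewrite /a rmorphN rmorphM mulNr; congr (- _).
  by rewrite -fmorphV /= conj_rc mulrAC (mulrC ('[x, y]^* )) mul_conj_cm -rmorphM.
rewrite ReN /= /a cmN cmM cmV cm_rc (ger0_norm (ltW ny2)).
set c := cm _; set p := nm x; set q := nm y.
have -> : p ^+ 2 + (c / q ^+ 2 * q) ^+ 2 + 2 * - (c ^+ 2 / q ^+ 2) =
          (p ^+ 2 * q ^+ 2 - c ^+ 2) / q ^+ 2.
  by field; rewrite gt_eqF.
rewrite pmulr_lge0 ?invr_gt0 // subr_ge0 -exprMn ler_pXn2r //.
- by rewrite nnegrE cm_ge0.
- by rewrite nnegrE mulr_ge0 ?nm_ge0.
Qed.

Lemma nmD x y : nm (x + y) <= nm x + nm y.
Proof.
rewrite -(ler_pXn2r (n := 2)) ?nnegrE ?addr_ge0 ?nm_ge0 // nmD_sqr.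
have := le_trans (Re_le_cm _) (cauchy_schwarz x y); lra.
Qed.

Lemma nm_tri z x y : nm (x - y) <= nm (x - z) + nm (z - y).
Proof. by apply: le_trans (nmD _ _); rewrite addrA subrK. Qed.

Lemma nm_sum I (r : seq I) (P : pred I) (F : I -> V) :
  nm (\sum_(i <- r | P i) F i) <= \sum_(i <- r | P i) nm (F i).
Proof.
elim/big_ind2: _ => [||//]; first by rewrite nm0.
by move=> a b c d h1 h2; apply: le_trans (nmD _ _) _; exact: lerD.
Qed.

Lemma nm_eps x (c : R) : (forall e, 0 < e -> nm x <= c * e) -> x = 0.
Proof.
move=> h; apply: nm_eq0; apply/eqP; rewrite eq_le nm_ge0 andbT.
apply/ler_addgt0Pr => e e0; rewrite add0r.
have c1 : 0 < `|c| + 1 by rewrite ltr_wpDl.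
apply: le_trans (h (e / (`|c| + 1)) _) _; first by rewrite divr_gt0.
rewrite mulrCA ler_piMr ?(ltW e0) // ler_pdivrMr // mul1r.
by rewrite (le_trans (ler_norm c)) // lerDl.
Qed.

Lemma ipNl x y : '[- x, y] = - '[x, y].
Proof. by rewrite linearNl. Qed.
Lemma ipNr x y : '[x, - y] = - '[x, y].
Proof. by rewrite linearNr. Qed.

Lemma ip_inj x y : (forall z, '[x, z] = '[y, z]) -> x = y.
Proof.
move=> h; apply/eqP; rewrite -subr_eq0 -(dnorm_eq0 (ip_form V)).
by rewrite ipBl h subrr.
Qed.

Lemma ip_le_nm (M : R) x y : 0 <= M ->
  ('[x] <= rc (M ^+ 2) * '[y]) = (nm x <= M * nm y).
Proof.
move=> M0; rewrite !ipE -rmorphM rc_ler -exprMn ler_pXn2r // ?nnegrE ?nm_ge0 //.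
by rewrite mulr_ge0 ?nm_ge0.
Qed.

Lemma ip_lt_nm (e : R) x : 0 <= e -> ('[x] < rc (e ^+ 2)) = (nm x < e).
Proof. by move=> e0; rewrite ipE rc_ltr ltr_pXn2r // ?nnegrE ?nm_ge0. Qed.

End Norm.

(** Paired with an arbitrary vector, a linear identity becomes a ring identity. *)
Ltac vring := apply: ip_inj => ?; rewrite !(ipDl, ipBl, ipZl, ipNl, ip0l); ring.

(** * Bounded operators *)
Section LinearFun.
Context {R : realType} {V W : lmodType (C R)} (T : V -> W) (linT : linear T).
Lemma lin0 : T 0 = 0.
Proof. by have := linT (-1) 0 0; rewrite !scaleN1r oppr0 !addNr addr0. Qed.
Lemma linZ a x : T (a *: x) = a *: T x.
Proof. by have := linT a x 0; rewrite lin0 !addr0. Qed.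
Lemma linD x y : T (x + y) = T x + T y.
Proof. by have := linT 1 x y; rewrite !scale1r. Qed.
Lemma linN x : T (- x) = - T x.
Proof. by rewrite -scaleN1r linZ scaleN1r. Qed.
Lemma linB x y : T (x - y) = T x - T y.
Proof. by rewrite linD linN. Qed.
Lemma lin_sum I (r : seq I) (P : pred I) (F : I -> V) :
  T (\sum_(i <- r | P i) F i) = \sum_(i <- r | P i) T (F i).
Proof. by elim/big_rec2: _ => [|i y1 y2 _ <-]; [exact: lin0|rewrite linD]. Qed.
End LinearFun.

Section Operators.
Context {R : realType} {V : ipspace R}.
Implicit Types (S T : V -> V) (A : set (V -> V)).

Definition op_bound (M : R) T := forall x, nm (T x) <= M * nm x.

Lemma bounded_operatorP T : bounded_operator T <->
  linear T /\ exists2 M, 0 <= M & op_bound M T.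
Proof.
split=> -[lT]; last first.
  by move=> [M M0 h]; split=> //; exists (rc (M ^+ 2)) => x; rewrite ip_le_nm.
move=> [M hM]; split=> //; exists (Num.sqrt `|complex.Re M|); first exact: sqrtr_ge0.
move=> x; rewrite -ip_le_nm ?sqrtr_ge0 // sqr_sqrtr //.
apply: le_trans (hM x) _.
have := le_trans (ip_ge0 _) (hM x); rewrite ipE => h.
have [x0|/eqP x0] := eqVneq (nm x) 0; first by rewrite x0 expr0n !mulr0.
have nx : 0 < rc (nm x ^+ 2).
  by rewrite -(rmorph0 rc) rc_ltr lt0r sqr_ge0 andbT expf_eq0 /=; apply/eqP.
rewrite pmulr_lge0 // in h; rewrite ler_pM2r //.
by rewrite rc_le // ler_norm.
Qed.

(** The conditions on a C*-subalgebra, with estimates in R and without the one on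
    adjoints: commutants of a single operator satisfy them. *)
Definition op_closed A := [/\ A id,
  (forall a S T, A S -> A T -> A (fun x => a *: S x + T x)),
  (forall S T, A S -> A T -> A (S \o T)) &
  (forall T, bounded_operator T -> (forall e : R, 0 < e ->
     exists2 S, A S & forall x, nm (T x - S x) <= e * nm x) -> A T)].

Lemma op_closed0 A : op_closed A -> A (fun=> 0).
Proof.
case=> h1 h2 _ _; have := h2 (-1) _ _ h1 h1; congr (A _).
by apply/funext => x; rewrite scaleN1r addNr.
Qed.

Lemma op_closedZ A a T : op_closed A -> A T -> A (fun x => a *: T x).
Proof.
move=> hA AT; case: (hA) => _ h2 _ _; have := h2 a _ _ AT (op_closed0 hA); congr (A _).
by apply/funext => x; rewrite addr0.
Qed.

Lemma op_closedD A S T : op_closed A -> A S -> A T -> A (fun x => S x + T x).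
Proof.
move=> hA AS AT; case: (hA) => _ h2 _ _; have := h2 1 _ _ AS AT; congr (A _).
by apply/funext => x; rewrite scale1r.
Qed.

Lemma op_closedB A S T : op_closed A -> A S -> A T -> A (fun x => S x - T x).
Proof.
move=> hA AS AT; have := op_closedD hA AS (op_closedZ (-1) hA AT); congr (A _).
by apply/funext => x; rewrite scaleN1r.
Qed.

Lemma op_closed_cstar A : cstar_subalgebra A -> op_closed A.
Proof.
case=> -[_ h1] h2 h3 _ h4; split=> // T bT h; apply: h4 => // _ /gt0_rc_sqr[e e0 ->].
by have [S AS hS] := h _ e0; exists S => // x; rewrite ip_le_nm // ltW.
Qed.

Lemma adjoint_sym S T : adjoint S T -> adjoint T S.
Proof. by move=> h x y; rewrite ipC -h -ipC. Qed.

Lemma adjoint_uniq S T T' : adjoint S T -> adjoint S T' -> T = T'.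
Proof.
move=> h h'; apply/funext => y; apply: ip_inj => z.
by rewrite ipC -h h' -ipC.
Qed.

Lemma adjoint_linear S T : adjoint S T -> linear T.
Proof.
move=> h a x y; apply: ip_inj => z.
by rewrite ipDl ipZl !(adjoint_sym h) ipDl ipZl.
Qed.

Lemma adjoint_bound M S T : adjoint S T -> op_bound M S -> op_bound M T.
Proof.
move=> h b x; have [->|Tx] := eqVneq (T x) 0.
  by rewrite nm0; apply: le_trans (b x); rewrite nm_ge0.
have Tx0 : 0 < nm (T x).
  by rewrite lt0r nm_ge0 andbT; apply: contraNneq Tx => /nm_eq0 ->.
rewrite -(ler_pM2l Tx0) -expr2 nm_sqr -h.
apply: le_trans (Re_le_cm _) _; apply: le_trans (cauchy_schwarz _ _) _.
by rewrite mulrA [X in _ <= X * _]mulrC ler_wpM2r ?nm_ge0.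
Qed.

Lemma adjoint_bounded S T : adjoint S T -> bounded_operator S -> bounded_operator T.
Proof.
move=> h /bounded_operatorP[_ [M M0 b]]; apply/bounded_operatorP; split.
  exact: adjoint_linear h.
by exists M => //; exact: adjoint_bound b.
Qed.

Lemma adjoint_comp S S' T T' : adjoint S S' -> adjoint T T' ->
  adjoint (S \o T) (T' \o S').
Proof. by move=> h k x y /=; rewrite h k. Qed.

Lemma adjoint_lin a S S' T T' : adjoint S S' -> adjoint T T' ->
  adjoint (fun x => a *: S x + T x) (fun x => a^* *: S' x + T' x).
Proof. by move=> h k x y; rewrite ipDl ipZl h k ipDr ipZr conjCK. Qed.

Lemma adjoint_id : adjoint (@id V) id. Proof. by []. Qed.

Lemma bounded_lin a S T : bounded_operator S -> bounded_operator T ->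
  bounded_operator (fun x => a *: S x + T x).
Proof.
move=> /bounded_operatorP[lS [M M0 hM]] /bounded_operatorP[lT [N N0 hN]].
apply/bounded_operatorP; split.
  move=> c x y; rewrite lS lT !scalerDr !scalerA (mulrC a c) -!addrA; congr (_ + _).
  by rewrite addrCA.
exists (cm a * M + N); first by rewrite addr_ge0 ?mulr_ge0 ?cm_ge0.
move=> x; apply: le_trans (nmD _ _) _; rewrite nmZ mulrDl lerD ?hN //.
by rewrite -mulrA ler_wpM2l ?cm_ge0.
Qed.

Lemma bounded_comp S T : bounded_operator S -> bounded_operator T ->
  bounded_operator (S \o T).
Proof.
move=> /bounded_operatorP[lS [M M0 hM]] /bounded_operatorP[lT [N N0 hN]].
apply/bounded_operatorP; split; first by move=> c x y /=; rewrite lT lS.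
exists (M * N); first exact: mulr_ge0.
by move=> x /=; apply: le_trans (hM _) _; rewrite -mulrA ler_wpM2l.
Qed.

Lemma bounded_id : bounded_operator (@id V).
Proof.
apply/bounded_operatorP; split=> [//|].
by exists 1; rewrite ?ler01 // => x; rewrite mul1r.
Qed.

Lemma cstar_subalgebra_bounded : cstar_subalgebra (@bounded_operator R V).
Proof.
split.
- by split=> //; exact: bounded_id.
- by move=> a S T; exact: bounded_lin.
- by move=> S T; exact: bounded_comp.
- by move=> S T bS aST; exact: adjoint_bounded aST bS.
- by [].
Qed.

Lemma complete_nm (u : nat -> V) : complete_ipspace V ->
  (forall e : R, 0 < e -> exists N, forall m n, (N <= m)%N -> (N <= n)%N ->
     nm (u m - u n) < e) ->
  exists l, forall e : R, 0 < e -> exists N, forall n, (N <= n)%N -> nm (u n - l) < e.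
Proof.
move=> cV h.
have [|l hl] := cV u; last first.
  exists l => e e0; have e2 : 0 < rc (e ^+ 2).
    by rewrite -(rmorph0 rc) rc_ltr exprn_gt0.
  have [N hN] := hl _ e2; exists N => n /hN; rewrite ip_lt_nm //.
  exact: ltW.
move=> _ /gt0_rc_sqr[e se ->]; have [N hN] := h _ se; exists N => m n Nm Nn.
by rewrite ip_lt_nm ?hN // ltW.
Qed.

End Operators.

(** ** Square roots *)
Section SquareRoot.
Context {R : realType} {V : ipspace R} (Y : V -> V).
Hypotheses (cV : complete_ipspace V) (lY : linear Y) (aY : adjoint Y Y)
  (bY : op_bound 1 Y).

(** The iterates of Q |-> (Y + Q^2) / 2 from 0; if Q is their limit, then 1 - Q is a
    square root of 1 - Y. *)
Fixpoint sqrt_iter n : V -> V :=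
  if n is m.+1 then
    fun x => rc 2^-1 *: (Y x + sqrt_iter m (sqrt_iter m x))
  else fun=> 0.

(** The case Y = 1, which dominates the others in norm. *)
Fixpoint sqrt_bound n : R :=
  if n is m.+1 then (1 + sqrt_bound m ^+ 2) / 2 else 0.

Local Notation Qn := sqrt_iter.
Local Notation qn := sqrt_bound.

Lemma sqrt_iterS n x : Qn n.+1 x = rc 2^-1 *: (Y x + Qn n (Qn n x)).
Proof. by []. Qed.

Lemma sqrt_boundS n : qn n.+1 = (1 + qn n ^+ 2) / 2.
Proof. by []. Qed.

Lemma sqrt_bound_itv n : 0 <= qn n <= 1.
Proof.
elim: n => [|n /andP[h1 h2]]; first by rewrite lexx ler01.
have : qn n ^+ 2 <= 1 by rewrite expr_le1.
have : 0 <= qn n ^+ 2 by rewrite sqr_ge0.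
by rewrite sqrt_boundS => ? ?; apply/andP; split; lra.
Qed.

Lemma sqrt_bound_ge0 n : 0 <= qn n.
Proof. by have /andP[] := sqrt_bound_itv n. Qed.

Lemma sqrt_bound_incr n : qn n <= qn n.+1.
Proof.
elim: n => [|n IH]; first exact: sqrt_bound_ge0.
rewrite 2!sqrt_boundS ler_pM2r ?invr_gt0 // lerD2l.
by rewrite ler_pXn2r // nnegrE sqrt_bound_ge0.
Qed.

Lemma sqrt_iter_linear n : linear (Qn n).
Proof.
elim: n => [|n IH] a x y; first by rewrite /= scaler0 addr0.
rewrite !sqrt_iterS !IH lY scalerA mulrC -scalerA -scalerDr; congr (_ *: _).
by rewrite scalerDr addrACA.
Qed.

Lemma sqrt_iter_bound n : op_bound (qn n) (Qn n).
Proof.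
elim: n => [|n IH] x; first by rewrite /= nm0 mul0r.
rewrite sqrt_boundS sqrt_iterS nmZ cm_rc ger0_norm ?invr_ge0 // mulrC.
rewrite mulrAC ler_wpM2r ?invr_ge0 // mulrDl expr2.
apply: le_trans (nmD _ _) _; apply: lerD; first exact: bY.
by apply: le_trans (IH _) _; rewrite -mulrA ler_wpM2l // sqrt_bound_ge0.
Qed.

(** Q' = Q_(n+1) and Q = Q_n commute, so Q'^2 - Q^2 = Q' (Q' - Q) + (Q' - Q) Q, and
    for Y = 1 the same identity holds between positive numbers. *)
Lemma sqrt_iter_step n x : nm (Qn n.+1 x - Qn n x) <= (qn n.+1 - qn n) * nm x.
Proof.
elim: n x => [|n IH] x.
  by have := sqrt_iter_bound 1 x; rewrite [Qn 0 _]/= [qn 0]/= !subr0.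
have -> : Qn n.+2 x - Qn n.+1 x = rc 2^-1 *:
    (Qn n.+1 (Qn n.+1 x - Qn n x) + (Qn n.+1 (Qn n x) - Qn n (Qn n x))).
  rewrite sqrt_iterS [X in _ - X]sqrt_iterS -scalerBr; congr (_ *: _).
  rewrite (linB (sqrt_iter_linear n.+1)) addrA subrK.
  by rewrite opprD addrACA subrr add0r.
have -> : qn n.+2 - qn n.+1 = 2^-1 * ((qn n.+1 - qn n) * (qn n.+1 + qn n)).
  rewrite -subr_sqr sqrt_boundS [X in _ - X]sqrt_boundS; set a := qn n; set b := qn _.
  by field.
rewrite nmZ cm_rc ger0_norm ?invr_ge0 // -mulrA ler_wpM2l ?invr_ge0 //.
apply: le_trans (nmD _ _) _; rewrite mulrDr [in leRHS]mulrDl; apply: lerD.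
  apply: le_trans (sqrt_iter_bound _ _) _; rewrite [in leRHS]mulrAC mulrC.
  by rewrite ler_wpM2r ?sqrt_bound_ge0.
apply: le_trans (IH _) _; rewrite -mulrA ler_wpM2l //.
  by rewrite subr_ge0 sqrt_bound_incr.
exact: sqrt_iter_bound.
Qed.

Lemma sqrt_iter_diff m n x : (n <= m)%N ->
  nm (Qn m x - Qn n x) <= (qn m - qn n) * nm x.
Proof.
elim: m => [|m IH]; first by rewrite leqn0 => /eqP ->; rewrite subrr nm0 subrr mul0r.
rewrite leq_eqVlt => /orP[/eqP ->|]; first by rewrite subrr nm0 subrr mul0r.
rewrite ltnS => /IH h; apply: le_trans (nm_tri (Qn m x) _ _) _.
rewrite (_ : qn m.+1 - qn n = (qn m.+1 - qn m) + (qn m - qn n)); last by rewrite addrA subrK.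
by rewrite mulrDl lerD // sqrt_iter_step.
Qed.

Lemma sqrt_bound_le m n : (n <= m)%N -> qn n <= qn m.
Proof.
elim: m => [|m IH]; first by rewrite leqn0 => /eqP ->.
rewrite leq_eqVlt => /orP[/eqP ->//|]; rewrite ltnS => /IH h.
exact: le_trans (sqrt_bound_incr _).
Qed.

Lemma sqrt_bound_cauchy (e : R) : 0 < e -> exists N, forall m, (N <= m)%N ->
  qn m - qn N <= e.
Proof.
move=> e0; have nd : nondecreasing_seq qn by apply/nondecreasing_seqP; exact: sqrt_bound_incr.
have cq : cvgn qn.
  apply: nondecreasing_is_cvgn => //.
  by exists 1 => _ [n _ <-]; have /andP[] := sqrt_bound_itv n.
have h m := nondecreasing_cvgn_le nd cq m.
move/cvgrPdist_lt: cq => /(_ e e0)[N _ hN]; exists N => m Nm.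
have := hN N (leqnn N); rewrite ltr_norml => /andP[_ h'].
by apply: ltW; apply: le_lt_trans h'; rewrite lerD2r.
Qed.

Lemma sqrt_iter_adjoint n : adjoint (Qn n) (Qn n).
Proof.
elim: n => [|n IH] x y; first by rewrite /= ip0l ip0r.
rewrite !sqrt_iterS ipZl ipZr conj_rc ipDl ipDr aY; congr (_ * (_ + _)).
by rewrite !IH.
Qed.

Lemma sqrt_limit : exists2 Q : V -> V, forall x (e : R), 0 < e ->
    exists N, forall m, (N <= m)%N -> nm (Qn m x - Q x) < e &
  forall e : R, 0 < e -> exists n, forall x, nm (Q x - Qn n x) <= e * nm x.
Proof.
have /choice[Q hQ] : forall x, exists y, forall e : R, 0 < e ->
    exists N, forall m, (N <= m)%N -> nm (Qn m x - y) < e.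
  move=> x; apply: complete_nm => // e e0.
  have x1 : 0 < nm x + 1 by rewrite ltr_wpDl ?nm_ge0.
  have d0 : 0 < e / 2 / (nm x + 1) by rewrite !divr_gt0.
  have [N hN] := sqrt_bound_cauchy d0; exists N => m n Nm Nn.
  apply: le_lt_trans (nm_tri (Qn N x) _ _) _; rewrite [ltRHS]splitr.
  have h k : (N <= k)%N -> nm (Qn k x - Qn N x) < e / 2.
    move=> Nk; apply: le_lt_trans (sqrt_iter_diff _ Nk) _.
    apply: le_lt_trans (_ : e / 2 / (nm x + 1) * nm x < _).
      by rewrite ler_wpM2r ?nm_ge0 // hN.
    by rewrite mulrAC ltr_pdivrMr // ltr_pM2l ?divr_gt0 // ltrDl.
  by apply: ltrD; [exact: h|rewrite nmB; exact: h].
exists Q => // e e0; have [N hN] := sqrt_bound_cauchy e0; exists N => x.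
apply/ler_addgt0Pr => d d0; have [M hM] := hQ x _ d0.
apply: le_trans (nm_tri (Qn (maxn M N) x) _ _) _; rewrite addrC; apply: lerD.
  apply: le_trans (sqrt_iter_diff _ (leq_maxr _ _)) _.
  by rewrite ler_wpM2r ?nm_ge0 // hN // leq_maxr.
by rewrite nmB ltW // hM // leq_maxl.
Qed.

Lemma nm_lim (u : nat -> V) l c : (forall e : R, 0 < e -> exists N, forall m,
  (N <= m)%N -> nm (u m - l) < e) -> (forall m, nm (u m) <= c) -> nm l <= c.
Proof.
move=> ul uc; apply/ler_addgt0Pr => e e0; have [N hN] := ul _ e0.
rewrite -[l](subrK (u N)) addrC; apply: le_trans (nmD _ _) _.
by rewrite lerD // nmB ltW // hN.
Qed.

(** The square root of the positive operator 1 - Y lies in every norm-closed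
    algebra of operators that contains Y: in particular it commutes with whatever
    commutes with Y. *)
Theorem sqrt_contraction : exists P : V -> V,
  [/\ bounded_operator P, adjoint P P, (forall x, P (P x) = x - Y x),
      (forall x, 0 <= complex.Re '[P x, x]) &
      forall A, op_closed A -> A Y -> A P].
Proof.
have [Q hQ uQ] := sqrt_limit.
have lQ : linear Q.
  move=> a x y; apply/eqP; rewrite -subr_eq0; apply/eqP.
  apply: (nm_eps (c := 1 + cm a + 1)) => e e0.
  have [N1 h1] := hQ (a *: x + y) _ e0; have [N2 h2] := hQ x _ e0.
  have [N3 h3] := hQ y _ e0; pose N := maxn N1 (maxn N2 N3).
  have -> : Q (a *: x + y) - (a *: Q x + Q y) =
    (Q (a *: x + y) - Qn N (a *: x + y)) + (a *: (Qn N x - Q x) + (Qn N y - Q y)).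
    rewrite sqrt_iter_linear; vring.
  apply: le_trans (nmD _ _) _; rewrite 2!mulrDl mul1r -addrA; apply: lerD.
    by rewrite nmB ltW // h1 // leq_maxl.
  apply: le_trans (nmD _ _) _; rewrite nmZ; apply: lerD.
    by rewrite ler_wpM2l ?cm_ge0 // ltW // h2 // /N maxnCA leq_maxl.
  by rewrite ltW // h3 // /N maxnA leq_maxr.
have bQ : op_bound 1 Q.
  move=> x; rewrite mul1r; apply: nm_lim (hQ x) _ => m.
  apply: le_trans (sqrt_iter_bound _ _) _; rewrite ler_piMl ?nm_ge0 //.
  by have /andP[] := sqrt_bound_itv m.
have BQ : bounded_operator Q by apply/bounded_operatorP; split=> //; exists 1.
have aQ : adjoint Q Q.
  move=> x y; apply/eqP; rewrite -subr_eq0; apply/eqP/cm_eq0/eqP.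
  rewrite eq_le cm_ge0 andbT; apply/ler_addgt0Pr => e e0; rewrite add0r.
  have c1 : 0 < 2 * (nm x * nm y) + 1 by rewrite ltr_wpDl // !mulr_ge0 ?nm_ge0.
  have [N hN] := uQ _ (divr_gt0 e0 c1).
  have -> : '[Q x, y] - '[x, Q y] = '[Q x - Qn N x, y] - '[x, Q y - Qn N y].
    by rewrite ipBl ipBr sqrt_iter_adjoint opprB addrA subrK.
  apply: le_trans (cmD _ _) _; rewrite cmN.
  apply: le_trans (lerD (cauchy_schwarz _ _) (cauchy_schwarz _ _)) _.
  set d := e / _ in hN *.
  have h1 : nm (Q x - Qn N x) * nm y <= d * nm x * nm y by rewrite ler_wpM2r ?nm_ge0.
  have h2 : nm x * nm (Q y - Qn N y) <= d * nm y * nm x.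
    by rewrite [leLHS]mulrC ler_wpM2r ?nm_ge0.
  apply: le_trans (lerD h1 h2) _.
  have -> : e = d * (2 * (nm x * nm y) + 1) by rewrite /d divfK // gt_eqF.
  have d0 : 0 < d by exact: divr_gt0.
  by rewrite -subr_ge0; move: d0; nra.
have eQ x : Q x = rc 2^-1 *: (Y x + Q (Q x)).
  apply/eqP; rewrite -subr_eq0; apply/eqP; apply: (nm_eps (c := 1 + (1 + nm x))).
  move=> e e0; have [n0 hn0] := uQ _ e0; have [N1 h1] := hQ x _ e0.
  have [N2 h2] := sqrt_bound_cauchy e0; pose N := maxn N1 (maxn N2 n0).
  have uN y : nm (Q y - Qn N y) <= e * nm y.
    apply: nm_lim (_ : forall d, 0 < d -> exists M, forall m, (M <= m)%N ->
       nm ((Qn (maxn N m) y - Qn N y) - (Q y - Qn N y)) < d) _ => [d d0|m].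
      have [M hM] := hQ y _ d0; exists M => m Mm; rewrite opprB addrA subrK hM //.
      exact: leq_trans (leq_maxr _ _).
    apply: le_trans (sqrt_iter_diff _ (leq_maxl _ _)) _; rewrite ler_wpM2r ?nm_ge0 //.
    have N2N : (N2 <= N)%N by rewrite /N maxnCA leq_maxl.
    apply: le_trans (h2 (maxn N m) _); last exact: leq_trans (leq_maxl _ _).
    by rewrite lerD2l lerN2 sqrt_bound_le.
  have -> : Q x - rc 2^-1 *: (Y x + Q (Q x)) = (Q x - Qn N.+1 x) +
     rc 2^-1 *: (Qn N (Qn N x - Q x) + (Qn N (Q x) - Q (Q x))).
    rewrite sqrt_iterS (linB (sqrt_iter_linear N)); vring.
  apply: le_trans (nmD _ _) _; rewrite mulrDl mul1r; apply: lerD.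
    by rewrite nmB ltW // h1 // (leq_trans (leq_maxl N1 (maxn N2 n0))) // leqnSn.
  rewrite nmZ cm_rc ger0_norm ?invr_ge0 //.
  apply: le_trans (_ : nm (Qn N (Qn N x - Q x) + (Qn N (Q x) - Q (Q x))) <= _).
    by rewrite ler_piMl ?nm_ge0 // invf_le1 // ler1n.
  apply: le_trans (nmD _ _) _; rewrite mulrDl mul1r; apply: lerD.
    apply: le_trans (sqrt_iter_bound _ _) _; apply: le_trans (_ : 1 * e <= _).
      apply: ler_pM; rewrite ?sqrt_bound_ge0 ?nm_ge0 //.
        by have /andP[] := sqrt_bound_itv N.
      by rewrite ltW // h1 // leq_maxl.
    by rewrite mul1r.
  rewrite nmB; apply: le_trans (uN _) _; rewrite mulrC ler_wpM2r ?(ltW e0) //.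
  by have := bQ x; rewrite mul1r.
exists (fun x => x - Q x); split.
- have := bounded_lin (-1) BQ bounded_id; congr bounded_operator.
  by apply/funext => x; rewrite scaleN1r addrC.
- by move=> x y; rewrite ipBl ipBr aQ.
- move=> x; rewrite (linB lQ).
  have -> : Y x = Q x + Q x - Q (Q x).
    rewrite {1 2}eQ -scalerDl -rmorphD /= (_ : 2^-1 + 2^-1 = 1) ?rmorph1 ?scale1r ?addrK //.
    by field.
  vring.
- move=> x; rewrite ipBl.
  have := le_trans (Re_le_cm _) (cauchy_schwarz (Q x) x).
  have := bQ x; rewrite mul1r; have := nm_ge0 x; have := nm_sqr x.
  rewrite ReD ReN => <- x0 h1 h2; rewrite subr_ge0; apply: le_trans h2 _.
  by rewrite expr2 ler_wpM2r.
- move=> A hA AY; have h n : A (Qn n).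
    elim: n => [|n IH]; first exact: op_closed0.
    apply: op_closedZ => //; apply: op_closedD => //.
    by case: (hA) => _ _ h _; exact: h.
  apply: op_closedB => //; first by case: hA.
  case: (hA) => _ _ _; apply=> // e /uQ[n hn].
  by exists (Qn n).
Qed.

End SquareRoot.

(** * Compact operators *)
Section Compact.
Context {R : realType} {V : ipspace R}.
Implicit Types (S T : V -> V).

Lemma compact_operatorP T : compact_operator T <-> bounded_operator T /\
  forall e : R, 0 < e -> exists s : seq V, forall x, nm x <= 1 ->
    exists2 y, y \in s & nm (T x - y) < e.
Proof.
have le1 (x : V) : ('[x] <= 1) = (nm x <= 1).
  by rewrite ipE -(rmorph1 rc) rc_ler expr_le1 ?nm_ge0.
split=> -[bT h]; split=> //.
  move=> e e0; have e2 : 0 < rc (e ^+ 2) by rewrite -(rmorph0 rc) rc_ltr exprn_gt0.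
  have [s hs] := h _ e2; exists s => x; rewrite -le1 => /hs[y ys].
  by rewrite ip_lt_nm ?ltW //; exists y.
move=> _ /gt0_rc_sqr[e e0 ->]; have [s hs] := h _ e0; exists s => x.
by rewrite le1 => /hs[y ys xy]; exists y => //; rewrite ip_lt_nm // ltW.
Qed.

Lemma compact_lin a S T : compact_operator S -> compact_operator T ->
  compact_operator (fun x => a *: S x + T x).
Proof.
move=> /compact_operatorP[bS hS] /compact_operatorP[bT hT].
apply/compact_operatorP; split=> [|e e0]; first exact: bounded_lin.
have a1 : 0 < cm a + 1 by rewrite ltr_wpDl ?cm_ge0.
have e2 : 0 < e / 2 by rewrite divr_gt0.
have [s hs] := hS _ (divr_gt0 e2 a1); have [t ht] := hT _ e2.
exists [seq a *: y + z | y <- s, z <- t] => x x1.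
have [y ys xy] := hs _ x1; have [z zt xz] := ht _ x1.
exists (a *: y + z); first by apply/allpairsP; exists (y, z).
have -> : a *: S x + T x - (a *: y + z) = a *: (S x - y) + (T x - z) by vring.
apply: le_lt_trans (nmD _ _) _; rewrite [ltRHS]splitr nmZ ler_ltD //.
apply: le_trans (_ : cm a * (e / 2 / (cm a + 1)) <= _).
  by rewrite ler_wpM2l ?cm_ge0 // ltW.
rewrite mulrCA ler_piMr ?(ltW e2) // ler_pdivrMr // mul1r.
by rewrite lerDl.
Qed.

Lemma compact_comp S T : compact_operator S -> bounded_operator T ->
  compact_operator (S \o T).
Proof.
move=> /compact_operatorP[bS hS] bT; apply/compact_operatorP.
split=> [|e e0]; first exact: bounded_comp.
have /bounded_operatorP[lS _] := bS.
have /bounded_operatorP[lT [M M0 hM]] := bT.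
have M1 : 0 < M + 1 by rewrite ltr_wpDl.
have [s hs] := hS _ (divr_gt0 e0 M1); exists [seq rc (M + 1) *: y | y <- s] => x x1.
have [|y ys xy] := hs (rc (M + 1)^-1 *: T x).
  rewrite nmZ cm_rc ger0_norm ?invr_ge0 ?(ltW M1) // mulrC ler_pdivrMr // mul1r.
  apply: le_trans (hM x) _.
  by apply: le_trans (_ : M * 1 <= _); [rewrite ler_wpM2l|rewrite mulr1 lerDl].
exists (rc (M + 1) *: y); first exact: map_f.
have -> : (S \o T) x - rc (M + 1) *: y =
    rc (M + 1) *: (S (rc (M + 1)^-1 *: T x) - y).
  rewrite (linZ lS) scalerBr scalerA -rmorphM divff ?gt_eqF //.
  by rewrite rmorph1 scale1r.
by rewrite nmZ cm_rc ger0_norm ?(ltW M1) // mulrC -ltr_pdivlMr.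
Qed.

Lemma compact0 : compact_operator (fun=> 0 : V).
Proof.
apply/compact_operatorP; split.
  by apply: op_closed0; exact/op_closed_cstar/cstar_subalgebra_bounded.
by move=> e e0; exists [:: 0] => x _; exists 0; rewrite ?mem_head // subr0 nm0.
Qed.

Lemma compact_lim T : bounded_operator T -> (forall e : R, 0 < e ->
  exists2 S, compact_operator S & forall x, nm (T x - S x) <= e * nm x) ->
  compact_operator T.
Proof.
move=> bT h; apply/compact_operatorP; split=> // e e0.
have e2 : 0 < e / 2 by rewrite divr_gt0.
have [S /compact_operatorP[_ hS] TS] := h _ e2.
have [s hs] := hS _ e2; exists s => x x1; have [y ys xy] := hs _ x1.
exists y => //; apply: le_lt_trans (nm_tri (S x) _ _) _.
rewrite [ltRHS]splitr ler_ltD //; apply: le_trans (TS x) _.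
by rewrite ler_piMr // ltW.
Qed.

(** The points of a square grid of step e / 4. *)
Lemma complex_net (e M : R) : 0 < e -> exists s : seq (C R), forall z, cm z <= M ->
  exists2 y, y \in s & cm (z - y) < e.
Proof.
move=> e0; pose d := e / 4; have d0 : 0 < d by rewrite divr_gt0.
pose N := Num.bound `|M / d|.
pose t := [seq d * (k%:R - N%:R) | k <- iota 0 (N + N).+1].
have ht (r : R) : `|r| <= M -> exists2 y, y \in t & `|r - y| <= d.
  move=> rM; have hN : M / d < N%:R.
    exact: le_lt_trans (ler_norm _) (archi_boundP (normr_ge0 _)).
  have rd : `|r / d| <= M / d.
    by rewrite normrM normfV (gtr0_norm d0) ler_pM2r ?invr_gt0.
  have r0 : 0 <= r / d + N%:R.
    by rewrite -lerBlDr sub0r; move: rd; rewrite ler_norml => /andP[h _];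
      apply: le_trans h; rewrite lerN2 ltW.
  have /andP[h1 h2] := truncn_itv r0; set k := Num.truncn _ in h1 h2.
  exists (d * (k%:R - N%:R)).
    apply/mapP; exists k => //; rewrite mem_iota add0n ltnS /=.
    rewrite -(ler_nat R) natrD; apply: le_trans h1 _; rewrite lerD2r.
    by apply: le_trans (ler_norm _) _; apply: le_trans rd _; exact: ltW.
  have -> : r - d * (k%:R - N%:R) = d * (r / d + N%:R - k%:R).
    by field; rewrite gt_eqF.
  rewrite normrM (gtr0_norm d0) ler_piMr ?(ltW d0) // ler_norml; apply/andP; split.
    by rewrite (le_trans _ (_ : 0 <= _)) ?subr_ge0 // oppr_le0.
  by rewrite lerBlDl natr1 ltW.
exists [seq (Complex x y : C R) | x <- t, y <- t] => z zM.
have [x xt hx] := ht _ (le_trans (Re_norm_cm z) zM).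
have [y yt hy] := ht _ (le_trans (Im_norm_cm z) zM).
exists (Complex x y); first by apply/allpairsP; exists (x, y).
apply: le_lt_trans (cm_le_ReIm _) _.
have -> : complex.Re (z - Complex x y) = complex.Re z - x by case: (z).
have -> : complex.Im (z - Complex x y) = complex.Im z - y by case: (z).
by apply: le_lt_trans (lerD hx hy) _; rewrite /d; lra.
Qed.

Lemma compact_rank1 (l : V -> C R) v (M : R) : scalar l ->
  (forall x, cm (l x) <= M * nm x) -> compact_operator (fun x => l x *: v).
Proof.
move=> ll lM; have v1 : 0 < nm v + 1 by rewrite ltr_wpDl ?nm_ge0.
apply/compact_operatorP; split.
  apply/bounded_operatorP; split.
    by move=> a x y; rewrite ll scalerDl -scalerA.
  exists (`|M| * nm v); first by rewrite mulr_ge0 ?nm_ge0.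
  move=> x; rewrite nmZ mulrAC ler_wpM2r ?nm_ge0 //.
  by apply: le_trans (lM x) _; rewrite ler_wpM2r ?nm_ge0 // ler_norm.
move=> e e0; have [s hs] := complex_net `|M| (divr_gt0 e0 v1).
exists [seq y *: v | y <- s] => x x1; have [|y ys xy] := hs (l x).
  apply: le_trans (lM x) _; apply: le_trans (_ : `|M| * nm x <= _).
    by rewrite ler_wpM2r ?nm_ge0 // ler_norm.
  by rewrite ler_piMr.
exists (y *: v); first exact: map_f.
rewrite -scalerBl nmZ; apply: le_lt_trans (_ : cm (l x - y) * (nm v + 1) < _).
  by rewrite ler_wpM2l ?cm_ge0 // lerDl.
by rewrite -ltr_pdivlMr.
Qed.

End Compact.

Lemma small_inv {R : realType} (d : R) : 0 < d ->
  exists N, forall n, (N <= n)%N -> n.+1%:R^-1 < d.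
Proof.
move=> d0; exists (Num.bound d^-1) => n Nn.
rewrite invf_plt ?posrE ?ltr0Sn //; apply: lt_le_trans (archi_boundP _) _.
  by rewrite invr_ge0 ltW.
by rewrite ler_nat (leq_trans Nn).
Qed.

Section AdjointLimit.
Context {R : realType} {V : ipspace R}.

(** An operator and its adjoint have the same norm, so the adjoints of
    approximations of T form a Cauchy sequence. *)
Lemma adjoint_lim (T : V -> V) : complete_ipspace V ->
  (forall e : R, 0 < e -> exists S S', adjoint S S' /\
     forall x, nm (T x - S x) <= e * nm x) ->
  exists T', adjoint T T'.
Proof.
move=> cV h; have /choice[S hS] : forall n, exists S, exists S', adjoint S S' /\
    forall x, nm (T x - S x) <= n.+1%:R^-1 * nm x.
  by move=> n; apply: h; rewrite invr_gt0 ltr0Sn.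
have {hS} /choice[S' hS] := hS.
have hb m n : op_bound (m.+1%:R^-1 + n.+1%:R^-1) (fun x => S' m x - S' n x).
  apply: (@adjoint_bound _ _ _ (fun x => S m x - S n x)).
    by move=> x y; rewrite ipBl ipBr (hS m).1 (hS n).1.
  move=> x; rewrite mulrDl; apply: le_trans (nm_tri (T x) _ _) _.
  by rewrite lerD ?(hS n).2 // nmB (hS m).2.
have /choice[T' hT'] : forall y, exists l, forall e : R, 0 < e ->
    exists N, forall n, (N <= n)%N -> nm (S' n y - l) < e.
  move=> y; apply: complete_nm => // e e0.
  have y1 : 0 < 2 * (nm y + 1) by rewrite mulr_gt0 // ltr_wpDl ?nm_ge0.
  have [N hN] := small_inv (divr_gt0 e0 y1).
  exists N => m n /hN hm /hN hn; apply: le_lt_trans (hb m n y) _.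
  apply: le_lt_trans (_ : (e / (2 * (nm y + 1)) * 2) * nm y < _).
    by rewrite ler_wpM2r ?nm_ge0 // mulr_natr mulr2n lerD // ltW.
  have -> : e / (2 * (nm y + 1)) * 2 * nm y = e * (nm y / (nm y + 1)).
    by field; rewrite gt_eqF // ltr_wpDl ?nm_ge0.
  rewrite gtr_pMr // ltr_pdivrMr ?mul1r ?ltrDl //.
  by rewrite ltr_wpDl ?nm_ge0.
exists T' => x y; apply/eqP; rewrite -subr_eq0; apply/eqP/cm_eq0/eqP.
rewrite eq_le cm_ge0 andbT; apply/ler_addgt0Pr => e e0; rewrite add0r.
have c1 : 0 < nm x * nm y + nm x + 1 by rewrite ltr_wpDl ?addr_ge0 ?mulr_ge0 ?nm_ge0.
have d0 := divr_gt0 e0 c1; set d := e / _ in d0.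
have [N1 h1] := small_inv d0; have [N2 h2] := hT' y _ d0.
pose N := maxn N1 N2.
have -> : '[T x, y] - '[x, T' y] = '[T x - S N x, y] + '[x, S' N y - T' y].
  by rewrite ipBl ipBr (hS N).1 addrA subrK.
apply: le_trans (cmD _ _) _.
apply: le_trans (lerD (cauchy_schwarz _ _) (cauchy_schwarz _ _)) _.
have k1 : nm (T x - S N x) * nm y <= d * nm x * nm y.
  rewrite ler_wpM2r ?nm_ge0 //; apply: le_trans ((hS N).2 x) _.
  by rewrite ler_wpM2r ?nm_ge0 // ltW // h1 // leq_maxl.
have k2 : nm x * nm (S' N y - T' y) <= nm x * d.
  by rewrite ler_wpM2l ?nm_ge0 // ltW // h2 // leq_maxr.
apply: le_trans (lerD k1 k2) _.
have -> : e = d * (nm x * nm y + nm x + 1) by rewrite /d divfK // gt_eqF.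
by rewrite -subr_ge0; nra.
Qed.

End AdjointLimit.

(** * The C*-algebra generated by a set of operators *)
Section Generated.
Context {R : realType} {V : ipspace R} (G : set (V -> V)).
Hypotheses (cV : complete_ipspace V) (bG : G `<=` @bounded_operator R V)
  (aG : forall T, G T -> exists S, adjoint T S).
Local Notation gen := (cstar_gen G).

Lemma gen_sub : G `<=` gen.
Proof. by move=> T GT A _; apply. Qed.

Lemma gen_bounded : gen `<=` @bounded_operator R V.
Proof. by move=> T; apply => //; exact: cstar_subalgebra_bounded. Qed.

Lemma gen_cstar : cstar_subalgebra gen.
Proof.
split.
- by split; [exact: gen_bounded|exact: cstar_gen_id].
- move=> a S T hS hT A hA GA; case: (hA) => _ h _ _ _.
  by apply: h; [exact: hS|exact: hT].
- by move=> S T; exact: cstar_gen_comp.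
- move=> S T hS aST A hA GA; case: (hA) => _ _ _ h _.
  by apply: h aST; exact: hS.
- move=> T bT h A hA GA; case: (hA) => _ _ _ _; apply=> // e /h[S hS TS].
  by exists S => //; exact: hS.
Qed.

Lemma gen_op_closed : op_closed gen.
Proof. exact/op_closed_cstar/gen_cstar. Qed.

Lemma gen_adjoint S T : gen S -> adjoint S T -> gen T.
Proof. by case: gen_cstar => _ _ _ h _; exact: h. Qed.

Lemma cstar_nm_lim (A : set (V -> V)) :
  (forall T, bounded_operator T -> (forall e : R, 0 < e ->
     exists2 S, A S & forall x, nm (T x - S x) <= e * nm x) -> A T) ->
  forall T, bounded_operator T -> (forall e : C R, 0 < e -> exists2 S, A S &
     forall x, '[T x - S x] <= e * '[x]) -> A T.
Proof.
move=> h T bT hT; apply: h => // e e0.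
have e2 : 0 < rc (e ^+ 2) by rewrite -(rmorph0 rc) rc_ltr exprn_gt0.
have [S AS TS] := hT _ e2; exists S => // x.
by rewrite -ip_le_nm // ltW.
Qed.

(** The bounded operators that have an adjoint form a C*-subalgebra, by
    [adjoint_lim]. *)
Lemma gen_has_adjoint T : gen T -> exists2 S, adjoint T S & gen S.
Proof.
move=> gT; suff [S TS] : exists S, adjoint T S.
  by exists S => //; exact: gen_adjoint TS.
move: gT; move=> /(_ [set T | bounded_operator T /\ exists S, adjoint T S]).
case=> //; last by move=> S GS; split; [exact: bG|exact: aG].
split.
- split; first by move=> ? [].
  by split; [exact: bounded_id|exists id; exact: adjoint_id].
- move=> a S U [bS [S' hS]] [bU [U' hU]]; split; first exact: bounded_lin.
  by eexists; exact: adjoint_lin hS hU.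
- move=> S U [bS [S' hS]] [bU [U' hU]]; split; first exact: bounded_comp.
  by eexists; exact: adjoint_comp hS hU.
- move=> S U [bS _] SU; split; first exact: adjoint_bounded SU bS.
  by exists S; exact: adjoint_sym.
- apply: cstar_nm_lim => U bU h; split=> //; apply: adjoint_lim => // e /h.
  by move=> [S [_ [S' hS]] US]; exists S, S'.
Qed.

(** The set to which the definition of the algebra is applied consists of the T such
    that P holds for T and for its adjoint. *)
Lemma gen_ind (P : (V -> V) -> Prop) :
  (forall T, G T -> P T /\ forall S, adjoint T S -> P S) -> P id ->
  (forall a S T, gen S -> gen T -> P S -> P T -> P (fun x => a *: S x + T x)) ->
  (forall S T, gen S -> gen T -> P S -> P T -> P (S \o T)) ->
  (forall T, gen T -> (forall e : R, 0 < e -> exists2 S, gen S /\ P S &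
     forall x, nm (T x - S x) <= e * nm x) -> P T) ->
  forall T, gen T -> P T.
Proof.
move=> hG hid hlin hcomp hlim T gT.
have := gT [set T | [/\ gen T, P T & forall S, adjoint T S -> P S]].
case=> //; last by move=> S GS; split; [exact: gen_sub|case: (hG _ GS)..].
have [_ glin gcomp gadj glim] := gen_cstar.
split.
- split; first by move=> ? [/gen_bounded].
  split=> //; first exact: cstar_gen_id.
  by move=> S /(adjoint_uniq adjoint_id) <-.
- move=> a S U [gS PS hS] [gU PU hU]; split; [exact: glin|exact: hlin|].
  have [S' aS gS'] := gen_has_adjoint gS; have [U' aU gU'] := gen_has_adjoint gU.
  by move=> W /(adjoint_uniq (adjoint_lin a aS aU)) <-; apply: hlin; auto.
- move=> S U [gS PS hS] [gU PU hU]; split; [exact: gcomp|exact: hcomp|].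
  have [S' aS gS'] := gen_has_adjoint gS; have [U' aU gU'] := gen_has_adjoint gU.
  by move=> W /(adjoint_uniq (adjoint_comp aS aU)) <-; apply: hcomp; auto.
- move=> S U [gS PS hS] SU; split; [exact: gadj SU|exact: hS|].
  by move=> W /(adjoint_uniq (adjoint_sym SU)) <-.
- apply: cstar_nm_lim => U bU h.
  have gU : gen U.
    by case: gen_op_closed => _ _ _; apply => // e /h[S [gS _ _] US]; exists S.
  split=> //; first by apply: hlim => // e /h[S [gS PS _] US]; exists S.
  move=> W UW; apply: hlim => [|e /h[S [gS PS hS] US]]; first exact: gadj UW.
  have [S' aS gS'] := gen_has_adjoint gS; exists S'; first by split; auto.
  apply: (@adjoint_bound _ _ _ (fun x => U x - S x)) => // x y.
  by rewrite ipBl ipBr UW aS.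
Qed.

End Generated.

(** * Representations *)
Section Representation.
Context {R : realType} {V : ipspace R} (G : set (V -> V)).
Hypotheses (cV : complete_ipspace V) (bG : G `<=` @bounded_operator R V)
  (aG : forall T, G T -> exists S, adjoint T S).
Local Notation gen := (cstar_gen G).
Context {K : ipspace R} (pi : set (V -> V) -> K -> K).
Hypothesis hpi : representation G pi.
Local Notation rho T := (pi (ccoset G T)).

Lemma ccosetP S T : gen S -> gen T -> compact_operator (fun x => S x - T x) ->
  ccoset G S = ccoset G T.
Proof.
move=> gS gT cST; apply/seteqP; split=> U [gU cU]; split=> //.
  have := compact_lin 1 cU cST; congr compact_operator.
  by apply/funext => x; rewrite scale1r addrA subrK.
have := compact_lin (-1) cST cU; congr compact_operator.
by apply/funext => x; rewrite scaleN1r; vring.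
Qed.

Lemma ccoset_refl T : gen T -> ccoset G T T.
Proof.
move=> gT; split=> //; have := @compact0 R V; congr compact_operator.
by apply/funext => x; rewrite subrr.
Qed.

Lemma rho_bounded T : gen T -> bounded_operator (rho T).
Proof. by case: hpi => h _ _ _ _; exact: h. Qed.

Lemma rho_linear T : gen T -> linear (rho T).
Proof. by move=> /rho_bounded[]. Qed.

Lemma rho_id x : rho id x = x.
Proof. by case: hpi => _ -> _ _ _. Qed.

Lemma rho_lin a S T x : gen S -> gen T ->
  rho (fun x => a *: S x + T x) x = a *: rho S x + rho T x.
Proof. by move=> gS gT; case: hpi => _ _ -> //. Qed.

Lemma rho_comp S T x : gen S -> gen T -> rho (S \o T) x = rho S (rho T x).
Proof. by move=> gS gT; case: hpi => _ _ _ -> //. Qed.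

Lemma rho_adjoint S T : gen S -> adjoint S T -> adjoint (rho S) (rho T).
Proof. by move=> gS ST; case: hpi => _ _ _ _; apply. Qed.

Lemma gen_closed : op_closed gen.
Proof. exact: gen_op_closed. Qed.

Lemma rho0 x : rho (fun=> 0) x = 0.
Proof.
have := rho_lin (-1) x (@cstar_gen_id _ _ G) (@cstar_gen_id _ _ G).
rewrite (_ : (fun x => -1 *: id x + id x) = fun=> 0 :> V).
  by move=> ->; rewrite rho_id scaleN1r addNr.
by apply/funext => y; rewrite scaleN1r addNr.
Qed.

Lemma rhoZ a T x : gen T -> rho (fun x => a *: T x) x = a *: rho T x.
Proof.
move=> gT; have := rho_lin a x gT (op_closed0 gen_closed).
rewrite rho0 addr0 => <-; congr (pi (ccoset G _) x).
by apply/funext => y; rewrite addr0.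
Qed.

Lemma rhoD S T x : gen S -> gen T -> rho (fun x => S x + T x) x = rho S x + rho T x.
Proof.
move=> gS gT; have := rho_lin 1 x gS gT.
rewrite scale1r => <-; congr (pi (ccoset G _) x).
by apply/funext => y; rewrite scale1r.
Qed.

Lemma rhoB S T x : gen S -> gen T -> rho (fun x => S x - T x) x = rho S x - rho T x.
Proof.
move=> gS gT; have := rho_lin (-1) x gT gS.
rewrite scaleN1r addrC => <-; congr (pi (ccoset G _) x).
by apply/funext => y; rewrite scaleN1r addrC.
Qed.

(** For ||T|| <= 1, the operator 1 - T^*T has a square root P in the algebra, so
    that ||x||^2 - ||rho(T) x||^2 = ||rho(P) x||^2. *)
Lemma rho_contractive (M : R) T : 0 < M -> gen T -> op_bound M T ->
  op_bound M (rho T).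
Proof.
move=> M0 gT bT x; have [T' aT gT'] := gen_has_adjoint cV bG aG gT.
have lT := (gen_bounded bG gT).1; have lT' := (gen_bounded bG gT').1.
pose Y y := rc (M ^- 2) *: (T' \o T) y.
have gTT : gen (T' \o T) by exact: cstar_gen_comp.
have gY : gen Y by exact: op_closedZ gen_closed gTT.
have lY : linear Y by case: (gen_bounded bG gY).
have M2 : 0 < M ^- 2 by rewrite invr_gt0 exprn_gt0.
have aY : adjoint Y Y.
  by move=> y z; rewrite ipZl ipZr conj_rc /= -aT -(adjoint_sym aT).
have bY : op_bound 1 Y.
  move=> y; rewrite mul1r nmZ cm_rc ger0_norm ?(ltW M2) //= mulrC.
  rewrite ler_pdivrMr ?exprn_gt0 //; apply: le_trans (adjoint_bound aT bT _) _.
  by rewrite expr2 mulrCA ler_wpM2l ?(ltW M0) // mulrC; have := bT y; rewrite mulrC.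
have [P [bP aP P2 _ PA]] := sqrt_contraction cV lY aY bY.
have gP : gen P := PA _ gen_closed gY.
have h : rho P (rho P x) = x - rc (M ^- 2) *: rho T' (rho T x).
  rewrite -(rho_comp _ gP gP) -(rho_comp _ gT' gT) -(rhoZ _ _ gTT).
  rewrite -[X in X - _]rho_id -(rhoB _ (@cstar_gen_id _ _ G) gY).
  by congr (pi (ccoset G _) x); apply/funext => y; exact: P2.
have := Re_ip_ge0 (rho P x); rewrite (rho_adjoint gP aP) h ipBr ipZr conj_rc.
rewrite -(rho_adjoint gT aT) ReD ReN Re_rcM -!nm_sqr subr_ge0 => le.
rewrite -(ler_pXn2r (n := 2)) ?nnegrE ?mulr_ge0 ?nm_ge0 ?(ltW M0) //.
by rewrite exprMn -ler_pdivrMl // exprn_gt0.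
Qed.

Lemma rho_approx (e : R) S T : 0 < e -> gen S -> gen T ->
  (forall x, nm (T x - S x) <= e * nm x) ->
  forall x, nm (rho T x - rho S x) <= e * nm x.
Proof.
move=> e0 gS gT TS x; rewrite -rhoB //.
apply: rho_contractive => //; exact: op_closedB gen_closed gT gS.
Qed.

Lemma invariant_gen (W : set K) : closed_subspace W ->
  (forall T, G T -> (forall x, W x -> W (rho T x)) /\
     forall S, adjoint T S -> forall x, W x -> W (rho S x)) ->
  forall T, gen T -> forall x, W x -> W (rho T x).
Proof.
move=> [W0 Wlin Wcl] hG; apply: gen_ind => //.
- by move=> x; rewrite rho_id.
- by move=> a S T gS gT hS hT x Wx; rewrite (rho_lin _ _ gS gT); apply: Wlin; auto.
- by move=> S T gS gT hS hT x Wx; rewrite (rho_comp _ gS gT); auto.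
- move=> T gT h x Wx; apply: Wcl => _ /gt0_rc_sqr[e e0 ->].
  have x1 : 0 < nm x + 1 by rewrite ltr_wpDl ?nm_ge0.
  have d0 := divr_gt0 e0 x1; have [S [gS hS] TS] := h _ d0.
  exists (rho S x); first exact: hS.
  rewrite ip_lt_nm ?(ltW e0) //; apply: le_lt_trans (rho_approx d0 gS gT TS x) _.
  by rewrite mulrAC ltr_pdivrMr // ltr_pM2l // ltrDl.
Qed.

(** The T with H rho(T) = rho(T) H form a norm-closed algebra, because rho is
    contractive. *)
Lemma commute_gen (H : K -> K) : bounded_operator H ->
  (forall T, G T -> (forall x, H (rho T x) = rho T (H x)) /\
     forall S, adjoint T S -> forall x, H (rho S x) = rho S (H x)) ->
  forall T, gen T -> forall x, H (rho T x) = rho T (H x).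
Proof.
move=> /bounded_operatorP[lH [M M0 bH]] hG; apply: gen_ind => //.
- by move=> x; rewrite !rho_id.
- by move=> a S T gS gT hS hT x; rewrite !(rho_lin _ _ gS gT) lH hS hT.
- by move=> S T gS gT hS hT x; rewrite !(rho_comp _ gS gT) hS hT.
- move=> T gT h x; apply/eqP; rewrite -subr_eq0; apply/eqP.
  apply: (nm_eps (c := M * nm x + nm (H x))) => e e0.
  have [S [gS hS] TS] := h _ e0; have aTS := rho_approx e0 gS gT TS.
  have -> : H (rho T x) - rho T (H x) =
      H (rho T x - rho S x) - (rho T (H x) - rho S (H x)).
    by rewrite (linB lH) hS; vring.
  apply: le_trans (nmD _ _) _; rewrite nmN mulrDl lerD //; last first.
    by rewrite mulrC aTS.
  by apply: le_trans (bH _) _; rewrite -mulrA ler_wpM2l // mulrC aTS.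
Qed.

Lemma commute_adjoint (H H' : K -> K) : adjoint H H' ->
  (forall T, gen T -> forall x, H (rho T x) = rho T (H x)) ->
  forall T, gen T -> forall x, H' (rho T x) = rho T (H' x).
Proof.
move=> aH hH T gT x; have [T' aT gT'] := gen_has_adjoint cV bG aG gT.
apply: ip_inj => z.
rewrite (adjoint_sym aH) (rho_adjoint gT aT) (rho_adjoint gT aT).
by rewrite (adjoint_sym aH) hH.
Qed.

End Representation.

Section Intertwine.
Context {R : realType} {V : ipspace R} (G : set (V -> V)).
Hypotheses (cV : complete_ipspace V) (bG : G `<=` @bounded_operator R V)
  (aG : forall T, G T -> exists S, adjoint T S).
Local Notation gen := (cstar_gen G).
Context {K L : ipspace R} (p : set (V -> V) -> K -> K) (q : set (V -> V) -> L -> L).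
Hypotheses (hp : representation G p) (hq : representation G q).

Lemma intertwine_gen (U : K -> L) : linear U -> (forall x, nm (U x) = nm x) ->
  (forall T, G T -> (forall x, U (p (ccoset G T) x) = q (ccoset G T) (U x)) /\
     forall S, adjoint T S -> forall x, U (p (ccoset G S) x) = q (ccoset G S) (U x)) ->
  forall T, gen T -> forall x, U (p (ccoset G T) x) = q (ccoset G T) (U x).
Proof.
move=> lU iU hG; apply: (gen_ind cV bG aG hG).
- by move=> x; rewrite (rho_id hp) (rho_id hq).
- by move=> a S T gS gT hS hT x; rewrite (rho_lin hp _ _ gS gT) (rho_lin hq _ _ gS gT) lU hS hT.
- by move=> S T gS gT hS hT x; rewrite (rho_comp hp _ gS gT) (rho_comp hq _ gS gT) hS hT.
- move=> T gT h x; apply/eqP; rewrite -subr_eq0; apply/eqP.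
  apply: (nm_eps (c := nm x + nm x)) => e e0.
  have [S [gS hS] TS] := h _ e0.
  have -> : U (p (ccoset G T) x) - q (ccoset G T) (U x) =
      U (p (ccoset G T) x - p (ccoset G S) x) -
      (q (ccoset G T) (U x) - q (ccoset G S) (U x)).
    by rewrite (linB lU) hS; vring.
  apply: le_trans (nmD _ _) _; rewrite nmN mulrDl iU lerD //.
    by rewrite mulrC (rho_approx cV bG aG hp).
  by rewrite mulrC -(iU x) (rho_approx cV bG aG hq).
Qed.

End Intertwine.

(** * Schur's lemma *)
Section Schur.
Context {R : realType} {V : ipspace R} (G : set (V -> V)).
Hypotheses (cV : complete_ipspace V) (bG : G `<=` @bounded_operator R V)
  (aG : forall T, G T -> exists S, adjoint T S).
Local Notation gen := (cstar_gen G).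
Context {K : ipspace R} (pi : set (V -> V) -> K -> K).
Hypotheses (cK : complete_ipspace K) (hpi : irreducible_rep G pi).
Local Notation rho T := (pi (ccoset G T)).

Lemma irreducible_subspace (W : set K) : closed_subspace W ->
  (forall T, gen T -> forall x, W x -> W (rho T x)) ->
  (forall x, W x -> x = 0) \/ forall x, W x.
Proof.
move=> cW hW; case: hpi => _ _ /(_ W cW)[_ x [T gT <-]|->|->]; first exact: hW.
  by left.
by right.
Qed.

Lemma closed_kernel (L : K -> K) : bounded_operator L ->
  closed_subspace [set x | L x = 0].
Proof.
move=> bL; have lL := bL.1; split => /=.
- exact: lin0.
- by move=> a x y hx hy; rewrite lL hx hy scaler0 addr0.
- by move=> x; exact: bounded_eq0.
Qed.

Lemma irreducible_kernel (L : K -> K) : bounded_operator L ->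
  (forall T, gen T -> forall x, L (rho T x) = rho T (L x)) ->
  (forall x, L x = 0 -> x = 0) \/ forall x, L x = 0.
Proof.
move=> bL cL; apply: (irreducible_subspace (closed_kernel bL)) => T gT x /= Lx.
by rewrite cL // Lx (lin0 (rho_linear _ gT)) //; case: hpi.
Qed.

(** With P = |H|, the product (P + H)(P - H) vanishes, and both factors commute
    with the representation. *)
Lemma schur_sign (H : K -> K) : bounded_operator H -> adjoint H H ->
  (forall T, gen T -> forall x, H (rho T x) = rho T (H x)) ->
  (forall x, 0 <= complex.Re '[H x, x]) \/ (forall x, complex.Re '[H x, x] <= 0).
Proof.
move=> /bounded_operatorP[lH [M M0 bH]] aH cH.
have M1 : 0 < M + 1 by rewrite ltr_wpDl.
have c0 : 0 <= (M + 1)^-1 by rewrite invr_ge0 ltW.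
pose F x := rc (M + 1)^-1 *: H x.
have lF : linear F.
  by move=> a x y; rewrite /F lH scalerDr !scalerA mulrC.
have aF : adjoint F F by move=> x y; rewrite ipZl ipZr conj_rc aH.
have bF : op_bound 1 F.
  move=> x; rewrite mul1r nmZ cm_rc ger0_norm // mulrC ler_pdivrMr //.
  by apply: le_trans (bH x) _; rewrite mulrC ler_wpM2l ?nm_ge0 // lerDl.
have BF : bounded_operator F by apply/bounded_operatorP; split=> //; exists 1.
have cF T : gen T -> forall x, F (rho T x) = rho T (F x).
  by move=> gT x; rewrite /F cH // (linZ (rho_linear _ gT)) //; case: hpi.
pose Y x := x - F (F x).
have lY : linear Y by move=> a x y; rewrite /Y !lF scalerBr; vring.
have aY : adjoint Y Y by move=> x y; rewrite ipBl ipBr !aF.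
have bY : op_bound 1 Y.
  move=> x; rewrite mul1r -(ler_pXn2r (n := 2)) ?nnegrE ?nm_ge0 // nmD_sqr nmN.
  rewrite ipNr ReN -aF -nm_sqr.
  have : nm (F (F x)) ^+ 2 <= nm (F x) ^+ 2.
    by rewrite ler_pXn2r ?nnegrE ?nm_ge0 //; have := bF (F x); rewrite mul1r.
  by have := sqr_ge0 (nm (F x)); lra.
have [P [bP aP P2 P0 PA]] := sqrt_contraction cK lY aY bY.
have lP := bP.1.
have cP T : gen T -> forall x, P (rho T x) = rho T (P x).
  move=> gT; have lT : linear (rho T) by apply: rho_linear gT; case: hpi.
  have /bounded_operatorP[_ [N N0 bT]] : bounded_operator (rho T).
    by apply: rho_bounded gT; case: hpi.
  apply: (PA [set S | forall x, S (rho T x) = rho T (S x)]); last first.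
    by move=> x; rewrite /Y !cF // (linB lT).
  split=> //=.
  - by move=> a S U hS hU x; rewrite hS hU lT.
  - by move=> S U hS hU x /=; rewrite hU hS.
  - move=> S bS h x; apply/eqP; rewrite -subr_eq0; apply/eqP.
    apply: (nm_eps (c := N * nm x + N * nm x)) => e e0; have [U hU SU] := h _ e0.
    have -> : S (rho T x) - rho T (S x) =
        (S (rho T x) - U (rho T x)) - rho T (S x - U x).
      by rewrite (linB lT) hU; vring.
    apply: le_trans (nmD _ _) _; rewrite nmN mulrDl lerD //.
      by apply: le_trans (SU _) _; rewrite mulrC ler_wpM2r ?(ltW e0).
    by apply: le_trans (bT _) _; rewrite -mulrA ler_wpM2l // mulrC.
have cPF x : P (F x) = F (P x).
  apply: (PA [set S | forall x, S (F x) = F (S x)]); last first.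
    by move=> y; rewrite /Y (linB lF).
  split=> //=.
  - by move=> a S U hS hU y; rewrite hS hU lF.
  - by move=> S U hS hU y /=; rewrite hU hS.
  - move=> S bS h y; apply/eqP; rewrite -subr_eq0; apply/eqP.
    apply: (nm_eps (c := nm y + nm y)) => e e0; have [U hU SU] := h _ e0.
    have -> : S (F y) - F (S y) = (S (F y) - U (F y)) - F (S y - U y).
      by rewrite (linB lF) hU; vring.
    apply: le_trans (nmD _ _) _; rewrite nmN mulrDl lerD //.
      apply: le_trans (SU _) _; rewrite mulrC ler_wpM2r ?(ltW e0) //.
      by have := bF y; rewrite mul1r.
    by apply: le_trans (bF _) _; rewrite mul1r mulrC.
have HF x : complex.Re '[H x, x] = (M + 1) * complex.Re '[F x, x].
  by rewrite ipZl Re_rcM mulrA divff ?mul1r ?gt_eqF.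
pose L x := P x + F x.
have bL : bounded_operator L.
  have := bounded_lin 1 bP BF; congr bounded_operator.
  by apply/funext => x; rewrite scale1r.
have cL T : gen T -> forall x, L (rho T x) = rho T (L x).
  move=> gT x; rewrite /L cP // cF // (linD (rho_linear _ gT)) //; by case: hpi.
case: (irreducible_kernel bL cL) => [inj|L0]; [left|right] => x.
  have PF : P x - F x = 0.
    apply: inj; rewrite /L (linB lP) (linB lF) P2 cPF /Y; vring.
  by rewrite HF pmulr_rge0 //; move/eqP: PF; rewrite subr_eq0 => /eqP <-.
have PF : F x = - P x.
  by have := L0 x; rewrite /L => /eqP; rewrite addrC addr_eq0 => /eqP.
by rewrite HF pmulr_rle0 // PF ipNl ReN oppr_le0.
Qed.

(** By [schur_sign] for H - t, the quadratic form of H is l ||x||^2, where l is the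
    supremum of the t with t <= H. *)
Lemma schur_selfadjoint (H : K -> K) : bounded_operator H -> adjoint H H ->
  (forall T, gen T -> forall x, H (rho T x) = rho T (H x)) ->
  exists l : R, forall x, H x = rc l *: x.
Proof.
move=> bH aH cH; have /bounded_operatorP[lH [M M0 hM]] := bH.
have shift t : (forall x, t * nm x ^+ 2 <= complex.Re '[H x, x]) \/
               (forall x, complex.Re '[H x, x] <= t * nm x ^+ 2).
  pose F x := rc (- t) *: x + H x.
  have E x : complex.Re '[F x, x] = complex.Re '[H x, x] - t * nm x ^+ 2.
    by rewrite ipDl ipZl ReD Re_rcM -nm_sqr mulNr addrC.
  have [||T gT x|h|h] := @schur_sign F.
  - exact: bounded_lin bounded_id bH.
  - by move=> x y; rewrite ipDl ipDr ipZl ipZr conj_rc aH.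
  - have hr : representation G pi by case: hpi.
    by rewrite /F cH // (linD (rho_linear hr gT)) (linZ (rho_linear hr gT)).
  - by left=> x; have := h x; rewrite E subr_ge0.
  - by right=> x; have := h x; rewrite E subr_le0.
pose E := [set t : R | forall x, t * nm x ^+ 2 <= complex.Re '[H x, x]].
have HM x : `|complex.Re '[H x, x]| <= M * nm x ^+ 2.
  apply: le_trans (Re_norm_cm _) _; apply: le_trans (cauchy_schwarz _ _) _.
  by rewrite expr2 mulrA ler_wpM2r ?nm_ge0.
have [x0 nx0] : exists x : K, x != 0 by case: hpi.
have nx1 : 0 < nm x0.
  by rewrite lt0r nm_ge0 andbT; apply: contraNneq nx0 => /nm_eq0 ->.
have EM : E (- M).
  by move=> x; have := HM x; rewrite ler_norml mulNr => /andP[].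
have ubE t : E t -> t <= M.
  move=> /(_ x0) h; have := le_trans h (le_trans (ler_norm _) (HM x0)).
  by rewrite ler_pM2r // exprn_gt0.
have supE : has_sup E by split; [exists (- M)|exists M => t; exact: ubE].
pose l := sup E; exists l => x.
have lower y : l * nm y ^+ 2 <= complex.Re '[H y, y].
  have [y0|y0] := eqVneq (nm y) 0.
    by have := EM y; rewrite y0 expr0n !mulr0.
  have y2 : 0 < nm y ^+ 2 by rewrite exprn_gt0 // lt0r y0 nm_ge0.
  rewrite -ler_pdivlMr //; apply: ge_sup; first by exists (- M).
  by move=> t /(_ y); rewrite ler_pdivlMr.
have upper y : complex.Re '[H y, y] <= l * nm y ^+ 2.
  apply/ler_addgt0Pr => e e0.
  have y1 : 0 < nm y ^+ 2 + 1 by rewrite ltr_wpDl ?sqr_ge0.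
  have d0 := divr_gt0 e0 y1; set d := e / _ in d0.
  case: (shift (l + d)) => [h|/(_ y) h].
    by have := ub_le_sup supE.2 h; rewrite -/l gerDl leNgt d0.
  apply: le_trans h _; rewrite mulrDl lerD2l.
  have -> : e = d * (nm y ^+ 2 + 1) by rewrite /d divfK // gt_eqF.
  by rewrite ler_pM2l // lerDl.
pose F y := rc (- l) *: y + H y.
have F0 y : complex.Re '[F y, y] = 0.
  apply/eqP; rewrite ipDl ipZl ReD Re_rcM -nm_sqr mulNr addrC subr_eq0.
  by rewrite eq_le lower upper.
have lF : linear F by move=> a y z; rewrite /F lH !scalerDr !scalerA (mulrC a); vring.
have aF : adjoint F F by move=> y z; rewrite ipDl ipDr ipZl ipZr conj_rc aH.
(* A self-adjoint operator with zero quadratic form is zero: expand at x + F x. *)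
suff : F x = 0.
  by rewrite /F addrC => /eqP; rewrite rmorphN scaleNr subr_eq0 => /eqP.
apply: nm_eq0; apply/eqP; rewrite -sqrf_eq0 nm_sqr; apply/eqP.
have := F0 (x + F x); rewrite (linD lF) ipDl (ipDr (F x) x) (ipDr (F (F x)) x).
rewrite !ReD !F0 add0r addr0 (aF (F x) x).
by move=> h; move/eqP: h; rewrite -mulr2n mulrn_eq0 => /eqP.
Qed.

(** H is a combination of two self-adjoint operators, H + H' and i (H' - H), and H'
    commutes with the representation as well. *)
Lemma schur (H H' : K -> K) : bounded_operator H -> adjoint H H' ->
  (forall T, gen T -> forall x, H (rho T x) = rho T (H x)) ->
  exists c : C R, forall x, H x = c *: x.
Proof.
move=> bH aH cH; have bH' := adjoint_bounded aH bH.
have hr : representation G pi by case: hpi.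
have cH' := commute_adjoint cV bG aG hr aH cH.
have aH' := adjoint_sym aH.
have ci : ('i : C R)^* = - 'i by rewrite conjCi.
have [|||a ha] := @schur_selfadjoint (fun x => 1 *: H x + H' x).
- exact: bounded_lin.
- by move=> x y; rewrite ipDl ipDr ipZl ipZr rmorph1 aH aH' addrC !mul1r.
- by move=> T gT x; rewrite cH // cH' // (rho_linear hr).
have [|||b hb] := @schur_selfadjoint (fun x => (- 'i) *: H x + (fun y => 'i *: H' y) x).
- apply: bounded_lin => //; apply: op_closedZ => //.
  exact/op_closed_cstar/cstar_subalgebra_bounded.
- move=> x y; rewrite ipDl ipDr !ipZl !ipZr aH aH' rmorphN /= ci opprK addrC.
  by rewrite addrC.
- move=> T gT x; rewrite /= cH // cH' // (linD (rho_linear hr gT)).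
  by rewrite !(linZ (rho_linear hr gT)).
exists ((rc a + 'i * rc b) / 2) => x.
have i2 : 'i * 'i = -1 :> C R by rewrite -expr2 sqrCi.
have E : H x + H x = (rc a + 'i * rc b) *: x.
  rewrite scalerDl -scalerA -ha -hb; apply: ip_inj => z; rewrite !(ipDl, ipZl).
  transitivity ('[H x, z] + '[H' x, z] - 'i * 'i * ('[H x, z] - '[H' x, z])).
    by rewrite i2; ring.
  by ring.
apply: ip_inj => z; have := congr1 (fun y => '[y, z]) E.
by rewrite /= ipDl !ipZl mulrAC => <-; field.
Qed.

End Schur.

(** * The Jones-Wenzl recursion *)
Section JonesWenzl.
Context {R : realType} (a1 a2 : C R).
Hypotheses (ha1 : `|a1| = (sqrtC 3%:R)^-1) (ha2 : `|a2| = (sqrtC 3%:R)^-1).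
Local Notation word := (seq 'I_3).
Local Notation tensor := (word -> (C R)^o).
Local Notation mvec := (@mvec R).
Local Notation mvecA := (mvecA a1 a2).
Local Notation mp := (@mproj R).
Local Notation mt := (mprojA a1 a2).
Local Notation g := (jw a1 a2).
Implicit Types (w : word) (f : tensor).
Local Arguments Defs.subst : simpl never.
Local Arguments Defs.letter : simpl never.

Lemma tensorZ (a : C R) f w : (a *: f : tensor) w = a * (f w : C R) :> C R.
Proof. by []. Qed.

Lemma letter_subst w i a : letter (subst w i a) i = a.
Proof. by rewrite /letter /subst nth_set_nth /= eqxx. Qed.

Lemma letter_subst_neq w i j a : i != j -> letter (subst w j a) i = letter w i.
Proof. by move=> ij; rewrite /letter /subst nth_set_nth /= (negPf ij). Qed.

Lemma subst_subst w i a b : subst (subst w i a) i b = subst w i b.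
Proof. by rewrite /subst set_set_nth eqxx. Qed.

Lemma subst_comm w i j a b : i != j ->
  subst (subst w i a) j b = subst (subst w j b) i a.
Proof. by move=> ij; rewrite /subst set_set_nth (negPf ij). Qed.

Lemma size_subst w i a : size (subst w i a) = maxn i.+1 (size w).
Proof. exact: size_set_nth. Qed.

Lemma subst_letter w i : (i < size w)%N -> subst w i (letter w i) = w.
Proof.
move=> iw; apply: (@eq_from_nth _ ord0) => [|j _].
  by rewrite size_subst; apply/maxn_idPr.
by rewrite /subst nth_set_nth /=; case: eqP => [->|].
Qed.

Lemma ord3P (P : 'I_3 -> Prop) : P ord0 -> P (inord 1) -> P (inord 2) -> forall i, P i.
Proof.
move=> h0 h1 h2 [[|[|[|//]]] hi].
- by rewrite (_ : Ordinal hi = ord0) //; apply: val_inj.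
- by rewrite (_ : Ordinal hi = inord 1) //; apply: val_inj; rewrite /= inordK.
- by rewrite (_ : Ordinal hi = inord 2) //; apply: val_inj; rewrite /= inordK.
Qed.

Lemma sum3 (F : 'I_3 -> C R) : \sum_i F i = F ord0 + F (inord 1) + F (inord 2).
Proof.
rewrite !big_ord_recr big_ord0 /= add0r; congr (F _ + F _ + F _); apply: val_inj;
  by rewrite /= ?inordK.
Qed.

Definition alpha (i : 'I_3) : C R := [:: a1; a2; a1]`_i.

Lemma rev_ord3 : (rev_ord (ord0 : 'I_3) = inord 2) * (rev_ord (inord 1 : 'I_3) = inord 1) *
  (rev_ord (inord 2 : 'I_3) = ord0).
Proof. by do ![split]; apply: val_inj; rewrite /= ?inordK. Qed.

Lemma mvecAE i j : mvecA i j = if j == rev_ord i then alpha i else 0.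
Proof.
rewrite /mvecA /alpha; congr (if _ then _ else _).
by elim/ord3P: i; elim/ord3P: j; rewrite -val_eqE /= ?inordK.
Qed.

Lemma norm_a_sqr (a : C R) : `|a| = (sqrtC 3%:R)^-1 -> a^* * a = 3%:R^-1.
Proof. by move=> h; rewrite mulrC -normCK h exprVn sqrtCK. Qed.

Lemma alpha_sqr i : (alpha i)^* * alpha i = 3%:R^-1.
Proof.
by elim/ord3P: i; rewrite /alpha /= ?inordK //= norm_a_sqr.
Qed.

Lemma alpha_rev i : alpha (rev_ord i) = alpha i.
Proof. by elim/ord3P: i; rewrite rev_ord3 /alpha /= ?inordK. Qed.

Lemma sum_mvecA x (F : 'I_3 -> C R) :
  \sum_b mvecA x b * F b = alpha x * F (rev_ord x).
Proof.
rewrite (bigD1 (rev_ord x)) //= big1 ?addr0 => [|i /negPf h]; rewrite mvecAE.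
  by rewrite eqxx.
by rewrite h mul0r.
Qed.

Lemma sum_mvecAC x (F : 'I_3 -> C R) :
  \sum_b (mvecA x b)^* * F b = (alpha x)^* * F (rev_ord x).
Proof.
rewrite (bigD1 (rev_ord x)) //= big1 ?addr0 => [|i /negPf h]; rewrite mvecAE.
  by rewrite eqxx.
by rewrite h conjC0 mul0r.
Qed.

Lemma mvec_conj a : (mvec a)^* = mvec a.
Proof.
have h : ((sqrtC 2%:R)^-1 : C R)^* = (sqrtC 2%:R)^-1.
  by apply: conj_Creal; rewrite realV ger0_real // sqrtC_ge0 ler0n.
by elim/ord3P: a; rewrite /Defs.mvec /= ?inordK //= conjC0.
Qed.

Lemma mvecE : (mvec ord0 = (sqrtC 2%:R)^-1) * (mvec (inord 1) = 0) *
  (mvec (inord 2) = (sqrtC 2%:R)^-1).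
Proof. by rewrite /Defs.mvec /= ?inordK. Qed.

Lemma half_sqr : (sqrtC 2%:R)^-1 * (sqrtC 2%:R)^-1 = 2%:R^-1 :> C R.
Proof. by rewrite -expr2 exprVn sqrtCK. Qed.

Lemma mvec_norm : \sum_a (mvec a)^* * mvec a = 1.
Proof. by rewrite sum3 !mvec_conj !mvecE mulr0 addr0 half_sqr; field. Qed.

Lemma mvec_rev a : mvec (rev_ord a) = mvec a.
Proof. by elim/ord3P: a; rewrite rev_ord3 !mvecE. Qed.

(** The contractions of f with v in position i, and with v_A in positions i, i+1. *)
Definition contr i f w : C R := \sum_a mvec a * f (subst w i a).
Definition contrA i f w : C R :=
  \sum_a (alpha a)^* * f (subst (subst w i a) i.+1 (rev_ord a)).

Lemma mprojE i f w : mp i f w = mvec (letter w i) * contr i f w.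
Proof.
by rewrite /mproj; congr (_ * _); apply: eq_bigr => a _; rewrite mvec_conj.
Qed.

Lemma mprojAE i f w :
  mt i f w = mvecA (letter w i) (letter w i.+1) * contrA i f w.
Proof.
rewrite /mprojA; congr (_ * _); apply: eq_bigr => a _.
by rewrite (sum_mvecAC a (fun b => f (subst (subst w i a) i.+1 b))).
Qed.

Lemma contr_subst i f w a : contr i f (subst w i a) = contr i f w.
Proof. by apply: eq_bigr => b _; rewrite subst_subst. Qed.

Lemma contrA_subst i f w a : contrA i f (subst w i a) = contrA i f w.
Proof. by apply: eq_bigr => b _; rewrite subst_subst. Qed.

Lemma contrA_substS i f w a : contrA i f (subst w i.+1 a) = contrA i f w.
Proof.
apply: eq_bigr => b _; rewrite (subst_comm w a b); last by rewrite gtn_eqF.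
by rewrite subst_subst.
Qed.

Lemma mprojK i f : mp i (mp i f) = mp i f.
Proof.
apply/funext => w; rewrite mprojE {1}/contr.
under eq_bigr => a _ do rewrite mprojE letter_subst contr_subst mulrA.
rewrite -mulr_suml mprojE -[X in X * _ = _](mvec_conj); congr (_ * _); last first.
  rewrite [X in X * _](_ : _ = 1) ?mul1r // -mvec_norm.
  by apply: eq_bigr => a _; rewrite mvec_conj.
exact: mvec_conj.
Qed.

Lemma mproj_comm i j f : i != j -> mp i (mp j f) = mp j (mp i f).
Proof.
move=> ij; have ji : j != i by rewrite eq_sym.
apply/funext => w; rewrite !mprojE /contr.
under eq_bigr => a _ do rewrite mprojE letter_subst_neq // mulrCA mulr_sumr.
under [in RHS]eq_bigr => a _ do rewrite mprojE letter_subst_neq // mulrCA mulr_sumr.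
rewrite -!mulr_sumr exchange_big /= mulrCA; do 2!congr (_ * _).
apply: eq_bigr => a _; apply: eq_bigr => b _.
by rewrite subst_comm // mulrCA.
Qed.

Lemma mproj_mprojA_comm i j f : i != j -> i != j.+1 ->
  mp i (mt j f) = mt j (mp i f).
Proof.
move=> ij ij1; have ji : j != i by rewrite eq_sym.
have ji1 : j.+1 != i by rewrite eq_sym.
apply/funext => w; rewrite mprojE mprojAE /contr /contrA.
under eq_bigr => a _ do
  rewrite mprojAE (letter_subst_neq _ _ ji) (letter_subst_neq _ _ ji1) mulrCA mulr_sumr.
under [in RHS]eq_bigr => a _ do
  rewrite mprojE (letter_subst_neq _ _ ij1) (letter_subst_neq _ _ ij) mulrCA mulr_sumr.
rewrite -!mulr_sumr exchange_big /= mulrCA; do 2!congr (_ * _).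
apply: eq_bigr => a _; apply: eq_bigr => b _.
by rewrite (subst_comm _ _ _ ij) (subst_comm _ _ _ ij1) mulrCA.
Qed.

Lemma mprojA_comm i j f : (i.+1 < j)%N -> mt i (mt j f) = mt j (mt i f).
Proof.
move=> ij; have n1 : j != i by rewrite gtn_eqF // (ltn_trans _ ij).
have n2 : j != i.+1 by rewrite gtn_eqF.
have n3 : j.+1 != i by rewrite gtn_eqF // ltnS (leq_trans _ ij) // leqW.
have n4 : j.+1 != i.+1 by rewrite eqSS.
have [m1 m2] : i != j /\ i != j.+1 by split; rewrite eq_sym.
have [m3 m4] : i.+1 != j /\ i.+1 != j.+1 by split; rewrite eq_sym.
apply/funext => w; rewrite !mprojAE /contrA.
under eq_bigr => a _ do
  rewrite mprojAE !(letter_subst_neq _ _ n2, letter_subst_neq _ _ n1,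
    letter_subst_neq _ _ n3, letter_subst_neq _ _ n4) mulrCA mulr_sumr.
under [in RHS]eq_bigr => a _ do
  rewrite mprojAE !(letter_subst_neq _ _ m2, letter_subst_neq _ _ m1,
    letter_subst_neq _ _ m3, letter_subst_neq _ _ m4) mulrCA mulr_sumr.
rewrite -!mulr_sumr exchange_big /= mulrCA; do 2!congr (_ * _).
apply: eq_bigr => a _; apply: eq_bigr => b _.
rewrite !(subst_comm _ _ _ m3) !(subst_comm _ _ _ m1).
rewrite !(subst_comm _ _ _ m4) !(subst_comm _ _ _ m2).
by rewrite mulrCA.
Qed.

Lemma mproj_mprojA i f : mp i.+1 (mt i f) = mp i (mt i f).
Proof.
have n1 : i != i.+1 by rewrite ltn_eqF.
have n2 : i.+1 != i by rewrite gtn_eqF.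
apply/funext => w; rewrite !mprojE /contr.
under eq_bigr => a _ do
  rewrite mprojAE letter_subst (letter_subst_neq _ _ n1) contrA_substS mulrA (mulrC (mvec a)).
under [in RHS]eq_bigr => a _ do
  rewrite mprojAE letter_subst (letter_subst_neq _ _ n2) contrA_subst mulrA (mulrC (mvec a)).
rewrite -!mulr_suml !mulrA; congr (_ * _).
set x := letter w i; set y := letter w i.+1.
rewrite sum_mvecA mvec_rev (bigD1 (rev_ord y)) //= big1 ?addr0.
  by rewrite mvecAE rev_ordK eqxx mvec_rev alpha_rev; elim/ord3P: x; elim/ord3P: y;
     rewrite !mvecE /alpha /= ?inordK //= ?(mul0r, mulr0) // mulrC -mulrA (mulrC a1) mulrA.
move=> a ay; rewrite mvecAE ifN ?mul0r //.
by apply: contra ay => /eqP ->; rewrite rev_ordK.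
Qed.

Lemma alpha_mvec a b : (alpha a)^* * (mvec a * mvec b) = (alpha b)^* * (mvec a * mvec b).
Proof.
by elim/ord3P: a; elim/ord3P: b; rewrite !mvecE /alpha /= ?inordK //= !(mulr0, mul0r).
Qed.

Lemma mprojA_mproj i f : mt i (mp i.+1 f) = mt i (mp i f).
Proof.
have n1 : i != i.+1 by rewrite ltn_eqF.
have n2 : i.+1 != i by rewrite gtn_eqF.
apply/funext => w; rewrite !mprojAE; congr (_ * _); rewrite /contrA.
pose F x y := f (subst (subst w i x) i.+1 y).
transitivity (\sum_a \sum_c (alpha a)^* * (mvec a * mvec c) * F a c).
  apply: eq_bigr => a _; rewrite mprojE letter_subst contr_subst mvec_rev mulr_sumr mulr_sumr.
  by apply: eq_bigr => c _; rewrite !mulrA.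
transitivity (\sum_a \sum_c (alpha a)^* * (mvec a * mvec c) * F c (rev_ord a)); last first.
  apply: eq_bigr => a _; rewrite mprojE (letter_subst_neq _ _ n1) letter_subst.
  rewrite mulr_sumr mulr_sumr; apply: eq_bigr => c _.
  by rewrite (subst_comm _ _ _ n2) subst_subst !mulrA.
rewrite [RHS](reindex_inj rev_ord_inj) /= [RHS]exchange_big /=.
apply: eq_bigr => a _; apply: eq_bigr => c _.
rewrite rev_ordK alpha_rev mvec_rev; congr (_ * _).
by rewrite alpha_mvec (mulrC (mvec c)).
Qed.

(** With [mprojA_braid], these are the relations of the Motzkin algebra that Wenzl's
    induction needs: t_i p_i t_i = t_i / 3 and t_(i+1) t_i t_(i+1) = t_(i+1) / 9. *)
Lemma mprojA_mproj_mprojA i f : mt i (mp i (mt i f)) = 3%:R^-1 *: mt i f.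
Proof.
have n1 : i != i.+1 by rewrite ltn_eqF.
have n2 : i.+1 != i by rewrite gtn_eqF.
apply/funext => w; rewrite tensorZ !mprojAE mulrCA; congr (_ * _).
rewrite /contrA.
under eq_bigr => a _ do rewrite mprojE (letter_subst_neq _ _ n1) letter_subst.
have E a : contr i (mt i f) (subst (subst w i a) i.+1 (rev_ord a)) =
    mvec a * alpha a * contrA i f w.
  rewrite /contr (bigD1 a) //= big1 ?addr0 => [|b ba]; rewrite mprojAE;
    rewrite letter_subst (letter_subst_neq _ _ n2) letter_subst
      contrA_subst contrA_substS contrA_subst mvecAE.
    by rewrite eqxx mulrA.
  by rewrite ifN ?(mul0r, mulr0) //; apply: contra ba => /eqP/rev_ord_inj ->.
under eq_bigr => a _ do rewrite E !mulrA.
rewrite -mulr_suml; congr (_ * _).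
transitivity (\sum_a 3%:R^-1 * ((mvec a)^* * mvec a)).
  apply: eq_bigr => a _; rewrite -(alpha_sqr a) mvec_conj; ring.
by rewrite -mulr_sumr mvec_norm mulr1.
Qed.

Lemma mprojAK i f : mt i (mt i f) = mt i f.
Proof.
have n2 : i.+1 != i by rewrite gtn_eqF.
have n1 : i != i.+1 by rewrite ltn_eqF.
apply/funext => w; rewrite !mprojAE; congr (_ * _); rewrite {1}/contrA.
under eq_bigr => a _ do rewrite mprojAE letter_subst (letter_subst_neq _ _ n1) letter_subst
  contrA_substS contrA_subst mvecAE eqxx mulrA alpha_sqr.
rewrite -mulr_suml sum3 -[RHS]mul1r; congr (_ * _).
by field.
Qed.

Lemma mprojA_braid i f : mt i.+1 (mt i (mt i.+1 f)) = 9%:R^-1 *: mt i.+1 f.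
Proof.
have n1 : i != i.+1 by rewrite ltn_eqF.
have n2 : i.+1 != i by rewrite gtn_eqF.
have n3 : i != i.+2 by rewrite ltn_eqF.
have n4 : i.+2 != i by rewrite gtn_eqF.
have n5 : i.+1 != i.+2 by rewrite ltn_eqF.
have n6 : i.+2 != i.+1 by rewrite gtn_eqF.
apply/funext => w; rewrite tensorZ !mprojAE mulrCA; congr (_ * _).
set x := letter w i.
rewrite {1}/contrA.
have E b : mt i (mt i.+1 f) (subst (subst w i.+1 b) i.+2 (rev_ord b)) =
    if b == rev_ord x then alpha x * ((alpha x)^* * (alpha x * contrA i.+1 f w)) else 0.
  rewrite mprojAE !(letter_subst_neq _ _ n3) !(letter_subst_neq _ _ n1)
    (letter_subst_neq _ _ n5) letter_subst -/x mvecAE.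
  case: eqP => [->|_]; last by rewrite mul0r.
  congr (_ * _); rewrite {1}/contrA (bigD1 x) //= big1 ?addr0 => [|d dx]; last first.
    rewrite mprojAE letter_subst (letter_subst_neq _ _ n6) (letter_subst_neq _ _ n4).
    rewrite letter_subst mvecAE ifN ?(mul0r, mulr0) // rev_ordK.
    by rewrite eq_sym; apply: contra dx => /eqP; rewrite rev_ordK => ->.
  congr (_ * _); rewrite mprojAE letter_subst (letter_subst_neq _ _ n6).
  rewrite (letter_subst_neq _ _ n4) letter_subst mvecAE eqxx alpha_rev.
  congr (_ * _); rewrite contrA_subst (subst_comm _ _ _ n4).
  rewrite contrA_substS (subst_comm _ _ _ n2) contrA_subst.
  apply: eq_bigr => a _; congr (_ * f _).
  rewrite (subst_comm _ _ _ n1) (subst_comm _ _ _ n3).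
  rewrite -[X in subst _ i X](_ : letter (subst (subst w i.+1 a) i.+2 (rev_ord a)) i = x).
    by rewrite subst_letter // !size_subst !leq_max ltnW.
  by rewrite (letter_subst_neq _ _ n3) (letter_subst_neq _ _ n1).
under eq_bigr => b _ do rewrite E.
rewrite (bigD1 (rev_ord x)) //= eqxx big1 ?addr0 => [|b /negPf ->]; last by rewrite mulr0.
rewrite alpha_rev.
transitivity (((alpha x)^* * alpha x) * ((alpha x)^* * alpha x) * contrA i.+1 f w).
  by ring.
by rewrite alpha_sqr; congr (_ * _); field.
Qed.

(** At the argument 1/4, the recursion of the P_k has the double characteristic
    root 1/2. *)
Lemma jwpolyE k : (@jwpoly R k).[(3%:R^-1^-1 - 1) ^- 2] = k.+1%:R / 2%:R ^+ k.
Proof.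
suff [] : (@jwpoly R k).[(3%:R^-1^-1 - 1) ^- 2] = k.+1%:R / 2%:R ^+ k /\
  (@jwpoly R k.+1).[(3%:R^-1^-1 - 1) ^- 2] = k.+2%:R / 2%:R ^+ k.+1 by [].
elim: k => [|k [IH1 IH2]].
  by split; rewrite /= hornerC; field.
split=> //; rewrite [@jwpoly R k.+2]/= -/(@jwpoly R k.+1) hornerD hornerN hornerM hornerX.
rewrite IH1 IH2 !exprS invrK; set t : C R := 2%:R ^+ k.
rewrite -(natr1 k.+2) -(natr1 k.+1) -(natr1 k).
have t0 : t != 0 by rewrite expf_neq0 // pnatr_eq0.
by field.
Qed.

Lemma jwcoefE k : @jwcoef R k.+1 = 3%:R * k.+1%:R / k.+2%:R.
Proof.
rewrite /jwcoef succnK !jwpolyE invrK exprS; set t : C R := 2%:R ^+ k.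
rewrite -(natr1 k.+1) -(natr1 k).
have t0 : t != 0 by rewrite expf_neq0 // pnatr_eq0.
have k0 : k%:R + 1 + 1 != 0 :> C R by rewrite !natr1 pnatr_eq0.
by field; rewrite t0 k0.
Qed.

End JonesWenzl.

Section Wenzl.
Context {R : realType} (a1 a2 : C R).
Hypotheses (ha1 : `|a1| = (sqrtC 3%:R)^-1) (ha2 : `|a2| = (sqrtC 3%:R)^-1).
Local Notation word := (seq 'I_3).
Local Notation tensor := (word -> (C R)^o).
Local Notation mp := (@mproj R).
Local Notation mt := (mprojA a1 a2).
Local Notation g := (jw a1 a2).
Implicit Types (w : word) (f : tensor).

(** The range of the k-th Jones-Wenzl idempotent ([jw_fix], [jw_rangeP]) *)
Definition jw_kernel k f :=
  (forall i, (i < k)%N -> mp i f = 0) /\ (forall i, (i.+1 < k)%N -> mt i f = 0).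

Lemma jwSS k f : g k.+2 f =
  g k.+1 (f - mp k.+1 f) - jwcoef k.+1 *: g k.+1 (mt k (g k.+1 f)).
Proof. by []. Qed.

Let lp i := @mproj_linear R i.
Let lt i := mprojA_linear a1 a2 i.
Let lg k := jw_linear a1 a2 k.

Lemma jw_kernel_le k l f : (l <= k)%N -> jw_kernel k f -> jw_kernel l f.
Proof.
move=> lk [h1 h2]; split=> i il; [apply: h1|apply: h2]; exact: leq_trans lk.
Qed.

Lemma jw_fix k f : jw_kernel k f -> g k f = f.
Proof.
elim: k f => [//|[|k] IH] f hf; first by rewrite /= (hf.1 0%N) // subr0.
have h : g k.+1 f = f by apply: IH; exact: jw_kernel_le hf.
rewrite jwSS (hf.1 k.+1) // subr0 h (hf.2 k) // (lin0 (lg _)) scaler0.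
by rewrite subr0.
Qed.

(** What Wenzl's induction carries along. By the last condition, the coefficient in
    the recursion is the one for which the next idempotent is killed by the new t. *)
Record jw_spec k : Prop := JwSpec {
  jw_range f : jw_kernel k (g k f) ;
  jw_mp i f : (i < k)%N -> g k (mp i f) = 0 ;
  jw_mp_comm i f : (k <= i)%N -> mp i (g k f) = g k (mp i f) ;
  jw_mt_comm i f : (k <= i)%N -> mt i (g k f) = g k (mt i f) ;
  jw_mt_sandwich l f : k = l.+1 ->
    jwcoef k *: mt l (g k (mt l f)) = g l (mt l f) }.

Lemma jw_spec1 : jw_spec 1.
Proof.
split.
- move=> f; split=> [[|//] _|//]; rewrite /= (linB (lp 0)) mprojK subrr //.
- by move=> [|//] f _; rewrite /= mprojK subrr.
- by move=> [//|i] f _; rewrite /= (linB (lp _)) mproj_comm.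
- move=> [//|i] f _; rewrite /= (linB (lt _)) -mproj_mprojA_comm //.
- move=> [] // f _; rewrite /= (linB (lt _)) mprojAK // mprojA_mproj_mprojA //.
  transitivity ((jwcoef 1 * (1 - 3%:R^-1)) *: mt 0 f).
    by rewrite -scalerA scalerBl scale1r.
  by rewrite jwcoefE -[RHS]scale1r; congr (_ *: _); field.
Qed.

Lemma jw_idem k : jw_spec k.+1 -> forall f, g k.+1 (g k.+1 f) = g k.+1 f.
Proof. by move=> h f; apply: jw_fix; exact: jw_range. Qed.

(** Under the new t, the second term of the recursion cancels the first one by
    [jw_mt_sandwich]. The sandwich relation of the next degree amounts to
    c_(k+1) (1 - 1/3 - c_k / 9) = 1 for the coefficients c_k = 3 k / (k + 1). *)
Lemma jw_specS k : jw_spec k.+1 -> (forall f, mt k (g k f) = g k (mt k f)) ->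
  jw_spec k.+2.
Proof.
move=> h hk; have [hr hp hpc htc hs] := h.
have tp f : mt k (g k.+1 (mp k.+1 f)) = 0.
  by rewrite -hpc // mprojA_mproj (hr f).1 // (lin0 (lt _)).
have c0 : jwcoef k.+1 != 0 :> C R.
  rewrite jwcoefE !mulf_eq0 invr_eq0 !pnatr_eq0 //.
have comm i f : (k.+2 <= i)%N ->
    (mp i (g k.+2 f) = g k.+2 (mp i f)) * (mt i (g k.+2 f) = g k.+2 (mt i f)).
  move=> ki; have ki1 : (k.+1 <= i)%N by exact: leq_trans ki.
  have n1 : i != k.+1 by rewrite gtn_eqF.
  have n2 : i != k by rewrite gtn_eqF // ltnW.
  split; rewrite !jwSS.
    rewrite (linB (lp _)) (linZ (lp _)) !hpc // (linB (lp _)) mproj_comm //.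
    by rewrite mproj_mprojA_comm // hpc.
  rewrite (linB (lt _)) (linZ (lt _)) !(htc i) // (linB (lt _)).
  rewrite -(mproj_mprojA_comm _ _ (j := i)) //; last 2 first.
  - by rewrite eq_sym.
  - by rewrite ltn_eqF // ltnS ltnW.
  by rewrite -mprojA_comm // htc.
split.
- move=> f; split=> i.
  + rewrite ltnS leq_eqVlt => /orP[/eqP ->|ik].
      rewrite jwSS (linB (lp _)) (linZ (lp _)) !hpc // (linB (lp _)) mprojK subrr.
      by rewrite mproj_mprojA hp // (lin0 (lg _)) scaler0 subrr.
    by rewrite jwSS (linB (lp _)) (linZ (lp _)) !(hr _).1 // scaler0 subrr.
  + rewrite ltnS leq_eqVlt eqSS => /orP[/eqP ->|ik]; last first.
      by rewrite jwSS (linB (lt _)) (linZ (lt _)) !(hr _).2 // scaler0 subrr.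
    rewrite jwSS (linB (lt _)) (linZ (lt _)) hs // (linB (lg _)) (linB (lt _)) tp subr0.
    rewrite -hk (_ : g k (g k.+1 f) = g k.+1 f) ?subrr //.
    by apply: jw_fix; apply: jw_kernel_le (hr f).
- move=> i f; rewrite jwSS ltnS leq_eqVlt => /orP[/eqP ->|ik].
    rewrite mprojK subrr (lin0 (lg _)) -hpc // mprojA_mproj (hr _).1 //.
    by rewrite (lin0 (lt _)) (lin0 (lg _)) scaler0 subrr.
  rewrite mproj_comm ?gtn_eqF // -(linB (lp _)) !hp // (lin0 (lt _)).
  by rewrite (lin0 (lg _)) scaler0 subrr.
- by move=> i f ki; rewrite comm.
- by move=> i f ki; rewrite comm.
- move=> l f [<-]; rewrite jwSS (linB (lt _)) (linZ (lt _)) !(htc k.+1) //.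
  rewrite (linB (lt _)) mprojAK // mprojA_mproj_mprojA // -(htc k.+1 f) //.
  rewrite mprojA_braid // !(linZ (lg _)) (htc k.+1 f) // jw_idem // (linB (lg _)) (linZ (lg _)).
  transitivity ((jwcoef k.+2 * (1 - 3%:R^-1 - jwcoef k.+1 * 9%:R^-1)) *:
      g k.+1 (mt k.+1 f)).
    by rewrite -scalerA !scalerBl scale1r scalerA.
  rewrite -[RHS]scale1r; congr (_ *: _); rewrite !jwcoefE -(natr1 k.+2) -(natr1 k.+1).
  by field; rewrite (addrC 1) !natr1 !pnatr_eq0.
Qed.

Lemma jw_specP k : jw_spec k.+1.
Proof.
suff [] : jw_spec k.+1 /\ forall f, mt k (g k f) = g k (mt k f) by [].
elim: k => [|k [IH1 IH2]]; first by split=> //; exact: jw_spec1.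
split; first exact: jw_specS.
by move=> f; apply: jw_mt_comm.
Qed.

Lemma jw_rangeP k f : jw_kernel k (g k f).
Proof. by case: k => [|k]; [split|exact: jw_range (jw_specP k) f]. Qed.

(** [jw_fix] and [jw_rangeP], read on the words of length k; on the other words all
    terms vanish. *)
Lemma motzkinP k f : motzkin a1 a2 k f <-> degree k f /\ jw_kernel k f.
Proof.
split=> [[df [h _ fh]]|[df kf]]; split=> //; last first.
  by exists f => // w _; rewrite jw_fix.
have fg w : size w = k -> f w = g k h w := fh w.
have [k1 k2] := jw_rangeP k h; split=> i ik; apply/funext => w.
- pose w' := subst w i (letter w i).
  have -> : mp i f w = mp i f w'.
    by rewrite !mprojE letter_subst contr_subst.
  have [wk|wk] := eqVneq (size w') k.
    rewrite -[RHS](congr1 (fun F => F w') (k1 i ik)) !mprojE; congr (_ * _).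
    apply: eq_bigr => a _; rewrite subst_subst fg // size_subst -wk size_subst //.
  rewrite mprojE /contr big1 ?mulr0 // => a _; rewrite df ?mulr0 //.
  by rewrite subst_subst size_subst; move: wk; rewrite size_subst.
- pose w' := subst (subst w i (letter w i)) i.+1 (letter w i.+1).
  have n1 : i != i.+1 by rewrite ltn_eqF.
  have -> : mt i f w = mt i f w'.
    rewrite !mprojAE letter_subst letter_subst_neq // letter_subst contrA_substS.
    by rewrite contrA_subst.
  have sw a b : size (subst (subst w i a) i.+1 b) = size w' by rewrite !size_subst.
  have [wk|wk] := eqVneq (size w') k.
    rewrite -[RHS](congr1 (fun F => F w') (k2 i ik)) !mprojAE; congr (_ * _).
    rewrite !contrA_substS !contrA_subst.
    by apply: eq_bigr => a _; rewrite fg // sw.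
  rewrite mprojAE contrA_substS contrA_subst /contrA big1 ?mulr0 // => a _.
  by rewrite df ?mulr0 // sw.
Qed.

End Wenzl.

(** * Twisted coordinates *)
Section Coordinates.
Context {R : realType} (a1 a2 : C R).
Hypotheses (ha1 : `|a1| = (sqrtC 3%:R)^-1) (ha2 : `|a2| = (sqrtC 3%:R)^-1).
Local Notation word := (seq 'I_3).
Local Notation tensor := (word -> (C R)^o).
Local Notation coord := (nat -> nat -> C R).
Local Notation i1 := (inord 1 : 'I_3).
Local Notation i2 := (inord 2 : 'I_3).
Implicit Types (w l r : word) (f g : tensor) (phi psi : coord).

(** Divided by the product of these weights over the letters, an element of H_k takes
    equal values on the words of a class. The square root makes this compatible with
    the relation between (v_1 - v_3)^2 and v_2^2. *)
Definition twist (a : 'I_3) : C R :=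
  [:: (sqrtC 2%:R)^-1; sqrtC (a1^* / a2^*); - (sqrtC 2%:R)^-1]`_a.

Definition twist_word w : C R := \prod_(a <- w) twist a.

Lemma twistE : (twist ord0 = (sqrtC 2%:R)^-1) * (twist i1 = sqrtC (a1^* / a2^*)) *
  (twist i2 = - (sqrtC 2%:R)^-1).
Proof. by rewrite /twist /= ?inordK. Qed.

Definition second (a : 'I_3) := a == i1.

Lemma secondE : (second ord0 = false) * (second i1 = true) * (second i2 = false).
Proof. by rewrite /second -!val_eqE /= !inordK. Qed.

(** In the twisted word the letters v_1 - v_3 and v_2 are exchanged at every second
    position, counted from the right. The relation (v_1 - v_3)^2 ~ v_2^2 becomes a
    commutation, and the class of a word is given by its length and by the number
    of letters of the first kind in the twisted word. *)
Fixpoint tcount w : nat :=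
  if w is a :: w' then ((~~ second a) (+) odd (size w')) + tcount w' else 0.

Lemma tcount_le w : (tcount w <= size w)%N.
Proof. by elim: w => //= a w IH; exact: (leq_add (leq_b1 _) IH). Qed.

Lemma tcount_cat l r r' : size r = size r' ->
  (tcount (l ++ r) + tcount r' = tcount (l ++ r') + tcount r)%N.
Proof.
move=> rr'; elim: l => [|a l IH] /=; first by rewrite addnC.
by rewrite !size_cat rr' -!addnA IH.
Qed.

Lemma twist_word_cons a w : twist_word (a :: w) = twist a * twist_word w.
Proof. by rewrite /twist_word big_cons. Qed.

Lemma twist_word_cat l r : twist_word (l ++ r) = twist_word l * twist_word r.
Proof. by rewrite /twist_word big_cat. Qed.

Lemma a_neq0 (a : C R) : `|a| = (sqrtC 3%:R)^-1 -> a != 0.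
Proof.
by move=> h; rewrite -normr_eq0 h invr_eq0 sqrtC_eq0 pnatr_eq0.
Qed.

Lemma twist_neq0 a : twist a != 0.
Proof.
have h : (sqrtC 2%:R)^-1 != 0 :> C R by rewrite invr_eq0 sqrtC_eq0 pnatr_eq0.
elim/ord3P: a; rewrite twistE ?oppr_eq0 // sqrtC_eq0 mulf_eq0 invr_eq0 !conjC_eq0.
by rewrite !(negPf (a_neq0 _)).
Qed.

Lemma twist_word_neq0 w : twist_word w != 0.
Proof.
by elim: w => [|a w IH]; rewrite ?twist_word_cons ?mulf_neq0 ?twist_neq0 // /twist_word big_nil oner_neq0.
Qed.

Lemma twist1_sqr : twist i1 * twist i1 = a1^* / a2^*.
Proof. by rewrite twistE -expr2 sqrtCK. Qed.

Lemma twist_norm : (twist i1 * (twist i1)^* = 1) *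
  (twist ord0 * (twist ord0)^* + twist i2 * (twist i2)^* = 1).
Proof.
split.
  rewrite -normCK -normrX expr2 twist1_sqr normrM normfV !norm_conjC ha1 ha2.
  by rewrite divff // invr_eq0 sqrtC_eq0 pnatr_eq0.
have h : ((sqrtC 2%:R)^-1 : C R)^* = (sqrtC 2%:R)^-1.
  by apply: conj_Creal; rewrite realV ger0_real // sqrtC_ge0 ler0n.
by rewrite !twistE rmorphN /= h mulrNN half_sqr; field.
Qed.

(** The representatives of the classes, on which coordinates are read off. *)
Fixpoint class_word (k p : nat) : word :=
  if k is k'.+1 then
    if (p <= k')%N then (if odd k' then ord0 else i1) :: class_word k' p
    else (if odd k' then i1 else ord0) :: class_word k' p.-1
  else [::].

Lemma size_class_word k p : size (class_word k p) = k.
Proof. by elim: k p => //= k IH p; case: ifP => _ /=; rewrite IH. Qed.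

Lemma tcount_class_word k p : (p <= k)%N -> tcount (class_word k p) = p.
Proof.
elim: k p => [|k IH] p /=; first by rewrite leqn0 => /eqP.
case: ifP => [pk _|/negbT]; first by rewrite /= size_class_word IH //; case: odd; rewrite secondE.
rewrite -ltnNge => kp pk; have -> : p = k.+1 by apply/eqP; rewrite eqn_leq pk.
by rewrite /= size_class_word IH //; case: odd; rewrite secondE.
Qed.

(** [jw_kernel] in terms of concatenations instead of substitutions *)
Definition letter_rel k f :=
  (forall l r, (size l + size r).+1 = k ->
     f (l ++ ord0 :: r) + f (l ++ i2 :: r) = 0) /\
  (forall l r, (size l + size r).+2 = k ->
     a1^* * (f (l ++ ord0 :: i2 :: r) + f (l ++ i2 :: ord0 :: r)) +
     a2^* * f (l ++ i1 :: i1 :: r) = 0).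

Lemma subst_cat l a r b : subst (l ++ a :: r) (size l) b = l ++ b :: r.
Proof. by elim: l => //= c l IH; rewrite /subst /= -/(subst _ _ _) IH. Qed.

Lemma subst_catS l a c r b : subst (l ++ a :: c :: r) (size l).+1 b = l ++ a :: b :: r.
Proof. by rewrite -cat_rcons -[in X in subst _ X](size_rcons l a) subst_cat cat_rcons. Qed.

Lemma letter_cat l a r : letter (l ++ a :: r) (size l) = a.
Proof. by rewrite /letter nth_cat ltnn subnn. Qed.

Lemma letter_catS l a c r : letter (l ++ a :: c :: r) (size l).+1 = c.
Proof. by rewrite -cat_rcons -(size_rcons l a) letter_cat. Qed.

Lemma contr_cat l a r f : contr (size l) f (l ++ a :: r) =
  (sqrtC 2%:R)^-1 * (f (l ++ ord0 :: r) + f (l ++ i2 :: r)).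
Proof. by rewrite /contr sum3 !mvecE !subst_cat mul0r addr0 mulrDr. Qed.

Lemma contrA_cat l a b r f : contrA a1 a2 (size l) f (l ++ a :: b :: r) =
  a1^* * (f (l ++ ord0 :: i2 :: r) + f (l ++ i2 :: ord0 :: r)) +
  a2^* * f (l ++ i1 :: i1 :: r).
Proof.
rewrite /contrA sum3 !subst_cat !subst_catS !rev_ord3 /alpha /= !inordK //=.
ring.
Qed.

Lemma word_split w i : (i < size w)%N ->
  exists l a r, w = l ++ a :: r /\ size l = i.
Proof.
move=> iw; exists (take i w), (nth ord0 w i), (drop i.+1 w); split.
  by rewrite -drop_nth // cat_take_drop.
by rewrite size_take iw.
Qed.

Lemma letter_relP k f : degree k f -> (jw_kernel a1 a2 k f <-> letter_rel k f).
Proof.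
move=> df; split=> -[h1 h2]; split.
- move=> l r lrk; have lk : (size l < k)%N by rewrite -lrk ltnS leq_addr.
  have := congr1 (fun F => F (l ++ ord0 :: r)) (h1 _ lk).
  rewrite mprojE letter_cat contr_cat mvecE mulrA half_sqr => /eqP.
  by rewrite mulf_eq0 invr_eq0 pnatr_eq0 => /eqP.
- move=> l r lrk; have lk : ((size l).+1 < k)%N by rewrite -lrk !ltnS leq_addr.
  have := congr1 (fun F => F (l ++ ord0 :: i2 :: r)) (h2 _ lk).
  rewrite mprojAE letter_cat letter_catS contrA_cat mvecAE rev_ord3 eqxx => /eqP.
  by rewrite mulf_eq0 (negPf (a_neq0 ha1)) => /eqP.
- move=> i ik; apply/funext => w; rewrite mprojE -(contr_subst i f w ord0).
  set w' := subst w i ord0.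
  have iw : (i < size w')%N by rewrite size_subst leq_max leqnn.
  have [l [a [r [wE lE]]]] := word_split iw; rewrite wE -lE contr_cat.
  have [wk|wk] := eqVneq (size w') k.
    by rewrite h1 ?mulr0 // -wk wE size_cat addnS.
  by rewrite !df ?addr0 ?mulr0 //; move: wk; rewrite wE !size_cat.
- move=> i ik; apply/funext => w; rewrite mprojAE -(contrA_subst a1 a2 i f w ord0).
  rewrite -(contrA_substS a1 a2 i f _ ord0); set w' := subst _ _ _.
  have iw : (i < size w')%N by rewrite !size_subst leq_max leqW.
  have iw1 : (i.+1 < size w')%N by rewrite size_subst leq_max leqnn.
  have [l [a [r [wE lE]]]] := word_split iw; case: r wE => [|b r] wE.
    by move: iw1; rewrite wE size_cat lE /= addn1 ltnn.
  rewrite wE -lE contrA_cat.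
  have [wk|wk] := eqVneq (size w') k.
    by rewrite h2 ?mulr0 // -wk wE size_cat !addnS.
  by rewrite !df ?addr0 ?mulr0 ?addr0 ?mulr0 //; move: wk; rewrite wE !size_cat.
Qed.

Lemma letter_rel_cons k f a : letter_rel k.+1 f -> letter_rel k (fun w => f (a :: w)).
Proof.
move=> [h1 h2]; split=> l r lr; first by apply: (h1 (a :: l)); rewrite /= addSn lr.
by apply: (h2 (a :: l)); rewrite /= addSn lr.
Qed.

(** By induction, f is given by a function of the class after each fixed first
    letter; the relations between the first two letters glue these functions. *)
Lemma letter_rel_class k f : letter_rel k f ->
  exists c : nat -> C R, forall w, size w = k -> f w = twist_word w * c (tcount w).
Proof.
elim: k f => [|k IH] f hf.
  exists (fun _ => f [::]) => w /size0nil ->.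
  by rewrite /twist_word big_nil mul1r.
have [c0 h0] := IH _ (letter_rel_cons ord0 hf).
have [c1 h1] := IH _ (letter_rel_cons i1 hf).
pose d (b : bool) p := if b then c1 p / twist i1 else c0 p / twist ord0.
have hd a w : size w = k -> f (a :: w) = twist a * twist_word w * d (second a) (tcount w).
  elim/ord3P: a => wk; rewrite /d secondE.
  - by rewrite h0 //; field; rewrite twist_neq0.
  - by rewrite h1 //; field; rewrite twist_neq0.
  - have := hf.1 [::] w; rewrite /= add0n wk => /(_ erefl)/eqP.
    rewrite addrC addr_eq0 => /eqP ->; rewrite h0 // (_ : twist i2 = - twist ord0); last by rewrite !twistE.
    by field; rewrite twist_neq0.
(* The relations on the first two letters, followed by the word that represents p *)
have hilo p : (p < k)%N -> d (odd k) p = d (~~ odd k) p.+1.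
  case: k => // k in IH hf c0 h0 c1 h1 d hd *; rewrite ltnS => pk.
  pose r := class_word k p.
  have rk : size r = k by rewrite size_class_word.
  have f00 : f [:: ord0, i2 & r] = - f [:: ord0, ord0 & r].
    have := hf.1 [:: ord0] r; rewrite /= rk add1n => /(_ erefl)/eqP.
    by rewrite addrC addr_eq0 => /eqP.
  have f20 : f [:: i2, ord0 & r] = - f [:: ord0, ord0 & r].
    have := hf.1 [::] (ord0 :: r); rewrite /= rk => /(_ erefl)/eqP.
    by rewrite addrC addr_eq0 => /eqP.
  have := hf.2 [::] r; rewrite /= rk => /(_ erefl).
  rewrite f00 f20 !hd /= ?rk // !twist_word_cons !secondE !tcount_class_word //.
  set x := d false _; set y := d true _ => E.
  have {E} : (- a1^* * twist_word r) * (x - y) = 0.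
    rewrite -E; transitivity (- (a1^* * (2%:R * ((sqrtC 2%:R)^-1 * (sqrtC 2%:R)^-1)) *
       (twist_word r * x)) + a2^* * (twist i1 * twist i1) * (twist_word r * y)); last first.
      by rewrite [twist ord0]twistE; ring.
    rewrite half_sqr twist1_sqr; field.
    by rewrite conjC_eq0 a_neq0.
  move/eqP; rewrite mulf_eq0 mulf_eq0 oppr_eq0 conjC_eq0 (negPf (a_neq0 ha1)).
  rewrite (negPf (twist_word_neq0 _)) /= subr_eq0 => /eqP; rewrite /x /y.
  by case: (odd k) => /=; rewrite ?add0n ?add1n => ->.
exists (fun p => if p is p'.+1 then d (odd k) p' else d (~~ odd k) 0%N).
move=> [//|a w] [wk]; rewrite hd // twist_word_cons; congr (_ * _) => /=; rewrite wk.
have -> : second a = ~~ (~~ second a (+) odd k) (+) odd k.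
  by case: second; case: odd.
case: (~~ second a (+) odd k); first by case: (odd k).
rewrite (_ : (~~ (~~ false (+) odd k) (+) odd k) = false); last by case: odd.
rewrite /= add0n; case: tcount (tcount_le w) => [//|p]; rewrite wk => pk.
by rewrite hilo.
Qed.

Lemma class_letter_rel k f c :
  (forall w, size w = k -> f w = twist_word w * c (tcount w)) -> letter_rel k f.
Proof.
move=> h; split=> l r lrk.
  rewrite !h ?size_cat /= ?addnS // !twist_word_cat !twist_word_cons !twistE.
  have -> : tcount (l ++ i2 :: r) = tcount (l ++ ord0 :: r).
    have := @tcount_cat l (i2 :: r) (ord0 :: r) erefl.
    by rewrite /= !secondE => /addIn.
  by ring.
rewrite !h ?size_cat /= ?addnS // !twist_word_cat !twist_word_cons.
have e1 : tcount (l ++ [:: i2, ord0 & r]) = tcount (l ++ [:: ord0, i2 & r]).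
  have := @tcount_cat l [:: i2, ord0 & r] [:: ord0, i2 & r] erefl.
  by rewrite /= !secondE => /addIn.
have -> : tcount (l ++ [:: i1, i1 & r]) = tcount (l ++ [:: ord0, i2 & r]).
  have := @tcount_cat l [:: i1, i1 & r] [:: ord0, i2 & r] erefl.
  by rewrite /= !secondE; case: odd => /addIn.
rewrite e1; set c' := c _.
transitivity (- (a1^* * (2%:R * ((sqrtC 2%:R)^-1 * (sqrtC 2%:R)^-1)) *
  (twist_word l * twist_word r * c')) + a2^* * (twist i1 * twist i1) * (twist_word l * twist_word r * c')).
  by rewrite !twistE; ring.
rewrite half_sqr twist1_sqr; field.
by rewrite conjC_eq0 a_neq0.
Qed.

(** The arguments of phi are the numbers of letters of the two kinds in the twisted
    word. *)
Definition of_coord phi : tensor := fun w =>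
  twist_word w * phi (tcount w) (size w - tcount w)%N.

Definition coord_of f : coord := fun p q =>
  f (class_word (p + q) p) / twist_word (class_word (p + q) p).

Lemma of_coordK phi : coord_of (of_coord phi) = phi.
Proof.
apply/funext => p; apply/funext => q; rewrite /coord_of /of_coord.
rewrite tcount_class_word ?leq_addr // size_class_word addKn.
by rewrite mulrC mulKf // twist_word_neq0.
Qed.

Lemma of_coord_motzkin phi k : motzkin a1 a2 k (component k (of_coord phi)).
Proof.
have df : degree k (component k (of_coord phi)).
  by move=> w wk; rewrite /component (negPf wk).
apply/motzkinP => //; split=> //; apply/letter_relP => //.
apply: (@class_letter_rel _ _ (fun p => phi p (k - p)%N)) => w wk.
by rewrite /component wk eqxx /of_coord wk.
Qed.

Lemma coord_ofK f : (forall k, motzkin a1 a2 k (component k f)) ->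
  of_coord (coord_of f) = f.
Proof.
move=> h; apply/funext => w; have /(motzkinP ha1 ha2)[df kf] := h (size w).
have [c hc] := letter_rel_class (iffLR (letter_relP df) kf).
have E u : size u = size w -> f u = twist_word u * c (tcount u).
  by move=> uw; rewrite -hc // /component uw eqxx.
rewrite /of_coord /coord_of subnKC ?tcount_le // E ?size_class_word //.
rewrite tcount_class_word ?tcount_le // mulrAC mulfV ?twist_word_neq0 // mul1r.
by rewrite E.
Qed.

(** The inner product of the k-th symmetric power of C^2: the weight counts the words
    of a class ([sum_class]). *)
Definition coord_dot phi psi k : C R :=
  \sum_(p < k.+1) 'C(k, p)%:R * (phi p (k - p)%N * (psi p (k - p)%N)^*).

Lemma sum_tuple_cons k (F : word -> C R) :
  \sum_(w : k.+1.-tuple 'I_3) F w = \sum_a \sum_(w : k.-tuple 'I_3) F (a :: w).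
Proof.
rewrite pair_big /=.
rewrite (reindex (fun aw : 'I_3 * k.-tuple 'I_3 => [tuple of aw.1 :: aw.2])) //=.
exists (fun w : k.+1.-tuple 'I_3 => (thead w, [tuple of behead w])) => [[a w] _|w _] /=.
  by rewrite theadE; congr pair; apply: val_inj.
by rewrite -tuple_eta.
Qed.

Lemma sum_class k (h : nat -> C R) :
  \sum_(w : k.-tuple 'I_3) twist_word w * (twist_word w)^* * h (tcount w) =
  \sum_(p < k.+1) 'C(k, p)%:R * h p.
Proof.
elim: k h => [|k IH] h.
  rewrite (big_pred1 [tuple]) => [|w]; last by rewrite /= (tuple0 w) /= eqxx.
  by rewrite big_ord1 /twist_word big_nil conjC1 !mul1r.
rewrite (sum_tuple_cons _ (fun w => twist_word w * (twist_word w)^* * h (tcount w))).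
have E a : \sum_(w : k.-tuple 'I_3) twist_word (a :: w) * (twist_word (a :: w))^* * h (tcount (a :: w)) =
    twist a * (twist a)^* * \sum_(p < k.+1) 'C(k, p)%:R * h ((~~ second a (+) odd k) + p)%N.
  rewrite -(IH (fun p => h ((~~ second a (+) odd k) + p)%N)) mulr_sumr; apply: eq_bigr => w _.
  by rewrite twist_word_cons rmorphM /= size_tuple; ring.
rewrite sum3 !E !secondE addrAC -mulrDl twist_norm mul1r twist_norm mul1r -big_split /=.
transitivity (\sum_(p < k.+1) 'C(k, p)%:R * (h p + h p.+1)).
  by apply: eq_bigr => p _; case: odd; rewrite /= ?add0n ?add1n -mulrDr // addrC.
transitivity (\sum_(p < k.+1) 'C(k, p)%:R * h p + \sum_(p < k.+1) 'C(k, p)%:R * h p.+1).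
  by rewrite -big_split; apply: eq_bigr => p _; rewrite mulrDr.
rewrite [X in X + _]big_ord_recl [RHS]big_ord_recl /= !bin0 -addrA; congr (_ + _).
rewrite [X in _ + X]big_ord_recr [RHS]big_ord_recr /= addrA binn; congr (_ + _).
  rewrite -big_split; apply: eq_bigr => p _ /=.
  by rewrite /bump /= add1n binS natrD mulrDl.
by rewrite /bump /= add1n binn.
Qed.

Lemma slice_dot_coord phi psi k :
  slice_dot (of_coord phi) (of_coord psi) k = coord_dot phi psi k.
Proof.
rewrite /coord_dot -(sum_class k (fun p => phi p (k - p)%N * (psi p (k - p)%N)^*)).
rewrite /slice_dot; apply: eq_bigr => w _.
by rewrite /of_coord size_tuple rmorphM; ring.
Qed.

End Coordinates.

(** * Operators on the Fock space *)
Section CoordinateOperators.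
Context {R : realType}.
Local Notation coord := (nat -> nat -> C R).
Implicit Types (phi psi : coord) (c : bool).

(** [coord_dot phi phi k] as a real number *)
Definition slice_nm phi k : R := \sum_(p < k.+1) 'C(k, p)%:R * cm (phi p (k - p)%N) ^+ 2.

Lemma coord_dot_nm phi k : coord_dot phi phi k = rc (slice_nm phi k).
Proof.
rewrite rmorph_sum; apply: eq_bigr => p _.
by rewrite rmorphM rmorph_nat mul_conj_cm.
Qed.

Lemma slice_nm_ge0 phi k : 0 <= slice_nm phi k.
Proof. by apply: sumr_ge0 => p _; rewrite mulr_ge0 ?sqr_ge0. Qed.

(** Annihilation and creation of the letter that c stands for: the twist makes it a
    letter of the first or of the second kind according to the parity of the degree. *)
Definition ann c phi : coord := fun p q =>
  if odd (p + q) (+) c then phi p q.+1 else phi p.+1 q.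

Definition cre c phi : coord := fun p q =>
  if odd (p + q) (+) c then p%:R / (p + q)%:R * phi p.-1 q
  else q%:R / (p + q)%:R * phi p q.-1.

(** All the relations below hold up to a bounded operator times this one, which is
    compact ([compact_damping]). *)
Definition damp phi : coord := fun p q => (p + q).+1%:R^-1 * phi p q.

(** The n-th symmetric power of the vector (w1, w2) *)
Definition coherent (w1 w2 : C R) n : coord := fun p q =>
  if (p + q == n)%N then w1 ^+ p * w2 ^+ q else 0.

(** Pascal's rule for the weights *)
Lemma coord_dot_pascal phi psi k : coord_dot phi psi k.+1 =
  coord_dot (ann false phi) (ann false psi) k + coord_dot (ann true phi) (ann true psi) k.
Proof.
pose h p := phi p (k.+1 - p)%N * (psi p (k.+1 - p)%N)^*.
transitivity (\sum_(p < k.+1) 'C(k, p)%:R * h p + \sum_(p < k.+1) 'C(k, p)%:R * h p.+1).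
  rewrite /coord_dot -/(h _) big_ord_recl [X in _ = X + _]big_ord_recl /= !bin0 -addrA.
  congr (_ + _); rewrite big_ord_recr [X in _ = _ + X]big_ord_recr /= addrA !binn.
  rewrite /bump /= add1n; congr (_ + _); rewrite -big_split; apply: eq_bigr => p _ /=.
  by rewrite add1n binS natrD mulrDl.
rewrite /coord_dot -!big_split; apply: eq_bigr => p _ /=.
have pk : (p <= k)%N by rewrite -ltnS.
rewrite /ann subnKC // -!mulrDr; congr (_ * _); rewrite /h subSS subSn //.
by case: odd => /=; rewrite // addrC.
Qed.

Lemma coord_dot_cre c phi psi k :
  coord_dot (cre c phi) psi k.+1 = coord_dot phi (ann c psi) k.
Proof.
rewrite /coord_dot /cre /ann.
have k0 : k.+1%:R != 0 :> C R by rewrite pnatr_eq0.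
have [oc|oc] := boolP (odd k (+) c).
  rewrite big_ord_recr /= subnn addn0 /= addNb oc /= !mul0r mulr0 addr0.
  apply: eq_bigr => p _; have pk : (p <= k)%N by rewrite -ltnS.
  rewrite subnKC ?(leqW pk) //= addNb oc /= subnKC // oc subSn //=.
  rewrite !mulrA; congr (_ * _ * _); rewrite -[(k - p).+1]subSn // -natrM.
  by rewrite mulnC -(mul_bin_down k.+1) natrM mulrAC mulfV ?mul1r.
rewrite big_ord_recl /= subn0 add0n /= addNb (negPf oc) /= !mul0r mulr0 add0r.
apply: eq_bigr => p _; have pk : (p <= k)%N by rewrite -ltnS.
rewrite /bump /= add1n add0n subSS addSn subnKC // addNb (negPf oc) /=.
rewrite !mulrA; congr (_ * _ * _); rewrite -natrM mulnC -mul_bin_diag natrM.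
by rewrite mulrAC mulfV ?mul1r.
Qed.

Lemma coord_dot_cre0 c phi psi : coord_dot (cre c phi) psi 0 = 0.
Proof. by rewrite /coord_dot big_ord1 /cre; case: ifP => _; rewrite !mul0r mulr0. Qed.

Lemma ann_cre c phi p q : ann c (cre c phi) p q =
  (if odd (p + q) (+) c then q.+1%:R else p.+1%:R) / (p + q).+1%:R * phi p q.
Proof.
rewrite /ann /cre; case: ifP => h.
  by rewrite addnS /= addNb h.
by rewrite addSn /= addNb h.
Qed.

Lemma cre_ann c phi p q : cre c (ann c phi) p q =
  (if odd (p + q) (+) c then p%:R else q%:R) / (p + q)%:R * phi p q.
Proof.
rewrite /ann /cre; case: ifP => h.
  case: p h => [|p] h; first by rewrite !mul0r.
  by move: h; rewrite addSn /= addNb => /negbTE ->.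
case: q h => [|q] h; first by rewrite !mul0r.
by move: h; rewrite addnS /= addNb => /negbFE ->.
Qed.

Lemma cre_ann_neg c phi p q : cre (~~ c) (ann c phi) p q =
  if odd (p + q) (+) c then q%:R / (p + q)%:R * phi p.+1 q.-1
  else p%:R / (p + q)%:R * phi p.-1 q.+1.
Proof.
rewrite /ann /cre addbN; case: ifP => [/negbTE h|/negbFE h].
  rewrite h; case: p h => [|p] h; first by rewrite !mul0r.
  by move: h; rewrite addSn /= addNb => /negbFE ->.
rewrite h; case: q h => [|q] h; first by rewrite !mul0r.
by move: h; rewrite addnS /= addNb => /negbTE ->.
Qed.

Lemma ann_neg_cre c phi p q : ann (~~ c) (cre c phi) p q =
  if odd (p + q) (+) c then q%:R / (p + q).+1%:R * phi p.+1 q.-1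
  else p%:R / (p + q).+1%:R * phi p.-1 q.+1.
Proof.
rewrite /ann /cre addbN; case: ifP => [/negbTE h|/negbFE h].
  by rewrite h addnS /= addNb h.
by rewrite h addSn /= addNb h.
Qed.

Lemma ann_ann phi : ann false (ann false phi) = ann true (ann true phi).
Proof.
apply/funext => p; apply/funext => q; rewrite /ann !(addnS, addSn) /= !addbF !addbT.
by case: odd.
Qed.

Lemma ann_coherent c w1 w2 n : ann c (coherent w1 w2 n.+1) =
  fun p q => (if odd n (+) c then w2 else w1) * coherent w1 w2 n p q.
Proof.
apply/funext => p; apply/funext => q; rewrite /ann /coherent !(addnS, addSn) eqSS.
case: eqP => [->|_]; last by rewrite if_same mulr0.
by case: ifP => _; rewrite exprS; ring.
Qed.

Lemma slice_nm_coherent w1 w2 n k : cm w1 ^+ 2 + cm w2 ^+ 2 = 1 ->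
  slice_nm (coherent w1 w2 n) k = (k == n)%:R.
Proof.
move=> w; have [->|kn] := eqVneq k n; last first.
  rewrite /slice_nm big1 // => p _; have pk : (p <= k)%N by rewrite -ltnS.
  by rewrite /coherent subnKC // (negPf kn) cm0 expr0n mulr0.
elim: n => [|n IH]; first by rewrite /slice_nm big_ord1 /coherent /= !expr0 mulr1 cm1 expr1n mulr1.
apply: rcI; rewrite -coord_dot_nm coord_dot_pascal !ann_coherent.
have sc a phi : coord_dot (fun p q => a * phi p q) (fun p q => a * phi p q) n =
    rc (cm a ^+ 2 * slice_nm phi n).
  rewrite coord_dot_nm /slice_nm mulr_sumr; congr rc; apply: eq_bigr => p _.
  by rewrite cmM exprMn mulrCA.
rewrite !sc IH !mulr1 -rmorphD.
by case: odd => /=; rewrite ?w // addrC w.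
Qed.

Lemma slice_nm_ann c phi k : slice_nm (ann c phi) k <= slice_nm phi k.+1.
Proof.
rewrite -rc_ler -!coord_dot_nm coord_dot_pascal.
by case: c; [rewrite lerDr|rewrite lerDl]; rewrite coord_dot_nm -(rmorph0 rc) rc_ler slice_nm_ge0.
Qed.

Lemma slice_nm_le (b : nat -> nat -> R) phi k : (forall p q, 0 <= b p q <= 1) ->
  slice_nm (fun p q => rc (b p q) * phi p q) k <= slice_nm phi k.
Proof.
move=> hb; apply: ler_sum => p _; rewrite ler_wpM2l ?ler0n // cmM cm_rc.
have /andP[b0 b1] := hb p (k - p)%N.
by rewrite exprMn ler_piMl ?sqr_ge0 // ger0_norm // expr_le1.
Qed.

Lemma slice_nm_cre c phi k : slice_nm (cre c phi) k.+1 <= slice_nm phi k.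
Proof.
rewrite -rc_ler -!coord_dot_nm coord_dot_cre.
apply: ler_sum => p _; have pk : (p <= k)%N by rewrite -ltnS.
rewrite ler_wpM2l ?ler0n // ann_cre subnKC //.
have [b /andP[b0 b1] ->] : exists2 b : R, 0 <= b <= 1 &
    (if odd k (+) c then (k - p).+1%:R else p.+1%:R) / k.+1%:R = rc b.
  exists ((if odd k (+) c then (k - p).+1%:R else p.+1%:R) / k.+1%:R).
    apply/andP; split; first by rewrite divr_ge0 //; case: ifP.
    rewrite ler_pdivrMr ?ltr0Sn // mul1r.
    by case: ifP => _; rewrite ler_nat ltnS // leq_subr.
  by rewrite rmorphM fmorphV rmorph_nat; case: ifP => _; rewrite rmorph_nat.
rewrite rmorphM /= conj_rc mulrCA ler_piMl ?mul_conjC_ge0 //.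
by rewrite -(rmorph1 rc) rc_ler.
Qed.

Lemma slice_nm_cre0 c phi : slice_nm (cre c phi) 0 = 0.
Proof. by apply: rcI; rewrite -coord_dot_nm coord_dot_cre0. Qed.

Lemma dampE phi : damp phi = fun p q => rc (p + q).+1%:R^-1 * phi p q.
Proof.
by apply/funext => p; apply/funext => q; rewrite fmorphV rmorph_nat.
Qed.

Lemma slice_nm_damp phi k : slice_nm (damp phi) k <= slice_nm phi k.
Proof.
rewrite dampE; apply: slice_nm_le => p q.
by rewrite invr_ge0 ler0n invf_le1 ?ltr0Sn // ler1n.
Qed.

Lemma slice_nmB phi psi k :
  slice_nm (fun p q => phi p q - psi p q) k <= 2 * slice_nm phi k + 2 * slice_nm psi k.
Proof.
rewrite !mulr_sumr -big_split; apply: ler_sum => p _ /=.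
rewrite !(mulrCA 2) -mulrDr ler_wpM2l ?ler0n //.
set x := phi _ _; set y := psi _ _.
apply: le_trans (_ : (cm x + cm y) ^+ 2 <= _).
  by rewrite ler_pXn2r ?nnegrE ?addr_ge0 ?cm_ge0 // -(cmN y) cmD.
by have := sqr_ge0 (cm x - cm y); lra.
Qed.

Lemma slice_nm_coord phi p q : cm (phi p q) ^+ 2 <= slice_nm phi (p + q).
Proof.
have pk : (p < (p + q).+1)%N by rewrite ltnS leq_addr.
rewrite /slice_nm (bigD1 (Ordinal pk)) //= addKn.
apply: le_trans (_ : 'C(p + q, p)%:R * cm (phi p q) ^+ 2 <= _).
  by rewrite ler_peMl ?sqr_ge0 // ler1n bin_gt0 leq_addr.
by rewrite lerDl sumr_ge0 // => i _; rewrite mulr_ge0 ?sqr_ge0.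
Qed.

End CoordinateOperators.

Section FockSpace.
Context {R : realType} (a1 a2 : C R).
Hypotheses (ha1 : `|a1| = (sqrtC 3%:R)^-1) (ha2 : `|a2| = (sqrtC 3%:R)^-1).
Local Notation coord := (nat -> nat -> C R).
Local Notation fock := (fock a1 a2).
Local Notation V := (fock_space a1 a2).
Implicit Types (f g : V) (phi psi : coord) (c : bool).

Definition co f : coord := coord_of a1 a2 (val (f : fock)).

Definition coord_summable phi :=
  exists M : R, forall n, \sum_(0 <= k < n) slice_nm phi k <= M.

Lemma sum_rc (F : nat -> R) n : \sum_(0 <= k < n) rc (F k) = rc (\sum_(0 <= k < n) F k).
Proof. by rewrite rmorph_sum. Qed.

Lemma square_summableP phi : square_summable (of_coord a1 a2 phi) <-> coord_summable phi.
Proof.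
have E n : \sum_(0 <= k < n) slice_dot (of_coord a1 a2 phi) (of_coord a1 a2 phi) k =
    rc (\sum_(0 <= k < n) slice_nm phi k).
  rewrite -sum_rc; apply: eq_bigr => k _.
  by rewrite slice_dot_coord // coord_dot_nm.
split=> -[M hM]; last by exists (rc M) => n; rewrite E rc_ler.
exists (complex.Re M) => n; have := hM n; rewrite E lecE => /andP[_].
by [].
Qed.

Definition of_co phi : V := insubd (0 : fock) (of_coord a1 a2 phi).

Lemma val_of_co phi : coord_summable phi -> val (of_co phi : fock) = of_coord a1 a2 phi.
Proof.
move=> h; rewrite /of_co val_insubd ifT //; apply/asboolP; split.
  exact/square_summableP.
by move=> k; exact: of_coord_motzkin.
Qed.

Lemma of_coK phi : coord_summable phi -> co (of_co phi) = phi.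
Proof. by move=> h; rewrite /co val_of_co // of_coordK. Qed.

Lemma val_co f : of_coord a1 a2 (co f) = val (f : fock).
Proof. by apply: coord_ofK => //; have /asboolP[] := valP (f : fock). Qed.

Lemma co_inj f g : co f = co g -> f = g.
Proof. by move=> h; apply: val_inj; rewrite -!val_co h. Qed.

Lemma co_summable f : coord_summable (co f).
Proof. by apply/square_summableP; rewrite val_co; exact: fock_summable. Qed.

Lemma co_lin a f g : co (a *: f + g) = fun p q => a * co f p q + co g p q.
Proof.
apply/funext => p; apply/funext => q; rewrite /co /coord_of mulrA -mulrDl.
by rewrite -[val _]/(a *: val (f : fock) + val (g : fock)) tensorE.
Qed.

Lemma ip_co f g : '[f, g] = csum (coord_dot (co f) (co g)).
Proof.
rewrite -[LHS]/(fdot (val (f : fock)) (val (g : fock))) /fdot; congr csum.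
by apply/funext => k; rewrite -!val_co slice_dot_coord.
Qed.

Lemma nm_co f : nm f ^+ 2 = limn (series (slice_nm (co f))).
Proof.
rewrite nm_sqr ip_co /csum /=; congr (limn (series _)).
by apply/funext => k; rewrite coord_dot_nm.
Qed.

Lemma co_series_cvg f : cvgn (series (slice_nm (co f))).
Proof.
apply: nondecreasing_is_cvgn.
  apply/nondecreasing_seqP => n; rewrite !seriesEnat /= big_nat_recr //= lerDl.
  exact: slice_nm_ge0.
have [M hM] := co_summable f; exists M => _ [n _ <-].
by rewrite seriesEnat; exact: hM.
Qed.

Lemma sum_slice_nm f n : \sum_(0 <= k < n) slice_nm (co f) k <= nm f ^+ 2.
Proof.
rewrite nm_co; have := nondecreasing_cvgn_le _ (@co_series_cvg f) n.
rewrite seriesEnat; apply; apply/nondecreasing_seqP => k.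
by rewrite ?seriesEnat /= big_nat_recr //= lerDl slice_nm_ge0.
Qed.

Lemma nm_le_sum f M : (forall n, \sum_(0 <= k < n) slice_nm (co f) k <= M) ->
  nm f ^+ 2 <= M.
Proof.
move=> h; rewrite nm_co; apply: limr_le; first exact: co_series_cvg.
by near=> n; rewrite seriesEnat; exact: h.
Unshelve. all: by end_near.
Qed.

Lemma nm_le_sqr f (M : R) : 0 <= M ->
  (forall n, \sum_(0 <= k < n) slice_nm (co f) k <= M ^+ 2) -> nm f <= M.
Proof. by move=> M0 /nm_le_sum; rewrite ler_pXn2r // nnegrE nm_ge0. Qed.

Lemma co_le_nm f p q : cm (co f p q) <= nm f.
Proof.
rewrite -(ler_pXn2r (n := 2)) ?nnegrE ?nm_ge0 ?cm_ge0 //.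
apply: le_trans (slice_nm_coord _ _ _) _; apply: le_trans (sum_slice_nm f (p + q).+1).
by rewrite big_nat_recr //= lerDr sumr_ge0 // => k _; exact: slice_nm_ge0.
Qed.

Definition co_op (F : coord -> coord) f : V := of_co (F (co f)).

(** What makes [co_op F] a contraction. An operator that lowers the degree needs more
    slices on the right, hence m. *)
Record co_bounded (F : coord -> coord) : Prop := CoBounded {
  co_bounded_lin : forall a phi psi, F (fun p q => a * phi p q + psi p q) =
    fun p q => a * F phi p q + F psi p q ;
  co_bounded_sum : forall phi n, exists m,
    \sum_(0 <= k < n) slice_nm (F phi) k <= \sum_(0 <= k < m) slice_nm phi k }.

Lemma co_bounded_summable F phi : co_bounded F -> coord_summable phi ->
  coord_summable (F phi).
Proof.
move=> [_ h] [M hM]; exists M => n; have [m hm] := h phi n.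
exact: le_trans (hM m).
Qed.

Lemma co_opE F f : co_bounded F -> co (co_op F f) = F (co f).
Proof.
by move=> bF; apply: of_coK; apply: co_bounded_summable => //; exact: co_summable.
Qed.

Lemma co_op_bound F : co_bounded F -> op_bound 1 (co_op F).
Proof.
move=> bF f; rewrite mul1r; apply: nm_le_sqr (nm_ge0 _) _ => n.
rewrite co_opE //; have [m hm] := co_bounded_sum bF (co f) n.
exact: le_trans hm (sum_slice_nm _ _).
Qed.

Lemma co_op_linear F : co_bounded F -> linear (co_op F).
Proof.
move=> bF a f g; apply: co_inj.
by rewrite co_opE // !co_lin !co_opE // (co_bounded_lin bF).
Qed.

Lemma co_op_bounded F : co_bounded F -> bounded_operator (co_op F).
Proof.
move=> bF; apply/bounded_operatorP; split; first exact: co_op_linear.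
by exists 1; [exact: ler01|exact: co_op_bound].
Qed.

Lemma co_bounded_ann c : co_bounded (ann c).
Proof.
split=> [a phi psi|phi n].
  by apply/funext => p; apply/funext => q; rewrite /ann; case: ifP.
exists n.+1; rewrite big_nat_recl //= -[leLHS]add0r lerD ?slice_nm_ge0 //.
by apply: ler_sum => k _; exact: slice_nm_ann.
Qed.

Lemma co_bounded_cre c : co_bounded (cre c).
Proof.
split=> [a phi psi|phi n].
  by apply/funext => p; apply/funext => q; rewrite /cre; case: ifP => _; ring.
exists n; case: n => [|n]; first by rewrite !big_geq.
rewrite big_nat_recl //= slice_nm_cre0 add0r big_nat_recr //= -[leLHS]addr0.
rewrite lerD ?slice_nm_ge0 //; apply: ler_sum => k _; exact: slice_nm_cre.
Qed.

Lemma co_bounded_damp : co_bounded (@damp R).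
Proof.
split=> [a phi psi|phi n].
  by apply/funext => p; apply/funext => q; rewrite /damp; ring.
by exists n; apply: ler_sum => k _; exact: slice_nm_damp.
Qed.

Lemma sum_indicator n m : \sum_(0 <= k < m) (k == n)%:R <= 1 :> R.
Proof.
have -> : \sum_(0 <= k < m) (k == n)%:R = (n < m)%:R :> R.
  elim: m => [|m IH]; first by rewrite big_geq.
  rewrite big_nat_recr //= IH ltnS.
  by case: (ltngtP n m); rewrite ?addr0 ?add0r.
by rewrite lern1 leq_b1.
Qed.

Lemma coord_summable_coherent w1 w2 n : cm w1 ^+ 2 + cm w2 ^+ 2 = 1 ->
  coord_summable (coherent w1 w2 n).
Proof.
move=> w; exists 1 => m; rewrite (eq_bigr _ (fun k _ => slice_nm_coherent n k w)).
exact: sum_indicator.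
Qed.

Definition shift c : V -> V := co_op (cre c).
Definition shift_adj c : V -> V := co_op (ann c).
Definition damping : V -> V := co_op (@damp R).
Definition psi_vec w1 w2 n : V := of_co (coherent w1 w2 n).

Lemma co_shift c f : co (shift c f) = cre c (co f).
Proof. exact/co_opE/co_bounded_cre. Qed.
Lemma co_shift_adj c f : co (shift_adj c f) = ann c (co f).
Proof. exact/co_opE/co_bounded_ann. Qed.
Lemma co_damping f : co (damping f) = damp (co f).
Proof. exact/co_opE/co_bounded_damp. Qed.

Lemma csum_shift (z : nat -> C R) : z 0%N = 0 -> csum z = csum (fun k => z k.+1).
Proof.
move=> z0; have E (u : nat -> R) : u 0%N = 0 ->
    limn (series u) = limn (series (fun k => u k.+1)).
  move=> u0; have -> : series (fun k => u k.+1) = (fun n => series u n.+1).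
    apply/funext => n; rewrite !seriesEnat /= [RHS]big_nat_recl //= u0 add0r.
    by [].
  rewrite /lim; congr xget; apply/seteqP; split=> l /=; by rewrite (cvg_shiftS (series u)).
by rewrite /csum (E (fun k => complex.Re (z k))) ?z0 // (E (fun k => complex.Im (z k))) ?z0.
Qed.

Lemma adjoint_shift c : adjoint (shift c) (shift_adj c).
Proof.
move=> f g; rewrite !ip_co co_shift co_shift_adj csum_shift; last exact: coord_dot_cre0.
by congr csum; apply/funext => k; rewrite coord_dot_cre.
Qed.

Lemma co_D f g : co (f + g) = fun p q => co f p q + co g p q.
Proof.
have := co_lin 1 f g; rewrite scale1r => ->.
by apply/funext => p; apply/funext => q; rewrite mul1r.
Qed.

Lemma co_0 : co 0 = fun _ _ => 0.
Proof.
have := co_lin (-1) 0 0; rewrite scaler0 addr0 => h.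
apply/funext => p; apply/funext => q; have := congr1 (fun F => F p q) h.
by rewrite mulN1r addNr.
Qed.

Lemma co_Z a f : co (a *: f) = fun p q => a * co f p q.
Proof.
have := co_lin a f 0; rewrite addr0 => ->.
by apply/funext => p; apply/funext => q; rewrite co_0 addr0.
Qed.

Lemma co_B f g : co (f - g) = fun p q => co f p q - co g p q.
Proof.
rewrite co_D -scaleN1r co_Z.
by apply/funext => p; apply/funext => q; rewrite mulN1r.
Qed.

Let fun2P phi psi : (forall p q, phi p q = psi p q) -> phi = psi.
Proof. by move=> h; apply/funext => p; apply/funext => q. Qed.

Let natS_neq0 n : n.+1%:R != 0 :> C R.
Proof. by rewrite pnatr_eq0. Qed.

Lemma shift_sum f : shift_adj false (shift false f) + shift_adj true (shift true f) =
  f + damping f.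
Proof.
apply/co_inj/fun2P => p q; rewrite !co_D !co_shift_adj !co_shift !ann_cre co_damping.
rewrite /damp addbF addbT; have h := natS_neq0 (p + q).
have -> : p.+1%:R = (p + q).+1%:R + 1 - q.+1%:R :> C R.
  by rewrite -!(natr1 p, natr1 q, natr1 (p + q)) natrD; ring.
by move: h; set N : C R := (p + q).+1%:R; set M : C R := q.+1%:R => h; case: odd => /=; field.
Qed.

Let frac_diag (N P x : C R) : N != 0 -> N + 1 != 0 ->
  (N - P + 1) / (N + 1) * x + P / N * x = x + (N + 1)^-1 * (P / N * x).
Proof. by move=> h h'; field; rewrite h h'. Qed.

Let frac_cross (N P x : C R) : N != 0 -> N + 1 != 0 ->
  P / N * x - P / (N + 1) * x = (N + 1)^-1 * (P / N * x).
Proof. by move=> h h'; field; rewrite h h'. Qed.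

Lemma shift_diag c f : shift_adj c (shift c f) + shift c (shift_adj c f) =
  f + damping (shift c (shift_adj c f)).
Proof.
apply/co_inj/fun2P => p q; rewrite !co_D co_damping co_shift_adj !co_shift co_shift_adj.
rewrite /damp ann_cre cre_ann; have h := natS_neq0 (p + q).
have [pq|pq] := eqVneq (p + q)%N 0%N.
  move/eqP: pq; rewrite addn_eq0 => /andP[/eqP -> /eqP ->].
  by rewrite !if_same !mul0r mulr0 !addr0 divff ?mul1r // pnatr_eq0.
have h' : (p + q)%:R != 0 :> C R by rewrite pnatr_eq0.
rewrite -natr1 in h *; case: ifP => _; rewrite -frac_diag //; congr (_ / _ * _ + _).
  by rewrite -natr1 natrD; ring.
by rewrite -natr1 natrD; ring.
Qed.

Lemma shift_cross c f : shift (~~ c) (shift_adj c f) - shift_adj (~~ c) (shift c f) =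
  damping (shift (~~ c) (shift_adj c f)).
Proof.
apply/co_inj/fun2P => p q; rewrite co_B co_damping co_shift_adj !co_shift co_shift_adj.
rewrite /damp ann_neg_cre cre_ann_neg; have h := natS_neq0 (p + q).
have [pq|pq] := eqVneq (p + q)%N 0%N.
  move/eqP: pq; rewrite addn_eq0 => /andP[/eqP -> /eqP ->].
  by case: ifP => _; rewrite !mul0r subrr mulr0.
have h' : (p + q)%:R != 0 :> C R by rewrite pnatr_eq0.
by rewrite -natr1 in h *; case: ifP => _; rewrite frac_cross.
Qed.

Lemma shift_sqr f : shift_adj false (shift_adj false f) =
  shift_adj true (shift_adj true f).
Proof. by apply: co_inj; rewrite !co_shift_adj ann_ann. Qed.

Lemma co_psi_vec w1 w2 n : cm w1 ^+ 2 + cm w2 ^+ 2 = 1 ->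
  co (psi_vec w1 w2 n) = coherent w1 w2 n.
Proof. by move=> w; apply/of_coK/coord_summable_coherent. Qed.

Lemma psi_vec_ip w1 w2 n m : cm w1 ^+ 2 + cm w2 ^+ 2 = 1 ->
  '[psi_vec w1 w2 n, psi_vec w1 w2 m] = (n == m)%:R.
Proof.
move=> w; have [<-|nm] := eqVneq n m; last first.
  rewrite ip_co !co_psi_vec // (_ : coord_dot _ _ = fun=> 0).
    rewrite /csum /= (_ : series (fun=> 0) = fun=> 0 :> R) ?lim_cst //.
    by apply/funext => k; rewrite seriesEnat /= big1.
  apply/funext => k; rewrite /coord_dot big1 // => p _; rewrite /coherent.
  case: eqP => [->|_]; last by rewrite mul0r mulr0.
  by rewrite (negPf nm) conjC0 !mulr0.
rewrite ipE; suff -> : nm (psi_vec w1 w2 n) ^+ 2 = 1 by rewrite rmorph1.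
apply/eqP; rewrite eq_le; apply/andP; split.
  apply: nm_le_sum => j; rewrite co_psi_vec //.
  rewrite (eq_bigr _ (fun k _ => slice_nm_coherent n k w)); exact: sum_indicator.
apply: le_trans (sum_slice_nm _ n.+1); rewrite co_psi_vec // big_nat_recr //=.
rewrite slice_nm_coherent // eqxx lerDr sumr_ge0 // => k _.
exact: slice_nm_ge0.
Qed.

Lemma psi_vec_ann c w1 w2 n : cm w1 ^+ 2 + cm w2 ^+ 2 = 1 ->
  shift_adj c (psi_vec w1 w2 n.+1) = (if odd n (+) c then w2 else w1) *: psi_vec w1 w2 n.
Proof.
by move=> w; apply: co_inj; rewrite co_shift_adj co_Z !co_psi_vec // ann_coherent.
Qed.

Lemma psi_vec_damping w1 w2 n : cm w1 ^+ 2 + cm w2 ^+ 2 = 1 ->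
  damping (psi_vec w1 w2 n) = rc n.+1%:R^-1 *: psi_vec w1 w2 n.
Proof.
move=> w; apply/co_inj/fun2P => p q; rewrite co_damping co_Z co_psi_vec //.
rewrite dampE /coherent; case: eqP => [->//|_]; by rewrite !mulr0.
Qed.

End FockSpace.

Section FockTopology.
Context {R : realType} (a1 a2 : C R).
Hypotheses (ha1 : `|a1| = (sqrtC 3%:R)^-1) (ha2 : `|a2| = (sqrtC 3%:R)^-1).
Local Notation coord := (nat -> nat -> C R).
Local Notation V := (fock_space a1 a2).
Implicit Types (f g : V) (phi psi : coord) (c : bool).

Definition null_seq (v : nat -> R) :=
  forall e : R, 0 < e -> exists N, forall n, (N <= n)%N -> v n <= e.

Lemma null_seq_lin a v v' : 0 <= a -> null_seq v -> null_seq v' ->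
  null_seq (fun n => a * v n + v' n).
Proof.
move=> a0 hv hv' e e0; have a1' : 0 < a + 1 by rewrite ltr_wpDl.
have e2 : 0 < e / 2 by rewrite divr_gt0.
have [N hN] := hv _ (divr_gt0 e2 a1'); have [N' hN'] := hv' _ e2.
exists (maxn N N') => n; rewrite geq_max => /andP[n1 n2].
rewrite [leRHS]splitr lerD ?hN' //; apply: le_trans (_ : a * (e / 2 / (a + 1)) <= _).
  by rewrite ler_wpM2l // hN.
by rewrite mulrCA ler_piMr ?(ltW e2) // ler_pdivrMr // mul1r lerDl.
Qed.

Lemma null_seq_sum (I : Type) (r : seq I) (a : I -> R) (v : I -> nat -> R) :
  (forall i, 0 <= a i) -> (forall i, null_seq (v i)) ->
  null_seq (fun n => \sum_(i <- r) a i * v i n).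
Proof.
move=> ha hv; elim: r => [|i r IH].
  by move=> e e0; exists 0%N => n _; rewrite big_nil ltW.
move=> e e0; have [N hN] := null_seq_lin (ha i) (hv i) IH e0.
by exists N => n /hN; rewrite big_cons.
Qed.

(** The coordinates converge one by one, and Cauchy estimates pass to the limit on
    finitely many degrees at a time. *)
Lemma fock_complete : complete_ipspace V.
Proof.
move=> u hu.
have {}hu : forall e : R, 0 < e -> exists N, forall m n, (N <= m)%N -> (N <= n)%N ->
    nm (u m - u n) < e.
  move=> e e0; have e2 : 0 < rc (e ^+ 2) by rewrite -(rmorph0 rc) rc_ltr exprn_gt0.
  have [N hN] := hu _ e2; exists N => m n Nm Nn.
  by rewrite -ip_lt_nm ?ltW // hN.
have /choice[phi hphi] : forall p, exists x : nat -> C R, forall q (e : R), 0 < e ->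
    exists N, forall n, (N <= n)%N -> cm (co (u n) p q - x q) < e.
  move=> p; suff /choice[x hx] : forall q, exists x, forall e : R, 0 < e ->
      exists N, forall n, (N <= n)%N -> cm (co (u n) p q - x) < e by exists x.
  move=> q; apply: complexC_complete => e /hu[N hN]; exists N => m n Nm Nn.
  apply: le_lt_trans (hN _ _ Nm Nn).
  by have := co_le_nm ha1 ha2 (u m - u n) p q; rewrite co_B.
have nphi n : null_seq (fun l => \sum_(0 <= k < n)
    slice_nm (fun p q => co (u l) p q - phi p q) k).
  suff : null_seq (fun l => \sum_(0 <= k < n)
      1 * slice_nm (fun p q => co (u l) p q - phi p q) k).
    move=> h e /h[N hN]; exists N => l /hN; congr (_ <= _).
    by apply: eq_bigr => k _; rewrite mul1r.
  apply: (@null_seq_sum _ _ (fun=> 1)) => // k.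
  apply: (@null_seq_sum _ _ (fun p : 'I_k.+1 => 'C(k, p)%:R)) => // p e e0.
  have se : 0 < Num.sqrt e by rewrite sqrtr_gt0.
  have [N hN] := hphi p (k - p)%N _ se; exists N => l /hN h.
  by rewrite -[leRHS]sqr_sqrtr ?(ltW e0) // ler_pXn2r ?nnegrE ?cm_ge0 ?ltW.
have bound n l e : 0 < e -> (forall m, (l <= m)%N -> nm (u l - u m) <= e) ->
    \sum_(0 <= k < n) slice_nm (fun p q => co (u l) p q - phi p q) k <= 2 * e ^+ 2.
  move=> e0 hl; apply/ler_addgt0Pr => d d0.
  have d2 : 0 < d / 2 by rewrite divr_gt0.
  have [N hN] := nphi n _ d2; pose m := maxn N l.
  apply: le_trans (_ : 2 * nm (u l - u m) ^+ 2 +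
     2 * \sum_(0 <= k < n) slice_nm (fun p q => co (u m) p q - phi p q) k <= _).
    apply: le_trans (lerD (ler_wpM2l _ (sum_slice_nm ha1 ha2 (u l - u m) n)) (lexx _)) => //.
    rewrite !mulr_sumr -big_split; apply: ler_sum => k _ /=.
    rewrite (_ : (fun p q => co (u l) p q - phi p q) =
      fun p q => co (u l - u m) p q - (phi p q - co (u m) p q)); last first.
      by apply/funext => p; apply/funext => q; rewrite co_B; ring.
    apply: le_trans (slice_nmB _ _ _) _; rewrite lerD2l ler_wpM2l //.
    by apply: ler_sum => p _; rewrite cmB.
  apply: lerD; last first.
    have -> : d = 2 * (d / 2) by field.
    by rewrite ler_wpM2l // hN // leq_maxl.
  rewrite ler_wpM2l // ler_pXn2r ?nnegrE ?nm_ge0 ?(ltW e0) //.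
  by apply: hl; exact: leq_maxr.
have sphi : coord_summable phi.
  have [N hN] := hu _ (ltr01 : 0 < 1 :> R).
  exists (2 * nm (u N) ^+ 2 + 2 * (2 * 1 ^+ 2)) => n.
  apply: le_trans (_ : 2 * \sum_(0 <= k < n) slice_nm (co (u N)) k +
    2 * \sum_(0 <= k < n) slice_nm (fun p q => co (u N) p q - phi p q) k <= _).
    rewrite !mulr_sumr -big_split; apply: ler_sum => k _ /=.
    rewrite {1}(_ : phi = fun p q => co (u N) p q - (co (u N) p q - phi p q)).
      exact: slice_nmB.
    by apply/funext => p; apply/funext => q; rewrite subKr.
  apply: lerD; rewrite ler_wpM2l //; first exact: sum_slice_nm.
  by apply: bound => // m Nm; rewrite ltW // hN.
exists (of_co a1 a2 phi) => _ /gt0_rc_sqr[e e0 ->].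
have e2 : 0 < e / 2 by rewrite divr_gt0.
have [N hN] := hu _ e2; exists N => n Nn; rewrite ip_lt_nm ?(ltW e0) //.
rewrite -(ltr_pXn2r (n := 2)) ?nnegrE ?nm_ge0 ?(ltW e0) //.
apply: le_lt_trans (_ : 2 * (e / 2) ^+ 2 < _).
  apply: nm_le_sum => // k; rewrite co_B of_coK //; apply: bound => // m nm'.
  by rewrite ltW // hN // (leq_trans Nn).
by have : 0 < e ^+ 2; [rewrite exprn_gt0|lra].
Qed.

Lemma coord_summable_finite phi N : (forall p q, (N <= p + q)%N -> phi p q = 0) ->
  coord_summable phi.
Proof.
move=> h; exists (\sum_(0 <= k < N) slice_nm phi k) => n.
apply: le_trans (_ : \sum_(0 <= k < n + N) slice_nm phi k <= _).
  rewrite [leRHS](big_cat_nat _ (n := n)) ?leq_addr //= lerDl.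
  by apply: sumr_ge0 => k _; exact: slice_nm_ge0.
rewrite [leLHS](big_cat_nat _ (n := N)) ?leq_addl //= gerDl big_nat.
apply: sumr_le0 => k /andP[Nk _]; rewrite /slice_nm big1 // => p _.
by rewrite h ?cm0 ?expr0n ?mulr0 // subnKC // -ltnS.
Qed.

Definition unit_coord (p q : nat) : coord :=
  fun p' q' => ((p' == p) && (q' == q))%:R.

Lemma co_unit p q : co (of_co a1 a2 (unit_coord p q)) = unit_coord p q.
Proof.
apply: of_coK => //; apply: (@coord_summable_finite _ (p + q).+1) => p' q'.
by rewrite /unit_coord; case: eqP => // ->; case: eqP => // ->; rewrite ltnn.
Qed.

Lemma compact_sum (I : Type) (r : seq I) (T : I -> V -> V) :
  (forall i, compact_operator (T i)) -> compact_operator (fun x => \sum_(i <- r) T i x).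
Proof.
move=> h; elim: r => [|i r IH].
  by have := @compact0 R V; congr compact_operator; apply/funext => x; rewrite big_nil.
have := compact_lin 1 (h i) IH; congr compact_operator.
by apply/funext => x; rewrite big_cons scale1r.
Qed.

Lemma co_sum (I : Type) (r : seq I) (F : I -> V) p q :
  co (\sum_(i <- r) F i) p q = \sum_(i <- r) co (F i) p q.
Proof.
elim: r => [|i r IH]; first by rewrite !big_nil co_0.
by rewrite !big_cons co_D IH.
Qed.

(** Truncations in the degree have finite rank, and the factor 1/(n + 1) makes the
    rest small. *)
Lemma compact_damping : compact_operator (@damping R a1 a2).
Proof.
have bD := @co_bounded_damp R.
apply: compact_lim; first by apply: co_op_bounded.
move=> e e0; have [N hN] := small_inv e0.
pose T (pq : nat * nat) f := ((pq.1 + pq.2).+1%:R^-1 * co f pq.1 pq.2) *: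
  of_co a1 a2 (unit_coord pq.1 pq.2).
pose r := [seq (p, q) | p <- iota 0 N, q <- iota 0 N].
exists (fun f => \sum_(pq <- r) T pq f).
  apply: compact_sum => -[p q]; apply: (@compact_rank1 _ _ (fun f => (p + q).+1%:R^-1 * co f p q) _ 1) => /= [a f g|f].
    by rewrite co_lin mulrDr mulrCA.
  rewrite cmM cmV (_ : _%:R = rc (p + q).+1%:R); last by rewrite rmorph_nat.
  rewrite cm_rc ger0_norm // mul1r; apply: le_trans (co_le_nm ha1 ha2 f p q).
  by rewrite ler_piMl ?cm_ge0 // invf_le1 ?ltr0Sn // ler1n.
move=> f; pose b p q := (if (p < N)%N && (q < N)%N then 0 else (p + q).+1%:R^-1) : R.
have E : co (damping f - \sum_(pq <- r) T pq f) = fun p q => rc (b p q) * co f p q.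
  rewrite co_B co_damping //; apply/funext => p; apply/funext => q.
  rewrite co_sum dampE /b; have [pq|pq] := boolP ((p < N)%N && (q < N)%N).
    have rpq : (p, q) \in r.
      have /andP[pN qN] := pq; apply/allpairsP; exists (p, q).
      by rewrite /= !mem_iota !add0n pN qN.
    rewrite (bigD1_seq (p, q)) //=; last first.
      by apply: allpairs_uniq; rewrite ?iota_uniq // => -[? ?] [? ?] _ _ /=.
    rewrite /T co_Z co_unit /unit_coord !eqxx mulr1 big1 ?addr0.
      by rewrite fmorphV rmorph_nat subrr rmorph0 mul0r.
    move=> [p' q'] /=; rewrite xpair_eqE negb_and => h.
    rewrite co_Z co_unit /unit_coord (eq_sym p) (eq_sym q).
    by case/orP: h => /negPf ->; rewrite ?andbF mulr0.
  rewrite big1_seq ?subr0 // => -[p' q'] /= /allpairsP[[x y] [/= xN yN [-> ->]]].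
  rewrite /T co_Z co_unit /unit_coord; case: eqP => [px|]; last by rewrite mulr0.
  case: eqP => [qy|]; last by rewrite mulr0.
  by move: pq xN yN; rewrite px qy !mem_iota !add0n /= => + xN yN; rewrite xN yN.
apply: nm_le_sqr => //; first by rewrite mulr_ge0 ?nm_ge0 ?ltW.
move=> n; rewrite E.
apply: le_trans (_ : e ^+ 2 * \sum_(0 <= k < n) slice_nm (co f) k <= _); last first.
  by rewrite exprMn ler_wpM2l ?sqr_ge0 // sum_slice_nm.
rewrite mulr_sumr; apply: ler_sum => k _; rewrite /slice_nm mulr_sumr.
apply: ler_sum => p _; rewrite [leRHS]mulrCA ler_wpM2l ?ler0n // cmM exprMn cm_rc ler_wpM2r ?sqr_ge0 //.
have pk : (p <= k)%N by rewrite -ltnS.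
rewrite ler_pXn2r ?nnegrE ?(ltW e0) // /b; case: ifP => [_|h].
  by rewrite normr0 ltW.
rewrite ger0_norm // subnKC // ltW // hN //; move/negbT: h; rewrite negb_and -!leqNgt.
by case/orP => h; apply: leq_trans h _; rewrite ?leq_subr.
Qed.

(** ** The generators *)
Lemma ann_second g a k (w : k.-tuple 'I_3) :
  of_coord a1 a2 (co g) (a :: w) =
  twist a1 a2 a * of_coord a1 a2 (ann (second a) (co g)) w.
Proof.
rewrite /of_coord twist_word_cons -mulrA; congr (_ * (_ * _)).
rewrite /ann /= subnKC ?tcount_le //.
case: (second a); case: (odd (size w)); rewrite /= ?add0n ?add1n ?subSS ?subSn ?tcount_le //.
Qed.

Lemma coord_dot_lin a b phi phi' psi k :
  coord_dot (fun p q => a * phi p q + b * phi' p q) psi k =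
  a * coord_dot phi psi k + b * coord_dot phi' psi k.
Proof.
rewrite /coord_dot !mulr_sumr -big_split; apply: eq_bigr => p _ /=.
by ring.
Qed.

Lemma fdot_tensor_vec (x : seq 'I_3 -> (C R)^o) (y : bool -> C R) f g :
  (forall a, x [:: a] = twist a1 a2 a * y (second a)) ->
  fdot (tensor_vec x (val (f : fock a1 a2))) (val (g : fock a1 a2)) =
  '[y false *: shift false f + y true *: shift true f, g].
Proof.
move=> hx; rewrite ip_co // co_D !co_Z !co_shift // /fdot.
rewrite csum_shift; last first.
  rewrite /slice_dot big1 // => w _; rewrite (tuple0 w) /= mul0r //.
rewrite [RHS]csum_shift; last by rewrite coord_dot_lin !coord_dot_cre0 !mulr0 addr0.
congr csum; apply/funext => k; rewrite coord_dot_lin !coord_dot_cre.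
rewrite -!(slice_dot_coord ha1 ha2) /slice_dot.
rewrite (sum_tuple_cons _ (fun w => tensor_vec x (val (f : fock a1 a2)) w *
  (val (g : fock a1 a2) w)^*)).
have E a : \sum_(w : k.-tuple 'I_3) tensor_vec x (val (f : fock a1 a2)) (a :: w) *
    (val (g : fock a1 a2) (a :: w))^* = twist a1 a2 a * (twist a1 a2 a)^* * y (second a) *
    \sum_(w : k.-tuple 'I_3) of_coord a1 a2 (co f) w *
      (of_coord a1 a2 (ann (second a) (co g)) w)^*.
  rewrite mulr_sumr; apply: eq_bigr => w _.
  rewrite /tensor_vec hx -!(val_co ha1 ha2) ann_second rmorphM /=.
  by ring.
rewrite sum3 !E !secondE; have [g1 g2] := twist_norm ha1 ha2.
set A := \sum_(w : k.-tuple 'I_3) _ * (of_coord a1 a2 (ann false _) w)^*.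
set B := \sum_(w : k.-tuple 'I_3) _ * (of_coord a1 a2 (ann true _) w)^*.
rewrite -[y false * A]mul1r -[y true * B]mul1r -{1}g2 -g1; ring.
Qed.

Lemma motzkin1 (x : seq 'I_3 -> (C R)^o) : motzkin a1 a2 1 x <->
  degree 1 x /\ exists y : bool -> C R, forall a, x [:: a] = twist a1 a2 a * y (second a).
Proof.
split=> [/(motzkinP ha1 ha2)[dx kx]|[dx [y hy]]].
  split=> //; have [c hc] := letter_rel_class ha1 ha2 (iffLR (letter_relP a2 ha1 dx) kx).
  exists (fun b => c (~~ b : nat)) => a; rewrite hc //= twist_word_cons /twist_word big_nil mulr1.
  by rewrite addbF addn0.
apply/(motzkinP ha1 ha2); split=> //; apply/(letter_relP a2 ha1) => //.
apply: (@class_letter_rel _ _ _ ha2 _ _ (fun p => y (p == 0%N))) => -[//|a [|//]] _.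
rewrite hy twist_word_cons /twist_word big_nil mulr1 /= addbF addn0.
by case: second.
Qed.

Lemma creationP x (y : bool -> C R) (T : V -> V) :
  (forall a, x [:: a] = twist a1 a2 a * y (second a)) ->
  creation x T <-> T = fun f => y false *: shift false f + y true *: shift true f.
Proof.
move=> hx; split=> [h|-> f g]; last by rewrite (fdot_tensor_vec _ _ hx).
apply/funext => f; apply: ip_inj => g; rewrite -(fdot_tensor_vec _ _ hx).
exact: h.
Qed.

Lemma creations_span T : creations a1 a2 T <->
  exists al be, T = fun f => al *: shift false f + be *: shift true f.
Proof.
split=> [[x /motzkin1[dx [y hy]] /(creationP _ hy) ->]|[al [be ->]]].
  by exists (y false), (y true).
pose y b : C R := if b then be else al.
pose x : seq 'I_3 -> (C R)^o := fun w =>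
  if w is [:: a] then twist a1 a2 a * y (second a) else 0.
exists x; last exact/(creationP (y := y)).
by apply/motzkin1; split=> [[|a [|b w]]|] //; exists y.
Qed.

End FockTopology.

(** * The facts about the Fock space that determine the quotient *)
(** [S false] and [S true] span the generators, [S'] gives their adjoints, [E] is the
    compact defect of the relations, and [psi w1 w2 n] are the coherent vectors. *)
Record shift_model {R : realType} (V : ipspace R) (G : set (V -> V))
    (S S' : bool -> V -> V) (E : V -> V) (psi : C R -> C R -> nat -> V) : Prop :=
  ShiftModel {
  sm_complete : complete_ipspace V ;
  sm_span : forall T, G T <-> exists al be, T = fun x => al *: S false x + be *: S true x ;
  sm_bounded : forall c, bounded_operator (S c) ;
  sm_adjoint : forall c, adjoint (S c) (S' c) ;
  sm_compact : compact_operator E ;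
  sm_sum : forall x, S' false (S false x) + S' true (S true x) = x + E x ;
  sm_diag : forall c x, S' c (S c x) + S c (S' c x) = x + E (S c (S' c x)) ;
  sm_cross : forall c x, S (~~ c) (S' c x) - S' (~~ c) (S c x) = E (S (~~ c) (S' c x)) ;
  sm_sqr : forall x, S' false (S' false x) = S' true (S' true x) ;
  sm_psi_ip : forall w1 w2 n m, cm w1 ^+ 2 + cm w2 ^+ 2 = 1 ->
    '[psi w1 w2 n, psi w1 w2 m] = (n == m)%:R ;
  sm_psi_adjoint : forall c w1 w2 n, cm w1 ^+ 2 + cm w2 ^+ 2 = 1 ->
    S' c (psi w1 w2 n.+1) = (if odd n (+) c then w2 else w1) *: psi w1 w2 n ;
  sm_psi_E : forall w1 w2 n, cm w1 ^+ 2 + cm w2 ^+ 2 = 1 ->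
    E (psi w1 w2 n) = rc n.+1%:R^-1 *: psi w1 w2 n }.

Lemma fock_shift_model (R : realType) (a1 a2 : C R)
    (ha1 : `|a1| = (sqrtC 3%:R)^-1) (ha2 : `|a2| = (sqrtC 3%:R)^-1) :
  shift_model (creations a1 a2) (@shift R a1 a2) (@shift_adj R a1 a2)
    (@damping R a1 a2) (@psi_vec R a1 a2).
Proof.
split.
- exact: fock_complete.
- by move=> T; exact: creations_span.
- by move=> c; apply: co_op_bounded => //; exact: co_bounded_cre.
- by move=> c; exact: adjoint_shift.
- exact: compact_damping.
- by move=> x; exact: shift_sum.
- by move=> c x; exact: shift_diag.
- by move=> c x; exact: shift_cross.
- by move=> x; exact: shift_sqr.
- by move=> *; exact: psi_vec_ip.
- by move=> *; exact: psi_vec_ann.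
- by move=> *; exact: psi_vec_damping.
Qed.

(** * Irreducible representations *)
Section ShiftAlgebra.
Context {R : realType} {V : ipspace R} (G : set (V -> V)).
Context (S S' : bool -> V -> V) (E : V -> V) (psi : C R -> C R -> nat -> V).
Hypothesis M : shift_model G S S' E psi.
Local Notation gen := (cstar_gen G).

Lemma sm_G_bounded : G `<=` @bounded_operator R V.
Proof.
move=> T /(sm_span M)[al [be ->]]; apply: bounded_lin; first exact: (sm_bounded M).
apply: op_closedZ; last exact: (sm_bounded M).
exact/op_closed_cstar/cstar_subalgebra_bounded.
Qed.

Lemma sm_span_adjoint al be : adjoint (fun x => al *: S false x + be *: S true x)
  (fun x => al^* *: S' false x + be^* *: S' true x).
Proof.
apply: adjoint_lin; first exact: (sm_adjoint M).
by move=> x y; rewrite ipZl ipZr conjCK (sm_adjoint M).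
Qed.

Lemma sm_G_adjoint T : G T -> exists T', adjoint T T'.
Proof. by move=> /(sm_span M)[al [be ->]]; eexists; exact: sm_span_adjoint. Qed.

Lemma sm_G c : G (S c).
Proof.
apply/(sm_span M); case: c; [exists 0, 1|exists 1, 0]; apply/funext => x;
  by rewrite scale0r scale1r ?add0r ?addr0.
Qed.

Lemma sm_gen_S c : gen (S c).
Proof. by apply: gen_sub; exact: sm_G. Qed.

Lemma sm_gen_S' c : gen (S' c).
Proof. exact (@gen_adjoint _ _ _ (@sm_G_bounded) _ _ (@sm_gen_S c) (sm_adjoint M c)). Qed.

Let cV := sm_complete M.
Let oc := gen_closed (@sm_G_bounded).

Context {K : ipspace R} (pi : set (V -> V) -> K -> K).
Hypothesis hpi : representation G pi.
Local Notation rho T := (pi (ccoset G T)).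
Local Notation A c := (rho (S c)).
Local Notation A' c := (rho (S' c)).

Lemma rho_adjS c : adjoint (A c) (A' c).
Proof. by apply: (rho_adjoint hpi); [exact: sm_gen_S|exact: (sm_adjoint M)]. Qed.

Lemma A_linear c : linear (A c).
Proof. by apply: (rho_linear hpi); exact: sm_gen_S. Qed.
Lemma A'_linear c : linear (A' c).
Proof. by apply: (rho_linear hpi); exact: sm_gen_S'. Qed.

(** A representation of the quotient does not see compact defects: the relations of
    [shift_model] become exact. *)
Lemma rho_compact_eq T U x : gen T -> gen U ->
  compact_operator (fun y => T y - U y) -> rho T x = rho U x.
Proof. by move=> gT gU cTU; rewrite (ccosetP gT gU cTU). Qed.

Let gcomp T U : gen T -> gen U -> gen (T \o U).
Proof. exact: cstar_gen_comp. Qed.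
Let gadd T U : gen T -> gen U -> gen (fun x => T x + U x).
Proof. exact: op_closedD oc. Qed.

Let rcomp T U x : gen T -> gen U -> rho (T \o U) x = rho T (rho U x).
Proof. by move=> gT gU; exact: (rho_comp hpi x gT gU). Qed.

Lemma rel_sum x : A' false (A false x) + A' true (A true x) = x.
Proof.
have g1 : gen (S' false \o S false) := @gcomp _ _ (@sm_gen_S' false) (@sm_gen_S false).
have g2 : gen (S' true \o S true) := @gcomp _ _ (@sm_gen_S' true) (@sm_gen_S true).
rewrite -!rcomp; try exact: sm_gen_S; try exact: sm_gen_S'.
rewrite -(rhoD hpi _ g1 g2) -[RHS](rho_id hpi); apply: rho_compact_eq.
- exact: gadd.
- exact: cstar_gen_id.
- have := sm_compact M; congr compact_operator; apply/funext => y.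
  by rewrite /= (sm_sum M) addrC addKr.
Qed.

Lemma rel_diag c x : A' c (A c x) + A c (A' c x) = x.
Proof.
have g1 : gen (S' c \o S c) := @gcomp _ _ (@sm_gen_S' c) (@sm_gen_S c).
have g2 : gen (S c \o S' c) := @gcomp _ _ (@sm_gen_S c) (@sm_gen_S' c).
rewrite -!rcomp; try exact: sm_gen_S; try exact: sm_gen_S'.
rewrite -(rhoD hpi _ g1 g2) -[RHS](rho_id hpi); apply: rho_compact_eq.
- exact: gadd.
- exact: cstar_gen_id.
- have := compact_comp (sm_compact M) (gen_bounded (@sm_G_bounded) g2).
  congr compact_operator; apply/funext => y.
  by rewrite /= (sm_diag M) addrC addKr.
Qed.

Lemma rel_cross c x : A (~~ c) (A' c x) = A' (~~ c) (A c x).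
Proof.
have g1 : gen (S (~~ c) \o S' c) := @gcomp _ _ (@sm_gen_S (~~ c)) (@sm_gen_S' c).
have g2 : gen (S' (~~ c) \o S c) := @gcomp _ _ (@sm_gen_S' (~~ c)) (@sm_gen_S c).
rewrite -!rcomp; try exact: sm_gen_S; try exact: sm_gen_S'.
apply: rho_compact_eq => //.
have := compact_comp (sm_compact M) (gen_bounded (@sm_G_bounded) g1).
congr compact_operator; apply/funext => y.
by rewrite /= (sm_cross M).
Qed.

Lemma rel_sqr' x : A' false (A' false x) = A' true (A' true x).
Proof.
rewrite -!rcomp; try exact: sm_gen_S'.
by congr (pi (ccoset G _) x); apply/funext => y; exact: (sm_sqr M).
Qed.

Lemma rel_sqr x : A false (A false x) = A true (A true x).
Proof.
apply: ip_inj => y; rewrite !rho_adjS; exact: congr1 (rel_sqr' y).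
Qed.

(** The sum X and the difference Y of the two generators anticommute, with each
    other and with each other's adjoint, and are normal. *)
Definition repX x := A false x + A true x.
Definition repY x := A false x - A true x.
Definition repX' x := A' false x + A' true x.
Definition repY' x := A' false x - A' true x.
Local Notation X := repX.
Local Notation Y := repY.
Local Notation X' := repX'.
Local Notation Y' := repY'.

Lemma rho_SE c x : A c x = rc 2^-1 *: (X x + (-1) ^+ c *: Y x).
Proof.
have h : rc 2^-1 + rc 2^-1 = 1 :> C R.
  by rewrite -rmorphD -(rmorph1 rc); congr rc; field.
apply: ip_inj => z; transitivity ((rc 2^-1 + rc 2^-1) * '[A c x, z]).
  by rewrite h mul1r.
by rewrite /repX /repY; case: c => /=; rewrite ?expr1 ?expr0 !(ipZl, ipDl, ipNl); ring.
Qed.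

Lemma rho_S'E c x : A' c x = rc 2^-1 *: (X' x + (-1) ^+ c *: Y' x).
Proof.
have h : rc 2^-1 + rc 2^-1 = 1 :> C R.
  by rewrite -rmorphD -(rmorph1 rc); congr rc; field.
apply: ip_inj => z; transitivity ((rc 2^-1 + rc 2^-1) * '[A' c x, z]).
  by rewrite h mul1r.
by rewrite /repX' /repY'; case: c => /=; rewrite ?expr1 ?expr0 !(ipZl, ipDl, ipNl); ring.
Qed.

Lemma X_linear : linear X.
Proof. by move=> a x y; rewrite /repX !A_linear; vring. Qed.
Lemma Y_linear : linear Y.
Proof. by move=> a x y; rewrite /repY !A_linear; vring. Qed.
Lemma X'_linear : linear X'.
Proof. by move=> a x y; rewrite /repX' !A'_linear; vring. Qed.
Lemma Y'_linear : linear Y'.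
Proof. by move=> a x y; rewrite /repY' !A'_linear; vring. Qed.

Lemma X_adjoint : adjoint X X'.
Proof. by move=> x y; rewrite ipDl ipDr !rho_adjS. Qed.
Lemma Y_adjoint : adjoint Y Y'.
Proof. by move=> x y; rewrite ipBl ipBr !rho_adjS. Qed.

Let expand := ((linD (A_linear false)), (linD (A_linear true)), (linN (A_linear false)),
  (linN (A_linear true)), (linD (A'_linear false)), (linD (A'_linear true)),
  (linN (A'_linear false)), (linN (A'_linear true))).

Lemma XY x : X (Y x) = - Y (X x).
Proof. by rewrite /repX /repY !expand rel_sqr; vring. Qed.

Let AA' c x : A c (A' c x) = x - A' c (A c x).
Proof. by rewrite -{2}(rel_diag c x); vring. Qed.

Lemma XY' x : X (Y' x) = - Y' (X x).
Proof.
rewrite /repX /repY' !expand !AA' (rel_cross false) (rel_cross true); vring.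
Qed.

Lemma X'Y x : X' (Y x) = - Y (X' x).
Proof.
rewrite /repX' /repY !expand !AA' (rel_cross false) (rel_cross true); vring.
Qed.

Lemma X'Y' x : X' (Y' x) = - Y' (X' x).
Proof. by rewrite /repX' /repY' !expand rel_sqr'; vring. Qed.

Lemma X'XY'Y x : X' (X x) + Y' (Y x) = x + x.
Proof.
transitivity ((A' false (A false x) + A' true (A true x)) +
  (A' false (A false x) + A' true (A true x))); last by rewrite rel_sum.
rewrite /repX /repY /repX' /repY' !expand; vring.
Qed.

Lemma X_normal x : X (X' x) = X' (X x).
Proof.
pose D := x - (A' false (A false x) + A' true (A true x)).
have D0 : D = 0 by rewrite /D rel_sum subrr.
transitivity (X' (X x) + (D + D)); last by rewrite D0 !addr0.
rewrite /repX /repX' !expand !AA' (rel_cross false) (rel_cross true) /D; vring.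
Qed.

Lemma Y_normal x : Y (Y' x) = Y' (Y x).
Proof.
pose D := x - (A' false (A false x) + A' true (A true x)).
have D0 : D = 0 by rewrite /D rel_sum subrr.
transitivity (Y' (Y x) + (D + D)); last by rewrite D0 !addr0.
rewrite /repY /repY' !expand !AA' (rel_cross false) (rel_cross true) /D; vring.
Qed.

(** The images of the generators are combinations of X and Y ([rho_SE]). *)
Lemma commute_XY (H : K -> K) : bounded_operator H ->
  (forall x, H (X x) = X (H x)) -> (forall x, H (Y x) = Y (H x)) ->
  (forall x, H (X' x) = X' (H x)) -> (forall x, H (Y' x) = Y' (H x)) ->
  forall T, gen T -> forall x, H (rho T x) = rho T (H x).
Proof.
move=> bH hX hY hX' hY'; have lH := bH.1.
have hA c x : H (A c x) = A c (H x) by rewrite !rho_SE (linZ lH) (linD lH) (linZ lH) hX hY.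
have hA' c x : H (A' c x) = A' c (H x).
  by rewrite !rho_S'E (linZ lH) (linD lH) (linZ lH) hX' hY'.
apply: (commute_gen cV (@sm_G_bounded) (@sm_G_adjoint) hpi bH) => T /(sm_span M)[al [be ->]].
have gz c a : gen (fun y => a *: S c y) by apply: op_closedZ oc (@sm_gen_S c).
have gz' c a : gen (fun y => a *: S' c y) by apply: op_closedZ oc (@sm_gen_S' c).
split=> [x|T' /(adjoint_uniq (sm_span_adjoint al be)) <- x].
  rewrite !(rho_lin hpi _ _ (@sm_gen_S false) (gz true be)).
  rewrite !(rhoZ (@sm_G_bounded) hpi _ _ (@sm_gen_S true)).
  by rewrite (linD lH) !(linZ lH) !hA.
rewrite !(rho_lin hpi _ _ (@sm_gen_S' false) (gz' true (be^*))).
rewrite !(rhoZ (@sm_G_bounded) hpi _ _ (@sm_gen_S' true)).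
by rewrite (linD lH) !(linZ lH) !hA'.
Qed.

Lemma X_bounded : bounded_operator X.
Proof.
have := bounded_lin 1 (rho_bounded hpi (@sm_gen_S false)) (rho_bounded hpi (@sm_gen_S true)).
by congr bounded_operator; apply/funext => x; rewrite scale1r.
Qed.
Lemma Y_bounded : bounded_operator Y.
Proof.
have := bounded_lin (-1) (rho_bounded hpi (@sm_gen_S true)) (rho_bounded hpi (@sm_gen_S false)).
by congr bounded_operator; apply/funext => x; rewrite scaleN1r addrC.
Qed.
Lemma X'_bounded : bounded_operator X'.
Proof. exact: adjoint_bounded X_adjoint X_bounded. Qed.
(** ** The span of finitely many vectors *)
Definition orthonormal_fam n (e : 'I_n -> K) := forall i j, '[e i, e j] = (i == j)%:R.
Definition in_span n (e : 'I_n -> K) x := x = \sum_i '[x, e i] *: e i.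

Lemma span_lin n (e : 'I_n -> K) (a : 'I_n -> C R) : orthonormal_fam e ->
  in_span e (\sum_i a i *: e i).
Proof.
move=> oe; rewrite /in_span; apply: eq_bigr => i _; congr (_ *: _).
rewrite ip_suml (bigD1 i) //= big1 ?addr0 => [|j /negPf ji].
  by rewrite ipZl oe eqxx mulr1.
by rewrite ipZl oe ji mulr0.
Qed.

Lemma in_span_lin n (e : 'I_n -> K) a x y : in_span e x -> in_span e y ->
  in_span e (a *: x + y).
Proof.
rewrite /in_span => hx hy; rewrite {1}hx {1}hy scaler_sumr -big_split.
by apply: eq_bigr => i _; rewrite ipDl ipZl scalerDl scalerA.
Qed.

Lemma in_span_self n (e : 'I_n -> K) i : orthonormal_fam e -> in_span e (e i).
Proof.
move=> oe; rewrite /in_span (bigD1 i) //= oe eqxx scale1r big1 ?addr0 // => j ji.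
by rewrite oe eq_sym (negPf ji) scale0r.
Qed.

Lemma in_span_sum n (e : 'I_n -> K) I (r : seq I) (F : I -> K) :
  (forall i, in_span e (F i)) -> in_span e (\sum_(i <- r) F i).
Proof.
move=> h; elim: r => [|i r IH]; rewrite ?big_nil ?big_cons.
  by rewrite /in_span big1 // => i _; rewrite ip0l scale0r.
by rewrite -[F i]scale1r; exact: in_span_lin.
Qed.

Lemma span_closed n (e : 'I_n -> K) : closed_subspace [set x | in_span e x].
Proof.
pose L x := x - \sum_i '[x, e i] *: e i.
suff bL : bounded_operator L.
  have := closed_kernel bL; congr closed_subspace; apply/seteqP.
  by split=> x /=; rewrite /L /in_span; [move/eqP; rewrite subr_eq0 => /eqP|move=> {1}->; rewrite subrr].
apply/bounded_operatorP; split.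
  move=> a x y; rewrite /L.
  have -> : \sum_i '[a *: x + y, e i] *: e i =
      a *: (\sum_i '[x, e i] *: e i) + \sum_i '[y, e i] *: e i.
    rewrite scaler_sumr -big_split; apply: eq_bigr => i _ /=.
    by rewrite ipDl ipZl scalerDl scalerA.
  vring.
exists (1 + \sum_i nm (e i) ^+ 2).
  by rewrite addr_ge0 // sumr_ge0 // => i _; rewrite sqr_ge0.
move=> x; apply: le_trans (nmD _ _) _; rewrite nmN mulrDl mul1r lerD //.
apply: le_trans (nm_sum _ _ _) _; rewrite mulr_suml; apply: ler_sum => i _.
rewrite nmZ expr2 mulrAC ler_wpM2r ?nm_ge0 // mulrC.
exact: cauchy_schwarz.
Qed.

Hypothesis irr : irreducible_rep G pi.

(** The span is closed, so irreducibility applies to it. *)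
Lemma invariant_span n (e : 'I_n.+1 -> K) : orthonormal_fam e ->
  (forall i, [/\ in_span e (X (e i)), in_span e (Y (e i)),
     in_span e (X' (e i)) & in_span e (Y' (e i))]) ->
  forall x, in_span e x.
Proof.
move=> oe he.
have inv F : linear F -> (forall i, in_span e (F (e i))) ->
    forall x, in_span e x -> in_span e (F x).
  move=> lF hF x hx; rewrite hx (lin_sum lF); apply: in_span_sum => i.
  rewrite (linZ lF) -[X in in_span e X]addr0; apply: in_span_lin => //.
  by rewrite /in_span big1 // => j _; rewrite ip0l scale0r.
have iX := inv _ X_linear (fun i => let: And4 h _ _ _ := he i in h).
have iY := inv _ Y_linear (fun i => let: And4 _ h _ _ := he i in h).
have iX' := inv _ X'_linear (fun i => let: And4 _ _ h _ := he i in h).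
have iY' := inv _ Y'_linear (fun i => let: And4 _ _ _ h := he i in h).
have i0 : in_span e 0 by rewrite /in_span big1 // => j _; rewrite ip0l scale0r.
have iZ a x : in_span e x -> in_span e (a *: x).
  by move=> hx; rewrite -[_ *: _]addr0; exact: in_span_lin.
have iA c x : in_span e x -> in_span e (A c x).
  move=> hx; rewrite rho_SE; apply: (iZ); rewrite addrC; apply: in_span_lin; [exact: iY|exact: iX].
have iA' c x : in_span e x -> in_span e (A' c x).
  move=> hx; rewrite rho_S'E; apply: (iZ); rewrite addrC; apply: in_span_lin; [exact: iY'|exact: iX'].
have gz c a : gen (fun y => a *: S c y) by apply: op_closedZ oc (@sm_gen_S c).
have gz' c a : gen (fun y => a *: S' c y) by apply: op_closedZ oc (@sm_gen_S' c).
have := irreducible_subspace irr (span_closed e).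
case=> [||//].
- apply: (invariant_gen cV (@sm_G_bounded) (@sm_G_adjoint) hpi (span_closed e)) => T.
  move=> /(sm_span M)[al [be ->]]; split=> [x hx|T' /(adjoint_uniq (sm_span_adjoint al be)) <- x hx].
    rewrite (rho_lin hpi _ _ (@sm_gen_S false) (gz true be)) (rhoZ (@sm_G_bounded) hpi _ _ (@sm_gen_S true)).
    by apply: in_span_lin; [exact: iA|apply/iZ/iA].
  rewrite (rho_lin hpi _ _ (@sm_gen_S' false) (gz' true (be^*))) (rhoZ (@sm_G_bounded) hpi _ _ (@sm_gen_S' true)).
  by apply: in_span_lin; [exact: iA'|apply/iZ/iA'].
- move=> h; have := oe ord0 ord0; rewrite eqxx (h (e ord0)); last exact: in_span_self.
  by rewrite ip0l => /esym/eqP; rewrite oner_eq0.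
Qed.

End ShiftAlgebra.

Section Classification.
Context {R : realType} {V : ipspace R} (G : set (V -> V)).
Context (S S' : bool -> V -> V) (E : V -> V) (psi : C R -> C R -> nat -> V).
Hypothesis M : shift_model G S S' E psi.
Local Notation gen := (cstar_gen G).
Context {K : ipspace R} (pi : set (V -> V) -> K -> K).
Hypotheses (cK : complete_ipspace K) (irr : irreducible_rep G pi).
Local Notation X := (repX G S pi).
Local Notation Y := (repY G S pi).
Local Notation X' := (repX' G S' pi).
Local Notation Y' := (repY' G S' pi).

Let hpi : representation G pi. Proof. by case: irr. Qed.
Let lX := X_linear M hpi.
Let lY := Y_linear M hpi.
Let lX' := X'_linear M hpi.
Let lY' := Y'_linear M hpi.
Let aX := X_adjoint M hpi.
Let aY := Y_adjoint M hpi.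

Let central (H H' : K -> K) : bounded_operator H -> adjoint H H' ->
  (forall x, H (X x) = X (H x)) -> (forall x, H (Y x) = Y (H x)) ->
  (forall x, H (X' x) = X' (H x)) -> (forall x, H (Y' x) = Y' (H x)) ->
  exists c : C R, forall x, H x = c *: x.
Proof.
move=> bH aH h1 h2 h3 h4.
have cm := commute_XY M hpi bH h1 h2 h3 h4.
exact: (schur (sm_complete M) (@sm_G_bounded _ _ _ _ _ _ _ M) (sm_G_adjoint M) cK irr bH aH cm).
Qed.

Lemma central_XX : exists c : C R, forall x, X (X x) = c *: x.
Proof.
apply: (@central (X \o X) (X' \o X')) => /=.
- by apply: bounded_comp; exact: (X_bounded M hpi).
- exact: adjoint_comp.
- by [].
- by move=> x; rewrite (XY M hpi) (linN lX) (XY M hpi) opprK.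
- by move=> x; rewrite !(X_normal M hpi).
- by move=> x; rewrite (XY' M hpi) (linN lX) (XY' M hpi) opprK.
Qed.

Let YX x : Y (X x) = - X (Y x). Proof. by rewrite (XY M hpi) opprK. Qed.
Let YX' x : Y (X' x) = - X' (Y x). Proof. by rewrite (X'Y M hpi) opprK. Qed.
Let Y'X x : Y' (X x) = - X (Y' x). Proof. by rewrite (XY' M hpi) opprK. Qed.
Let Y'X' x : Y' (X' x) = - X' (Y' x). Proof. by rewrite (X'Y' M hpi) opprK. Qed.

Lemma central_YY : exists c : C R, forall x, Y (Y x) = c *: x.
Proof.
apply: (@central (Y \o Y) (Y' \o Y')) => /=.
- by apply: bounded_comp; exact: (Y_bounded M hpi).
- exact: adjoint_comp.
- by move=> x; rewrite YX (linN lY) YX opprK.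
- by [].
- by move=> x; rewrite YX' (linN lY) YX' opprK.
- by move=> x; rewrite !(Y_normal M hpi).
Qed.

Lemma central_X'X : exists c : C R, forall x, X' (X x) = c *: x.
Proof.
apply: (@central (X' \o X) (X' \o X)) => /=.
- by apply: bounded_comp; [exact: (X'_bounded M hpi)|exact: (X_bounded M hpi)].
- by apply: adjoint_comp => //; exact: adjoint_sym.
- by move=> x; rewrite (X_normal M hpi).
- by move=> x; rewrite (XY M hpi) (linN lX') (X'Y M hpi) opprK.
- by move=> x; rewrite (X_normal M hpi).
- by move=> x; rewrite (XY' M hpi) (linN lX') (X'Y' M hpi) opprK.
Qed.

(** X^*X and Y^*Y are central and positive, with sum 2. *)
Lemma norm_XY : exists r : R, [/\ 0 <= r, r <= 2,
  forall x, X' (X x) = rc r *: x & forall x, Y' (Y x) = rc (2 - r) *: x].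
Proof.
have [c hc] := central_X'X; have [x0 nx0] : exists x : K, x != 0 by case: irr.
have n0 : 0 < nm x0 ^+ 2.
  by rewrite exprn_gt0 // lt0r nm_ge0 andbT; apply: contraNneq nx0 => /nm_eq0 ->.
have cE : c = rc (nm (X x0) ^+ 2 / nm x0 ^+ 2).
  have : '[X' (X x0), x0] = '[X x0] by exact: (adjoint_sym aX).
  rewrite hc ipZl !ipE => h.
  by rewrite fmorph_div /= -h mulfK // fmorph_eq0 gt_eqF.
set r := nm (X x0) ^+ 2 / nm x0 ^+ 2 in cE.
have hY x : Y' (Y x) = rc (2 - r) *: x.
  have -> : Y' (Y x) = x + x - X' (X x) by rewrite -(X'XY'Y M hpi x); vring.
  by rewrite hc cE rmorphB /= rmorph_nat; vring.
exists r; split.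
- by rewrite divr_ge0 // sqr_ge0.
- have : '[Y' (Y x0), x0] = '[Y x0] by exact: (adjoint_sym aY).
  rewrite hY ipZl !ipE -rmorphM => /rcI h.
  by rewrite -subr_ge0 -(pmulr_lge0 _ n0) h sqr_ge0.
- by move=> x; rewrite hc cE.
- exact: hY.
Qed.

Let nm_isometry (Z Z' : K -> K) (r : R) : adjoint Z Z' -> 
  (forall x, Z' (Z x) = rc r *: x) -> forall x, nm (Z x) ^+ 2 = r * nm x ^+ 2.
Proof.
move=> aZ h x; apply: rcI; rewrite -ipE -[LHS](adjoint_sym aZ) h ipZl ipE.
by rewrite -rmorphM.
Qed.

Let sqr_scalar (Z Z' : K -> K) (r : R) (c : C R) : linear Z -> adjoint Z Z' -> 0 <= r ->
  (forall x, Z' (Z x) = rc r *: x) -> (forall x, Z (Z x) = c *: x) -> cm c = r.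
Proof.
move=> lZ aZ r0 h1 h2; have [x0 nx0] : exists x : K, x != 0 by case: irr.
have n0 : 0 < nm x0 ^+ 2.
  by rewrite exprn_gt0 // lt0r nm_ge0 andbT; apply: contraNneq nx0 => /nm_eq0 ->.
have := nm_isometry aZ h1 (Z x0); rewrite h2 nmZ exprMn (nm_isometry aZ h1) mulrA.
move=> /(mulIf (lt0r_neq0 n0)) => h.
by apply/eqP; rewrite -(eqrXn2 (n := 2)) ?cm_ge0 // h expr2.
Qed.

(** (Z - s) (Z + s) = 0 if s is a square root of c. *)
Let eigenvector (Z : K -> K) (c : C R) (x0 : K) : linear Z -> c != 0 -> x0 != 0 ->
  (forall x, Z (Z x) = c *: x) ->
  exists e : K, e != 0 /\ (Z e = sqrtC c *: e \/ Z e = - sqrtC c *: e).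
Proof.
move=> lZ c0 nx0 h; set s := sqrtC c.
have s0 : s != 0 by rewrite sqrtC_eq0.
have [z|z] := eqVneq (s *: x0 + Z x0) 0.
  exists x0; split=> //; right; move/eqP: z; rewrite addrC addr_eq0 => /eqP ->.
  by rewrite scaleNr.
exists (s *: x0 + Z x0); split=> //; left.
by rewrite (linD lZ) (linZ lZ) h -(sqrtCK c) -/s scalerDr scalerA expr2 addrC.
Qed.

Let normalize (e : K) : e != 0 -> exists a : C R, a != 0 /\ '[a *: e] = 1.
Proof.
move=> e0; have n0 : 0 < nm e.
  by rewrite lt0r nm_ge0 andbT; apply: contraNneq e0 => /nm_eq0 ->.
exists (rc (nm e)^-1); split; first by rewrite fmorph_eq0 invr_eq0 gt_eqF.
rewrite ipE nmZ cm_rc ger0_norm ?invr_ge0 ?ltW // mulVf ?gt_eqF //.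
by rewrite expr1n rmorph1.
Qed.

Lemma invariant_line (e : K) : '[e] = 1 ->
  (exists t, X e = t *: e) -> (exists t, Y e = t *: e) ->
  (exists t, X' e = t *: e) -> (exists t, Y' e = t *: e) ->
  forall x, x = '[x, e] *: e.
Proof.
move=> e1 [t1 h1] [t2 h2] [t3 h3] [t4 h4] x.
have oe : orthonormal_fam (fun i : 'I_1 => e).
  by move=> i j; rewrite !ord1 eqxx.
have sp a : in_span (fun i : 'I_1 => e) (a *: e).
  by have := span_lin (fun=> a) oe; rewrite big_ord1.
have /(_ x) : forall x, in_span (fun i : 'I_1 => e) x.
  by apply: (invariant_span M hpi irr oe) => i; rewrite h1 h2 h3 h4; split; exact: sp.
by rewrite /in_span big_ord1.
Qed.

(** For Z = X or Z = Y when the other one vanishes: an eigenvector of Z then spans an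
    invariant line. *)
Lemma rep_dim1 (Z Z' : K -> K) : linear Z -> adjoint Z Z' ->
  (forall x, Z' (Z x) = 2 *: x) -> (exists c : C R, forall x, Z (Z x) = c *: x) ->
  (forall e : K, '[e] = 1 -> (exists t, Z e = t *: e) -> (exists t, Z' e = t *: e) ->
     forall x, x = '[x, e] *: e) ->
  exists (e : K) (t : C R), [/\ '[e] = 1, forall x, x = '[x, e] *: e, cm t ^+ 2 = 2 &
    forall x, Z x = t *: x].
Proof.
move=> lZ aZ hZ' [c hZ] line; have [x0 nx0] : exists x : K, x != 0 by case: irr.
have hZ2 x : Z' (Z x) = rc 2 *: x by rewrite hZ' rmorph_nat.
have c2 : cm c = 2 by apply: (sqr_scalar lZ aZ _ hZ2 hZ).
have c0 : c != 0 by apply/eqP => c0; move: c2; rewrite c0 cm0 => /esym/eqP; rewrite pnatr_eq0.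
have [e [e0 he]] := eigenvector lZ c0 nx0 hZ.
have [t [t2 ht]] : exists t, cm t ^+ 2 = 2 /\ Z e = t *: e.
  have s2 : cm (sqrtC c) ^+ 2 = 2 by rewrite -cmX sqrtCK.
  by case: he => he; [exists (sqrtC c)|exists (- sqrtC c); rewrite cmN].
have [a [a0 ae1]] := normalize e0; exists (a *: e), t.
have t0 : t != 0 by apply/eqP => t0; move: t2; rewrite t0 cm0 expr0n => /esym/eqP; rewrite pnatr_eq0.
have Zae : Z (a *: e) = t *: (a *: e) by rewrite (linZ lZ) ht !scalerA mulrC.
have sp := line _ ae1 _ _; have {}sp : forall x, x = '[x, a *: e] *: (a *: e).
  apply: sp; first by exists t.
  exists (2 / t); rewrite mulrC -scalerA -hZ' Zae.
  by rewrite (linZ (adjoint_linear aZ) t) scalerA mulVf // scale1r.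
split=> // x; rewrite [in LHS](sp x) (linZ lZ) Zae [in RHS](sp x) !scalerA.
by congr (_ *: _); ring.
Qed.

(** The extreme cases r = 0 and r = 2 of [norm_XY] are X = 0 and Y = 0. In between,
    let e be an eigenvector of X; then Y e is one for the opposite eigenvalue, and
    the two span an invariant plane. *)
Theorem irreducible_classification :
  (exists (e : K) (t : C R), [/\ '[e] = 1, forall x, x = '[x, e] *: e, cm t ^+ 2 = 2 &
     ((forall x, X x = t *: x) /\ (forall x, Y x = 0)) \/
     ((forall x, X x = 0) /\ (forall x, Y x = t *: x))]) \/
  (exists (e : 'I_2 -> K) (sg dl : C R), [/\ orthonormal_fam e, (forall x, in_span e x),
     sg != 0 /\ dl != 0, cm sg + cm dl = 2 &
     [/\ X (e ord0) = sqrtC sg *: e ord0, X (e ord_max) = - sqrtC sg *: e ord_max,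
         Y (e ord0) = sqrtC dl *: e ord_max & Y (e ord_max) = - sqrtC dl *: e ord0]]).
Proof.
have [r [r0 r2 hX hY]] := norm_XY.
have [sg hsg] := central_XX; have [dl' hdl'] := central_YY; pose dl := - dl'.
have nX := nm_isometry aX hX; have nY := nm_isometry aY hY.
have [r_0|r_0] := eqVneq r 0.
  left; have X0 x : X x = 0.
    by apply: nm_eq0; apply/eqP; rewrite -sqrf_eq0 nX r_0 mul0r.
  have X'0 x : X' x = 0.
    by apply: ip_inj => z; rewrite (adjoint_sym aX) X0 ip0l ip0r.
  have [||e ? ?|e [t [h1 h2 h3 h4]]] := @rep_dim1 Y Y' lY aY.
  - by move=> x; rewrite hY r_0 subr0 rmorph_nat.
  - by exists dl'.
  - by move=> ?; apply: invariant_line => //; exists 0; rewrite scale0r.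
  - by exists e, t; split=> //; right.
have [r_2|r_2] := eqVneq r 2.
  left; have Y0 x : Y x = 0.
    by apply: nm_eq0; apply/eqP; rewrite -sqrf_eq0 nY r_2 subrr mul0r.
  have Y'0 x : Y' x = 0.
    by apply: ip_inj => z; rewrite (adjoint_sym aY) Y0 ip0l ip0r.
  have [||e ? ?|e [t [h1 h2 h3 h4]]] := @rep_dim1 X X' lX aX.
  - by move=> x; rewrite hX r_2 rmorph_nat.
  - by exists sg.
  - by move=> ?; apply: invariant_line => //; exists 0; rewrite scale0r.
  - by exists e, t; split=> //; left.
right; have r20 : 0 <= 2 - r by rewrite subr_ge0.
have csg : cm sg = r := sqr_scalar lX aX r0 hX hsg.
have cdl : cm dl = 2 - r by rewrite cmN; exact: sqr_scalar lY aY r20 hY hdl'.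
have sg0 : sg != 0 by apply/eqP => z; move: csg r_0; rewrite z cm0 => <-; rewrite eqxx.
have r2' : 2 - r != 0 by rewrite subr_eq0 eq_sym.
have dl0 : dl != 0 by apply/eqP => z; move: cdl r2'; rewrite z cm0 => <-; rewrite eqxx.
set s := sqrtC sg; set d := sqrtC dl.
have s0 : s != 0 by rewrite sqrtC_eq0.
have d0 : d != 0 by rewrite sqrtC_eq0.
have [x0 nx0] : exists x : K, x != 0 by case: irr.
(* Y exchanges the eigenvectors of the two eigenvalues s and - s of X. *)
have [e [e0 Xe]] : exists e, e != 0 /\ X e = s *: e.
  have [e [e0 [Xe|Xe]]] := eigenvector lX sg0 nx0 hsg; first by exists e.
  exists (Y e); split; last by rewrite (XY M hpi) Xe (linZ lY) scaleNr opprK.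
  apply/eqP => Ye; have := nY e; rewrite Ye nm0 expr0n => /esym/eqP.
  rewrite mulf_eq0 (negPf r2') sqrf_eq0 /= => /eqP /nm_eq0 z.
  by rewrite z eqxx in e0.
have [a [a0 e1]] := normalize e0.
have {}Xe : X (a *: e) = s *: (a *: e) by rewrite (linZ lX) Xe !scalerA mulrC.
set e' := a *: e in e1 Xe; pose f := d^-1 *: Y e'.
have Yf : Y f = - d *: e'.
  rewrite /f (linZ lY) hdl' -[dl']opprK -/dl -(sqrtCK dl) -/d scalerA; congr (_ *: _).
  by field.
have Ye : Y e' = d *: f by rewrite /f scalerA mulfV // scale1r.
have Xf : X f = - s *: f.
  by rewrite /f (linZ lX) (XY M hpi) Xe (linZ lY) scaleNr scalerN !scalerA (mulrC s).
have s2 : s * s = sg by rewrite -expr2 sqrtCK.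
have eigen' (t : C R) u : t != 0 -> X u = t *: u -> X' u = (rc r / t) *: u.
  move=> t0 Xu; rewrite mulrC -scalerA -hX Xu (linZ lX') scalerA mulVf //.
  by rewrite scale1r.
have ns0 : - s != 0 by rewrite oppr_eq0.
have X'e := eigen' _ _ s0 Xe; have X'f := eigen' _ _ ns0 Xf.
have Y'f : Y' f = (rc (2 - r) / d) *: e'.
  by rewrite /f (linZ lY') hY scalerA mulrC.
have Y'e : Y' e' = (rc (2 - r) / - d) *: f.
  have := hY f; rewrite Yf (linZ lY') => h.
  have nd0 : - d != 0 by rewrite oppr_eq0.
  by rewrite mulrC -scalerA -h scalerA mulVf // scale1r.
have cs : cm s ^+ 2 = r by rewrite -cmX sqrtCK.
have cd : cm d ^+ 2 = 2 - r by rewrite -cmX sqrtCK.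
have f1 : '[f] = 1.
  rewrite ipE /f nmZ exprMn nY cmV exprVn cd mulKf //.
  by rewrite -ipE.
have ef : '[e', f] = 0.
  have : '[X e', f] = '[e', X' f] := aX e' f.
  rewrite Xe X'f ipZl ipZr -cs -mul_conj_cm.
  rewrite (_ : s * s^* / - s = - s^*); last by field.
  rewrite rmorphN /= conjCK mulNr => /eqP; rewrite -addr_eq0 -mulrDl -mulr2n.
  by rewrite mulf_eq0 mulrn_eq0 (negPf s0) /= => /eqP.
pose ee (i : 'I_2) := if i == ord0 then e' else f.
have e0E : ee ord0 = e' by [].
have e1E : ee ord_max = f by [].
have I2 (i : 'I_2) : i = ord0 \/ i = ord_max.
  by case: i => [[|[|//]] hi]; [left|right]; apply: val_inj.
have oe : orthonormal_fam ee.
  move=> i j; case: (I2 i) => ->; case: (I2 j) => ->; rewrite ?e0E ?e1E //.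
  by rewrite ipC ef conjC0.
have sp0 t : in_span ee (t *: e').
  by rewrite -e0E -[_ *: _]addr0; apply: in_span_lin; [exact: in_span_self|
    rewrite /in_span big1 // => i _; rewrite ip0l scale0r].
have sp1 t : in_span ee (t *: f).
  by rewrite -e1E -[_ *: _]addr0; apply: in_span_lin; [exact: in_span_self|
    rewrite /in_span big1 // => i _; rewrite ip0l scale0r].
exists ee, sg, dl; split=> //.
- apply: (invariant_span M hpi irr oe) => i.
  case: (I2 i) => ->; rewrite ?e0E ?e1E ?Xe ?Ye ?X'e ?Y'e ?Xf ?Yf ?X'f ?Y'f.
    by split.
  by split.
- by rewrite csg cdl addrC subrK.
Qed.

End Classification.

(** * Unitary equivalence *)
Section FiniteDim.
Context {R : realType}.

Lemma hilbert_dim_complete (K : ipspace R) d : hilbert_dim K d -> complete_ipspace K.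
Proof.
move=> [e [oe se]] u hu.
have {}hu : forall r : R, 0 < r -> exists N, forall m n, (N <= m)%N -> (N <= n)%N ->
    nm (u m - u n) < r.
  move=> r r0; have r2 : 0 < rc (r ^+ 2) by rewrite -(rmorph0 rc) rc_ltr exprn_gt0.
  have [N hN] := hu _ r2; exists N => m n Nm Nn.
  by rewrite -ip_lt_nm ?ltW // hN.
have ne i : nm (e i) = 1.
  apply/eqP; rewrite -(eqrXn2 (n := 2)) ?nm_ge0 // nm_sqr oe eqxx expr1n.
  by rewrite -(rmorph1 rc).
have /choice[l hl] : forall i, exists l : C R, forall r : R, 0 < r ->
    exists N, forall n, (N <= n)%N -> cm ('[u n, e i] - l) < r.
  move=> i; apply: complexC_complete => r /hu[N hN]; exists N => m n Nm Nn.
  rewrite -ipBl; apply: le_lt_trans (cauchy_schwarz _ _) _.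
  by rewrite ne mulr1 hN.
exists (\sum_i l i *: e i) => _ /gt0_rc_sqr[r r0 ->].
have d1 : 0 < d.+1%:R :> R by rewrite ltr0Sn.
have /choice[N hN] : forall i, exists N, forall n, (N <= n)%N ->
    cm ('[u n, e i] - l i) < r / d.+1%:R.
  by move=> i; apply: hl; rewrite divr_gt0.
exists (\max_i N i) => n Nn; rewrite ip_lt_nm ?(ltW r0) //.
rewrite {1}(se (u n)) -sumrB; apply: le_lt_trans (nm_sum _ _ _) _.
apply: le_lt_trans (_ : \sum_(i < d) r / d.+1%:R < _).
  apply: ler_sum => i _; rewrite -scalerBl nmZ ne mulr1 ltW // hN //.
  exact: leq_trans (leq_bigmax i) Nn.
by rewrite sumr_const card_ord -[_ *+ d]mulr_natr mulrAC ltr_pdivrMr // ltr_pM2l // ltr_nat.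
Qed.

Lemma hilbert_dim_12 (K : ipspace R) : hilbert_dim K 1 -> ~ hilbert_dim K 2.
Proof.
move=> [e [oe se]] [f [of2 _]].
have fE i : f i = '[f i, e ord0] *: e ord0 by rewrite {1}(se (f i)) big_ord1.
have := of2 ord0 ord_max; rewrite (fE ord0) (fE ord_max) ipZl ipZr oe eqxx mulr1.
move=> /eqP; rewrite mulf_eq0 conjC_eq0 => /orP[]/eqP z.
  have := of2 ord0 ord0; rewrite (fE ord0) z scale0r ip0l eqxx.
  by move=> /esym/eqP; rewrite oner_eq0.
have := of2 ord_max ord_max; rewrite (fE ord_max) z scale0r ip0l eqxx.
by move=> /esym/eqP; rewrite oner_eq0.
Qed.

Definition cvbasis d (i : 'I_d) : cvspace R d := delta_mx i 0.

Lemma cvdotE d (x y : cvspace R d) :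
  '[x, y] = \sum_i (x : 'cV_d) i 0 * ((y : 'cV_d) i 0)^*.
Proof. by []. Qed.

Lemma cv_coord d (x : cvspace R d) i : '[x, cvbasis i] = (x : 'cV_d) i 0.
Proof.
rewrite cvdotE (bigD1 i) //= mxE !eqxx conjC1 mulr1 big1 ?addr0 // => j ji.
by rewrite mxE (negPf ji) conjC0 mulr0.
Qed.

Lemma cv_hilbert_dim d : hilbert_dim (cvspace R d) d.
Proof.
exists (@cvbasis d); split=> [i j|x].
  by rewrite cv_coord mxE eqxx andbT eq_sym.
apply/matrixP => i j; rewrite ord1 summxE (bigD1 i) //= mxE cv_coord mxE !eqxx mulr1.
rewrite big1 ?addr0 // => k ki; rewrite mxE cv_coord mxE eq_sym (negPf ki).
by rewrite mulr0.
Qed.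

End FiniteDim.

Section Transport.
Context {R : realType} {V : ipspace R} (G : set (V -> V)).
Context {K L : ipspace R} (pi : set (V -> V) -> K -> K) (U : K -> L) (W : L -> K).
Hypotheses (lU : linear U) (iU : forall x y, '[U x, U y] = '[x, y])
  (UK : cancel U W) (WK : cancel W U).

Let lW : linear W.
Proof. by move=> a x y; rewrite -{1}(WK x) -{1}(WK y) -lU UK. Qed.

Let iW x y : '[W x, W y] = '[x, y].
Proof. by rewrite -iU !WK. Qed.

Definition transport a x := U (pi a (W x)).

Lemma transport_irreducible : irreducible_rep G pi -> irreducible_rep G transport.
Proof.
move=> [[h1 h2 h3 h4 h5] [x0 nx0] hW].
have U0 : U 0 = 0 := lin0 lU.
split.
- split.
  + move=> T /h1 [lT [M hM]]; split; last first.
      by exists M => x; rewrite /transport iU -(iW x); exact: hM.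
    by move=> a x y; rewrite /transport lW lT lU.
  + by apply/funext => x; rewrite /transport h2 WK.
  + by move=> a T1 T2 g1 g2; apply/funext => x; rewrite /transport h3 // lU.
  + by move=> T1 T2 g1 g2; apply/funext => x; rewrite /transport /= UK h4.
  + move=> T1 T2 g1 a12 x y; rewrite /transport -[y in LHS]WK iU (h5 _ _ g1 a12).
    by rewrite -iU WK.
- exists (U x0); apply: contraNneq nx0 => z; rewrite -(UK x0) z -U0 UK.
  by [].
- move=> D [D0 Dl Dc] Di; pose D' := [set x | D (U x)].
  have [||D'0|D'T] := hW D'.
  + split; rewrite /D' /=.
    * by rewrite U0.
    * by move=> a x y hx hy; rewrite lU; exact: Dl.
    * move=> x hx; apply: Dc => e /hx[y Dy xy]; exists (U y) => //.
      by rewrite -(linB lU) iU.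
  + by move=> a x qa Dx; have := Di a (U x) qa Dx; rewrite /transport UK.
  + left; apply/seteqP; split=> [y Dy|y /= ->] //=.
    have : D' (W y) by rewrite /D' /= WK.
    by rewrite D'0 /= => z; rewrite -(WK y) z.
  + by right; apply/seteqP; split=> // y _; have : D' (W y); [rewrite D'T|rewrite /D' /= WK].
Qed.

Lemma transport_equivalent : unitarily_equivalent G pi transport.
Proof.
exists U; split=> // [y|a x _]; first by exists (W y).
by rewrite /transport UK.
Qed.

End Transport.

Section BasisEquivalence.
Context {R : realType} {V : ipspace R} (G : set (V -> V)).

Lemma basis_unitary (K L : ipspace R) d (e : 'I_d -> K) (f : 'I_d -> L) :
  (forall i j, '[e i, e j] = (i == j)%:R) -> (forall x, x = \sum_i '[x, e i] *: e i) ->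
  (forall i j, '[f i, f j] = (i == j)%:R) -> (forall x, x = \sum_i '[x, f i] *: f i) ->
  exists U W, [/\ linear U, forall x y : K, '[U x : L, U y] = '[x, y], cancel U W,
    cancel W U & forall i, U (e i) = f i].
Proof.
move=> oe se of2 sf.
exists (fun x => \sum_i '[x, e i] *: f i), (fun y => \sum_i '[y, f i] *: e i).
have lemma1 (K1 K2 : ipspace R) (e1 : 'I_d -> K1) (e2 : 'I_d -> K2) (x : K1) j :
    (forall i j, '[e2 i, e2 j] = (i == j)%:R) -> '[\sum_i '[x, e1 i] *: e2 i, e2 j] = '[x, e1 j].
  move=> oe2; rewrite ip_suml (bigD1 j) //= ipZl oe2 eqxx mulr1 big1 ?addr0 // => i ij.
  by rewrite ipZl oe2 (negPf ij) mulr0.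
split.
- move=> a x y; rewrite scaler_sumr -big_split; apply: eq_bigr => i _ /=.
  by rewrite ipDl ipZl scalerDl scalerA.
- move=> x y; rewrite ip_sumr {2}(se y) ip_sumr; apply: eq_bigr => j _.
  by rewrite !ipZr lemma1.
- by move=> x; rewrite [RHS]se; apply: eq_bigr => i _; rewrite lemma1.
- by move=> x; rewrite [RHS]sf; apply: eq_bigr => i _; rewrite lemma1.
- move=> i; rewrite (bigD1 i) //= oe eqxx scale1r big1 ?addr0 // => j ji.
  by rewrite oe eq_sym (negPf ji) scale0r.
Qed.

Lemma class_in_spectrum_dim (K : ipspace R) (pi : set (V -> V) -> K -> K) d :
  irreducible_rep G pi -> hilbert_dim K d -> class_in_spectrum G d pi.
Proof.
move=> irr [e [oe se]]; have [f [of2 sf]] := @cv_hilbert_dim R d.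
have [U [W [lU iU UK WK _]]] := basis_unitary oe se of2 sf.
exists (Irrep (transport_irreducible lU iU UK WK irr)).
exact: transport_equivalent.
Qed.

Lemma class_in_spectrum_hilbert_dim (K : ipspace R) (pi : set (V -> V) -> K -> K) d :
  class_in_spectrum G d pi -> hilbert_dim K d.
Proof.
move=> [p [U [lU iU sU _]]]; have [f [of2 sf]] := @cv_hilbert_dim R d.
have [W WK] := choice sU; exists (fun i => W (f i)); split=> [i j|x].
  by rewrite -iU !WK.
have inj y z : U y = U z -> y = z.
  move=> h; apply: ip_inj => w; by rewrite -iU h iU.
apply: inj; rewrite [LHS]sf (lin_sum lU); apply: eq_bigr => i _.
by rewrite (linZ lU) WK -[in RHS]iU WK.
Qed.

End BasisEquivalence.

Section ShiftEquivalence.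
Context {R : realType} {V : ipspace R} (G : set (V -> V)).
Context (S S' : bool -> V -> V) (E : V -> V) (psi : C R -> C R -> nat -> V).
Hypothesis M : shift_model G S S' E psi.

(** The unitary that maps one basis to the other intertwines X and Y, hence the
    whole algebra. *)
Lemma shift_equivalent (K L : ipspace R) (p : set (V -> V) -> K -> K)
    (q : set (V -> V) -> L -> L) d (e : 'I_d -> K) (f : 'I_d -> L)
    (mX mY : 'I_d -> 'I_d -> C R) :
  representation G p -> representation G q ->
  orthonormal_fam e -> (forall x, in_span e x) ->
  orthonormal_fam f -> (forall x, in_span f x) ->
  (forall i, repX G S p (e i) = \sum_j mX i j *: e j) ->
  (forall i, repX G S q (f i) = \sum_j mX i j *: f j) ->
  (forall i, repY G S p (e i) = \sum_j mY i j *: e j) ->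
  (forall i, repY G S q (f i) = \sum_j mY i j *: f j) ->
  unitarily_equivalent G p q.
Proof.
move=> hp hq oe se of2 sf hXp hXq hYp hYq.
have [U [W [lU iU UK WK Ue]]] := basis_unitary oe se of2 sf.
have nU x : nm (U x) = nm x by rewrite /nm iU.
have comm (P : K -> K) (Q : L -> L) (m : 'I_d -> 'I_d -> C R) : linear P -> linear Q ->
    (forall i, P (e i) = \sum_j m i j *: e j) -> (forall i, Q (f i) = \sum_j m i j *: f j) ->
    forall x, U (P x) = Q (U x).
  move=> lP lQ hP hQ x; rewrite (se x) !(lin_sum lP, lin_sum lU, lin_sum lQ).
  apply: eq_bigr => i _; rewrite !(linZ lP, linZ lU, linZ lQ) Ue hP hQ (lin_sum lU).
  by congr (_ *: _); apply: eq_bigr => j _; rewrite (linZ lU) Ue.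
have cX := comm _ _ _ (X_linear M hp) (X_linear M hq) hXp hXq.
have cY := comm _ _ _ (Y_linear M hp) (Y_linear M hq) hYp hYq.
have cA c x : U (p (ccoset G (S c)) x) = q (ccoset G (S c)) (U x).
  by rewrite !rho_SE (linZ lU) (linD lU) (linZ lU) cX cY.
have cA' c x : U (p (ccoset G (S' c)) x) = q (ccoset G (S' c)) (U x).
  apply: ip_inj => z; rewrite -(WK z) iU.
  rewrite (adjoint_sym (rho_adjS M hp c)) (adjoint_sym (rho_adjS M hq c)).
  by rewrite -cA iU.
have bG := @sm_G_bounded _ _ _ _ _ _ _ M; have aG := @sm_G_adjoint _ _ _ _ _ _ _ M.
have key : forall T, cstar_gen G T -> forall x, U (p (ccoset G T) x) = q (ccoset G T) (U x).
  apply: (intertwine_gen (sm_complete M) bG aG hp hq lU nU) => T /(sm_span M)[al [be ->]].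
  have gz c a : cstar_gen G (fun y => a *: S c y).
    by apply: op_closedZ (gen_closed bG) (@sm_gen_S _ _ _ _ _ _ _ M c).
  have gz' c a : cstar_gen G (fun y => a *: S' c y).
    by apply: op_closedZ (gen_closed bG) (@sm_gen_S' _ _ _ _ _ _ _ M c).
  split=> [x|T' /(adjoint_uniq (sm_span_adjoint M al be)) <- x].
    rewrite (rho_lin hp _ _ (@sm_gen_S _ _ _ _ _ _ _ M false) (gz true be)).
    rewrite (rho_lin hq _ _ (@sm_gen_S _ _ _ _ _ _ _ M false) (gz true be)).
    rewrite !(rhoZ bG _ _ _ (@sm_gen_S _ _ _ _ _ _ _ M true)) //.
    by rewrite (linD lU) !(linZ lU) !cA.
  rewrite (rho_lin hp _ _ (@sm_gen_S' _ _ _ _ _ _ _ M false) (gz' true (be^*))).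
  rewrite (rho_lin hq _ _ (@sm_gen_S' _ _ _ _ _ _ _ M false) (gz' true (be^*))).
  rewrite !(rhoZ bG _ _ _ (@sm_gen_S' _ _ _ _ _ _ _ M true)) //.
  by rewrite (linD lU) !(linZ lU) !cA'.
exists U; split=> // [y|_ x [T gT <-]]; first by exists (W y).
exact: key.
Qed.

(** The sign makes [sg] and [dl] the squares of z1 + z2 and z1 - z2 in the
    representation at the point z ([point_params2]). *)
Definition params2 (K : ipspace R) (p : set (V -> V) -> K -> K) (sg dl : C R) :=
  (forall x, repX G S p (repX G S p x) = sg *: x) /\
  (forall x, repY G S p (repY G S p x) = - dl *: x).

Lemma params2_uniq (K : ipspace R) (p : set (V -> V) -> K -> K) sg dl sg' dl' :
  (exists x : K, x != 0) -> params2 p sg dl -> params2 p sg' dl' -> sg = sg' /\ dl = dl'.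
Proof.
move=> [x x0] [h1 h2] [h3 h4]; split.
  have := h1 x; rewrite h3 => /eqP; rewrite -subr_eq0 -scalerBl scaler_eq0 (negPf x0) orbF.
  by rewrite subr_eq0 => /eqP.
have := h2 x; rewrite h4 => /eqP; rewrite -subr_eq0 -scalerBl scaler_eq0 (negPf x0) orbF.
by rewrite subr_eq0 eqr_opp => /eqP.
Qed.

Lemma irreducible_dim (K : ipspace R) (p : set (V -> V) -> K -> K) :
  complete_ipspace K -> irreducible_rep G p -> hilbert_dim K 1 \/ hilbert_dim K 2.
Proof.
move=> cK irr; have [[e [t [e1 se _ _]]]|[e [sg [dl [oe se _ _ _]]]]] :=
  irreducible_classification M cK irr.
  left; exists (fun=> e); split=> [i j|x]; first by rewrite !ord1 eqxx.
  by rewrite big_ord1.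
by right; exists e.
Qed.

Lemma irreducible_dim2 (K : ipspace R) (p : set (V -> V) -> K -> K) :
  irreducible_rep G p -> hilbert_dim K 2 ->
  exists (e : 'I_2 -> K) sg dl, [/\ orthonormal_fam e, (forall x, in_span e x),
     sg != 0 /\ dl != 0, cm sg + cm dl = 2 & params2 p sg dl /\
     [/\ repX G S p (e ord0) = sqrtC sg *: e ord0,
         repX G S p (e ord_max) = - sqrtC sg *: e ord_max,
         repY G S p (e ord0) = sqrtC dl *: e ord_max &
         repY G S p (e ord_max) = - sqrtC dl *: e ord0]].
Proof.
move=> irr dK; have cK := hilbert_dim_complete dK.
have [[e [t [e1 se _ _]]]|[e [sg [dl [oe se nz sum he]]]]] :=
  irreducible_classification M cK irr.
  exfalso; apply: (hilbert_dim_12 _ dK); exists (fun=> e).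
  by split=> [i j|x]; rewrite ?ord1 ?eqxx ?big_ord1.
exists e, sg, dl; split=> //; split=> //; case: he => h1 h2 h3 h4.
have hp : representation G p by case: irr.
have lX := X_linear M hp; have lY := Y_linear M hp.
have s2 : sqrtC sg * sqrtC sg = sg by rewrite -expr2 sqrtCK.
have d2 : sqrtC dl * sqrtC dl = dl by rewrite -expr2 sqrtCK.
rewrite /params2; move: (repX G S p) (repY G S p) (sqrtC sg) (sqrtC dl)
  lX lY s2 d2 h1 h2 h3 h4 => X Y s d lX lY s2 d2 h1 h2 h3 h4.
split=> x; rewrite (se x) !big_ord_recl big_ord0 addr0.
  rewrite (_ : lift ord0 ord0 = ord_max); last exact: val_inj.
  rewrite !(linD lX) !(linZ lX) h1 h2 !(linZ lX) h1 h2 scalerDr !scalerA -s2.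
  by congr (_ *: _ + _ *: _); ring.
rewrite (_ : lift ord0 ord0 = ord_max); last exact: val_inj.
rewrite !(linD lY) !(linZ lY) h3 h4 !(linZ lY) h3 h4 scalerDr !scalerA -d2.
by congr (_ *: _ + _ *: _); ring.
Qed.

(** The matrices in [irreducible_dim2] depend on the parameters only. *)
Lemma params2_equivalent (K L : ipspace R) (p : set (V -> V) -> K -> K)
    (q : set (V -> V) -> L -> L) sg dl :
  irreducible_rep G p -> hilbert_dim K 2 -> irreducible_rep G q -> hilbert_dim L 2 ->
  params2 p sg dl -> params2 q sg dl -> unitarily_equivalent G p q.
Proof.
move=> ip dK iq dL pp pq.
have [e [sg1 [dl1 [oe se _ _ [pp' [h1 h2 h3 h4]]]]]] := irreducible_dim2 ip dK.
have [f [sg2 [dl2 [of2 sf _ _ [pq' [k1 k2 k3 k4]]]]]] := irreducible_dim2 iq dL.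
have xK : exists x : K, x != 0 by case: ip.
have xL : exists x : L, x != 0 by case: iq.
have [E1 E2] := params2_uniq xK pp' pp; have [E3 E4] := params2_uniq xL pq' pq.
rewrite E1 in h1 h2; rewrite E2 in h3 h4; rewrite E3 in k1 k2; rewrite E4 in k3 k4.
pose mX (i j : 'I_2) : C R := if i == j then (-1) ^+ i * sqrtC sg else 0.
pose mY (i j : 'I_2) : C R := if i == j then 0 else (-1) ^+ i * sqrtC dl.
have I2 (i : 'I_2) : i = ord0 \/ i = ord_max.
  by case: i => [[|[|//]] hi]; [left|right]; apply: val_inj.
have sum2 (D : ipspace R) (F : 'I_2 -> D) : \sum_j F j = F ord0 + F ord_max.
  by rewrite !big_ord_recl big_ord0 addr0 (_ : lift ord0 ord0 = ord_max) //; apply: val_inj.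
have hp : representation G p by case: ip.
have hq : representation G q by case: iq.
apply: (shift_equivalent (mX := mX) (mY := mY) hp hq oe se of2 sf) => i;
  rewrite sum2; case: (I2 i) => ->; rewrite /mX /mY /= ?expr0 ?expr1 ?mul1r ?mulN1r
    ?scale0r ?addr0 ?add0r //.
Qed.

End ShiftEquivalence.

(** * Symbols *)
Lemma ord2P (i : 'I_2) : i = ord0 \/ i = ord_max.
Proof. by case: i => [[|[|//]] hi]; [left|right]; apply: val_inj. Qed.

Lemma sum2 (D : zmodType) (F : 'I_2 -> D) : \sum_j F j = F ord0 + F ord_max.
Proof.
by rewrite !big_ord_recl big_ord0 addr0 (_ : lift ord0 ord0 = ord_max) //; apply: val_inj.
Qed.

Section Windows.
Context {R : realType} {V : ipspace R} (G : set (V -> V)).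
Context (S S' : bool -> V -> V) (E : V -> V) (psi : C R -> C R -> nat -> V).
Hypothesis M : shift_model G S S' E psi.
Local Notation gen := (cstar_gen G).
Local Notation Z := (C R * C R)%type.
Implicit Types (z : Z) (c : bool).

Definition sphere3 : set Z := [set z | cm z.1 ^+ 2 + cm z.2 ^+ 2 = 1].

(** Because of the conjugation, it is the shifts, and not their adjoints, that
    multiply by the coordinates of z. *)
Definition coherent_at z n : V := psi z.1^* z.2^* n.

Let sph_conj z : sphere3 z -> cm z.1^* ^+ 2 + cm z.2^* ^+ 2 = 1.
Proof. by rewrite !cm_conj. Qed.

Lemma coherent_at_ip z n m : sphere3 z -> '[coherent_at z n, coherent_at z m] = (n == m)%:R.
Proof. by move=> /sph_conj; exact: (sm_psi_ip M). Qed.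

(** The coefficient by which S_c maps degree n to degree n + 1, asymptotically *)
Definition shift_coef z c n : C R := if odd n (+) c then z.2 else z.1.

Lemma coherent_at_adjoint z c n : sphere3 z -> S' c (coherent_at z n.+1) = (shift_coef z c n)^* *: coherent_at z n.
Proof.
move=> /sph_conj h; rewrite /coherent_at (sm_psi_adjoint M) // /shift_coef.
by case: ifP.
Qed.

Lemma nm_coherent_at z n : sphere3 z -> nm (coherent_at z n) = 1.
Proof.
move=> hz; apply/eqP; rewrite -(eqrXn2 (n := 2)) ?nm_ge0 // nm_sqr coherent_at_ip // eqxx expr1n.
by rewrite -(rmorph1 rc).
Qed.

(** The squares of the distances sum to 1/(n+1), over the two generators. *)
Lemma coherent_at_shift z c n : sphere3 z ->
  nm (S c (coherent_at z n) - shift_coef z c n *: coherent_at z n.+1) ^+ 2 <= n.+1%:R^-1.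
Proof.
move=> hz.
have D b : nm (S b (coherent_at z n) - shift_coef z b n *: coherent_at z n.+1) ^+ 2 =
    nm (S b (coherent_at z n)) ^+ 2 - cm (shift_coef z b n) ^+ 2.
  rewrite nmD_sqr nmN nmZ nm_coherent_at // mulr1 ipNr ipZr (sm_adjoint M) coherent_at_adjoint // ipZr conjCK.
  rewrite coherent_at_ip // eqxx mulr1 [_^* * _]mulrC mul_conj_cm ReN /=; ring.
have sumS : nm (S false (coherent_at z n)) ^+ 2 + nm (S true (coherent_at z n)) ^+ 2 = 1 + n.+1%:R^-1.
  rewrite !nm_sqr !(sm_adjoint M) -ReD -ipDr (sm_sum M) ipDr coherent_at_ip // eqxx.
  rewrite /coherent_at (sm_psi_E M); last exact: sph_conj.
  by rewrite ipZr conj_rc -/(coherent_at z n) coherent_at_ip // eqxx mulr1 ReD.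
have sumC : cm (shift_coef z false n) ^+ 2 + cm (shift_coef z true n) ^+ 2 = 1.
  by rewrite -hz /shift_coef; case: odd => //=; rewrite addrC.
have := sqr_ge0 (nm (S (~~ c) (coherent_at z n) - shift_coef z (~~ c) n *: coherent_at z n.+1)).
rewrite !D; set v := n.+1%:R^-1 in sumS *; clearbody v.
by case: c => /= h; move: sumS sumC h; lra.
Qed.

(** Windows start so late that the errors in [coherent_at_shift], added over the
    window, are small; and distinct windows are disjoint. *)
Definition window_start N := (N.+1 ^ 4)%N.
(** Normalized sums over N + 1 degrees of the same parity. A shift by two degrees
    changes only two terms of a window, so that each S_c maps windows of one parity
    almost to multiples of those of the other parity. *)
Definition window z N (i : 'I_2) : V := rc (Num.sqrt N.+1%:R)^-1 *:
  \sum_(j < N.+1) coherent_at z ((window_start N + j).*2 + i)%N.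

Lemma window_inj N N' (i i' : 'I_2) (j : 'I_N.+1) (j' : 'I_N'.+1) :
  ((window_start N + j).*2 + i = (window_start N' + j').*2 + i')%N ->
  N = N' /\ i = i' :> nat.
Proof.
move=> h; have ii : i = i' :> nat.
  have := congr1 odd h; rewrite !oddD !odd_double /=.
  by case: i i' {h} => [[|[|//]] ?] [[|[|//]] ?].
split=> //; move: h; rewrite ii => /addIn/double_inj h.
have lt k l (x : 'I_k.+1) : (k < l)%N -> (window_start k + x < window_start l)%N.
  move=> kl; apply: leq_trans (_ : k.+2 ^ 4 <= _)%N; last by rewrite leq_exp2r.
  rewrite /window_start; have := ltn_ord x; set a := nat_of_ord x.
  move: (k.+1) a => m a am; apply: leq_trans (_ : m ^ 4 + m ^ 3 <= _)%N.
    by rewrite ltn_add2l (leq_trans am) // -{1}[m]expn1 leq_pexp2l // (leq_trans _ am).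
  by rewrite [in leqLHS]expnS -mulSnr [leqRHS]expnS leq_mul2l leq_exp2r // leqnSn orbT.
case: (ltngtP N N') => // NN.
  by have := lt _ _ j NN; rewrite h => /leq_trans /(_ (leq_addr j' _)); rewrite ltnn.
by have := lt _ _ j' NN; rewrite -h => /leq_trans /(_ (leq_addr j _)); rewrite ltnn.
Qed.

Let wN N : (Num.sqrt N.+1%:R)^-1 ^+ 2 * N.+1%:R = 1 :> R.
Proof. by rewrite exprVn sqr_sqrtr ?ler0n // mulVf // pnatr_eq0. Qed.

Lemma window_ip z N N' (i i' : 'I_2) : sphere3 z ->
  '[window z N i, window z N' i'] = ((N == N') && (i == i'))%:R.
Proof.
move=> hz; rewrite /window ipZl ipZr conj_rc ip_suml.
have [/andP[/eqP <- /eqP <-]|h] := boolP ((N == N') && (i == i')); last first.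
  rewrite big1 ?mulr0 // => j _; rewrite ip_sumr big1 // => j' _; rewrite coherent_at_ip //.
  case: eqP => // /window_inj[NN ii]; move: h; rewrite NN eqxx /=.
  by rewrite (_ : i == i') //; apply/eqP/val_inj.
rewrite (eq_bigr (fun=> 1)) => [|j _].
  rewrite sumr_const card_ord -(rmorph_nat rc) /= mulrA -!rmorphM /= -expr2 wN.
  by rewrite rmorph1.
rewrite ip_sumr (bigD1 j) //= coherent_at_ip // eqxx big1 ?addr0 // => j' jj'.
rewrite coherent_at_ip //; case: eqP => // /addIn/double_inj/addnI jE.
by move: jj'; rewrite -val_eqE /= jE eqxx.
Qed.

Lemma nm_window z N i : sphere3 z -> nm (window z N i) = 1.
Proof.
move=> hz; apply/eqP; rewrite -(eqrXn2 (n := 2)) ?nm_ge0 // nm_sqr window_ip // !eqxx expr1n.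
by rewrite -(rmorph1 rc).
Qed.

Definition window_comb z N (x : 'I_2 -> C R) : V := \sum_j x j *: window z N j.

Lemma window_comb_ip z N x j : sphere3 z -> '[window_comb z N x, window z N j] = x j.
Proof.
move=> hz; rewrite ip_suml (bigD1 j) //= ipZl window_ip // !eqxx mulr1 big1 ?addr0 // => k kj.
by rewrite ipZl window_ip // eqxx (negPf kj) mulr0.
Qed.

Lemma coord_le_window_comb z N x j : sphere3 z -> cm (x j) <= nm (window_comb z N x).
Proof.
move=> hz; rewrite -(window_comb_ip N x j hz); apply: le_trans (cauchy_schwarz _ _) _.
by rewrite nm_window // mulr1.
Qed.

Lemma window_comb_le z N x : sphere3 z -> nm (window_comb z N x) <= \sum_j cm (x j).
Proof.
move=> hz; apply: le_trans (nm_sum _ _ _) _; apply: ler_sum => j _.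
by rewrite nmZ nm_window // mulr1.
Qed.

Lemma window_combB z N x y : window_comb z N x - window_comb z N y = window_comb z N (fun j => x j - y j).
Proof. by rewrite /window_comb -sumrB; apply: eq_bigr => j _; rewrite scalerBl. Qed.

(** Up to e, the matrix m is the action of T on the two windows at large N. *)
Definition window_approx z (T : V -> V) (m : 'M[C R]_2) (e : R) :=
  exists N0, forall N, (N0 <= N)%N -> forall i,
    nm (T (window z N i) - window_comb z N (fun j => m j i)) <= e.

Lemma window_approx_dist z T T' m m' e e' d : sphere3 z ->
  (forall x, nm (T x - T' x) <= d * nm x) ->
  window_approx z T m e -> window_approx z T' m' e' -> forall i j, cm (m i j - m' i j) <= e + e' + d.
Proof.
move=> hz TT' [N hN] [N' hN'] i j; pose n := maxn N N'.
have h := hN n (leq_maxl _ _) j; have h' := hN' n (leq_maxr _ _) j.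
apply: le_trans (coord_le_window_comb n (fun k => m k j - m' k j) i hz) _.
rewrite -window_combB; apply: le_trans (nm_tri (T (window z n j)) _ _) _.
rewrite -addrA; apply: lerD; first by rewrite nmB.
apply: le_trans (nm_tri (T' (window z n j)) _ _) _; rewrite addrC; apply: lerD => //.
by have := TT' (window z n j); rewrite nm_window // mulr1.
Qed.

Let sqrtN_small (e : R) : 0 < e -> exists N0, forall N, (N0 <= N)%N ->
  (Num.sqrt N.+1%:R)^-1 <= e.
Proof.
move=> e0; have [N0 h] := small_inv (exprn_gt0 2 e0); exists N0 => N /h hN.
rewrite -(ler_pXn2r (n := 2)) ?nnegrE ?invr_ge0 ?sqrtr_ge0 ?(ltW e0) //.
by rewrite exprVn sqr_sqrtr ?ler0n // ltW.
Qed.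

(** A generator exchanges the two parities. *)
Definition shift_symbol z c : 'M[C R]_2 := \matrix_(i, j)
  if i == j then 0 else shift_coef z c j.
Definition shift_adj_symbol z c : 'M[C R]_2 := \matrix_(i, j)
  if i == j then 0 else (shift_coef z c i)^*.

Let shift_coef_parity z c m (i : 'I_2) : shift_coef z c (m.*2 + i) = shift_coef z c i.
Proof. by rewrite /shift_coef oddD odd_double. Qed.

Let lS c := (sm_bounded M c).1.
Let lS' c : linear (S' c). Proof. exact: adjoint_linear (sm_adjoint M c). Qed.

Let window_next z N : sphere3 z ->
  nm (rc (Num.sqrt N.+1%:R)^-1 *: (\sum_(j < N.+1) coherent_at z (window_start N + j).*2.+2 -
     \sum_(j < N.+1) coherent_at z ((window_start N + j).*2 + @ord0 1)%N)) <= 2 * (Num.sqrt N.+1%:R)^-1.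
Proof.
move=> hz; pose u j := coherent_at z (window_start N + j).*2.
have -> : \sum_(j < N.+1) coherent_at z (window_start N + j).*2.+2 -
     \sum_(j < N.+1) coherent_at z ((window_start N + j).*2 + @ord0 1)%N = u N.+1 - u 0%N.
  rewrite -(telescope_sumr u (leq0n N.+1)) big_mkord -sumrB; apply: eq_bigr => j _.
  by rewrite /u addn0 addnS doubleS.
rewrite nmZ cm_rc ger0_norm ?invr_ge0 ?sqrtr_ge0 // mulrC ler_wpM2r ?invr_ge0 ?sqrtr_ge0 //.
by apply: le_trans (nmD _ _) _; rewrite nmN !nm_coherent_at.
Qed.

Let S_window z c N (i : 'I_2) : sphere3 z ->
  nm (S c (window z N i) - rc (Num.sqrt N.+1%:R)^-1 *: (\sum_(j < N.+1)
    shift_coef z c i *: coherent_at z ((window_start N + j).*2 + i).+1)) <= (Num.sqrt N.+1%:R)^-1.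
Proof.
move=> hz; rewrite /window (linZ (lS c)) -scalerBr (lin_sum (lS c)) -sumrB nmZ cm_rc.
rewrite ger0_norm ?invr_ge0 ?sqrtr_ge0 // ler_piMr ?invr_ge0 ?sqrtr_ge0 //.
apply: le_trans (nm_sum _ _ _) _.
have N0 : 0 < N.+1%:R :> R by rewrite ltr0Sn.
apply: le_trans (_ : \sum_(j < N.+1) N.+1%:R^-1 <= _); last first.
  by rewrite sumr_const card_ord -[_ *+ N.+1]mulr_natr mulVf // gt_eqF.
apply: ler_sum => j _; rewrite -(shift_coef_parity z c (window_start N + j)).
have iN : 0 <= N.+1%:R^-1 :> R by rewrite invr_ge0.
rewrite -(ler_pXn2r (n := 2)) ?nnegrE ?nm_ge0 //.
apply: le_trans (coherent_at_shift _ _ hz) _; rewrite exprVn lef_pV2 ?posrE ?exprn_gt0 ?ltr0Sn //.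
rewrite -natrX ler_nat; apply: leq_trans (_ : window_start N <= _)%N.
  by rewrite leq_pexp2l.
by apply: leqW; apply: leq_trans (leq_addr _ _); rewrite -addnn -addnA leq_addr.
Qed.

Let cm_shift_coef z c n : sphere3 z -> cm (shift_coef z c n) <= 1.
Proof.
move=> hz; have hz1 : cm z.1 ^+ 2 + cm z.2 ^+ 2 = 1 := hz.
rewrite -(ler_pXn2r (n := 2)) ?nnegrE ?cm_ge0 // expr1n.
apply: le_trans (_ : cm z.1 ^+ 2 + cm z.2 ^+ 2 <= _); last by rewrite hz1.
by rewrite /shift_coef; case: ifP => _; rewrite ?lerDl ?lerDr sqr_ge0.
Qed.

Let S_succ z c N (i : 'I_2) : sphere3 z ->
  nm (rc (Num.sqrt N.+1%:R)^-1 *: (\sum_(j < N.+1)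
    shift_coef z c i *: coherent_at z ((window_start N + j).*2 + i).+1) -
    window_comb z N (fun j => shift_symbol z c j i)) <= 2 * (Num.sqrt N.+1%:R)^-1.
Proof.
move=> hz; rewrite /window_comb sum2 !mxE; case: (ord2P i) => ->.
  rewrite eqxx scale0r add0r /= -scaler_sumr /window !scalerA mulrC.
  have -> : \sum_(j < N.+1) coherent_at z ((window_start N + j).*2 + @ord_max 1)%N =
            \sum_(j < N.+1) coherent_at z ((window_start N + j).*2 + @ord0 1)%N.+1.
    by apply: eq_bigr => j _; rewrite /= addn0 addn1.
  by rewrite subrr nm0 mulr_ge0 // invr_ge0 sqrtr_ge0.
rewrite eqxx scale0r addr0 /= -scaler_sumr /window.
set P := \sum_(j < N.+1) _; set Q := \sum_(j < N.+1) _; set t := rc _.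
have -> : t *: (shift_coef z c (@ord_max 1) *: P) - shift_coef z c (@ord_max 1) *: (t *: Q) =
  shift_coef z c (@ord_max 1) *: (t *: (P - Q)) by vring.
rewrite nmZ; apply: le_trans (_ : 1 * (2 * (Num.sqrt N.+1%:R)^-1) <= _); last by rewrite mul1r.
apply: ler_pM; rewrite ?cm_ge0 ?nm_ge0 ?cm_shift_coef //.
have := window_next N hz; congr (nm (_ *: (_ - _)) <= _).
by apply: eq_bigr => j _; rewrite addn1.
Qed.

Lemma window_approx_S z c e : sphere3 z -> 0 < e -> window_approx z (S c) (shift_symbol z c) e.
Proof.
move=> hz e0; have e3 : 0 < e / 3 by rewrite divr_gt0.
have [N0 hN] := sqrtN_small e3; exists N0 => N /hN h i.
apply: le_trans (nm_tri (rc (Num.sqrt N.+1%:R)^-1 *: (\sum_(j < N.+1)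
    shift_coef z c i *: coherent_at z ((window_start N + j).*2 + i).+1)) _ _) _.
apply: le_trans (lerD (S_window _ _ _ hz) (S_succ _ _ _ hz)) _; move: h.
by set x := (_)^-1; lra.
Qed.

Let window_prev z N : sphere3 z ->
  nm (rc (Num.sqrt N.+1%:R)^-1 *: (\sum_(j < N.+1) coherent_at z (window_start N + j).*2.-1 -
     \sum_(j < N.+1) coherent_at z ((window_start N + j).*2 + @ord_max 1)%N)) <=
  2 * (Num.sqrt N.+1%:R)^-1.
Proof.
move=> hz; pose u j := coherent_at z (window_start N + j).*2.-1.
have -> : \sum_(j < N.+1) coherent_at z (window_start N + j).*2.-1 -
     \sum_(j < N.+1) coherent_at z ((window_start N + j).*2 + @ord_max 1)%N = - (u N.+1 - u 0%N).
  rewrite -(telescope_sumr u (leq0n N.+1)) big_mkord -sumrB -sumrN; apply: eq_bigr => j _.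
  by rewrite /u addnS doubleS /= addn1 opprB.
rewrite scalerN nmN nmZ cm_rc ger0_norm ?invr_ge0 ?sqrtr_ge0 // mulrC.
rewrite ler_wpM2r ?invr_ge0 ?sqrtr_ge0 //.
by apply: le_trans (nmD _ _) _; rewrite nmN !nm_coherent_at.
Qed.

Lemma window_approx_S' z c e : sphere3 z -> 0 < e -> window_approx z (S' c) (shift_adj_symbol z c) e.
Proof.
move=> hz e0; have e3 : 0 < e / 3 by rewrite divr_gt0.
have [N0 hN] := sqrtN_small e3; exists N0 => N /hN h i.
rewrite /window_comb sum2 !mxE; case: (ord2P i) => ->; rewrite eqxx scale0r ?add0r ?addr0 /=;
  rewrite /window (linZ (lS' c)) (lin_sum (lS' c)) [X in _ - X]scalerA
    [X in _ - X *: _]mulrC -scalerA -scalerBr; last first.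
  rewrite (eq_bigr (fun j : 'I_N.+1 => (shift_coef z c (@ord0 1))^* *:
      coherent_at z ((window_start N + j).*2 + @ord0 1)%N)) => [|j _].
    by rewrite -scaler_sumr subrr scaler0 nm0 ltW.
  by rewrite addn1 coherent_at_adjoint //; have := shift_coef_parity z c (window_start N + j) ord0;
    rewrite !addn0 => ->.
have odd2 n : (0 < n)%N -> shift_coef z c n.*2.-1 = shift_coef z c (@ord_max 1).
  by case: n => // n _; rewrite doubleS /= -addn1 (shift_coef_parity z c n ord_max).
rewrite (eq_bigr (fun j : 'I_N.+1 => (shift_coef z c (@ord_max 1))^* *:
    coherent_at z (window_start N + j).*2.-1)) => [|j _]; last first.
  have s0 : (0 < window_start N + j)%N by rewrite ltn_addr // expn_gt0.
  rewrite addn0 -[in LHS](prednK (n := (window_start N + j).*2)) ?double_gt0 //.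
  by rewrite coherent_at_adjoint // odd2.
rewrite -scaler_sumr -scalerBr scalerA mulrC -scalerA nmZ cm_conj.
apply: le_trans (_ : 1 * (2 * (Num.sqrt N.+1%:R)^-1) <= _).
  by apply: ler_pM; rewrite ?cm_ge0 ?nm_ge0 ?cm_shift_coef // window_prev.
by move: h; set x := (_)^-1; lra.
Qed.

End Windows.

Section ContinuityC.
Context {R : realType}.

Lemma continuousC_at (T : topologicalType) (f : T -> C R) t :
  {for t, continuous f} <-> forall e : R, 0 < e -> \forall x \near t, cm (f x - f t) < e.
Proof.
have FF : Filter (nbhs t) := nbhs_filter t.
split=> [/cvgrPdist_lt h e e0|h].
  have e0' : 0 < rc e by rewrite -(rmorph0 rc) rc_ltr.
  by apply: filterS (h _ e0') => x; rewrite cmE rc_ltr cmB.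
apply/cvgrPdist_lt => e e0.
have ee : e = rc (complex.Re e) := ge0_rc (ltW e0).
have e1 : 0 < complex.Re e by rewrite -rc_ltr -ee rmorph0.
by apply: filterS (h _ e1) => x; rewrite ee cmE rc_ltr cmB.
Qed.

Lemma conj_continuous : continuous (fun w : C R => w^*).
Proof.
move=> w; apply/continuousC_at => e e0.
have /continuousC_at/(_ _ e0) : {for w, continuous (id : C R -> C R)} by exact: cvg_id.
by apply: filterS => t; rewrite -rmorphB cm_conj.
Qed.
End ContinuityC.

Section Symbols.
Context {R : realType} {V : ipspace R} (G : set (V -> V)).
Context (S S' : bool -> V -> V) (E : V -> V) (psi : C R -> C R -> nat -> V).
Hypothesis M : shift_model G S S' E psi.
Local Notation gen := (cstar_gen G).
Local Notation Z := (C R * C R)%type.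
Local Notation sphere3 := (@sphere3 R).
Local Notation window := (@window R V psi).
Local Notation window_comb := (window_comb psi).
Local Notation window_approx := (window_approx psi).
Implicit Types (z : Z) (c : bool) (m : 'M[C R]_2).

Let sumC2 (e : R) : \sum_(j < 2) e = 2 * e.
Proof. by rewrite sum2; ring. Qed.

Lemma window_approx_id z e : 0 <= e -> window_approx z id 1%:M e.
Proof.
move=> e0; exists 0%N => N _ i; rewrite /window_comb (bigD1 i) //= mxE eqxx scale1r big1 ?addr0.
  by rewrite subrr nm0.
by move=> j ji; rewrite mxE (negPf ji) scale0r.
Qed.

Lemma window_approx_lin z a T T' m m' e e' : window_approx z T m e -> window_approx z T' m' e' ->
  window_approx z (fun x => a *: T x + T' x) (a *: m + m') (cm a * e + e').
Proof.
move=> [N hN] [N' hN']; exists (maxn N N') => n Nn i.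
have h := hN n (leq_trans (leq_maxl _ _) Nn) i.
have h' := hN' n (leq_trans (leq_maxr _ _) Nn) i.
have -> : window_comb z n (fun j => (a *: m + m') j i) =
    a *: window_comb z n (fun j => m j i) + window_comb z n (fun j => m' j i).
  rewrite /window_comb scaler_sumr -big_split; apply: eq_bigr => j _ /=.
  by rewrite !mxE scalerDl -scalerA.
rewrite opprD addrACA -scalerBr; apply: le_trans (nmD _ _) _; rewrite nmZ.
by rewrite lerD // ler_wpM2l ?cm_ge0.
Qed.

Lemma window_approx_comp z T T' m m' e e' B L : sphere3 z -> linear T -> 0 <= B -> op_bound B T ->
  (forall i j, cm (m' i j) <= L) -> 0 <= e ->
  window_approx z T m e -> window_approx z T' m' e' ->
  window_approx z (T \o T') (m *m m') (2 * (L * e) + B * e').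
Proof.
move=> hz lT B0 bT hL e0 [N hN] [N' hN']; exists (maxn N N') => n Nn i.
have h := hN n (leq_trans (leq_maxl _ _) Nn).
have h' := hN' n (leq_trans (leq_maxr _ _) Nn) i.
apply: le_trans (nm_tri (T (window_comb z n (fun j => m' j i))) _ _) _; rewrite addrC.
apply: lerD; last first.
  by rewrite /= -(linB lT); apply: le_trans (bT _) _; rewrite ler_wpM2l.
have -> : window_comb z n (fun j => (m *m m') j i) =
    \sum_k m' k i *: window_comb z n (fun j => m j k).
  rewrite /window_comb; under [RHS]eq_bigr => k _ do rewrite scaler_sumr.
  rewrite exchange_big /=; apply: eq_bigr => j _; rewrite mxE scaler_suml.
  by apply: eq_bigr => k _; rewrite mulrC -scalerA.
rewrite /window_comb (lin_sum lT) -sumrB; apply: le_trans (nm_sum _ _ _) _.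
rewrite -sumC2; apply: ler_sum => k _; rewrite (linZ lT) -scalerBr nmZ.
by rewrite ler_pM ?cm_ge0 ?nm_ge0.
Qed.

Lemma window_approx_lim z T T' m e d : sphere3 z -> (forall x, nm (T x - T' x) <= d * nm x) ->
  window_approx z T' m e -> window_approx z T m (d + e).
Proof.
move=> hz TT' [N hN]; exists N => n Nn i.
apply: le_trans (nm_tri (T' (window z n i)) _ _) _; apply: lerD; last exact: hN.
by have := TT' (window z n i); rewrite (nm_window M) // mulr1.
Qed.

Lemma window_approx_bound z T m e B : sphere3 z -> op_bound B T -> window_approx z T m e ->
  forall i j, cm (m i j) <= B + e.
Proof.
move=> hz bT [N hN] i j.
have := coord_le_window_comb M N (fun k => m k j) i hz; move/le_trans; apply.
have := hN N (leqnn _) j; set x := T _; set y := window_comb _ _ _ => h.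
rewrite -[y](subrKC x); apply: le_trans (nmD _ _) _; apply: lerD; last by rewrite nmB.
by have := bT (window z N j); rewrite (nm_window M) // mulr1.
Qed.

Lemma window_approx_change z T m m' e d : sphere3 z -> (forall i j, cm (m i j - m' i j) <= d) ->
  window_approx z T m e -> window_approx z T m' (e + 2 * d).
Proof.
move=> hz mm' [N hN]; exists N => n Nn i.
apply: le_trans (nm_tri (window_comb z n (fun j => m j i)) _ _) _; apply: lerD; first exact: hN.
rewrite window_combB -sumC2; apply: le_trans (window_comb_le M _ _ hz) _.
by apply: ler_sum => j _; exact: mm'.
Qed.

Lemma window_approx_ip z T m e : sphere3 z -> window_approx z T m e -> exists N0, forall N, (N0 <= N)%N ->
  forall i j, cm ('[T (window z N j), window z N i] - m i j) <= e.
Proof.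
move=> hz [N0 hN]; exists N0 => N /hN h i j.
rewrite -(window_comb_ip M N (fun k => m k j) i hz) -ipBl; apply: le_trans (cauchy_schwarz _ _) _.
by rewrite (nm_window M) // mulr1.
Qed.

(** The approximation is uniform on the sphere, so that this property is stable
    under norm limits and yields a continuous symbol. *)
Definition approximable (T : V -> V) := forall e : R, 0 < e -> exists f : Z -> 'M[C R]_2,
  (forall i j, continuous (fun z => f z i j)) /\ forall z, sphere3 z -> window_approx z T (f z) e.

Lemma approximable_generator c : approximable (S c) /\ approximable (S' c).
Proof.
have cf (k : nat) : continuous (fun z : Z => shift_coef z c k).
  by rewrite /shift_coef; case: (odd k (+) c) => z; [exact: cvg_snd|exact: cvg_fst].
split=> e e0.
  exists (fun z => shift_symbol z c); split=> [i j|z hz]; last exact: (window_approx_S M).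
  have -> : (fun z => shift_symbol z c i j) = if i == j then fun=> 0 else fun z => shift_coef z c j.
    by apply/funext => z; rewrite mxE; case: ifP.
  by case: ifP => _ ; [exact: cst_continuous|exact: cf].
exists (fun z => shift_adj_symbol z c); split=> [i j|z hz]; last exact: (window_approx_S' M).
have -> : (fun z => shift_adj_symbol z c i j) = if i == j then fun=> 0 else fun z => (shift_coef z c i)^*.
  by apply/funext => z; rewrite mxE; case: ifP.
case: ifP => _; first exact: cst_continuous.
by move=> z; exact: (continuous_comp (cf i z) (@conj_continuous R _)).
Qed.

Lemma approximable_lin a T T' : approximable T -> approximable T' ->
  approximable (fun x => a *: T x + T' x).
Proof.
move=> hT hT' e e0; have a1 : 0 < 2 * (cm a + 1) by rewrite mulr_gt0 // ltr_wpDl ?cm_ge0.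
have [f [cf hf]] := hT _ (divr_gt0 e0 a1); have e2 : 0 < e / 2 by rewrite divr_gt0.
have [g [cg hg]] := hT' _ e2; exists (fun z => a *: f z + g z); split=> [i j|z hz].
  have -> : (fun z => (a *: f z + g z) i j) = (fun z => a * f z i j + g z i j).
    by apply/funext => z; rewrite !mxE.
  by move=> z; apply: cvgD; [apply: cvgM; [exact: cvg_cst|exact: cf]|exact: cg].
have [N hN] := window_approx_lin a (hf z hz) (hg z hz); exists N => n Nn i.
apply: le_trans (hN n Nn i) _; rewrite [leRHS](splitr e) lerD2r mulrA.
by rewrite ler_pdivrMr //; have := cm_ge0 a; have := e0; nra.
Qed.

Lemma approximable_comp T T' : bounded_operator T -> bounded_operator T' ->
  approximable T -> approximable T' -> approximable (T \o T').
Proof.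
move=> /bounded_operatorP[lT [B B0 bT]] /bounded_operatorP[_ [B' B'0 bT']] hT hT' e e0.
have B1 : 0 < B + 1 by rewrite ltr_wpDl.
have [e2 e20 e2B] : exists2 e2, 0 < e2 & B * e2 <= e / 2.
  exists (e / 2 / (B + 1)); first by rewrite !divr_gt0.
  rewrite mulrA ler_pdivrMr // mulrC ler_pM2l ?divr_gt0 //; lra.
have L0 : 0 < B' + e2 by rewrite ltr_wpDl.
have [e1 e10 e1L] : exists2 e1, 0 < e1 & 2 * ((B' + e2) * e1) <= e / 2.
  exists (e / 4 / (B' + e2)); first by rewrite !divr_gt0.
  by rewrite [(B' + e2) * _]mulrC divfK ?gt_eqF //; lra.
have [f [cf hf]] := hT _ e10; have [g [cg hg]] := hT' _ e20.
exists (fun z => f z *m g z); split=> [i j|z hz].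
  have -> : (fun z => (f z *m g z) i j) =
      (fun z => f z i ord0 * g z ord0 j + f z i ord_max * g z ord_max j).
    by apply/funext => z; rewrite mxE sum2.
  by move=> z; apply: cvgD; apply: cvgM; (exact: cf || exact: cg).
have := window_approx_comp hz lT B0 bT (window_approx_bound hz bT' (hg z hz)) (ltW e10) (hf z hz) (hg z hz).
move=> [N hN]; exists N => n Nn i; apply: le_trans (hN n Nn i) _.
by rewrite [leRHS](splitr e) lerD.
Qed.

Lemma gen_approximable T : gen T -> approximable T.
Proof.
have bG := @sm_G_bounded _ _ _ _ _ _ _ M; have aG := @sm_G_adjoint _ _ _ _ _ _ _ M.
have aS c := (approximable_generator c).1; have aS' c := (approximable_generator c).2.
have a0 : approximable (fun=> 0).
  have := approximable_lin (-1) (aS false) (aS false); congr approximable.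
  by apply/funext => x; rewrite scaleN1r addNr.
have aZ a T0 : approximable T0 -> approximable (fun x => a *: T0 x).
  move=> h; have := approximable_lin a h a0; congr approximable.
  by apply/funext => x; rewrite addr0.
apply: (gen_ind (P := approximable) (sm_complete M) bG aG).
- move=> T0 /(sm_span M)[al [be ->]]; split.
    by apply: approximable_lin => //; exact: aZ.
  move=> T1 /(adjoint_uniq (sm_span_adjoint M al be)) <-.
  by apply: approximable_lin => //; exact: aZ.
- move=> e e0; exists (fun=> 1%:M); split=> [i j|z _]; last exact/window_approx_id/ltW.
  exact: cst_continuous.
- by move=> a T1 T2 _ _; exact: approximable_lin.
- move=> T1 T2 /(gen_bounded bG) b1 /(gen_bounded bG) b2; exact: approximable_comp.
- move=> T0 _ h e e0; have e2 : 0 < e / 2 by rewrite divr_gt0.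
  have [T1 [_ /(_ _ e2)[f [cf hf]]] hT1] := h _ e2; exists f; split=> // z hz.
  by rewrite [e]splitr; apply: window_approx_lim hT1 (hf z hz).
Qed.

(** The limit matrix exists by completeness of C ([symbolP]). *)
Definition symbol z T : 'M[C R]_2 := xget 0 [set m | forall e, 0 < e -> window_approx z T m e].

Let window_approx_uniq z T m m' e e' : sphere3 z -> window_approx z T m e -> window_approx z T m' e' ->
  forall i j, cm (m i j - m' i j) <= e + e'.
Proof.
move=> hz h h' i j; rewrite -[leRHS]addr0; apply: (window_approx_dist M hz _ h h').
by move=> x; rewrite subrr nm0 mul0r.
Qed.

Lemma symbolP z T : sphere3 z -> gen T -> forall e, 0 < e -> window_approx z T (symbol z T) e.
Proof.
move=> hz /gen_approximable aT.
suff [m hm] : exists m, forall e, 0 < e -> window_approx z T m e.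
  have : [set m | forall e, 0 < e -> window_approx z T m e] m by [].
  exact: xgetI.
have /choice[u hu] : forall n : nat, exists m, window_approx z T m n.+1%:R^-1.
  move=> n; have n0 : 0 < n.+1%:R^-1 :> R by rewrite invr_gt0 ltr0Sn.
  by have [f [_ hf]] := aT _ n0; exists (f z); exact: hf.
have cu (i j : 'I_2) : exists l : C R, forall e : R, 0 < e -> exists N, forall n, (N <= n)%N ->
    cm (u n i j - l) < e.
  apply: complexC_complete => e e0; have e2 : 0 < e / 2 by rewrite divr_gt0.
  have [N hN] := small_inv e2; exists N => p q Np Nq.
  apply: le_lt_trans (window_approx_uniq hz (hu p) (hu q) i j) _.
  by rewrite [ltRHS]splitr ltrD // hN.
have /choice[l hl] : forall p : 'I_2 * 'I_2, exists l : C R, forall e : R, 0 < e ->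
    exists N, forall n, (N <= n)%N -> cm (u n p.1 p.2 - l) < e by move=> p; exact: cu.
exists (\matrix_(i, j) l (i, j)) => e e0; have e3 : 0 < e / 3 by rewrite divr_gt0.
have /choice[N hN] : forall p, exists N, forall n, (N <= n)%N ->
  cm (u n p.1 p.2 - l p) < e / 3 by move=> p; exact: hl.
have [N0 hN0] := small_inv e3; pose n : nat := maxn N0 (\max_p N p).
have h : forall i j, cm (u n i j - (\matrix_(i, j) l (i, j)) i j) <= e / 3.
  move=> i j; rewrite mxE ltW // (hN (i, j)) // leq_max; apply/orP; right.
  exact: (leq_bigmax (i, j)).
have [N1 hN1] := window_approx_change hz h (hu n); exists N1 => k Nk i.
apply: le_trans (hN1 k Nk i) _; have := hN0 n (leq_maxl _ _).
by set x := n.+1%:R^-1; lra.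
Qed.

Lemma symbol_uniq z T m (c : R) : sphere3 z -> gen T ->
  (forall e, 0 < e -> window_approx z T m (c * e)) -> symbol z T = m.
Proof.
move=> hz gT hm; apply/matrixP => i j; apply/eqP; rewrite -subr_eq0; apply/eqP/cm_eq0.
apply/eqP; rewrite eq_le cm_ge0 andbT; apply/ler_addgt0Pl => e e0; rewrite addr0.
have c1 : 0 < `|c| + 1 by rewrite ltr_wpDl.
have d0 : 0 < e / (`|c| + 1) by rewrite divr_gt0.
have := window_approx_uniq hz (symbolP hz gT d0) (hm _ d0) i j; move/le_trans; apply.
rewrite -{1}[e / _]mul1r -mulrDl mulrCA ger_pMr // ler_pdivrMr // mul1r addrC lerD2r.
exact: ler_norm.
Qed.

Lemma symbol_id z : sphere3 z -> symbol z id = 1%:M.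
Proof.
move=> hz; apply: (@symbol_uniq _ _ _ 1) => // [|e e0]; first exact: cstar_gen_id.
by apply: window_approx_id; rewrite mul1r ltW.
Qed.

Lemma symbol_lin z a T T' : sphere3 z -> gen T -> gen T' ->
  symbol z (fun x => a *: T x + T' x) = a *: symbol z T + symbol z T'.
Proof.
move=> hz gT gT'; apply: (@symbol_uniq _ _ _ (cm a + 1)) => // [|e e0].
  by have [_ h _ _] := gen_closed (@sm_G_bounded _ _ _ _ _ _ _ M); exact: h.
by rewrite mulrDl mul1r; apply: window_approx_lin; exact: symbolP.
Qed.

Lemma symbol_comp z T T' : sphere3 z -> gen T -> gen T' ->
  symbol z (T \o T') = symbol z T *m symbol z T'.
Proof.
move=> hz gT gT'; have bG := @sm_G_bounded _ _ _ _ _ _ _ M.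
have /bounded_operatorP[lT [B B0 bT]] := gen_bounded bG gT.
have /bounded_operatorP[_ [B' _ bT']] := gen_bounded bG gT'.
apply: (@symbol_uniq _ _ _ (2 * (B' + 1) + B)) => // [|e e0]; first exact: cstar_gen_comp.
rewrite mulrDl -mulrA; apply: (window_approx_comp hz lT B0 bT _ (ltW e0)); try exact: symbolP.
exact: (window_approx_bound hz bT' (symbolP hz gT' ltr01)).
Qed.

Lemma symbol_adjoint z T T' : sphere3 z -> gen T -> gen T' -> adjoint T T' ->
  forall i j, symbol z T' i j = (symbol z T j i)^*.
Proof.
move=> hz gT gT' TT' i j; apply/eqP; rewrite -subr_eq0; apply/eqP/cm_eq0.
apply/eqP; rewrite eq_le cm_ge0 andbT; apply/ler_addgt0Pl => e e0; rewrite addr0.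
have e2 : 0 < e / 2 by rewrite divr_gt0.
have [N hN] := window_approx_ip hz (symbolP hz gT e2); have [N' hN'] := window_approx_ip hz (symbolP hz gT' e2).
pose n := maxn N N'.
have h := hN n (leq_maxl _ _) j i; have h' := hN' n (leq_maxr _ _) i j.
rewrite (_ : _ - _ = - ('[T' (window z n j), window z n i] - symbol z T' i j) +
   ('[T (window z n i), window z n j] - symbol z T j i)^*); last first.
  by rewrite rmorphB /= TT' -ipC; ring.
apply: le_trans (cmD _ _) _; rewrite cmN cm_conj.
by rewrite [leRHS]splitr lerD.
Qed.

(** Windows are orthonormal. If an entry of the matrix were non-zero, their images
    would be far from each other, against the total boundedness of the image of the
    unit ball. *)
Lemma symbol_compact z T : sphere3 z -> gen T -> compact_operator T -> symbol z T = 0.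
Proof.
move=> hz gT /compact_operatorP[_ cT]; apply/matrixP => i j; rewrite [RHS]mxE.
apply/eqP/negPn/negP => /cm_gt0 c0; set c := cm _ in c0.
have c4 : 0 < c / 4 by rewrite divr_gt0.
have [s hs] := cT _ c4; have [N0 hN] := symbolP hz gT c4.
have /choice[y hy] : forall N, exists y, y \in s /\ nm (T (window z N j) - y) < c / 4.
  by move=> N; have [|y ys h] := hs (window z N j); [rewrite (nm_window M)|exists y].
have ys N : (index (y N) s < size s)%N by rewrite index_mem; have [] := hy N.
(* Pigeonhole: two windows k and l share the nearby point of the net s. *)
pose f (k : 'I_(size s).+1) := Ordinal (ys (N0 + k)%N).
have [k [l [kl]]] : exists k l : 'I_(size s).+1, k != l /\ f k = f l.
  apply: contrapT => h; have : injective f.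
    by move=> k l kl; apply/eqP/negPn/negP => n; apply: h; exists k, l.
  by move=> /leq_card; rewrite !card_ord ltnn.
move=> /(congr1 val) /= /(congr1 (nth 0 s)); rewrite !nth_index; try by have [] := hy (N0 + k)%N.
  move=> ykl; set n := (N0 + k)%N in ykl; set p := (N0 + l)%N in ykl.
  have np : n != p by rewrite /n /p eqn_add2l.
  pose u N := window_comb z N (fun q => symbol z T q j).
  have : cm '[u n - u p, window z n i] <= nm (u n - u p).
    by apply: le_trans (cauchy_schwarz _ _) _; rewrite (nm_window M) // mulr1.
  rewrite ipBl (window_comb_ip M) // [X in _ - X](_ : _ = 0) ?subr0; last first.
    rewrite ip_suml big1 // => q _; rewrite ipZl (window_ip M) // eq_sym (negPf np).
    by rewrite mulr0.
  rewrite -/c leNgt => /negP; apply.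
  have h1 := hN n (leq_addr _ _) j; have h2 := hN p (leq_addr _ _) j.
  have [_ h3] := hy n; have [_ h4] := hy p; rewrite -ykl in h4.
  apply: le_lt_trans (nm_tri (T (window z n j)) _ _) _.
  have := nm_tri (T (window z p j)) (T (window z n j)) (u p).
  have := nm_tri (y n) (T (window z n j)) (T (window z p j)).
  rewrite [nm (u n - _)]nmB [nm (y n - _)]nmB -/(u n) -/(u p); move: h1 h2 h3 h4.
  rewrite -/(u n) -/(u p); lra.
by have [] := hy (N0 + l)%N.
Qed.

Lemma symbol_coset z T T' : sphere3 z -> gen T -> gen T' -> ccoset G T = ccoset G T' ->
  symbol z T = symbol z T'.
Proof.
move=> hz gT gT' TT'; have [_ cT] : ccoset G T' T by rewrite -TT'; exact: ccoset_refl.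
have gD : gen (fun x => T x - T' x).
  exact: op_closedB (gen_closed (@sm_G_bounded _ _ _ _ _ _ _ M)) _ _.
have := symbol_compact hz gD cT.
rewrite (_ : (fun x => T x - T' x) = fun x => -1 *: T' x + T x); last first.
  by apply/funext => x; rewrite scaleN1r addrC.
by rewrite symbol_lin // scaleN1r addrC => /eqP; rewrite subr_eq0 => /eqP.
Qed.

Lemma symbol_shift z c : sphere3 z -> symbol z (S c) = shift_symbol z c.
Proof.
move=> hz; apply: (@symbol_uniq _ _ _ 1) => // [|e e0]; first exact: (@sm_gen_S _ _ _ _ _ _ _ M).
by rewrite mul1r; exact: (window_approx_S M).
Qed.

(** The symbol is a uniform limit of continuous functions on the sphere. *)
Lemma symbol_continuous T i j z0 (e : R) : gen T -> sphere3 z0 -> 0 < e ->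
  \forall z \near z0, sphere3 z -> cm (symbol z T i j - symbol z0 T i j) < e.
Proof.
move=> gT hz0 e0; have e6 : 0 < e / 6 by rewrite divr_gt0.
have [f [cf hf]] := gen_approximable gT e6.
have /continuousC_at/(_ _ e6) := cf i j z0.
apply: filterS => z hz sz.
have h := window_approx_uniq sz (symbolP sz gT e6) (hf z sz) i j.
have h0 := window_approx_uniq hz0 (symbolP hz0 gT e6) (hf z0 hz0) i j.
rewrite (_ : _ - _ = (symbol z T i j - f z i j) + (f z i j - f z0 i j) -
   (symbol z0 T i j - f z0 i j)); last by ring.
apply: le_lt_trans (cmD _ _) _; rewrite cmN.
have := cmD (symbol z T i j - f z i j) (f z i j - f z0 i j).
by move: hz h h0; lra.
Qed.

End Symbols.

(** * Representations at the points of the sphere *)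
Section LineRep.
Context {R : realType} {V : ipspace R} (G : set (V -> V)).
Context {K : ipspace R} (pi : set (V -> V) -> K -> K).
Hypothesis hpi : representation G pi.
Local Notation gen := (cstar_gen G).

Lemma scale_bounded (L : ipspace R) (c : C R) : bounded_operator (fun x : L => c *: x).
Proof.
apply/bounded_operatorP; split=> [a x y|]; first by rewrite scalerDr !scalerA mulrC.
by exists (cm c); [exact: cm_ge0|move=> x; rewrite nmZ].
Qed.

Context (x0 : K) (chi : (V -> V) -> C R).
Hypotheses (nx0 : x0 != 0)
  (hchi : forall T, gen T -> pi (ccoset G T) x0 = chi T *: x0).

(** A common eigenvector x0 of the algebra defines a character. *)
Definition line_rep a (y : cvspace R 1) : cvspace R 1 := ('[pi a x0, x0] / '[x0]) *: y.

Lemma line_repE T y : gen T -> line_rep (ccoset G T) y = chi T *: y.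
Proof.
move=> gT; rewrite /line_rep hchi // ipZl mulfK //.
by rewrite (dnorm_eq0 (ip_form K)).
Qed.

Let eqs (c d : C R) : c *: x0 = d *: x0 -> c = d.
Proof.
by move=> /eqP; rewrite -subr_eq0 -scalerBl scaler_eq0 (negPf nx0) orbF subr_eq0 => /eqP.
Qed.

Lemma line_irreducible : irreducible_rep G line_rep.
Proof.
split.
- split.
  + by move=> T _; exact: scale_bounded.
  + apply/funext => y; rewrite line_repE; last exact: cstar_gen_id.
    rewrite (_ : chi id = 1) ?scale1r //; apply: eqs.
    by rewrite -hchi ?(rho_id hpi) ?scale1r //; exact: cstar_gen_id.
  + move=> a S T gS gT; apply/funext => y.
    rewrite !line_repE //; last first.
      move=> A cA GA; case: (cA) => _ h _ _ _; apply: h; [exact: gS|exact: gT].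
    rewrite (_ : chi _ = a * chi S + chi T) ?scalerDl ?scalerA //; apply: eqs.
    rewrite -hchi ?(rho_lin hpi) ?hchi ?scalerDl ?scalerA //.
    move=> A cA GA; case: (cA) => _ h _ _ _; apply: h; [exact: gS|exact: gT].
  + move=> S T gS gT; apply/funext => y; have gST := cstar_gen_comp gS gT.
    rewrite /= !line_repE // scalerA; congr (_ *: _); apply: eqs.
    rewrite -hchi // (rho_comp hpi) // hchi // (linZ (rho_linear hpi gS)) hchi // scalerA.
    by rewrite mulrC.
  + move=> S T gS ST x y.
    have gT : gen T by move=> A cA GA; case: (cA) => _ _ _ h _; apply: h ST; exact: gS.
    rewrite !line_repE // ipZl ipZr; congr (_ * _).
    have := rho_adjoint hpi gS ST x0 x0; rewrite !hchi // ipZl ipZr.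
    by apply: mulIf; rewrite (dnorm_eq0 (ip_form K)).
- exists (const_mx 1); apply/eqP => /matrixP/(_ ord0 ord0); rewrite !mxE.
  by apply/eqP; rewrite oner_eq0.
- move=> W [W0 Wl _] _; have [[w [Ww nw]]|h] := pselect (exists w, W w /\ w != 0); last first.
    left; apply/seteqP; split=> [w Ww|_ ->] //=; apply/eqP/negPn/negP => nw.
    by apply: h; exists w.
  right; apply/seteqP; split=> // y _.
  have w0 : (w : 'cV_1) ord0 ord0 != 0.
    apply: contraNneq nw => w0; apply/eqP/matrixP => i j; rewrite !ord1 w0 mxE //.
  have -> : y = ((y : 'cV_1) ord0 ord0 / (w : 'cV_1) ord0 ord0) *: w + 0 :> cvspace R 1.
    by rewrite addr0; apply/matrixP => i j; rewrite !ord1 mxE divfK.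
  exact: Wl.
Qed.

End LineRep.

Section PointRep.
Context {R : realType} {V : ipspace R} (G : set (V -> V)).
Context (S S' : bool -> V -> V) (E : V -> V) (psi : C R -> C R -> nat -> V).
Hypothesis M : shift_model G S S' E psi.
Local Notation gen := (cstar_gen G).
Local Notation sphere3 := (@sphere3 R).
Local Notation symbol := (symbol psi).
Implicit Types (z : C R * C R) (c : bool).

Let bG := @sm_G_bounded _ _ _ _ _ _ _ M.

(** The choice of the representative T does not matter ([coset_symbolE]). *)
Definition coset_symbol z a : 'M[C R]_2 :=
  xget 0 [set m | exists2 T, gen T & ccoset G T = a /\ m = symbol z T].

Definition point_rep z a : cvspace R 2 -> cvspace R 2 := fun x => coset_symbol z a *m x.

Lemma coset_symbolE z T : sphere3 z -> gen T -> coset_symbol z (ccoset G T) = symbol z T.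
Proof.
move=> hz gT; have h : [set m | exists2 T', gen T' & ccoset G T' = ccoset G T /\ m = symbol z T'] (symbol z T).
  by exists T.
by rewrite /coset_symbol; have [T' gT' [TT' ->]] := xgetI 0 h; exact: (symbol_coset M).
Qed.

Lemma point_repE z T x : sphere3 z -> gen T -> point_rep z (ccoset G T) x = symbol z T *m x.
Proof. by move=> hz gT; rewrite /point_rep coset_symbolE. Qed.

Definition cv2 (x y : C R) : cvspace R 2 := \col_i (if i == ord0 then x else y).

Lemma cv2P (w : cvspace R 2) : w = cv2 ((w : 'cV_2) ord0 ord0) ((w : 'cV_2) ord_max ord0).
Proof. by apply/matrixP => i j; rewrite !ord1 mxE; case: (ord2P i) => ->. Qed.

Lemma cv2_inj x y x' y' : cv2 x y = cv2 x' y' -> x = x' /\ y = y'.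
Proof.
by move=> /matrixP h; have := h ord0 ord0; have := h ord_max ord0; rewrite !mxE /=.
Qed.

Lemma cv2D x y x' y' : cv2 x y + cv2 x' y' = cv2 (x + x') (y + y').
Proof. by apply/matrixP => i j; rewrite !mxE; case: ifP. Qed.

Lemma cv2Z a x y : a *: cv2 x y = cv2 (a * x) (a * y).
Proof. by apply/matrixP => i j; rewrite !mxE; case: ifP. Qed.

Lemma shift_symbol_cv2 z c x y : shift_symbol z c *m cv2 x y =
  cv2 ((if c then z.1 else z.2) * y) ((if c then z.2 else z.1) * x).
Proof.
apply/matrixP => i j; rewrite mxE sum2 !mxE.
by case: (ord2P i) => -> /=; rewrite mul0r ?add0r ?addr0 /shift_coef /=; case: c.
Qed.

Lemma finite_dim_bounded (K : ipspace R) d (T : K -> K) : hilbert_dim K d -> linear T ->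
  bounded_operator T.
Proof.
move=> [e [oe se]] lT; apply/bounded_operatorP; split=> //.
exists (\sum_i nm (T (e i))) => [|x]; first by apply: sumr_ge0 => i _; exact: nm_ge0.
rewrite {1}(se x) (lin_sum lT) mulr_suml; apply: le_trans (nm_sum _ _ _) _.
apply: ler_sum => i _; rewrite (linZ lT) nmZ mulrC ler_wpM2l ?nm_ge0 //.
apply: le_trans (cauchy_schwarz _ _) _; rewrite (_ : nm (e i) = 1) ?mulr1 //.
by rewrite /nm oe eqxx sqrtr1.
Qed.

Lemma point_rep_representation z : sphere3 z -> representation G (point_rep z).
Proof.
move=> hz; split.
- move=> T gT; apply: (finite_dim_bounded (@cv_hilbert_dim R 2)) => a x y.
  by rewrite /point_rep mulmxDr scalemxAr.
- by apply/funext => x; rewrite point_repE ?(symbol_id M) ?mul1mx //; exact: cstar_gen_id.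
- move=> a T T' gT gT'; apply/funext => x; rewrite !point_repE //; last first.
    by have [_ h _ _] := gen_closed bG; exact: h.
  by rewrite (symbol_lin M) // mulmxDl -scalemxAl.
- move=> T T' gT gT'; apply/funext => x; have gTT' := cstar_gen_comp gT gT'.
  rewrite [RHS]/comp (point_repE x hz gTT') (point_repE x hz gT') (point_repE _ hz gT).
  by rewrite (symbol_comp M) // mulmxA.
- move=> T T' gT TT' x y; have gT' := gen_adjoint bG gT TT'.
  have := symbol_adjoint M hz gT gT' TT'; rewrite !point_repE //.
  rewrite (cv2P x) (cv2P y); move: (symbol z T) (symbol z T') => m m' hm.
  rewrite !cvdotE !sum2 !mxE !sum2 !mxE /= !hm !rmorphD !rmorphM /= !conjCK; ring.
Qed.

Lemma repX_cv2 z x y : sphere3 z ->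
  repX G S (point_rep z) (cv2 x y) = cv2 ((z.1 + z.2) * y) ((z.1 + z.2) * x).
Proof.
move=> hz; rewrite /repX !point_repE //; try exact: (@sm_gen_S _ _ _ _ _ _ _ M).
by rewrite !(symbol_shift M) // !shift_symbol_cv2 cv2D; congr cv2; ring.
Qed.

Lemma repY_cv2 z x y : sphere3 z ->
  repY G S (point_rep z) (cv2 x y) = cv2 (- ((z.1 - z.2) * y)) ((z.1 - z.2) * x).
Proof.
move=> hz; rewrite /repY !point_repE //; try exact: (@sm_gen_S _ _ _ _ _ _ _ M).
by rewrite !(symbol_shift M) // !shift_symbol_cv2 -scaleN1r cv2Z cv2D; congr cv2; ring.
Qed.

Lemma point_params2 z : sphere3 z ->
  params2 G S (point_rep z) ((z.1 + z.2) ^+ 2) ((z.1 - z.2) ^+ 2).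
Proof.
by move=> hz; split=> x; rewrite (cv2P x) ?repX_cv2 ?repY_cv2 // cv2Z; congr cv2; ring.
Qed.

(** If z1 <> z2 and z1 <> - z2, the images of X and XY generate the matrix
    algebra. *)
Lemma point_irreducible z : sphere3 z -> z.1 + z.2 != 0 -> z.1 - z.2 != 0 ->
  irreducible_rep G (point_rep z).
Proof.
move=> hz p0 q0; have hp := point_rep_representation hz.
split=> //.
  exists (cv2 1 0); apply/eqP => /matrixP/(_ ord0 ord0); rewrite !mxE /=.
  by apply/eqP; rewrite oner_eq0.
move=> W [W0 Wl _] Wi.
have WS c x : W x -> W (point_rep z (ccoset G (S c)) x).
  by move=> Wx; apply: Wi => //; exists (S c) => //; exact: (@sm_gen_S _ _ _ _ _ _ _ M).
have WD x y : W x -> W y -> W (x + y) by move=> Wx Wy; rewrite -[x]scale1r; exact: Wl.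
have WZ a x : W x -> W (a *: x) by move=> Wx; rewrite -[_ *: _]addr0; exact: Wl.
have WX x y : W (cv2 x y) -> W (cv2 y x).
  move=> Wx; have := WD _ _ (WS false _ Wx) (WS true _ Wx); rewrite -/(repX G S _ _) repX_cv2 //.
  move=> /(WZ (z.1 + z.2)^-1); rewrite cv2Z !mulrA mulVf // !mul1r //.
have WY x y : W (cv2 x y) -> W (cv2 (- y) x).
  move=> Wx; have := WD _ _ (WS false _ Wx) (WZ (-1) _ (WS true _ Wx)).
  rewrite scaleN1r -/(repY G S _ _) repY_cv2 //.
  by move=> /(WZ (z.1 - z.2)^-1); rewrite cv2Z mulrN !mulrA mulVf // !mul1r.
have W1 x y : W (cv2 x y) -> x != 0 -> W (cv2 1 0).
  move=> Wx x0; have := WD _ _ Wx (WZ (-1) _ (WY _ _ (WX _ _ Wx))).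
  rewrite cv2Z cv2D => /(WZ (x + x)^-1); rewrite cv2Z; congr (W (cv2 _ _)).
    by rewrite mulN1r opprK mulVf // -mulr2n mulrn_eq0.
  by rewrite mulN1r subrr mulr0.
have [[w [Ww nw]]|h] := pselect (exists w, W w /\ w != 0); last first.
  left; apply/seteqP; split=> [w Ww|_ ->] //=; apply/eqP/negPn/negP => nw.
  by apply: h; exists w.
right; apply/seteqP; split=> // y _.
have W10 : W (cv2 1 0).
  move: Ww nw; rewrite (cv2P w); set a := (w : 'cV_2) _ _; set b := (w : 'cV_2) _ _.
  move=> Wab; have [a0|/W1 h _] := eqVneq a 0; last exact: h Wab.
  have [b0|/W1 h _] := eqVneq b 0; last exact: h (WX _ _ Wab).
  by rewrite a0 b0 => /eqP; case; apply/matrixP => i j; rewrite !mxE; case: ifP.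
rewrite (cv2P y); set a := (y : 'cV_2) _ _; set b := (y : 'cV_2) _ _.
have := WD _ _ (WZ a _ W10) (WZ b _ (WX _ _ W10)); rewrite !cv2Z cv2D.
by congr (W (cv2 _ _)); ring.
Qed.

End PointRep.

Section Characters.
Context {R : realType} {V : ipspace R} (G : set (V -> V)).
Context (S S' : bool -> V -> V) (E : V -> V) (psi : C R -> C R -> nat -> V).
Hypothesis M : shift_model G S S' E psi.
Local Notation gen := (cstar_gen G).
Local Notation sphere3 := (@sphere3 R).
Local Notation symbol := (symbol psi).
Local Notation point_rep := (point_rep G psi).
Implicit Types (z : C R * C R) (c : bool).

Let adjoint0 (K : ipspace R) (T T' : K -> K) : adjoint T T' -> (forall x, T x = 0) ->
  forall x, T' x = 0.
Proof. by move=> TT' T0 x; apply: ip_inj => y; rewrite ipC -TT' T0 ip0l conjC0 ip0l. Qed.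

(** The eigenvalue of the symbol at the vector (1, t), as the first coordinate of its image *)
Definition character z t T : C R := symbol z T ord0 ord0 + t * symbol z T ord0 ord_max.

Let point_rep_cv2 z T t : sphere3 z -> gen T -> exists q,
  point_rep z (ccoset G T) (cv2 1 t) = cv2 (character z t T) q.
Proof.
move=> hz gT; exists ((symbol z T *m cv2 1 t) ord_max ord0).
rewrite (point_repE M) // [LHS]cv2P; congr cv2; rewrite mxE !big_ord_recl big_ord0 !mxE /=.
rewrite (_ : lift ord0 ord0 = ord_max); last exact: val_inj.
by rewrite /character; ring.
Qed.

(** If z1 = z2, all symbols commute with the exchange of the two coordinates. *)
Lemma character_plus z T : sphere3 z -> z.1 = z.2 -> gen T ->
  point_rep z (ccoset G T) (cv2 1 1) = character z 1 T *: cv2 1 1.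
Proof.
move=> hz z12 gT; have hp := point_rep_representation M hz.
have z0 : z.1 + z.2 != 0.
  apply/eqP => h; have z10 : z.1 = 0.
    apply/eqP; have : z.1 *+ 2 == 0 by rewrite mulr2n {2}z12 h.
    by rewrite mulrn_eq0.
  move: hz; rewrite /sphere3 /= -z12 z10 cm0 expr0n addr0.
  by move=> /eqP; rewrite eq_sym oner_eq0.
have Y0 x : repY G S (point_rep z) x = 0.
  rewrite (cv2P x) (repY_cv2 M) // z12 subrr !mul0r oppr0.
  by apply/matrixP => i j; rewrite !mxE; case: ifP.
have Y'0 := adjoint0 (Y_adjoint M hp) Y0.
have lX := X_linear M hp.
have comm x : repX G S (point_rep z) (point_rep z (ccoset G T) x) =
    point_rep z (ccoset G T) (repX G S (point_rep z) x).
  have h1 w : repX G S (point_rep z) (repY G S (point_rep z) w) =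
      repY G S (point_rep z) (repX G S (point_rep z) w) by rewrite !Y0 (lin0 lX).
  have h2 w : repX G S (point_rep z) (repY' G S' (point_rep z) w) =
      repY' G S' (point_rep z) (repX G S (point_rep z) w) by rewrite !Y'0 (lin0 lX).
  exact: (commute_XY M hp (X_bounded M hp) (fun=> erefl) h1 (X_normal M hp) h2 gT x).
have [q hq] := point_rep_cv2 1 hz gT; have := comm (cv2 1 1).
rewrite hq !(repX_cv2 M) // mulr1.
have -> : cv2 (z.1 + z.2) (z.1 + z.2) = (z.1 + z.2) *: cv2 1 1 by rewrite cv2Z mulr1.
rewrite (linZ (rho_linear hp gT)) hq cv2Z => /cv2_inj[/(mulfI z0) -> _].
by rewrite cv2Z mulr1.
Qed.

(** If z1 = - z2, all symbols commute with the rotation by a right angle, of which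
    (1, i) is an eigenvector. *)
Lemma character_minus z T : sphere3 z -> z.1 = - z.2 -> gen T ->
  point_rep z (ccoset G T) (cv2 1 'i) = character z 'i T *: cv2 1 'i.
Proof.
move=> hz z12 gT; have hp := point_rep_representation M hz.
have z0 : z.1 - z.2 != 0.
  apply/eqP => h; have z10 : z.1 = 0.
    apply/eqP; have : z.1 *+ 2 == 0 by rewrite mulr2n {2}z12 h.
    by rewrite mulrn_eq0.
  move: hz; rewrite /sphere3 /= -[z.2]opprK -z12 z10 oppr0 cm0 expr0n addr0.
  by move=> /eqP; rewrite eq_sym oner_eq0.
have X0 x : repX G S (point_rep z) x = 0.
  rewrite (cv2P x) (repX_cv2 M) // z12 addNr !mul0r.
  by apply/matrixP => i j; rewrite !mxE; case: ifP.
have X'0 := adjoint0 (X_adjoint M hp) X0.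
have lY := Y_linear M hp.
have comm x : repY G S (point_rep z) (point_rep z (ccoset G T) x) =
    point_rep z (ccoset G T) (repY G S (point_rep z) x).
  have h1 w : repY G S (point_rep z) (repX G S (point_rep z) w) =
      repX G S (point_rep z) (repY G S (point_rep z) w) by rewrite !X0 (lin0 lY).
  have h2 w : repY G S (point_rep z) (repX' G S' (point_rep z) w) =
      repX' G S' (point_rep z) (repY G S (point_rep z) w) by rewrite !X'0 (lin0 lY).
  exact: (commute_XY M hp (Y_bounded M hp) h1 (fun=> erefl) h2 (Y_normal M hp) gT x).
have [q hq] := point_rep_cv2 'i hz gT; have := comm (cv2 1 'i).
rewrite hq !(repY_cv2 M) // mulr1.
have -> : cv2 (- ((z.1 - z.2) * 'i)) (z.1 - z.2) = (- ((z.1 - z.2) * 'i)) *: cv2 1 'i.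
  by rewrite cv2Z mulr1 mulNr -mulrA -expr2 sqrCi mulrN1 opprK.
rewrite (linZ (rho_linear hp gT)) hq cv2Z => /cv2_inj[/eqP + _].
rewrite mulNr eqr_opp -mulrA (inj_eq (mulfI z0)) => /eqP ->.
by rewrite cv2Z mulr1 mulrC.
Qed.

End Characters.

(** * Continuous functions on the spectrum *)
Section HullKernel.
Context {R : realType} {V : ipspace R} (G : set (V -> V)).
Hypotheses (cV : complete_ipspace V) (bG : G `<=` @bounded_operator R V)
  (aG : forall T, G T -> exists T', adjoint T T').
Local Notation gen := (cstar_gen G).

(** Expand <P y, y> >= 0 at y = x - P x. *)
Lemma positive_contraction (P : V -> V) : linear P -> adjoint P P ->
  (forall x, 0 <= complex.Re '[P x, x]) -> op_bound 1 P -> op_bound 1 (fun x => x - P x).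
Proof.
move=> lP aP P0 bP x; rewrite mul1r -(ler_pXn2r (n := 2)) ?nnegrE ?nm_ge0 //.
rewrite nmD_sqr nmN ipNr ReN (ipC x) conj_Re.
have := P0 (x - P x).
rewrite (linB lP) ipBl !ipBr !(ReD, ReN) (aP (P x) x) -nm_sqr.
have : complex.Re '[P (P x), P x] <= nm (P x) ^+ 2.
  apply: le_trans (Re_le_cm _) _; apply: le_trans (cauchy_schwarz _ _) _.
  by rewrite expr2 ler_wpM2r ?nm_ge0 //; have := bP (P x); rewrite mul1r.
have := sqr_ge0 (nm (P x)); lra.
Qed.

(** The coset of |H| + H, which vanishes exactly where H is not positive *)
Lemma positive_part (H : V -> V) : gen H -> adjoint H H -> exists2 Q, gen Q &
  forall (K : ipspace R) (pi : set (V -> V) -> K -> K) (g : R), representation G pi ->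
    (exists x : K, x != 0) -> (forall x, pi (ccoset G H) x = rc g *: x) ->
    (exists x, pi (ccoset G Q) x != 0) <-> 0 < g.
Proof.
move=> gH aH; have oc := gen_closed bG.
have /bounded_operatorP[lH [B B0 bH]] := gen_bounded bG gH.
have B1 : 0 < B + 1 by rewrite ltr_wpDl.
pose t := (B + 1)^-1; have t0 : 0 < t by rewrite invr_gt0.
pose H1 x := rc t *: H x.
have gH1 : gen H1 by exact: op_closedZ oc gH.
have lH1 : linear H1 by case: (gen_bounded bG gH1).
have aH1 : adjoint H1 H1 by move=> x y; rewrite /H1 ipZl ipZr conj_rc aH.
have bH1 : op_bound 1 H1.
  move=> x; rewrite mul1r nmZ cm_rc ger0_norm ?(ltW t0) // mulrC ler_pdivrMr //.
  by apply: le_trans (bH x) _; rewrite mulrC ler_wpM2l ?nm_ge0 // lerDl.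
have sq y : nm (H1 y) ^+ 2 <= nm y ^+ 2.
  by rewrite ler_pXn2r ?nnegrE ?nm_ge0 //; have := bH1 y; rewrite mul1r.
(* The square root P of H1^2 = 1 - Y is |H1|. *)
pose HH := H1 \o H1; have gHH : gen HH := cstar_gen_comp gH1 gH1.
pose Y x := x - HH x.
have gY : gen Y by apply: op_closedB oc _ gHH; exact: cstar_gen_id.
have lY : linear Y by case: (gen_bounded bG gY).
have aY : adjoint Y Y by move=> x y; rewrite /Y /HH /= ipBl ipBr !aH1.
have bY : op_bound 1 Y.
  apply: positive_contraction.
  - by case: (gen_bounded bG gHH).
  - by move=> x y; rewrite /HH /= !aH1.
  - by move=> x; rewrite /HH /= aH1 Re_ip_ge0.
  - by move=> x; rewrite mul1r /HH /=; apply: le_trans (bH1 _) _; rewrite mul1r;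
      have := bH1 x; rewrite mul1r.
have [P [bP aP P2 P0 PA]] := sqrt_contraction cV lY aY bY.
have {PA}gP : gen P := PA _ oc gY.
have {}P2 x : P (P x) = H1 (H1 x) by rewrite P2 /Y /HH /= opprB addrC subrK.
have bP1 : op_bound 1 P.
  move=> x; rewrite mul1r -(ler_pXn2r (n := 2)) ?nnegrE ?nm_ge0 //.
  by rewrite nm_sqr aP P2 -aH1 -nm_sqr; exact: sq.
have gD : gen (fun x => x - P x) by apply: op_closedB oc _ gP; exact: cstar_gen_id.
have bD := positive_contraction bP.1 aP P0 bP1.
exists (fun x => P x + H1 x); first exact: op_closedD oc gP gH1.
move=> K pi g hpi [x0 nx0] hg.
pose p := pi (ccoset G P); pose g1 := t * g.
have g10 : (0 < g) = (0 < g1) by rewrite /g1 pmulr_rgt0.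
have hH1 x : pi (ccoset G H1) x = rc g1 *: x.
  by rewrite (rhoZ bG hpi) // hg scalerA -rmorphM.
have hQ x : pi (ccoset G (fun x => P x + H1 x)) x = p x + rc g1 *: x.
  by rewrite (rhoD hpi) // hH1.
have pp x : p (p x) = rc (g1 ^+ 2) *: x.
  rewrite /p -(rho_comp hpi) // (_ : P \o P = H1 \o H1); last by apply/funext => y; exact: P2.
  by rewrite (rho_comp hpi) // !hH1 scalerA -rmorphM expr2.
have lp : linear p := rho_linear hpi gP.
have pD x : nm (x - p x) <= nm x.
  have := rho_contractive cV bG aG hpi ltr01 gD bD x; rewrite mul1r.
  by rewrite (rhoB hpi) ?(rho_id hpi) //; exact: cstar_gen_id.
rewrite g10; split=> [[x]|g0]; last first.
  exists x0; rewrite hQ; apply/eqP => /eqP; rewrite addr_eq0 => /eqP h.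
  have := pD x0; rewrite h opprK -{1}[x0]scale1r -scalerDl nmZ -(rmorph1 rc) -rmorphD cm_rc.
  have n0 : 0 < nm x0 by rewrite lt0r nm_ge0 andbT; apply: contraNneq nx0 => /nm_eq0 ->.
  by rewrite ger0_norm ?addr_ge0 ?(ltW g0) // ger_pMl // gerDl leNgt g0.
rewrite hQ; set y := p x + _ => y0; rewrite ltNge; apply/negP => g1le.
have py : p y = rc g1 *: y.
  by rewrite /y (linD lp) (linZ lp) pp scalerDr scalerA -rmorphM -expr2 addrC.
have ny : 0 < nm y by rewrite lt0r nm_ge0 andbT; apply: contraNneq y0 => /nm_eq0 ->.
have := pD y; rewrite py -{1}[y]scale1r -scalerBl nmZ -(rmorph1 rc) -rmorphB cm_rc.
rewrite ger0_norm ?subr_ge0 ?(le_trans g1le) // ger_pMl // lerBlDl lerDr => h.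
have {h g1le}g1z : g1 = 0 by apply/eqP; rewrite eq_le g1le h.
have yE : y = p x by rewrite /y g1z rmorph0 scale0r addr0.
move: y0; rewrite yE => /eqP; apply; apply: nm_eq0; apply/eqP.
rewrite -[_ == 0](expf_eq0 _ 2) /= nm_sqr (rho_adjoint hpi gP aP) -/p pp g1z expr0n rmorph0.
by rewrite scale0r ip0r.
Qed.

(** The classes with |chi - c| < e are those at which e^2 - D'D, where D = T - c and
    D' is its adjoint, has a non-zero positive part; they form an open set. *)
Lemma scalar_continuous d T (chi : spectrum G d -> C R) : gen T ->
  (forall (s : spectrum G d) x, repr s (ccoset G T) x = chi s *: x) -> continuous chi.
Proof.
move=> gT hchi s0; apply/continuousC_at => e e0.
have [T' TT' gT'] := gen_has_adjoint cV bG aG gT.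
pose c := chi s0; pose D x := T x - c *: x; pose D' x := T' x - c^* *: x.
have gid := @cstar_gen_id _ _ G.
have oc : op_closed gen := gen_closed bG.
have gD : gen D by exact: (op_closedB oc gT (op_closedZ _ oc gid)).
have gD' : gen D' by exact: (op_closedB oc gT' (op_closedZ _ oc gid)).
have DD' : adjoint D D' by move=> x y; rewrite /D /D' ipBl ipBr ipZl ipZr conjCK TT'.
have gDD : gen (D' \o D) by exact: cstar_gen_comp.
pose H x := rc (e ^+ 2) *: x - (D' \o D) x.
have gH : gen H by exact: (op_closedB oc (op_closedZ _ oc gid) gDD).
have aH : adjoint H H.
  move=> x y; rewrite /H /= ipBl ipBr ipZl ipZr conj_rc -DD' (ipC (D' _)) -DD' -ipC //.
have [Q gQ hQ] := positive_part gH aH.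
have hs (s : spectrum G d) x : repr s (ccoset G H) x = rc (e ^+ 2 - cm (chi s - c) ^+ 2) *: x.
  have [hp _ _] := irrep_irreducible (repr s).
  have hD y : repr s (ccoset G D) y = (chi s - c) *: y.
    rewrite (rhoB hp) //; last exact: (op_closedZ _ oc gid).
    by rewrite (rhoZ bG hp) // (rho_id hp) hchi scalerBl.
  rewrite (rhoB hp) //; last exact: (op_closedZ _ oc gid).
  rewrite (rhoZ bG hp) // (rho_id hp) (rho_comp hp) // rmorphB /= scalerBl; congr (_ - _).
  apply: (@ip_inj _ (cvspace R d)) => y; rewrite (adjoint_sym (rho_adjoint hp gD DD')) !hD.
  by rewrite ipZl ipZr mulrA mul_conj_cm ipZl.
have : nbhs s0 [set s | exists2 a, [set ccoset G Q] a & ~ in_kernel s a].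
  apply: open_nbhs_nbhs; split.
    by exists [set ccoset G Q] => // _ ->; exists Q.
  exists (ccoset G Q) => //; apply/in_kernelN.
  have [hp nz _] := irrep_irreducible (repr (s0 : spectrum G d)).
  by apply/(hQ _ _ _ hp nz (hs s0)); rewrite /c subrr cm0 expr0n subr0 exprn_gt0.
apply: filterS => s [_ -> /in_kernelN]; have [hp nz _] := irrep_irreducible (repr s).
move=> /(hQ _ _ _ hp nz (hs s)); rewrite subr_gt0 => h.
by rewrite -(ltr_pXn2r (n := 2)) ?nnegrE ?cm_ge0 ?(ltW e0).
Qed.

End HullKernel.

(** * The model and its parameters *)
Section Model.
Context {R : realType}.
Local Notation Z := (C R * C R)%type.

Lemma rc_continuous : continuous (@rc R).
Proof.
move=> x; apply/continuousC_at => e e0.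
have /cvgrPdist_lt/(_ _ e0) : {for x, continuous (id : R -> R)} by exact: cvg_id.
by apply: filterS => y; rewrite -rmorphB cm_rc distrC.
Qed.

Lemma cm_continuous : continuous (@cm R).
Proof.
move=> z; have FF : Filter (nbhs z) := nbhs_filter z; apply/cvgrPdist_lt => e e0.
have /continuousC_at/(_ _ e0) : {for z, continuous (id : C R -> C R)} by exact: cvg_id.
apply: filterS => w; apply: le_lt_trans; rewrite ler_norml; apply/andP; split.
  by rewrite lerBrDl lerBlDr addrC -{1}(subrK z w) cmD.
by rewrite lerBlDr cmB -{1}(subrK w z) cmD.
Qed.

Lemma Complex_continuous : continuous (fun p : R * R => Complex p.1 p.2 : C R).
Proof.
move=> p; apply/continuousC_at => e e0; have e2 : 0 < e / 2 by rewrite divr_gt0.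
have /cvgrPdist_lt/(_ _ e2) h1 : {for p, continuous (fst : R * R -> R)} by exact: cvg_fst.
have /cvgrPdist_lt/(_ _ e2) h2 : {for p, continuous (snd : R * R -> R)} by exact: cvg_snd.
apply: filterS2 h1 h2 => q h1 h2; apply: le_lt_trans (cm_le_ReIm _) _.
by rewrite /= [ltRHS]splitr ltrD // distrC.
Qed.

(** The unit disc lies in the image of the square [-1, 1]^2. *)
Lemma unit_disc_compact (A : set (C R)) : closed A -> (forall z, A z -> cm z <= 1) -> compact A.
Proof.
move=> cA A1; apply: (@subclosed_compact _ _
  ((fun p : R * R => Complex p.1 p.2 : C R) @` (`[-1, 1] `*` `[-1, 1]))) => //.
  apply: continuous_compact; first exact/continuous_subspaceT/Complex_continuous.
  by apply: compact_setX; exact: segment_compact.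
move=> z /A1 z1; exists (complex.Re z, complex.Im z); last by case: z {z1}.
by split; rewrite /= in_itv /= -ler_norml; apply: le_trans z1;
  [exact: Re_norm_cm|exact: Im_norm_cm].
Qed.

Lemma circleE : circle R = [set z | cm z = 1].
Proof.
apply/seteqP; split=> z /=; rewrite /circle /= cmE; first by move=> h; apply: rcI; rewrite h rmorph1.
by move=> ->; rewrite rmorph1.
Qed.

Lemma closed_cm (f : Z -> R) (c : R) : continuous f -> closed [set z | f z = c].
Proof.
move=> cf; rewrite (_ : [set z | f z = c] = f @^-1` [set c]) //.
by apply: closed_comp => [z _|]; [exact: cf|exact: closed_eq].
Qed.

Lemma circle_compact : compact (circle R).
Proof.
apply: unit_disc_compact; last by rewrite circleE => z ->.
rewrite circleE (_ : [set z | _] = @cm R @^-1` [set 1]) //.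
by apply: closed_comp => [z _|]; [exact: cm_continuous|exact: closed_eq].
Qed.

Lemma disc_compact : compact [set z : C R | cm z <= 1].
Proof.
apply: unit_disc_compact => //.
rewrite (_ : [set z | _] = @cm R @^-1` [set x | x <= 1]) //.
by apply: closed_comp => [z _|]; [exact: cm_continuous|exact: closed_le].
Qed.

Lemma sphere3_compact : compact (@sphere3 R).
Proof.
apply: (@subclosed_compact _ _ ([set z : C R | cm z <= 1] `*` [set z : C R | cm z <= 1])).
- have c1 : continuous (fun z : Z => cm z.1).
    by move=> z; exact: (continuous_comp (f := fst) (g := @cm R) cvg_fst (@cm_continuous _)).
  have c2 : continuous (fun z : Z => cm z.2).
    by move=> z; exact: (continuous_comp (f := snd) (g := @cm R) cvg_snd (@cm_continuous _)).
  rewrite (_ : sphere3 = [set z : Z | cm z.1 * cm z.1 + cm z.2 * cm z.2 = 1]) //.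
  by apply: closed_cm => z; apply: cvgD; apply: cvgM; (exact: c1 || exact: c2).
- by apply: compact_setX; exact: disc_compact.
- move=> z; rewrite /sphere3 /= => h; split => /=;
    rewrite -(ler_pXn2r (n := 2)) ?nnegrE ?cm_ge0 // expr1n -h ?lerDl ?lerDr sqr_ge0 //.
Qed.

Lemma C2_hausdorff : hausdorff_space Z.
Proof. exact: (@norm_hausdorff (C R) (C R * C R)%type). Qed.

End Model.

Section ModelMap.
Context {R : realType}.
Local Notation Z := (C R * C R)%type.
Local Notation X := (R * C R * C R)%type.
Implicit Types (x y : X) (z : Z).

(** With z1 = r v w^* and z2 = sqrt(1 - r^2) w for a square root w of u, these are
    z1^2 + z2^2 and z1 z2. *)
Definition model_sum x : C R :=
  rc (x.1.1 ^+ 2) * x.2 ^+ 2 * x.1.2^* + rc (1 - x.1.1 ^+ 2) * x.1.2.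
Definition model_prod x : C R := rc (x.1.1 * Num.sqrt (1 - x.1.1 ^+ 2)) * x.2.
Definition model_map x : Z :=
  (model_sum x + 2 * model_prod x, model_sum x - 2 * model_prod x).
(** The parameters of the representation at z ([point_params2]) *)
Definition point_map z : Z := ((z.1 + z.2) ^+ 2, (z.1 - z.2) ^+ 2).

(** The compact space from which the model is obtained by removing and gluing *)
Definition solid : set X := `[0, isqrt2 R] `*` circle R `*` circle R.

Lemma isqrt2_gt0 : 0 < isqrt2 R.
Proof. by rewrite invr_gt0 sqrtr_gt0. Qed.

Lemma isqrt2_sqr : isqrt2 R ^+ 2 = 2^-1.
Proof. by rewrite exprVn sqr_sqrtr. Qed.

Lemma solidP x : solid x <-> [/\ 0 <= x.1.1, x.1.1 ^+ 2 <= 2^-1, cm x.1.2 = 1 & cm x.2 = 1].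
Proof.
rewrite /solid !circleE; case: x => [[r u] v] /=; rewrite /setX /= in_itv /=.
have sq : 0 <= r -> (r <= isqrt2 R) = (r ^+ 2 <= 2^-1).
  by move=> r0; rewrite -isqrt2_sqr ler_pXn2r ?nnegrE ?(ltW isqrt2_gt0).
split=> [[[/andP[r0 r2] cu] cv]|[r0 r2 cu cv]]; first by rewrite -sq.
by split=> //; split=> //; rewrite r0 sq.
Qed.

Lemma solid_compact : compact solid.
Proof.
by do 2?apply: compact_setX; [exact: segment_compact|exact: circle_compact|exact: circle_compact].
Qed.

Lemma model_map_continuous : continuous model_map.
Proof.
have cr : continuous (fun x => x.1.1).
  by move=> x; exact: (continuous_comp (f := fst) (g := fst) cvg_fst cvg_fst).
have cu : continuous (fun x => x.1.2).
  by move=> x; exact: (continuous_comp (f := fst) (g := snd) cvg_fst cvg_snd).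
have cv : continuous (fun x => x.2) by move=> x; exact: cvg_snd.
have cu' : continuous (fun x => x.1.2^*).
  by move=> x; exact: (continuous_comp (cu x) (@conj_continuous R _)).
have cr2 : continuous (fun x => x.1.1 ^+ 2).
  by move=> x; exact: (continuous_comp (cr x) (@exprn_continuous R 2 _)).
have cs : continuous (fun x => 1 - x.1.1 ^+ 2).
  by move=> x; apply: cvgB; [exact: cvg_cst|exact: cr2].
have cq : continuous (fun x => x.1.1 * Num.sqrt (1 - x.1.1 ^+ 2)).
  move=> x; apply: cvgM; first exact: cr.
  exact: (continuous_comp (cs x) (@sqrt_continuous R _)).
have crc (f : X -> R) : continuous f -> continuous (fun x => rc (f x)).
  by move=> cf x; exact: (continuous_comp (cf x) (@rc_continuous R _)).
have cp : continuous model_prod.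
  by move=> x; apply: cvgM; [exact: crc cq x|exact: cv].
have cm2 : continuous model_sum.
  move=> x; apply: cvgD; apply: cvgM.
  - apply: cvgM; first exact: crc cr2 x.
    by apply: cvgM; exact: cv.
  - exact: cu'.
  - exact: crc cs x.
  - exact: cu.
have h1 : continuous (fun x => model_sum x + 2 * model_prod x).
  by move=> x; apply: cvgD; [exact: cm2|apply: cvgM; [exact: cvg_cst|exact: cp]].
have h2 : continuous (fun x => model_sum x - 2 * model_prod x).
  by move=> x; apply: cvgB; [exact: cm2|apply: cvgM; [exact: cvg_cst|exact: cp]].
by move=> x; exact: (cvg_pair (h1 x) (h2 x)).
Qed.

Lemma point_map_continuous : continuous point_map.
Proof.
have c1 : continuous (fun z : Z => z.1 + z.2).
  by move=> z; apply: cvgD; [exact: cvg_fst|exact: cvg_snd].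
have c2 : continuous (fun z : Z => z.1 - z.2).
  by move=> z; apply: cvgB; [exact: cvg_fst|exact: cvg_snd].
have h1 : continuous (fun z : Z => (z.1 + z.2) * (z.1 + z.2)).
  by move=> z; apply: cvgM; exact: c1.
have h2 : continuous (fun z : Z => (z.1 - z.2) * (z.1 - z.2)).
  by move=> z; apply: cvgM; exact: c2.
by move=> z; exact: (cvg_pair (h1 z) (h2 z)).
Qed.

Let sqrn (a : R) : `|a| ^+ 2 = a ^+ 2.
Proof. by rewrite real_normK ?num_real. Qed.

Let conj_unit (u : C R) : cm u = 1 -> u * u^* = 1.
Proof. by move=> h; rewrite mul_conj_cm h expr1n rmorph1. Qed.

Lemma point_mapE z x : z.1 ^+ 2 + z.2 ^+ 2 = model_sum x -> z.1 * z.2 = model_prod x ->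
  point_map z = model_map x.
Proof. by move=> h1 h2; rewrite /point_map /model_map -h1 -h2; congr pair; ring. Qed.

(** The choice of a square root of u lifts [model_map] to the sphere. *)
Lemma solid_point x : solid x -> exists w, [/\ cm w = 1, w ^+ 2 = x.1.2 &
  let z := (rc x.1.1 * x.2 * w^*, rc (Num.sqrt (1 - x.1.1 ^+ 2)) * w) in
  sphere3 z /\ point_map z = model_map x].
Proof.
move=> /solidP[r0 r2 cu cv]; exists (sqrtC x.1.2).
have w2 : sqrtC x.1.2 ^+ 2 = x.1.2 by rewrite sqrtCK.
set w := sqrtC x.1.2 in w2 *.
have cw : cm w = 1.
  by apply/eqP; rewrite -(eqrXn2 (n := 2)) ?cm_ge0 // -cmX w2 cu expr1n.
have s0 : 0 <= 1 - x.1.1 ^+ 2 by move: r2; lra.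
split=> //=; split.
  rewrite /sphere3 /= !cmM cm_conj cw cv !cm_rc !mulr1 !sqrn sqr_sqrtr //.
  by rewrite addrC subrK.
apply: point_mapE => /=.
  rewrite /model_sum !exprMn -!rmorphXn /= sqr_sqrtr // -w2 rmorphXn /=; ring.
rewrite /model_prod rmorphM /= mulrACA -[RHS]mulr1 -(conj_unit cw); ring.
Qed.

Lemma model_circleP (s : C R) x : model_circle s x <-> x.1.1 = isqrt2 R /\ cm x.1.2 = 1 /\ x.2 = s * x.1.2.
Proof.
case: x => [[r u] v]; rewrite /model_circle circleE /=; split.
  by move=> [u' cu [<- <- <-]].
by move=> [-> [cu ->]]; exists u.
Qed.

Let r_isqrt2 (r : R) : 0 <= r -> r ^+ 2 = 2^-1 -> r = isqrt2 R.
Proof.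
move=> r0; rewrite -isqrt2_sqr => /eqP; rewrite eqrXn2 ?(ltW isqrt2_gt0) // => /eqP //.
Qed.

(** The coordinates are squares of z1 + z2 and z1 - z2; where one of these vanishes,
    r = |z1| = |z2| = 1/sqrt 2, and comparing phases gives v = - u or v = u. *)
Lemma model_map_eq0 (b : bool) x : solid x ->
  (if b then (model_map x).2 else (model_map x).1) = 0 <-> model_circle (if b then 1 else -1) x.
Proof.
move=> sx; have [w [cw w2 [_ zx]]] := solid_point sx; move: sx => /solidP[r0 r2 cu cv].
have s0 : 0 <= 1 - x.1.1 ^+ 2 by move: r2; lra.
have e2 : rc (2^-1) + rc (2^-1) = 1 :> C R.
  by rewrite -rmorphD -(rmorph1 rc); congr rc; field.
rewrite model_circleP -zx /point_map /=; set s : C R := if b then 1 else -1.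
have -> : ((if b then (rc x.1.1 * x.2 * w^* - rc (Num.sqrt (1 - x.1.1 ^+ 2)) * w) ^+ 2
    else (rc x.1.1 * x.2 * w^* + rc (Num.sqrt (1 - x.1.1 ^+ 2)) * w) ^+ 2) = 0) <->
    rc x.1.1 * x.2 * w^* = s * (rc (Num.sqrt (1 - x.1.1 ^+ 2)) * w).
  rewrite /s; split.
    case: b {s} => /eqP; rewrite expf_eq0 /= ?subr_eq0 ?addr_eq0 => /eqP -> /=; ring.
  by case: b {s} => -> /=; ring.
have cs : cm s = 1 by rewrite /s; case: b {s}; rewrite ?cmN cm1.
split=> [h|[rE [_ ->]]].
  have := congr1 (fun t => cm t ^+ 2) h; rewrite !cmM cs cm_conj cw cv !cm_rc !mulr1 mul1r.
  rewrite !sqrn sqr_sqrtr // => hr.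
  have rE : x.1.1 = isqrt2 R by apply: r_isqrt2 => //; move: hr; lra.
  split=> //; split=> //; move: h.
  rewrite (_ : Num.sqrt _ = x.1.1); last by rewrite -hr sqrtr_sqr ger0_norm.
  have r1 : rc x.1.1 != 0 by rewrite rE -(rmorph0 rc) (inj_eq rcI) gt_eqF // isqrt2_gt0.
  move=> h; apply: (mulfI r1); transitivity ((rc x.1.1 * x.2 * w^*) * w).
    by rewrite -mulrA [w^* * w]mulrC conj_unit // mulr1.
  by rewrite h -w2; ring.
have -> : Num.sqrt (1 - x.1.1 ^+ 2) = x.1.1.
  rewrite -[RHS](ger0_norm r0) -sqrtr_sqr rE isqrt2_sqr; congr Num.sqrt; lra.
rewrite -w2 (_ : _ * w^* = s * (rc x.1.1 * (w * (w * w^*)))); last by ring.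
by rewrite conj_unit // mulr1.
Qed.

(** The modulus r sqrt(1 - r^2) of z1 z2 determines r in [0, 1/sqrt 2], and its phase
    v if r <> 0. The value of z1^2 + z2^2 then gives
    (1 - r^2) (u - u') = r^2 v^2 (conj u' - conj u), where the moduli force
    r^2 = 1/2 unless u = u'. *)
Lemma model_map_inj x y : solid x -> solid y -> model_map x = model_map y ->
  x.1.1 = y.1.1 /\ (x = y \/ [/\ x.1.1 = 0 & x.1.2 = y.1.2] \/
    [/\ x.1.1 = isqrt2 R, y.1.2 = x.1.2^* * x.2 ^+ 2 & x.2 = y.2]).
Proof.
case: x y => [[r u] v] [[r' u'] v'] /solidP[/= r0 r2 cu cv] /solidP[/= r0' r2' cu' cv'].
rewrite /model_map => -[h1 h2].
have two0 : 2 != 0 :> C R by rewrite pnatr_eq0.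
have hs : model_sum (r, u, v) = model_sum (r', u', v').
  apply: (mulfI two0); transitivity ((model_sum (r, u, v) + 2 * model_prod (r, u, v)) +
    (model_sum (r, u, v) - 2 * model_prod (r, u, v))); first by ring.
  by rewrite h1 h2; ring.
have {h1 h2}hp : model_prod (r, u, v) = model_prod (r', u', v').
  by apply: (mulfI two0); move: h1; rewrite hs => /addrI.
rewrite /model_prod /= in hp; rewrite /model_sum /= in hs.
have rr : r = r'.
  have := congr1 (fun t => cm t ^+ 2) hp; rewrite !cmM cv cv' !cm_rc !mulr1 !sqrn !exprMn.
  rewrite !sqr_sqrtr; try by [move: r2; lra|move: r2'; lra].
  move=> h; apply/eqP; rewrite -(eqrXn2 (n := 2)) //; apply/eqP.
  move: h r2 r2'; set a := r ^+ 2; set b := r' ^+ 2 => h a2 b2.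
  have : (a - b) * (1 - a - b) = 0 by move: h; lra.
  by move=> /eqP; rewrite mulf_eq0 => /orP[]/eqP; lra.
subst r'; split=> //; have [r00|rn0] := eqVneq r 0.
  right; left; split=> //; move: hs; rewrite r00 expr0n /= !rmorph0 !mul0r !add0r subr0.
  by rewrite rmorph1 !mul1r.
have s0 : 0 < 1 - r ^+ 2 by move: r2; lra.
have vv : v = v'.
  apply: (mulfI _ hp); rewrite -(rmorph0 rc) (inj_eq rcI) mulf_neq0 // gt_eqF // sqrtr_gt0 //.
subst v'; have [uu|nu] := eqVneq u u'; [by left; rewrite uu|right; right].
have d0 : 0 < cm (u - u') by rewrite cm_gt0 // subr_eq0.
have hd : rc (1 - r ^+ 2) * (u - u') = rc (r ^+ 2) * (v ^+ 2 * (u'^* - u^*)).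
  by apply/eqP; rewrite -subr_eq0; apply/eqP; move/eqP: hs; rewrite -subr_eq0 => /eqP <-; ring.
have r12 : r ^+ 2 = 2^-1.
  have := congr1 (@cm R) hd; rewrite !cmM !cm_rc cv !mul1r -rmorphB cm_conj.
  rewrite cmB (cmB u') => /(mulIf (lt0r_neq0 d0)).
  rewrite !ger0_norm ?sqr_ge0 ?(ltW s0) //; lra.
split=> //; first exact: r_isqrt2.
move: hd; rewrite r12 (_ : 1 - 2^-1 = 2^-1 :> R); last by lra.
have i20 : rc 2^-1 != 0 :> C R by rewrite -(rmorph0 rc) (inj_eq rcI) invr_eq0 pnatr_eq0.
move=> /(mulfI i20) h.
have : (u - u') * (u^* * v ^+ 2 - u') = 0.
  have e1 : (u - u') * (u * u^*) * u' = v ^+ 2 * u^* * (u * (u' * u'^*) - (u * u^*) * u').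
    by rewrite mulrAC [in LHS]mulrA h; ring.
  by rewrite mulrBr; move: e1; rewrite !conj_unit // !mulr1 mul1r => ->; ring.
move=> /eqP; rewrite mulf_eq0 subr_eq0 (negPf nu) /= subr_eq0 => /eqP ->.
by [].
Qed.

Lemma model_map_glue x y : cm x.1.2 = 1 -> cm x.2 = 1 ->
  [/\ x.1.1 = 0, y.1.1 = 0 & y.1.2 = x.1.2] \/
  [/\ x.1.1 = isqrt2 R, y.1.1 = isqrt2 R, y.1.2 = x.1.2^* * x.2 ^+ 2 & y.2 = x.2] ->
  model_map x = model_map y.
Proof.
case: x y => [[r u] v] [[r' u'] v'] /= cu cv [[-> -> ->]|[-> -> -> ->]];
  rewrite /model_map /model_sum /model_prod /=.
  by rewrite expr0n /= !mul0r ?rmorph0 ?mul0r.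
rewrite isqrt2_sqr (_ : 1 - 2^-1 = 2^-1 :> R); last by lra.
set t := rc _; set p := 2 * _.
suff -> : t * v ^+ 2 * (u^* * v ^+ 2)^* + t * (u^* * v ^+ 2) = t * v ^+ 2 * u^* + t * u by [].
rewrite rmorphM rmorphXn /= conjCK.
rewrite (_ : t * v ^+ 2 * (u * v^* ^+ 2) = t * u * (v * v^*) ^+ 2); last by ring.
by rewrite conj_unit // expr1n; ring.
Qed.

(** The other square root of dl exchanges z1 and z2, so |z1| <= |z2| can be
    assumed. *)
Lemma model_map_surj (sg dl : C R) : cm sg + cm dl = 2 -> exists2 x, solid x & model_map x = (sg, dl).
Proof.
move=> hsum.
have [z hz [le hp]] : exists2 z : Z, sphere3 z & cm z.1 <= cm z.2 /\ point_map z = (sg, dl).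
  pose s := sqrtC sg; pose d := sqrtC dl.
  have s2 : s ^+ 2 = sg by rewrite sqrtCK.
  have d2 : d ^+ 2 = dl by rewrite sqrtCK.
  have key (d' : C R) : d' ^+ 2 = dl ->
      sphere3 ((s + d') / 2, (s - d') / 2) /\ point_map ((s + d') / 2, (s - d') / 2) = (sg, dl).
    move=> d'2; split.
      rewrite /sphere3 /=; apply: rcI; rewrite rmorphD /= -!mul_conj_cm !rmorphM /=.
      rewrite !(rmorphD, rmorphB, fmorphV) /= rmorph1.
      have e : rc (cm sg + cm dl) = s * s^* + d' * d'^*.
        by rewrite !mul_conj_cm -!cmX s2 d'2 rmorphD.
      rewrite hsum in e; transitivity ((s * s^* + d' * d'^*) / 2); first by field.
      by rewrite -e rmorphD rmorph1; field.
    by rewrite /point_map /=; congr pair; [rewrite -s2|rewrite -d'2]; field.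
  have [le|/ltW le] := leP (cm ((s + d) / 2)) (cm ((s - d) / 2)).
    by have [h1 h2] := key _ d2; exists ((s + d) / 2, (s - d) / 2).
  have [h1 h2] : sphere3 ((s + - d) / 2, (s - - d) / 2) /\
      point_map ((s + - d) / 2, (s - - d) / 2) = (sg, dl).
    by apply: key; rewrite sqrrN.
  by exists ((s + - d) / 2, (s - - d) / 2) => //=; split=> //; rewrite opprK.
have h1 : cm z.1 ^+ 2 + cm z.2 ^+ 2 = 1 := hz.
have z2 : 0 < cm z.2.
  rewrite lt0r cm_ge0 andbT; apply/eqP => z20; move: le h1; rewrite z20 => le.
  have -> : cm z.1 = 0 by apply/eqP; rewrite eq_le le cm_ge0.
  by move=> /eqP; rewrite expr0n addr0 eq_sym oner_eq0.
have lesq : cm z.1 ^+ 2 <= cm z.2 ^+ 2 by rewrite ler_pXn2r ?nnegrE ?cm_ge0.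
have sE : Num.sqrt (1 - cm z.1 ^+ 2) = cm z.2 by rewrite -h1 addrC addKr sqrtr_sqr ger0_norm ?cm_ge0.
pose w := z.2 / rc (cm z.2).
pose a := if z.1 == 0 then 1 else z.1 / rc (cm z.1).
have c2 : rc (cm z.2) != 0 :> C R by rewrite -(rmorph0 rc) (inj_eq rcI) gt_eqF.
have zw : z.2 = rc (cm z.2) * w by rewrite /w mulrC divfK.
have za : z.1 = rc (cm z.1) * a.
  rewrite /a; case: eqVneq => [->|n]; first by rewrite cm0 rmorph0 mul0r.
  by rewrite mulrC divfK // -(rmorph0 rc) (inj_eq rcI) gt_eqF // cm_gt0.
have cw : cm w = 1 by rewrite /w cmM cmV cm_rc ger0_norm ?cm_ge0 // mulfV // gt_eqF.
have ca : cm a = 1.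
  rewrite /a; case: eqVneq => [|n]; first by rewrite cm1.
  by rewrite cmM cmV cm_rc ger0_norm ?cm_ge0 // mulfV // gt_eqF // cm_gt0.
exists (cm z.1, w ^+ 2, a * w).
  by apply/solidP; rewrite /= cmX cmM cw ca mulr1 expr1n cm_ge0; split=> //; move: lesq h1; lra.
rewrite -hp; apply/esym/point_mapE.
  rewrite /model_sum /= -h1 [cm z.1 ^+ 2 + _]addrC addrK {1}za {1}zw.
  rewrite (_ : _ * (a * w) ^+ 2 * _ = rc (cm z.1 ^+ 2) * a ^+ 2 * (w * w^*) ^+ 2); last first.
    by rewrite rmorphXn /=; ring.
  by rewrite conj_unit // expr1n mulr1 !rmorphXn /=; ring.
by rewrite /model_prod /= sE {1}za {1}zw rmorphM /=; ring.
Qed.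

End ModelMap.

(** The last hypothesis makes h a quotient map. *)
Lemma quotient_homeomorphic (T B : topologicalType) (e : equiv_rel T) (h : T -> B) :
  continuous h -> (forall s, exists x, h x = s) -> (forall x y, h x = h y <-> e x y) ->
  (forall A, open (h @^-1` A) -> open A) ->
  homeomorphic B (quotient_topology {eq_quot e}).
Proof.
move=> ch sh he oh; have /choice[k hk] := sh.
pose Q := quotient_topology {eq_quot e}.
have hr x : h (repr (\pi_Q x)) = h x.
  by apply/he; have : \pi_Q (repr (\pi_Q x)) = \pi_Q x by [rewrite reprK]; move/eqmodP.
have kh x : \pi_Q (k (h x)) = \pi_Q x by apply/eqmodP/he; rewrite hk.
exists (fun s => \pi_Q (k s)), (fun q : Q => h (repr q)); split.
- by move=> s; rewrite hr hk.
- by move=> q; rewrite kh reprK.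
- apply/continuousP => A oA; apply: oh; rewrite (_ : _ @^-1` _ = \pi_Q @^-1` A) //.
  by apply/seteqP; split=> x /=; rewrite kh.
- apply: repr_comp_continuous => // x y /eqP xy; apply/eqP/he.
  exact/eqmodP.
Qed.

(** * Classes of dimension 2 *)
Section Spectrum2.
Context {R : realType} {V : ipspace R} (G : set (V -> V)).
Context (S S' : bool -> V -> V) (E : V -> V) (psi : C R -> C R -> nat -> V).
Hypothesis M : shift_model G S S' E psi.
Local Notation gen := (cstar_gen G).
Local Notation spec2 := (spectrum G 2).
Local Notation sphere3 := (@sphere3 R).
Local Notation symbol := (symbol psi).
Local Notation point_rep := (point_rep G psi).
Implicit Types (z : C R * C R) (c : bool).

Let bG := @sm_G_bounded _ _ _ _ _ _ _ M.
Let oc : op_closed gen := gen_closed bG.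
Let gS c : gen (S c) := @sm_gen_S _ _ _ _ _ _ _ M c.

Definition opX x := S false x + S true x.
Definition opY x := S false x - S true x.

Lemma gen_opX : gen opX. Proof. exact: (op_closedD oc (gS false) (gS true)). Qed.
Lemma gen_opY : gen opY. Proof. exact: (op_closedB oc (gS false) (gS true)). Qed.

Lemma rho_opX (K : ipspace R) (p : set (V -> V) -> K -> K) x : representation G p ->
  p (ccoset G opX) x = repX G S p x.
Proof. by move=> hp; rewrite (rhoD hp). Qed.

Lemma rho_opY (K : ipspace R) (p : set (V -> V) -> K -> K) x : representation G p ->
  p (ccoset G opY) x = repY G S p x.
Proof. by move=> hp; rewrite (rhoB hp). Qed.

Lemma repr_rep d (s : spectrum G d) : representation G (repr s).
Proof. by have [] := irrep_irreducible (repr s). Qed.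

Lemma isometry_inj (K L : ipspace R) (U : K -> L) : linear U ->
  (forall x y, '[U x, U y] = '[x, y]) -> injective U.
Proof.
move=> lU iU x y h; apply/eqP; rewrite -subr_eq0; apply/eqP/nm_eq0.
by rewrite /nm -iU (linB lU) h subrr ip0l sqrtr0.
Qed.

Lemma repr_equivalent d (p : irrep G d) : unitarily_equivalent G (repr (\pi_(spectrum G d) p)) p.
Proof.
by apply/asboolP; have : \pi_(spectrum G d) (repr (\pi_(spectrum G d) p)) = \pi p by
  [rewrite reprK]; move/eqmodP.
Qed.

Lemma equivalent_params2 (K L : ipspace R) (p : set (V -> V) -> K -> K)
    (q : set (V -> V) -> L -> L) sg dl : unitarily_equivalent G p q ->
  params2 G S q sg dl -> params2 G S p sg dl.
Proof.
move=> [U [lU iU _ Ui]] [h1 h2]; have inj := isometry_inj lU iU.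
have US c x : U (p (ccoset G (S c)) x) = q (ccoset G (S c)) (U x).
  by apply: Ui; exists (S c) => //; exact: gS.
have UX x : U (repX G S p x) = repX G S q (U x) by rewrite /repX (linD lU) !US.
have UY x : U (repY G S p x) = repY G S q (U x) by rewrite /repY (linB lU) !US.
by split=> x; apply: inj; rewrite ?UX ?UY ?h1 ?h2 (linZ lU).
Qed.

Definition spec_params (s : spec2) : C R * C R :=
  xget 0 [set q | params2 G S (repr s) q.1 q.2].

Lemma spec_params_uniq (s : spec2) sg dl : params2 G S (repr s) sg dl ->
  spec_params s = (sg, dl).
Proof.
move=> h; have h' : [set q | params2 G S (repr s) q.1 q.2] (sg, dl) by [].
have := xgetI 0 h'; rewrite -/(spec_params s) /=.
have [_ nz _] := irrep_irreducible (repr s).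
by case: (spec_params s) => a b /= h2; have [-> ->] := params2_uniq nz h2 h.
Qed.

Lemma spec_paramsP (s : spec2) : [/\ params2 G S (repr s) (spec_params s).1 (spec_params s).2,
  (spec_params s).1 != 0, (spec_params s).2 != 0 &
  cm (spec_params s).1 + cm (spec_params s).2 = 2].
Proof.
have [e [sg [dl [_ _ [h1 h2] h3 [h4 _]]]]] :=
  irreducible_dim2 M (irrep_irreducible (repr s)) (@cv_hilbert_dim R 2).
by rewrite (spec_params_uniq h4).
Qed.

Lemma spec_params_inj : injective spec_params.
Proof.
move=> s t st; rewrite -(reprK s) -(reprK t); apply/eqmodP/asboolP.
have [hs _ _ _] := spec_paramsP s; have [ht _ _ _] := spec_paramsP t; rewrite -st in ht.
have d2 := @cv_hilbert_dim R 2.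
exact: (params2_equivalent M (irrep_irreducible _) d2 (irrep_irreducible _) d2 hs ht).
Qed.

Lemma spec_params_continuous : continuous spec_params.
Proof.
have cV := sm_complete M; have aG := @sm_G_adjoint _ _ _ _ _ _ _ M.
have gXX := cstar_gen_comp gen_opX gen_opX.
have gYY := op_closedZ (-1) oc (cstar_gen_comp gen_opY gen_opY).
have c1 : continuous (fun s => (spec_params s).1).
  apply: (scalar_continuous cV bG aG gXX) => s x.
  have hs := repr_rep s; have [[h _] _ _ _] := spec_paramsP s.
  by rewrite (rho_comp hs _ gen_opX gen_opX) !rho_opX.
have c2 : continuous (fun s => (spec_params s).2).
  apply: (scalar_continuous cV bG aG gYY) => s x.
  have hs := repr_rep s; have [[_ h] _ _ _] := spec_paramsP s.
  rewrite (rhoZ bG hs _ _ (cstar_gen_comp gen_opY gen_opY)) (rho_comp hs _ gen_opY gen_opY).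
  by rewrite !rho_opY // h scaleN1r scaleNr opprK.
have -> : spec_params = fun s => ((spec_params s).1, (spec_params s).2).
  by apply/funext => s; case: spec_params.
by move=> s; exact: (cvg_pair (c1 s) (c2 s)).
Qed.

Lemma point_class z : sphere3 z -> z.1 + z.2 != 0 -> z.1 - z.2 != 0 ->
  exists s : spec2, spec_params s = point_map z /\
    forall T, gen T -> in_kernel s (ccoset G T) <-> symbol z T = 0.
Proof.
move=> hz p0 q0; pose p := Irrep (point_irreducible M hz p0 q0).
exists (\pi_spec2 p); have eqp := repr_equivalent p; split.
  exact: (spec_params_uniq (equivalent_params2 eqp (point_params2 M hz))).
move=> T gT; have [U [lU iU sU Ui]] := eqp; have inj := isometry_inj lU iU.
have hU x : U (repr (\pi_spec2 p) (ccoset G T) x) = symbol z T *m U x.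
  by rewrite Ui; [exact: (point_repE M)|exists T].
split=> [h|h x]; last by apply: inj; rewrite hU h mul0mx (lin0 lU).
apply/matrixP => i j; have [x Ux] := sU (delta_mx j 0).
have := hU x; rewrite h (lin0 lU) Ux -colE => /matrixP/(_ i 0).
by rewrite !mxE.
Qed.

(** The parameters are injective, so s is the class of [point_rep z]. *)
Lemma in_kernelP (s : spec2) z T : sphere3 z -> spec_params s = point_map z -> gen T ->
  in_kernel s (ccoset G T) <-> symbol z T = 0.
Proof.
move=> hz sz gT; have [_ n1 n2 _] := spec_paramsP s.
rewrite sz /point_map /= !expf_eq0 /= in n1 n2.
have [t [tz /(_ T gT)]] := point_class hz n1 n2.
by rewrite (spec_params_inj (etrans tz (esym sz))).
Qed.

Lemma symbol_kernel_compact T : gen T -> compact [set z | sphere3 z /\ symbol z T = 0].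
Proof.
move=> gT; apply: (@subclosed_compact _ _ sphere3); [|exact: sphere3_compact|by move=> z []].
have cS : closed sphere3 := compact_closed (@C2_hausdorff R) (@sphere3_compact R).
move=> z hz; have sz : sphere3 z.
  by apply: cS => A /(hz _)[w [[sw _] Aw]]; exists w.
split=> //; apply/matrixP => i j; rewrite [RHS]mxE; apply/eqP/negPn/negP => /cm_gt0 h.
have [w [[sw w0] /(_ sw)]] := hz _ (symbol_continuous M i j gT sz h).
by rewrite w0 mxE sub0r cmN ltxx.
Qed.

Theorem spectrum2_homeomorphic : homeomorphic spec2 (model R).
Proof.
have dom (x : @model_dom R) : solid (val x) /\
    ~ (model_circle 1 (val x) \/ model_circle (-1) (val x)).
  by have := set_mem (valP x) => -[].
have nz (x : @model_dom R) : (model_map (val x)).1 != 0 /\ (model_map (val x)).2 != 0.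
  have [sx nx] := dom x; split; apply/eqP => h; apply: nx.
    by right; apply/(model_map_eq0 false sx).
  by left; apply/(model_map_eq0 true sx).
have pt (x : @model_dom R) : exists2 z, sphere3 z & point_map z = model_map (val x).
  by have [sx _] := dom x; have [w [_ _ [h1 h2]]] := solid_point sx; eexists; [exact: h1|].
have /choice[h hh] : forall x : @model_dom R, exists s : spec2, spec_params s = model_map (val x).
  move=> x; have [z hz zx] := pt x; have [n1 n2] := nz x.
  rewrite -zx /point_map /= !expf_eq0 /= in n1 n2.
  by have [s [sz _]] := point_class hz n1 n2; exists s; rewrite sz.
have hE x y : h x = h y <-> model_map (val x) = model_map (val y).
  split=> [xy|xy]; first by rewrite -!hh xy.
  by apply: spec_params_inj; rewrite !hh.
have sol (s : spec2) y : solid y -> model_map y = spec_params s ->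
    exists2 x : @model_dom R, val x = y & h x = s.
  move=> sy ys; have [_ n1 n2 _] := spec_paramsP s; rewrite -ys in n1 n2.
  have dy : y \in @model_dom R.
    apply/mem_set; split=> //= -[] hy.
      by move: n2; rewrite (model_map_eq0 true sy).2 // eqxx.
    by move: n1; rewrite (model_map_eq0 false sy).2 // eqxx.
  exists (exist _ y dy) => //; apply: spec_params_inj.
  by rewrite hh -ys.
apply: (quotient_homeomorphic (e := model_eq_equiv R) (h := h)).
(* The classes that kill T have their parameters in a compact image of the sphere. *)
- apply/continuousP => _ [I IG ->].
  have key T : gen T -> open [set x | ~ in_kernel (h x) (ccoset G T)].
    move=> gT; pose K := point_map @` [set z | sphere3 z /\ symbol z T = 0].
    have cK : closed K.
      apply: compact_closed; first exact: C2_hausdorff.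
      apply: continuous_compact; last exact: symbol_kernel_compact.
      exact/continuous_subspaceT/point_map_continuous.
    have -> : [set x | ~ in_kernel (h x) (ccoset G T)] =
        (model_map \o val) @^-1` (~` K).
      apply/seteqP; split=> x /=.
        move=> nk [z [hz z0] zx]; apply: nk; apply/(in_kernelP hz _ gT) => //.
        by rewrite hh zx.
      move=> nK xk; apply: nK; have [z hz zx] := pt x; exists z => //; split=> //.
      by apply/(in_kernelP hz _ gT) => //; rewrite hh zx.
    apply: open_comp; last exact: closed_openC.
    move=> x _; apply: continuous_comp; last exact: model_map_continuous.
    exact: initial_continuous.
  have -> : h @^-1` [set s | exists2 a, I a & ~ in_kernel s a] =
      \bigcup_(a in I) [set x | ~ in_kernel (h x) a].
    by apply/seteqP; split=> x /= [a Ia na]; exists a.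
  by apply: bigcup_open => a /IG[T gT <-]; exact: key.
- move=> s; have [_ _ _ sm] := spec_paramsP s.
  have [y sy ys] := model_map_surj sm; rewrite -surjective_pairing in ys.
  by have [x _ <-] := sol _ _ sy ys; exists x.
- move=> x y; rewrite hE; split=> [xy|/asboolP].
    apply/asboolP; have [rr] := model_map_inj (dom x).1 (dom y).1 xy.
    case=> [/val_inj ->|]; first exact: rst_refl.
    move=> H; apply: rst_step; move: H rr; rewrite /model_glue.
    case: (\val x) (\val y) => [[r u] v] [[r' u'] v'] /=.
    by case=> [[-> ->]|[-> -> ->]] <-; [left|right].
  elim=> {x y} [x y|//|x y _ -> //|x y w _ -> _ -> //].
  have [/solidP[_ _ cu cv] _] := dom x.
  rewrite /model_glue => g; apply: model_map_glue => //; move: g.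
  case: (\val x) (\val y) => [[r u] v] [[r' u'] v'] /=.
  by case=> [[-> [-> ->]]|[-> [-> [-> ->]]]]; [left|right].
(* The parameters of the classes outside A are in a compact image of the solid. *)
- move=> A [W oW WA]; have hW w : W (val w) = A (h w) := congr1 (@^~ w) WA.
  pose D := model_map @` (@solid R `&` ~` W).
  have cD : closed D.
    apply: compact_closed; first exact: C2_hausdorff.
    apply: continuous_compact; first exact/continuous_subspaceT/model_map_continuous.
    by apply: compact_closedI; [exact: solid_compact|exact: open_closedC].
  have -> : A = spec_params @^-1` (~` D).
    apply/seteqP; split=> s /=.
      move=> As [y [sy nW] ys]; have [x xy hx] := sol _ _ sy ys.
      by apply: nW; rewrite -xy hW hx.
    move=> nD; have [_ _ _ sm] := spec_paramsP s.
    have [y sy ys] := model_map_surj sm; rewrite -surjective_pairing in ys.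
    have [x xy hx] := sol _ _ sy ys; rewrite -hx -hW xy.
    by apply: contrapT => nW; apply: nD; exists y.
  by apply: open_comp; [move=> s _; exact: spec_params_continuous|exact: closed_openC].
Qed.

End Spectrum2.

(** * Classes of dimension 1 *)
Section Spectrum1.
Context {R : realType} {V : ipspace R} (G : set (V -> V)).
Context (S S' : bool -> V -> V) (E : V -> V) (psi : C R -> C R -> nat -> V).
Hypothesis M : shift_model G S S' E psi.
Local Notation gen := (cstar_gen G).
Local Notation spec1 := (spectrum G 1).
Local Notation sphere3 := (@sphere3 R).
Local Notation point_rep := (point_rep G psi).
Local Notation character := (character psi).
Local Notation opX := (opX S).
Local Notation opY := (opY S).
Implicit Types (z : C R * C R) (b : bool) (u : circle R).

Let bG := @sm_G_bounded _ _ _ _ _ _ _ M.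

Lemma equivalent_scalar (K L : ipspace R) (p : set (V -> V) -> K -> K)
    (q : set (V -> V) -> L -> L) T c : unitarily_equivalent G p q -> gen T ->
  (forall y, q (ccoset G T) y = c *: y) -> forall x, p (ccoset G T) x = c *: x.
Proof.
move=> [U [lU iU _ Ui]] gT h x; apply: (isometry_inj lU iU).
by rewrite Ui ?h ?(linZ lU) //; exists T.
Qed.

Lemma dim1_scalars (s : spec1) : exists q : C R * C R,
  [/\ forall x, repr s (ccoset G opX) x = q.1 *: x,
      forall x, repr s (ccoset G opY) x = q.2 *: x &
      q.2 = 0 /\ cm q.1 ^+ 2 = 2 \/ q.1 = 0 /\ cm q.2 ^+ 2 = 2].
Proof.
have d1 := @cv_hilbert_dim R 1; have hp := repr_rep s.
have [[e [t [_ _ ct h]]]|[e [_ [_ [oe se _ _ _]]]]] := irreducible_classification M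
  (hilbert_dim_complete d1) (irrep_irreducible (repr s)); last first.
  by exfalso; apply: (hilbert_dim_12 d1); exists e.
case: h => -[hX hY]; [exists (t, 0)|exists (0, t)]; split=> [x|x|] /=;
  rewrite ?(rho_opX M) ?(rho_opY M) ?hX ?hY ?scale0r //; [by left|by right].
Qed.

Lemma spec1_inj (s t : spec1) (q : C R * C R) :
  (forall x, repr s (ccoset G opX) x = q.1 *: x) ->
  (forall x, repr s (ccoset G opY) x = q.2 *: x) ->
  (forall x, repr t (ccoset G opX) x = q.1 *: x) ->
  (forall x, repr t (ccoset G opY) x = q.2 *: x) -> s = t.
Proof.
move=> sX sY tX tY; rewrite -(reprK s) -(reprK t); apply/eqmodP/asboolP.
have [e [oe se]] := @cv_hilbert_dim R 1.
apply: (shift_equivalent (mX := fun _ _ => q.1) (mY := fun _ _ => q.2) M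
  (repr_rep s) (repr_rep t) oe se oe se) => i; rewrite big_ord1 ord1.
- by rewrite -(rho_opX M) //; exact: repr_rep.
- by rewrite -(rho_opX M) //; exact: repr_rep.
- by rewrite -(rho_opY M) //; exact: repr_rep.
- by rewrite -(rho_opY M) //; exact: repr_rep.
Qed.

(** The points of the two circles z1 = z2 and z1 = - z2, and the eigenvectors of
    all the symbols there. *)
Definition circle_point b (w : C R) : C R * C R :=
  let k := rc (isqrt2 R) * w in if b then ('i * k, - 'i * k) else (k, k).
Definition circle_slope b : C R := if b then 'i else 1.

Let cm_i : cm 'i = 1 :> R.
Proof. by apply: rcI; rewrite -cmE normCi rmorph1. Qed.

Lemma circle_point_sphere b w : cm w = 1 -> sphere3 (circle_point b w).
Proof.
move=> cw; rewrite /sphere3 /circle_point /=; case: b => /=; rewrite !cmM ?cmN ?cm_i cw cm_rc;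
  rewrite ger0_norm ?(ltW (@isqrt2_gt0 R)) // ?mul1r ?mulr1 isqrt2_sqr; lra.
Qed.

Let circle_cm u : cm (val u) = 1.
Proof. by have := set_mem (valP u); rewrite {1}circleE. Qed.

Lemma circle_class b u : exists s : spec1, [/\ forall T, gen T -> forall x,
  repr s (ccoset G T) x = character (circle_point b (val u)) (circle_slope b) T *: x,
  forall x, repr s (ccoset G opX) x =
    (if b then 0 else 2 * (rc (isqrt2 R) * val u)) *: x &
  forall x, repr s (ccoset G opY) x =
    (if b then 2 * (rc (isqrt2 R) * val u) else 0) *: x].
Proof.
have hz := circle_point_sphere b (circle_cm u).
set z := circle_point b (val u) in hz *; have hp := point_rep_representation M hz.
have hchi T : gen T -> point_rep z (ccoset G T) (cv2 1 (circle_slope b)) =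
    character z (circle_slope b) T *: cv2 1 (circle_slope b).
  rewrite /z /circle_point in hz *; case: b z hz hp => z hz hp gT.
    by apply: (character_minus M) => //=; rewrite mulNr opprK.
  exact: (character_plus M).
have nx0 : cv2 1 (circle_slope b) != 0.
  apply/eqP => /matrixP/(_ ord0 ord0); rewrite !mxE /=.
  by apply/eqP; rewrite oner_eq0.
pose p := Irrep (line_irreducible hp nx0 hchi).
have hs T : gen T -> forall x, repr (\pi_spec1 p) (ccoset G T) x =
    character z (circle_slope b) T *: x.
  move=> gT; apply: (equivalent_scalar (repr_equivalent p) gT) => y.
  exact: (line_repE nx0 hchi).
exists (\pi_spec1 p); split=> // x; rewrite hs; try exact: (gen_opX M); try exact: (gen_opY M).
  congr (_ *: _); have := hchi _ (gen_opX M); rewrite (rho_opX M) // (repX_cv2 M) // cv2Z !mulr1.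
  move=> /cv2_inj[<- _]; rewrite /z /circle_point /circle_slope; case: b {z hz hp hchi nx0 p hs} => /=.
    by rewrite mulNr subrr mul0r.
  ring.
congr (_ *: _); have := hchi _ (gen_opY M); rewrite (rho_opY M) // (repY_cv2 M) // cv2Z !mulr1.
move=> /cv2_inj[<- _]; rewrite /z /circle_point /circle_slope; case: b {z hz hp hchi nx0 p hs} => /=.
  rewrite mulNr opprK; move: (rc _ * _) => w.
  rewrite (_ : - _ = - ('i * 'i) * (2 * w)); last by ring.
  by rewrite -expr2 sqrCi opprK mul1r.
by rewrite subrr mul0r oppr0.
Qed.

Lemma open_nonzero (B : topologicalType) (f : B -> C R) : continuous f ->
  open [set x | f x != 0].
Proof.
move=> cf; rewrite (_ : [set x | _] = f @^-1` (~` [set 0])).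
  apply: open_comp; first by move=> x _; exact: cf.
  apply: closed_openC; apply: compact_closed; last exact: compact_set1.
  exact: (@norm_hausdorff (C R) (C R)).
by apply/seteqP; split=> x /= /eqP.
Qed.

Lemma bool_open (A : set bool) : open A.
Proof. by rewrite openE => b Ab; rewrite /interior nbhs_principalE; apply/principal_filterP. Qed.

Lemma character_continuous b T : gen T ->
  continuous (fun u => character (circle_point b (val u)) (circle_slope b) T).
Proof.
move=> gT u0; apply/continuousC_at => e e0.
have ck : continuous (fun w : C R => rc (isqrt2 R) * w) by exact: mulrl_continuous.
have ci : continuous (fun w : C R => 'i * (rc (isqrt2 R) * w)).
  by move=> w; exact: (continuous_comp (ck w) (@mulrl_continuous _ 'i _)).
have cn : continuous (fun w : C R => - 'i * (rc (isqrt2 R) * w)).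
  by move=> w; exact: (continuous_comp (ck w) (@mulrl_continuous _ (- 'i) _)).
have cz : continuous (circle_point b).
  by rewrite /circle_point; case: b => w; [exact: (cvg_pair (ci w) (cn w))|exact: (cvg_pair (ck w) (ck w))].
have cv : {for u0, continuous (fun u => circle_point b (val u))}.
  exact: (continuous_comp (@initial_continuous _ _ _ u0) (cz _)).
have hz := circle_point_sphere b (circle_cm u0); have e2 : 0 < e / 2 by rewrite divr_gt0.
have FF : Filter (nbhs u0) := nbhs_filter u0.
have near0 i j : \forall u \near u0, cm (symbol psi (circle_point b (val u)) T i j -
    symbol psi (circle_point b (val u0)) T i j) < e / 2.
  have : \forall u \near u0, sphere3 (circle_point b (val u)) -> cm (symbol psi
      (circle_point b (val u)) T i j - symbol psi (circle_point b (val u0)) T i j) < e / 2.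
    exact: cv _ (symbol_continuous M i j gT hz e2).
  by apply: filterS => u /(_ (circle_point_sphere b (circle_cm u))).
have n1 := near0 ord0 ord0; have n2 := near0 ord0 ord_max; move: n1 n2.
apply: filterS2 => u h1 h2.
rewrite /character opprD addrACA -mulrBr; apply: le_lt_trans (cmD _ _) _.
rewrite cmM [ltRHS]splitr ltrD // (_ : cm _ = 1) ?mul1r //.
by rewrite /circle_slope; case: b {h1 h2 cz cv hz near0}; rewrite ?cm_i ?cm1.
Qed.

(** The scalars of X and Y determine a class, and exactly one of them vanishes: which
    one does gives the circle, an open condition, and the other one the point on
    it. *)
Theorem spectrum1_homeomorphic : homeomorphic spec1 (bool * circle R)%type.
Proof.
have k2 : 2 * rc (isqrt2 R) * rc (isqrt2 R) = 1 :> C R.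
  rewrite -mulrA -rmorphM -expr2 isqrt2_sqr (_ : 2 = rc 2 :> C R); last by rewrite rmorph_nat.
  by rewrite -rmorphM /= mulfV ?rmorph1 // pnatr_eq0.
have /choice[h hh] : forall p : bool * circle R, exists s : spec1, [/\ forall T, gen T ->
    forall x, repr s (ccoset G T) x =
      character (circle_point p.1 (val p.2)) (circle_slope p.1) T *: x,
    forall x, repr s (ccoset G opX) x =
      (if p.1 then 0 else 2 * (rc (isqrt2 R) * val p.2)) *: x &
    forall x, repr s (ccoset G opY) x =
      (if p.1 then 2 * (rc (isqrt2 R) * val p.2) else 0) *: x].
  by move=> [b u]; exact: circle_class.
have /choice[q hq] := dim1_scalars.
have qX : continuous (fun s => (q s).1).
  apply: (scalar_continuous (sm_complete M) bG (@sm_G_adjoint _ _ _ _ _ _ _ M) (gen_opX M)) => s x.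
  by have [] := hq s.
have qY : continuous (fun s => (q s).2).
  apply: (scalar_continuous (sm_complete M) bG (@sm_G_adjoint _ _ _ _ _ _ _ M) (gen_opY M)) => s x.
  by have [] := hq s.
have /choice[f hf] : forall s : spec1, exists p : bool * circle R,
    p.1 = ((q s).1 == 0) /\ val p.2 = ((q s).1 + (q s).2) * rc (isqrt2 R).
  move=> s; have [_ _ hs] := hq s.
  have cu : ((q s).1 + (q s).2) * rc (isqrt2 R) \in circle R.
    apply/mem_set; rewrite circleE /= cmM cm_rc ger0_norm ?(ltW (@isqrt2_gt0 R)) //.
    apply/eqP; rewrite -(eqrXn2 (n := 2)) ?mulr_ge0 ?cm_ge0 ?(ltW (@isqrt2_gt0 R)) //.
    rewrite exprMn isqrt2_sqr expr1n; apply/eqP.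
    by case: hs => -[-> h2]; rewrite ?addr0 ?add0r h2 mulfV // pnatr_eq0.
  by exists ((q s).1 == 0, exist (fun w => w \in circle R) _ cu).
have qh p : q (h p) = if p.1 then (0, 2 * (rc (isqrt2 R) * val p.2))
    else (2 * (rc (isqrt2 R) * val p.2), 0).
  have [_ h1 h2] := hh p; have [h3 h4 _] := hq (h p).
  have [_ [x nx] _] := irrep_irreducible (repr (h p)).
  have eq (c d : C R) : c *: x = d *: x -> c = d.
    by move=> /eqP; rewrite -subr_eq0 -scalerBl scaler_eq0 (negPf nx) orbF subr_eq0 => /eqP.
  rewrite [q _]surjective_pairing (eq _ _ (etrans (esym (h3 x)) (h1 x))).
  rewrite (eq _ _ (etrans (esym (h4 x)) (h2 x))).
  by case: p.1.
have fh p : f (h p) = p.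
  have [f1 f2] := hf (h p); rewrite qh in f1 f2.
  have u0 : val p.2 != 0.
    apply/eqP => u0; have := circle_cm p.2; rewrite u0 cm0 => /eqP.
    by rewrite eq_sym oner_eq0.
  have k0 : 2 * (rc (isqrt2 R) * val p.2) != 0.
    rewrite mulrA mulf_neq0 //; apply/eqP => k0; move: k2; rewrite k0 mul0r => /eqP.
    by rewrite eq_sym oner_eq0.
  clear u0; move: f1 f2 k0; case: (f (h p)) => b u; case: p => b' u' /= f1 f2 k0; congr pair.
    by rewrite f1; case: b' {f1 f2} => /=; [exact: eqxx|exact: negPf].
  apply: val_inj; rewrite /= f2 -[RHS]mul1r -[X in _ = X * _]k2.
  by case: b' {f1 f2} => /=; move: (sval u') => w; ring.
have hfK s : h (f s) = s.
  have [h3 h4 hs] := hq s; have [_ h1 h2] := hh (f s); have [f1 f2] := hf s.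
  apply: (@spec1_inj _ _ (q s)) => // x; rewrite ?h1 ?h2 f1 f2; congr (_ *: _).
    case: eqP => [//|n]; have [[-> _]|[]//] := hs.
    rewrite addr0 -[RHS]mul1r -[X in _ = X * _]k2; ring.
  case: eqP => [->|n]; first by rewrite add0r -[RHS]mul1r -[X in _ = X * _]k2; ring.
  by have [[-> _]|[]//] := hs.
exists f, h; split=> //.
- have c1 : continuous (fun s => (f s).1).
    apply/continuousP => A _.
    have o1 : open [set s | (q s).1 != 0] := open_nonzero qX.
    have o2 : open [set s | (q s).2 != 0] := open_nonzero qY.
    have two0 : 2 != 0 :> R by rewrite pnatr_eq0.
    have e2 s : ((q s).1 == 0) = ((q s).2 != 0).
      have [_ _ [[-> h1]|[-> h1]]] := hq s; rewrite !eqxx.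
        by apply/eqP => h3; move: h1; rewrite h3 cm0 expr0n => /eqP; rewrite eq_sym (negPf two0).
      by apply/esym/eqP => h3; move: h1; rewrite h3 cm0 expr0n => /eqP; rewrite eq_sym (negPf two0).
    rewrite (_ : _ @^-1` A = \bigcup_(b in A) if b then [set s | (q s).2 != 0]
      else [set s | (q s).1 != 0]).
      by apply: bigcup_open => -[].
    apply/seteqP; split=> s /=; rewrite (hf s).1.
      by move=> As; exists ((q s).1 == 0) => //; case e1: ((q s).1 == 0); rewrite /= -?e2 e1.
    move=> [[] Ab /=]; first by rewrite -e2 => ->.
    by move=> /negPf ->.
  have c2 : continuous (fun s => (f s).2).
    have cD : continuous (fun s => (q s).1 + (q s).2).
      by move=> s; exact: (cvgD (qX s) (qY s)).
    have cM : continuous (fun s => ((q s).1 + (q s).2) * rc (isqrt2 R)).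
      by move=> s; exact: (continuous_comp (cD s) (@mulrr_continuous _ _ _)).
    apply: continuous_comp_initial; rewrite (_ : _ \o _ = fun s => ((q s).1 + (q s).2) *
      rc (isqrt2 R)) //.
    by apply/funext => t; exact: (hf t).2.
  rewrite (_ : f = fun s => ((f s).1, (f s).2)); last by apply/funext => s; case: (f s).
  by move=> s; exact: (cvg_pair (c1 s) (c2 s)).
- apply/continuousP => _ [I IG ->].
  have key T : gen T -> open [set p | ~ in_kernel (h p) (ccoset G T)].
    move=> gT; rewrite (_ : [set p | _] = \bigcup_b ((fst @^-1` [set b]) `&`
        (snd @^-1` [set u | character (circle_point b (val u)) (circle_slope b) T != 0]))).
      apply: bigcup_open => b _; apply: openI.
        by apply: open_comp; [move=> x _; exact: cvg_fst|exact: bool_open].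
      have cs : continuous (@snd bool (circle R)) by move=> x; exact: cvg_snd.
      exact: (open_comp (fun x _ => cs x) (open_nonzero (@character_continuous b _ gT))).
    apply/seteqP; split=> -[b u] /=; have [h1 _ _] := hh (b, u).
      move=> nk; exists b => //; split=> //=; apply/eqP => c0; apply: nk => x.
      by rewrite h1 //= c0 scale0r.
    move=> [_ _ [/= <- n0]] k; have [_ [x nx] _] := irrep_irreducible (repr (h (b, u))).
    by have := k x; rewrite h1 //= => /eqP; rewrite scaler_eq0 (negPf n0) (negPf nx).
  have -> : h @^-1` [set s | exists2 a, I a & ~ in_kernel s a] =
      \bigcup_(a in I) [set p | ~ in_kernel (h p) a].
    by apply/seteqP; split=> x /= [a Ia na]; exists a.
  by apply: bigcup_open => a /IG[T gT <-]; exact: key.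
Qed.

End Spectrum1.

Unset Implicit Arguments.

Theorem theorem1 (R : realType) (a1 a2 : C R)
    (ha1 : `|a1| = (sqrtC 3%:R)^-1) (ha2 : `|a2| = (sqrtC 3%:R)^-1) :
  [/\ subhomogeneous (creations a1 a2) 2,
      (forall (K : ipspace R)
          (pi : set (fock_space a1 a2 -> fock_space a1 a2) -> K -> K),
        complete_ipspace K -> irreducible_rep (creations a1 a2) pi ->
        (class_in_spectrum (creations a1 a2) 1 pi \/
         class_in_spectrum (creations a1 a2) 2 pi) /\
        ~ (class_in_spectrum (creations a1 a2) 1 pi /\
           class_in_spectrum (creations a1 a2) 2 pi)),
      homeomorphic (spectrum (creations a1 a2) 1) (bool * circle R)%type &
      homeomorphic (spectrum (creations a1 a2) 2) (model R)].
Proof.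
have M := fock_shift_model ha1 ha2; split.
- move=> K pi cK irr; have [d1|d2] := irreducible_dim M cK irr.
    by exists 1%N.
  by exists 2%N.
- move=> K pi cK irr; split.
    have [d1|d2] := irreducible_dim M cK irr; [left|right];
      exact: class_in_spectrum_dim.
  move=> [/class_in_spectrum_hilbert_dim d1 /class_in_spectrum_hilbert_dim d2].
  exact: hilbert_dim_12 d1 d2.
- exact: (spectrum1_homeomorphic M).
- exact: (spectrum2_homeomorphic M).
Qed.
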